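(* Let $q\ge 8/3$ and let $N,T\ge2$. Let $(c_n)_{n\in\mathbb{N}}\subset\mathbb{C}$ and suppose that \[ \sum_{N<n\le 2N}|c_n|^q\ll N^{1+o(1)}. \] Let $V>0$ and let $W\subset[0,T]$ be a $1$-separated set such that \[ \Big|\sum_{N<n\le 2N}c_n n^{it}\Big|\ge V \] for every $t\in W$. Then \[ |W|\le (NT)^{o(1)}\left(N^2V^{-2}+N^{18/5}V^{-4}+TN^{12/5}V^{-4}\right). \]
   Context: A set $W\subset\mathbb{R}$ is $1$-separated if $|t-t'|\ge1$ for all distinct $t,t'\in W$. The notation $Z^{o(1)}$ denotes a subpolynomial factor. The hypothesis means: for every $\delta>0$ there is a constant $C_\delta$ with $\sum_{N<n\le2N}|c_n|^q\le C_\delta N^{1+\delta}$. The conclusion means: for every $\delta'>0$ there is a constant $K$, depending only on $\delta'$, $q$ and the family $(C_\delta)_{\delta>0}$ (and not on $N,T,V,W$ or the $c_n$), such that $|W|\le K (NT)^{\delta'}\left(N^2V^{-2}+N^{18/5}V^{-4}+TN^{12/5}V^{-4}\right)$. *)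

(* Defs.v *)
From HB Require Import structures.
From mathcomp Require Import all_boot all_order all_algebra.
From mathcomp Require Import finmap.
From mathcomp Require Import all_classical all_reals all_analysis.
From mathcomp Require Import complex.

Set Implicit Arguments.
Unset Strict Implicit.
Unset Printing Implicit Defensive.

Import Order.TTheory GRing.Theory Num.Theory.

Local Open Scope classical_set_scope.
Local Open Scope ring_scope.
Local Open Scope complex_scope.

Definition separated1 (R : realType) (W : set R) : Prop :=
  forall t t' : R, W t -> W t' -> t <> t' -> 1 <= `|t - t'|.

(* n^{it} = exp(i t log n); only used for n >= 1, since ln 0 = 0 here. *)
Definition natpow_it (R : realType) (n : nat) (t : R) : R[i] :=
  cos (t * ln n%:R) +i* sin (t * ln n%:R).

(* N is real; the range n <= truncn (2N) contains every n with n <= 2N, so the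
   sum is over all natural numbers in ]N, 2N]. *)
Definition dyadic_sum (R : realType) (V : nmodType) (N : R) (f : nat -> V) : V :=
  \sum_(0 <= n < (Num.truncn (2 * N)).+1 | N < n%:R <= 2 * N) f n.

(* The norm of R[i] takes values in R[i]; this is the modulus as an element
   of R. *)
Definition cmod (R : realType) (z : R[i]) : R := complex.Re `|z|.

(* Main.v *)
(* The large values method of Guth and Maynard, in a form that only uses finite
   sums: [ln n] is replaced by a completely additive function with values in a
   fine lattice, and Poisson summation by a Fejér kernel that detects integers.

   Let the Dirichlet polynomial be at least [V] at [P] points [t_i] of an
   interval of length [T_0], and put [M = T_0 / N]. The nonzero frequencies of
   the Fejér kernel define a [P] by [P] matrix [K'], and by duality [V^2 P / (G N)],
   where [G] bounds the sum of the [|c_n|^2], is essentially at most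
   [(tr K'^2)^(1/2)] and [(tr K'^3)^(1/3)]. The quadratic trace is controlled by
   Heath-Brown's bound for the sums of [|sum_i (m / n)^(i t_i)|^2]; the cubic
   one, by counting near-solutions of ternary linear forms, is about at most
   [(M^2 P^(3/2) + M (P E)^(1/2)) / N] with [E] the additive energy of the points.
   If [|c_n| <= A], then [V^2 E << A^2 sum_(m, n ~ N) |sum_i (m / n)^(i t_i)|^3], and
   reflection bounds this cubic sum in terms of [P] and [E] again.

   The coefficients are split into dyadic levels [|c_n| ~ A]. As [q >= 8/3], a
   level has [G <= N^(1 + o(1)) A^(-2/3)], and the gain [G^(-3) = A^2] in the cubic trace
   compensates the loss of [A^2] in the energy bound. For [N^(7/10) <= V <= N^(4/5)]
   the points are grouped into intervals of length [T_0 = N^(6/5)]; for larger [V] the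
   quadratic trace suffices, with [T_0 = V^2 N^(-2/5)]; for smaller [V] the mean
   value theorem suffices. *)

Require Import Defs.
From HB Require Import structures.
From mathcomp Require Import all_boot all_order all_algebra.
From mathcomp Require Import finmap.
From mathcomp Require Import all_classical all_reals all_analysis.
From mathcomp Require Import complex ring lra zify.

Set Implicit Arguments.
Unset Strict Implicit.
Unset Printing Implicit Defensive.

Import Order.TTheory GRing.Theory Num.Theory.
Import numFieldNormedType.Exports.

Local Open Scope ring_scope.
Local Open Scope complex_scope.

(** * Complex moduli and phases *)

(** The thresholds are balance points. [N^2 V^(-2)] equals [N^(18/5) V^(-4)] at [V = N^(4/5)]; the
    mean value bound [T N V^(-2)] equals [T N^(12/5) V^(-4)] at [V = N^(7/10)]; and both choices of
    [T_0] make [T_0 N^(12/5) V^(-4)] equal to the larger of the other two terms, so that cutting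
    [[0, T]] into intervals of length [T_0] is free. No smooth weights are used. Smoothing is an
    average over short shifts: a shift multiplies each term by a phase, the average of these phases
    has modulus at least 1/2, and dividing by it makes the averaging an exact identity. Exactness is
    also the purpose of the lattice: grid points and the replaced logarithms differ by multiples of
    one step, so every change of variables is a reindexing without error, and complete additivity
    makes multiplication of integers a translation. All losses are powers of a single quantity [L],
    in the end a small power of a height [Z] polynomial in [N T]; this produces the factor
    [(N T)^delta']. *)

Notation "z ^J" := (conjc z) (at level 1, left associativity, format "z ^J").

Section ComplexModulus.
Variable R : realType.
Implicit Types (z w : R[i]) (x y : R).

Lemma cmodE z : cmod z = Num.sqrt (complex.Re z ^+ 2 + complex.Im z ^+ 2).
Proof. by rewrite /cmod; case: z. Qed.

Lemma cmod_ge0 z : 0 <= cmod z.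
Proof. by rewrite cmodE sqrtr_ge0. Qed.

Lemma cmodC z : (cmod z)%:C = `|z|.
Proof. by rewrite normc_def cmodE. Qed.

Lemma cmod_sqrE z : cmod z ^+ 2 = complex.Re z ^+ 2 + complex.Im z ^+ 2.
Proof. by rewrite cmodE sqr_sqrtr// addr_ge0// sqr_ge0. Qed.

Lemma cmod_sqr z : (cmod z ^+ 2)%:C = z * z^J.
Proof.
rewrite cmod_sqrE; case: z => a b /=; apply/eqP; rewrite eq_complex /=.
by apply/andP; split; apply/eqP; ring.
Qed.

Lemma cmodM z w : cmod (z * w) = cmod z * cmod w.
Proof. by apply: (@complexI R); rewrite rmorphM !cmodC normrM. Qed.

Lemma cmodD z w : cmod (z + w) <= cmod z + cmod w.
Proof. by rewrite -lecR rmorphD !cmodC ler_normD. Qed.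

Lemma cmodB z w : cmod (z - w) <= cmod z + cmod w.
Proof. by rewrite -lecR rmorphD !cmodC ler_normB. Qed.

Lemma cmodJ z : cmod z^J = cmod z.
Proof. by rewrite !cmodE; case: z => a b /=; rewrite sqrrN. Qed.

Lemma cmod0 : cmod (0 : R[i]) = 0.
Proof. by apply: (@complexI R); rewrite cmodC normr0. Qed.

Lemma cmod1 : cmod (1 : R[i]) = 1.
Proof. by apply: (@complexI R); rewrite cmodC normr1. Qed.

Lemma cmod_eq0 z : (cmod z == 0) = (z == 0).
Proof.
rewrite -[z == 0]normr_eq0 -cmodC; apply/eqP/eqP => [->//|].
by move/(congr1 (@complex.Re R)).
Qed.

Lemma cmodV z : cmod z^-1 = (cmod z)^-1.
Proof. by apply: (@complexI R); rewrite cmodC normfV -cmodC fmorphV. Qed.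

Lemma cmod_real x : cmod x%:C = `|x|.
Proof. by rewrite cmodE /= expr0n /= addr0 sqrtr_sqr. Qed.

Lemma cmod_sum (I : Type) (r : seq I) (P : pred I) (F : I -> R[i]) :
  cmod (\sum_(i <- r | P i) F i) <= \sum_(i <- r | P i) cmod (F i).
Proof.
elim/big_rec2: _ => [|i a b _ ab]; first by rewrite cmod0.
by rewrite (le_trans (cmodD _ _))// lerD2l.
Qed.

Lemma Re_le_cmod z : complex.Re z <= cmod z.
Proof.
rewrite cmodE (le_trans (ler_norm _))// -sqrtr_sqr ler_wsqrtr// lerDl.
exact: sqr_ge0.
Qed.

Lemma realC_sum (I : Type) (r : seq I) (P : pred I) (F : I -> R) :
  (\sum_(i <- r | P i) F i)%:C = \sum_(i <- r | P i) (F i)%:C.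
Proof. exact: rmorph_sum. Qed.

Lemma realCM x y : (x * y)%:C = x%:C * y%:C.
Proof. exact: rmorphM. Qed.

Lemma conjC_sum (I : Type) (r : seq I) (P : pred I) (F : I -> R[i]) :
  (\sum_(i <- r | P i) F i)^J = \sum_(i <- r | P i) (F i)^J.
Proof. exact: rmorph_sum. Qed.

Lemma conjCM z w : (z * w)^J = z^J * w^J.
Proof. exact: rmorphM. Qed.

Lemma cmod_sum_sqr (I : Type) (r : seq I) (F : I -> R[i]) :
  (cmod (\sum_(i <- r) F i) ^+ 2)%:C =
  \sum_(i <- r) \sum_(j <- r) F i * (F j)^J.
Proof.
by rewrite cmod_sqr conjC_sum mulr_suml; apply: eq_bigr => i _; rewrite mulr_sumr.
Qed.

End ComplexModulus.

Section CauchySchwarz.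
Variables (R : realType) (I : Type) (r : seq I).
Implicit Types (u v : I -> R) (z w : I -> R[i]).

(* the discriminant of [sum (u + t v)^2 >= 0] *)
Lemma sum_mul_sqr_le u v :
  (\sum_(i <- r) u i * v i) ^+ 2 <=
  (\sum_(i <- r) u i ^+ 2) * (\sum_(i <- r) v i ^+ 2).
Proof.
set A := \sum_(i <- r) u i ^+ 2; set B := \sum_(i <- r) v i ^+ 2.
set C := \sum_(i <- r) _.
have A0 : 0 <= A by apply: sumr_ge0 => i _; exact: sqr_ge0.
have B0 : 0 <= B by apply: sumr_ge0 => i _; exact: sqr_ge0.
have key s t : 0 <= s ^+ 2 * A + 2 * s * t * C + t ^+ 2 * B.
  rewrite /A /B /C !mulr_sumr -!big_split /=.
  apply: sumr_ge0 => i _; have := sqr_ge0 (s * u i + t * v i).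
  by congr (_ <= _); ring.
have [B00|B00] := eqVneq B 0.
  rewrite B00 mulr0; have [->|C0] := eqVneq C 0; first by rewrite expr0n.
  have := key 1 (- ((A + 1) / (2 * C))); rewrite B00 mulr0 addr0.
  have -> : 1 ^+ 2 * A + 2 * 1 * - ((A + 1) / (2 * C)) * C = -1 by field.
  by rewrite ler0N1.
have Bp : 0 < B by rewrite lt_def B00.
have h := key B (- C).
have : 0 <= B * (A * B - C ^+ 2) by move: h; congr (_ <= _); ring.
by rewrite pmulr_rge0// subr_ge0.
Qed.

Lemma sum_sqr_le u :
  (\sum_(i <- r) u i) ^+ 2 <= (size r)%:R * \sum_(i <- r) u i ^+ 2.
Proof.
have := sum_mul_sqr_le (fun=> 1) u.
rewrite (eq_bigr (fun i => u i)); last by move=> i _; rewrite mul1r.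
congr (_ <= _ * _); rewrite (eq_bigr (fun=> 1)); last first.
  by move=> i _; rewrite expr1n.
by rewrite big_const_seq count_predT iter_addr_0.
Qed.

Lemma cmod_sum_mul_sqr_le z w :
  cmod (\sum_(i <- r) z i * w i) ^+ 2 <=
  (\sum_(i <- r) cmod (z i) ^+ 2) * (\sum_(i <- r) cmod (w i) ^+ 2).
Proof.
apply: le_trans (sum_mul_sqr_le (fun i => cmod (z i)) (fun i => cmod (w i))).
rewrite ler_sqr ?nnegrE ?cmod_ge0//; last first.
  by apply: sumr_ge0 => i _; rewrite mulr_ge0 ?cmod_ge0.
by rewrite (le_trans (cmod_sum _ _ _))// ler_sum// => i _; rewrite cmodM.
Qed.

Lemma cmod_sum_sqr_le z :
  cmod (\sum_(i <- r) z i) ^+ 2 <= (size r)%:R * \sum_(i <- r) cmod (z i) ^+ 2.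
Proof.
apply: le_trans (sum_sqr_le (fun i => cmod (z i))).
rewrite ler_sqr ?nnegrE ?cmod_ge0 ?cmod_sum//.
by apply: sumr_ge0 => i _; exact: cmod_ge0.
Qed.

End CauchySchwarz.

Section Cis.
Variable R : realType.
Implicit Types x y : R.

Definition cis y : R[i] := cos y +i* sin y.

Arguments cis : simpl never.

Lemma cisD x y : cis (x + y) = cis x * cis y.
Proof. by rewrite /cis cosD sinD; apply/eqP; rewrite eq_complex /= eqxx /= addrC. Qed.

Lemma cis0 : cis 0 = 1.
Proof. by rewrite /cis cos0 sin0. Qed.

Lemma cisN y : cis (- y) = (cis y)^J.
Proof. by rewrite /cis cosN sinN. Qed.

Lemma cisB x y : cis (x - y) = cis x * (cis y)^J.
Proof. by rewrite cisD cisN. Qed.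

Lemma cmod_cis y : cmod (cis y) = 1.
Proof. by rewrite cmodE /= cos2Dsin2 sqrtr1. Qed.

Lemma cisMn y n : cis (y * n%:R) = cis y ^+ n.
Proof.
elim: n => [|n IH]; first by rewrite mulr0 cis0.
by rewrite mulrSr mulrDr mulr1 cisD IH exprSr.
Qed.

Lemma cis_2pi_nat n : cis (2 * pi * n%:R) = 1 :> R[i].
Proof.
rewrite cisMn (_ : cis (2 * pi) = 1) ?expr1n//.
by rewrite /cis mulr_natl cos2pi sin2pi.
Qed.

Lemma sin_mvt x : 0 < x -> exists2 c, 0 < c < x & sin x = cos c * x.
Proof.
move=> x0.
have [c cx h] : exists2 c, c \in `]0, x[ & sin x - sin 0 = cos c * (x - 0).
  apply: MVT => //; by apply: continuous_subspaceT => y; exact: continuous_sin.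
by exists c; [move: cx; rewrite in_itv | move: h; rewrite sin0 !subr0].
Qed.

Lemma abs_sin_le x : `|sin x| <= `|x|.
Proof.
have pos y : 0 < y -> `|sin y| <= y.
  move=> y0; have [c _ ->] := sin_mvt y0.
  by rewrite normrM (gtr0_norm y0) ler_piMl ?(ltW y0)// cos_max.
have [x0|x0|->] := ltgtP x 0; last by rewrite sin0.
  by rewrite -normrN -sinN -(normrN x) (le_trans (pos _ _)) ?oppr_gt0// ler_norm.
by rewrite (le_trans (pos _ _))// ler_norm.
Qed.

Lemma one_sub_cos_le x : 1 - cos x <= x ^+ 2 / 2.
Proof.
have -> : 1 - cos x = 2 * sin (x / 2) ^+ 2.
  have /(congr1 cos) : x = (x / 2) *+ 2 by rewrite mulr2n; field.
  by rewrite cos_mulr2n => ->; rewrite sin2cos2 mulr2n; ring.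
have h : sin (x / 2) ^+ 2 <= (x / 2) ^+ 2.
  by rewrite -[leLHS]real_normK ?num_real// -[leRHS]real_normK ?num_real//
    ler_sqr ?nnegrE// abs_sin_le.
by apply: (@le_trans _ _ (2 * (x / 2) ^+ 2)); [rewrite ler_pM2l | lra].
Qed.

Lemma abs_sub_sin_le x : `|x - sin x| <= x ^+ 2.
Proof.
have pos y : 0 < y -> `|y - sin y| <= y ^+ 2.
  move=> y0; have [c /andP[c0 cy] ->] := sin_mvt y0.
  have -> : y - cos c * y = y * (1 - cos c) by ring.
  rewrite normrM (gtr0_norm y0) expr2 ler_pM2l// ger0_norm ?subr_ge0 ?cos_le1//.
  have [c2|c2] := leP c 2.
    by have := one_sub_cos_le c; nra.
  by have := cos_geN1 c; lra.
have [x0|x0|->] := ltgtP x 0; last by rewrite sin0 subr0 normr0 expr0n.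
  have := pos (- x); rewrite oppr_gt0 x0 sqrrN sinN opprK => /(_ isT).
  by rewrite -normrN opprD !opprK.
exact: pos.
Qed.

Lemma cmod_cis_lin x : cmod (cis x - 1 - 0 +i* x) <= 2 * x ^+ 2.
Proof.
have h1 := one_sub_cos_le x.
have h2 := abs_sub_sin_le x.
have h3 : 0 <= 1 - cos x by rewrite subr_ge0 cos_le1.
have h0 : 0 <= 2 * x ^+ 2 by rewrite mulr_ge0 ?sqr_ge0.
rewrite -ler_sqr ?nnegrE ?cmod_ge0//.
rewrite cmod_sqrE /cis /= subr0.
have -> : (cos x - 1) ^+ 2 = (1 - cos x) ^+ 2 by ring.
have -> : (sin x - 0 - x) ^+ 2 = `|x - sin x| ^+ 2.
  by rewrite real_normK ?num_real//; ring.
have h4 : 0 <= `|x - sin x| by [].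
nra.
Qed.

Lemma cmod_cis_sub x y : cmod (cis x - cis y) <= `|x - y|.
Proof.
have -> : cis x - cis y = cis y * (cis (x - y) - 1).
  by rewrite mulrBr -cisD mulr1; congr (cis _ - _); ring.
rewrite cmodM cmod_cis mul1r; move: (x - y) => {x y} x.
rewrite -ler_sqr ?nnegrE ?cmod_ge0// cmod_sqrE /cis /= subr0.
rewrite real_normK ?num_real//.
have -> : (cos x - 1) ^+ 2 + sin x ^+ 2 = 2 * (1 - cos x).
  by rewrite sin2cos2; ring.
by have := one_sub_cos_le x; lra.
Qed.

Lemma cos_ge_half x : `|x| <= 1 -> 2^-1 <= cos x.
Proof.
move=> x1; have := one_sub_cos_le x.
have : x ^+ 2 <= 1 by rewrite -real_normK ?num_real// expr_le1.
lra.
Qed.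

End Cis.

(** * The divisor bound and the large sieve *)

Section DivisorBound.

(** A divisor is determined by its [p]-adic valuation and its part prime to [p]. *)
Lemma size_divisors_prime_part p n : prime p -> (0 < n)%N ->
  (size (divisors n) <= (logn p n).+1 * size (divisors n`_p^'))%N.
Proof.
move=> pp n0; have n'0 : (0 < n`_p^')%N by exact: part_gt0.
have -> : ((logn p n).+1 * size (divisors n`_p^') =
    size [seq p ^ i * e | i <- iota 0 (logn p n).+1, e <- divisors n`_p^'])%N.
  by rewrite size_allpairs size_iota.
apply: uniq_leq_size; first exact: divisors_uniq.
move=> d; rewrite -dvdn_divisors// => dn.
have d0 : (0 < d)%N by exact: dvdn_gt0 dn.
apply/allpairsP; exists (logn p d, d`_p^')%N => /=; split.
- by rewrite -[_ :: _]/(iota 0 (logn p n).+1) mem_iota add0n ltnS dvdn_leq_log.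
- by rewrite -dvdn_divisors// partn_dvd.
- by rewrite -p_part partnC.
Qed.

Variable R : realType.

(** Induction on [n] through its least prime factor [p], of multiplicity [a]. If [p < Y], then
    [a + 1 <= K p^(e a)], at the cost of one factor [K]; if [p >= Y], then [e ln p >= 1] and
    [a + 1 <= p^(e a)] holds without loss. The exponent [Y - k] bounds the number of small primes
    that can still occur when all prime factors are at least [k]. *)
Lemma size_divisors_rough (e : R) (K : R) (Y : nat) : 0 < e ->
  1 + (e * ln 2)^-1 <= K -> e^-1 <= ln (Y%:R : R) -> (0 < Y)%N ->
  forall n k, (0 < n)%N -> (forall p, prime p -> p %| n -> k <= p)%N ->
  (size (divisors n))%:R <= K ^+ (Y - k) * expR (e * ln n%:R).
Proof.
move=> e0 hK hY Y0.
have ln2 : 0 < ln 2 :> R by apply: ln_gt0; rewrite ltr1n.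
have K1 : 1 <= K.
  by rewrite (le_trans _ hK)// lerDl invr_ge0 mulr_ge0 ?ltW.
elim/ltn_ind => n IH k n0 hk.
have [->|n1] := eqVneq n 1%N.
  by rewrite (_ : divisors 1 = [:: 1%N])//= ln1 mulr0 expR0 mulr1 exprn_ege1.
have n2 : (1 < n)%N by rewrite ltn_neqAle eq_sym n1.
have pp := pdiv_prime n2; set p := pdiv n in pp.
have pn : (p %| n)%N by exact: pdiv_dvd.
have kp : (k <= p)%N by exact: hk.
set a := logn p n; set m := (n`_p^')%N.
have m0 : (0 < m)%N by exact: part_gt0.
have nE : n = (p ^ a * m)%N by rewrite -p_part partnC.
have a0 : (0 < a)%N by rewrite /a logn_gt0 mem_primes pp n0.
have p2 : (2 <= p)%N by exact: prime_gt1.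
have mn : (m < n)%N.
  rewrite nE -[X in (X < _)%N]mul1n ltn_mul2r m0/=.
  by rewrite (leq_trans _ (leq_pexp2l _ a0)) ?expn1// ltnW.
have hm q : prime q -> (q %| m)%N -> (p.+1 <= q)%N.
  move=> pq qm; rewrite ltn_neqAle; apply/andP; split; last first.
    by rewrite /p pdiv_min_dvd ?prime_gt1// (dvdn_trans qm)// dvdn_part.
  apply/eqP => pq'; have := part_pnat p^' n => /pnatP - /(_ m0) /(_ q pq qm).
  by rewrite !inE -pq' eqxx.
have h1 := IH _ mn p.+1 m0 hm.
have lnp : ln (2 : R) <= ln p%:R.
  by rewrite ler_ln ?posrE ?ltr0n ?(ltnW p2)// ler_nat.
have hE : expR (e * ln n%:R) = expR (e * (a%:R * ln p%:R)) * expR (e * ln m%:R) :> R.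
  rewrite -expRD -mulrDr {1}nE natrM lnM ?posrE ?ltr0n ?expn_gt0 ?(ltnW p2)//.
  by rewrite natrX lnXn ?ltr0n ?(ltnW p2)// mulr_natl.
have h2 : (size (divisors n))%:R <= (a.+1)%:R * (size (divisors m))%:R :> R.
  by rewrite -natrM ler_nat size_divisors_prime_part.
apply: (le_trans h2); rewrite hE.
have X1 := expR_ge1Dx (e * (a%:R * ln (p%:R : R))).
have [pY|Yp] := ltnP p Y.
  have -> : (Y - k = (Y - p.+1) + 1 + (p - k))%N by clear -pY kp; lia.
  rewrite !exprD expr1.
  apply: (@le_trans _ _ ((K * expR (e * (a%:R * ln p%:R))) *
     (K ^+ (Y - p.+1) * expR (e * ln m%:R)))).
    apply: ler_pM => //.
    rewrite -natr1 (le_trans _ (ler_wpM2l _ X1)) ?(le_trans _ K1)//.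
    have h : e * (a%:R * ln 2) <= e * (a%:R * ln (p%:R : R)).
      by rewrite ler_pM2l// ler_wpM2l.
    (* With [x = e ln 2], the product [(1 + 1 / x) (1 + a x)] is [1 + a] plus the nonnegative terms
       [1 / x + a x]. *)
    have h3 : 1 + a%:R <= (1 + (e * ln 2)^-1) * (1 + e * (a%:R * ln 2)) :> R.
      have -> : (1 + (e * ln 2)^-1) * (1 + e * (a%:R * ln 2)) =
        1 + a%:R + ((e * ln 2)^-1 + e * (a%:R * ln 2)) :> R.
        by field; rewrite !gt_eqF.
      by rewrite lerDl addr_ge0 ?invr_ge0 ?mulr_ge0// ltW.
    rewrite addrC (le_trans h3)// ler_pM//.
    - by rewrite addr_ge0 ?invr_ge0 ?mulr_ge0// ltW.
    - by rewrite addr_ge0 ?mulr_ge0// ltW.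
    - by rewrite lerD2l.
  have -> : K ^+ (Y - p.+1) * K * K ^+ (p - k) * (expR (e * (a%:R * ln p%:R)) * expR (e * ln m%:R))
    = (K * expR (e * (a%:R * ln p%:R)) * (K ^+ (Y - p.+1) * expR (e * ln m%:R))) * K ^+ (p - k).
    by ring.
  rewrite ler_peMr ?exprn_ege1// !mulr_ge0 ?expR_ge0 ?exprn_ge0//; lra.
move: h1; have -> : (Y - p.+1 = 0)%N by clear -Yp; lia.
rewrite expr0 mul1r => h1.
apply: (@le_trans _ _ (1 * (expR (e * (a%:R * ln p%:R)) * expR (e * ln m%:R)))).
  rewrite mul1r ler_pM//.
  have lnY : ln (Y%:R : R) <= ln p%:R by rewrite ler_ln ?posrE ?ltr0n ?ler_nat// (leq_trans _ Yp).
  have : 1 <= e * ln (p%:R : R).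
    by rewrite mulrC -ler_pdivrMr// mul1r (le_trans hY).
  rewrite -natr1 => he; apply: le_trans X1; rewrite addrC lerD2l.
  by rewrite mulrCA ler_peMr.
by rewrite ler_wpM2r ?mulr_ge0 ?expR_ge0// exprn_ege1.
Qed.

Lemma size_divisors_subpoly (e : R) : 0 < e ->
  exists2 K : R, 0 < K &
    forall n, (0 < n)%N -> (size (divisors n))%:R <= K * n%:R `^ e.
Proof.
move=> e0; set Y := (Num.truncn (expR e^-1 : R)).+1.
exists ((1 + (e * ln 2)^-1) ^+ Y).
  rewrite exprn_gt0// addr_gt0// invr_gt0 mulr_gt0//.
  by apply: ln_gt0; rewrite ltr1n.
move=> n n0.
have -> : n%:R `^ e = expR (e * ln n%:R) :> R.
  by rewrite /powR pnatr_eq0 gtn_eqF.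
have := @size_divisors_rough e _ Y e0 (lexx _) _ isT n 0 n0.
rewrite subn0; apply => //.
rewrite -[leLHS]expRK ler_ln ?posrE ?expR_gt0 ?ltr0n//.
by have /andP[_ /ltW] := truncn_itv (expR_ge0 (e^-1 : R)).
Qed.

End DivisorBound.

Section FiniteSums.
Variable R : realType.

Lemma ler_sum_uniq_sub (T : eqType) (s s' : seq T) (F : T -> R) :
  uniq s -> {subset s <= s'} -> (forall x, 0 <= F x) ->
  \sum_(x <- s) F x <= \sum_(x <- s') F x.
Proof.
move=> us ss F0; elim: s s' us ss => [|x s IH] s' /=.
  by rewrite big_nil => _ _; exact: sumr_ge0.
move=> /andP[xs us] ss.
have xs' : x \in s' by apply: ss; rewrite mem_head.
rewrite big_cons (perm_big _ (perm_to_rem xs')) big_cons lerD2l IH//.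
move=> y ys; have := ss y; rewrite inE ys orbT => /(_ isT).
rewrite (perm_mem (perm_to_rem xs')) inE => /orP[/eqP yx|//].
by rewrite -yx ys in xs.
Qed.

(* Each value [f x] collects the fibre of [f], so no more than [D] copies of
   [F m] occur. *)
Lemma ler_sum_fibre (T U : eqType) (s : seq T) (s' : seq U) (f : T -> U)
    (F : U -> R) (D : nat) :
  (forall x, x \in s -> f x \in s') -> uniq s' -> (forall u, 0 <= F u) ->
  (forall u, u \in s' -> (count (fun x => f x == u) s <= D)%N) ->
  \sum_(x <- s) F (f x) <= D%:R * \sum_(u <- s') F u.
Proof.
move=> fs us F0 hD.
have -> : \sum_(x <- s) F (f x) =
    \sum_(u <- s') (count (fun x => f x == u) s)%:R * F u.
  have h x : x \in s -> F (f x) = \sum_(u <- s') (f x == u)%:R * F u.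
    move=> xs; rewrite (bigD1_seq (f x)) ?fs//= eqxx mul1r big1 ?addr0//.
    by move=> u; rewrite eq_sym => /negbTE ->; rewrite mul0r.
  rewrite big_seq (eq_bigr _ h) -big_seq exchange_big /=.
  apply: eq_bigr => u _; rewrite -mulr_suml; congr (_ * _).
  by rewrite -sum1_count natr_sum [RHS]big_mkcond; apply: eq_bigr => i _; case: eqP.
rewrite mulr_sumr [leLHS]big_seq [leRHS]big_seq; apply: ler_sum => u us'.
by rewrite ler_wpM2r// ler_nat hD.
Qed.

End FiniteSums.

Section LayerCake.
Variable R : realType.

(* A dyadic substitute for [min (1, 1 / u)]. *)
Definition lc (J : nat) (u : R) : R :=
  \sum_(j < J) (2 ^- j) * (u <= 2 ^+ j)%R%:R.

Lemma lc_ge0 J u : 0 <= lc J u.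
Proof.
by apply: sumr_ge0 => j _; rewrite mulr_ge0// invr_ge0 exprn_ge0.
Qed.

(** Converts a pair of estimates, the trivial one and decay [1 / u], into layers. If [j] is the
    least index with [u <= 2^j], layer [j] alone gives [2^(-j)], while [s <= 1 / u < 2^(1 - j)] when
    [j > 0]. The bound [u <= 2^J] ensures that this layer is present. *)
Lemma le_lc J (s u : R) : 0 <= s -> u <= 2 ^+ J -> s <= 1 -> s * u <= 1 ->
  s <= 2 * lc J.+1 u.
Proof.
move=> s0 uJ s1 su1.
have ex : exists j, u <= 2 ^+ j by exists J.
case: (ex_minnP ex) => j hj jmin.
have jJ : (j < J.+1)%N by rewrite ltnS jmin.
have h : 2 ^- j <= lc J.+1 u.
  rewrite /lc (bigD1 (Ordinal jJ))//= hj mulr1 lerDl; apply: sumr_ge0 => i _.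
  by rewrite mulr_ge0// invr_ge0 exprn_ge0.
case: j hj jmin jJ h => [_ _ _|j hj jmin jJ].
  by rewrite expr0 invr1; lra.
move=> h; have hj' : 2 ^+ j < u.
  by rewrite ltNge; apply/negP => /jmin; rewrite ltnn.
have p2 : 0 < 2 ^+ j :> R by rewrite exprn_gt0.
have h2 : s <= 2 ^- j.
  rewrite -[leRHS]mulr1 -ler_pdivrMl ?invr_gt0// invrK mulrC.
  have [->|/eqP sn0] := eqVneq s 0; first by rewrite mul0r.
  by rewrite (le_trans _ su1)// ler_wpM2l// ltW.
rewrite (le_trans h2)// (le_trans _ (ler_wpM2l _ h))// exprS invfM.
by rewrite mulrA divff ?mul1r// pnatr_eq0.
Qed.

End LayerCake.

(** * Large sieve inequalities for almost orthogonal families *)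

Section LargeSieve.
Variables (R : realType) (I : finType) (nu : I -> R) (B : nat).

Definition multiplicity_le :=
  forall x : R, (#|[set i | (x <= nu i < x + 1)%R]| <= B)%N.

Hypothesis nuB : multiplicity_le.

Lemma card_window (x : R) (n : nat) :
  (#|[set i | (x <= nu i < x + n%:R)%R]| <= n * B)%N.
Proof.
elim: n => [|n IH].
  rewrite addr0 mul0n leqn0 cards_eq0; apply/eqP/setP => i; rewrite !inE.
  by apply/negbTE; rewrite negb_and -leNgt -ltNge; case: leP => // /ltW ->.
rewrite mulSn addnC (leq_trans _ (leq_add IH (nuB (x + n%:R))))//.
rewrite (leq_trans _ (leq_card_setU _ _))// subset_leq_card//.
apply/fintype.subsetP => i; rewrite !inE -natr1 addrA => /andP[-> ->].
by rewrite andbT /=; case: ltP.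
Qed.

(** The ball has length [2 * 2^j]; one more unit window is needed because the ball is closed and the
    windows are half-open. *)
Lemma card_ball (x : R) (j : nat) :
  (#|[set i | (`|x - nu i| <= 2 ^+ j)%R]|)%:R <= 3 * 2 ^+ j * B%:R :> R.
Proof.
apply: (@le_trans _ _ ((2 * 2 ^ j + 1) * B)%:R).
  rewrite ler_nat (leq_trans _ (card_window (x - 2 ^+ j) (2 * 2 ^ j + 1)))//.
  rewrite subset_leq_card//; apply/fintype.subsetP => i; rewrite !inE ler_norml.
  by rewrite natrD natrM natrX; move=> /andP[h1 h2]; apply/andP; split; lra.
rewrite natrM ler_wpM2r// natrD natrM natrX.
have : 1 <= 2 ^+ j :> R by rewrite exprn_ege1// ler1n.
lra.
Qed.

(** The weight [2^(-j)] cancels the size of the ball, so all layers contribute equally and only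
    their number [J] is lost. *)
Lemma lc_sum (J : nat) (x : R) :
  \sum_i lc J `|x - nu i| <= 3 * J%:R * B%:R.
Proof.
rewrite /lc exchange_big /=.
apply: (@le_trans _ _ (\sum_(j < J) 3 * B%:R)).
  apply: ler_sum => j _; rewrite -mulr_sumr.
  have p2 : 0 < 2 ^+ j :> R by rewrite exprn_gt0.
  rewrite mulrC ler_pdivrMr// mulrAC (le_trans _ (card_ball x j))//.
  rewrite -sum1_card natr_sum [leRHS]big_mkcond /=.
  by apply: ler_sum => i _; rewrite inE; case: ifP.
by rewrite sumr_const card_ord -[leLHS]mulr_natr mulrAC.
Qed.

Variables (n : nat) (E : I -> 'I_n -> R[i]) (h c : R) (J : nat).
Hypotheses (h0 : 0 <= h) (c0 : 0 <= c).
Hypothesis almost_orthogonal : forall i i',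
  h * cmod (\sum_k E i k * (E i' k)^J) <= c * lc J `|nu i - nu i'|.

(** Schur's test: open the square, replace [|a_i a_i'|] by the mean of the two squares, and use the
    symmetry of the majorant in [i] and [i']. *)
Lemma large_sieve (a : I -> R[i]) :
  h * \sum_k cmod (\sum_i a i * E i k) ^+ 2 <=
  3 * c * J%:R * B%:R * \sum_i cmod (a i) ^+ 2.
Proof.
have E1 : (h * \sum_k cmod (\sum_i a i * E i k) ^+ 2)%:C =
    \sum_i \sum_i' (a i * (a i')^J) * (h%:C * \sum_k E i k * (E i' k)^J).
  rewrite realCM realC_sum mulr_sumr.
  under eq_bigr => k _.
    rewrite cmod_sum_sqr mulr_sumr.
    under eq_bigr => i _ do rewrite mulr_sumr.
    over.
  rewrite exchange_big; apply: eq_bigr => i _.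
  rewrite exchange_big; apply: eq_bigr => i' _.
  rewrite !mulr_sumr; apply: eq_bigr => k _.
  by rewrite conjCM; ring.
set S := h * _ in E1 *.
have S0 : 0 <= S by rewrite mulr_ge0// sumr_ge0// => k _; rewrite sqr_ge0.
rewrite -(ger0_norm S0) -cmod_real E1.
apply: (@le_trans _ _ (\sum_i \sum_i'
    (cmod (a i) ^+ 2 + cmod (a i') ^+ 2) / 2 * (c * lc J `|nu i - nu i'|))).
  apply: (le_trans (cmod_sum _ _ _)); apply: ler_sum => i _.
  apply: (le_trans (cmod_sum _ _ _)); apply: ler_sum => i' _.
  rewrite !cmodM cmodJ cmod_real (ger0_norm h0).
  apply: ler_pM; rewrite ?mulr_ge0 ?cmod_ge0//.
  by have := sqr_ge0 (cmod (a i) - cmod (a i')); lra.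
have -> : \sum_i \sum_i' (cmod (a i) ^+ 2 + cmod (a i') ^+ 2) / 2 *
    (c * lc J `|nu i - nu i'|) =
    \sum_i \sum_i' cmod (a i) ^+ 2 * (c * lc J `|nu i - nu i'|).
  transitivity ((\sum_i \sum_i' cmod (a i) ^+ 2 * (c * lc J `|nu i - nu i'|)) / 2 +
     (\sum_i \sum_i' cmod (a i') ^+ 2 * (c * lc J `|nu i - nu i'|)) / 2).
    rewrite !mulr_suml -big_split /=; apply: eq_bigr => i _.
    by rewrite !mulr_suml -big_split /=; apply: eq_bigr => i' _; ring.
  rewrite [X in _ + X / 2]exchange_big /=.
  under [X in _ + X / 2]eq_bigr => i _.
    under eq_bigr => i' _ do rewrite distrC.
    over.
  by rewrite /=; lra.
rewrite mulr_sumr; apply: ler_sum => i _.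
rewrite -!mulr_sumr [leRHS]mulrC ler_wpM2l ?sqr_ge0//.
have := ler_wpM2l c0 (lc_sum J (nu i)); congr (_ <= _); ring.
Qed.

(** Duality: the left side [S] is also a pairing of [f] with the sums of [large_sieve] whose
    coefficients are the conjugates of the quantities being estimated. Cauchy-Schwarz gives
    [S^2 <= T L S], and one factor [S] cancels. *)
Lemma large_sieve_dual (f : 'I_n -> R[i]) :
  \sum_i cmod (h%:C * \sum_k f k * E i k) ^+ 2 <=
  3 * c * J%:R * B%:R * (h * \sum_k cmod (f k) ^+ 2).
Proof.
set L := 3 * c * J%:R * B%:R.
have L0 : 0 <= L by rewrite !mulr_ge0.
set b := fun i => h%:C * \sum_k f k * E i k.
set S := \sum_i cmod (b i) ^+ 2.
set T := h * \sum_k cmod (f k) ^+ 2.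
have S0 : 0 <= S by apply: sumr_ge0 => i _; rewrite sqr_ge0.
have T0 : 0 <= T by rewrite mulr_ge0// sumr_ge0// => i _; rewrite sqr_ge0.
have SE : S%:C = \sum_k (h%:C * f k) * \sum_i (b i)^J * E i k.
  rewrite /S realC_sum; under eq_bigr => i _.
    rewrite cmod_sqr /b {1}mulr_sumr mulr_suml; over.
  rewrite exchange_big; apply: eq_bigr => k _.
  by rewrite mulr_sumr; apply: eq_bigr => i _; rewrite /b; ring.
have key : S ^+ 2 <= T * (L * S).
  have -> : S ^+ 2 = cmod S%:C ^+ 2 by rewrite cmod_real (ger0_norm S0).
  rewrite SE (le_trans (cmod_sum_mul_sqr_le _ _ _))//.
  have -> : \sum_k cmod (h%:C * f k) ^+ 2 = h * T.
    rewrite /T !mulr_sumr; apply: eq_bigr => k _.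
    by rewrite cmodM cmod_real (ger0_norm h0); ring.
  rewrite -mulrA mulrCA ler_wpM2l//.
  apply: (le_trans (large_sieve _)); rewrite ler_wpM2l//.
  by apply: ler_sum => i _; rewrite cmodJ.
have [->|Sn0] := eqVneq S 0; first by rewrite mulr_ge0.
have Sp : 0 < S by rewrite lt_def Sn0.
by move: key; rewrite expr2 mulrA ler_pM2r// mulrC.
Qed.

End LargeSieve.

(** * Phase sums and the Fejér kernel *)

Section ExponentialSums.
Variable R : realType.
Implicit Types (h u al x : R).

(** The sum telescopes after multiplication by [cis u - 1], whose modulus is at least [|u| / 2] in
    this range by [cmod_cis_lin]. *)
Lemma geometric_bound u n : `|u| <= 4^-1 ->
  cmod (\sum_(k < n) cis (u * k%:R)) * `|u| <= 4.
Proof.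
move=> u4; set S := \sum_(k < n) _.
have tel : (cis u - 1) * S = cis (u * n%:R) - 1.
  rewrite /S mulr_sumr -(big_mkord predT (fun k => (cis u - 1) * cis (u * k%:R))).
  have -> : cis (u * n%:R) - 1 = cis (u * n%:R) - cis (u * 0%:R) :> R[i].
    by rewrite mulr0 cis0.
  rewrite -(@telescope_sumr _ 0 n (fun k => cis (u * k%:R)))//.
  apply: eq_bigr => k _.
    have -> : u * k.+1%:R = u + u * k%:R by rewrite -natr1; ring.
    by rewrite cisD mulrBl mul1r.
have h1 : cmod ((cis u - 1) * S) <= 2.
  by rewrite tel (le_trans (cmodB _ _))// !cmod_cis cmod1.
have h2 : `|u| / 2 <= cmod (cis u - 1).
  have h3 := cmod_cis_lin u.
  have h4 : cmod (0 +i* u) = `|u| by rewrite cmodE /= expr0n add0r sqrtr_sqr.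
  have : cmod (0 +i* u) <= cmod (cis u - 1) + cmod (cis u - 1 - 0 +i* u).
    rewrite -[X in cmod X <= _](_ : (cis u - 1) - (cis u - 1 - 0 +i* u) = 0 +i* u).
      exact: cmodB.
    by rewrite opprB addrCA subrr addr0.
  rewrite h4; have : 2 * u ^+ 2 <= `|u| / 2.
    rewrite -real_normK ?num_real//; have := normr_ge0 u; nra.
  lra.
rewrite cmodM in h1; have := cmod_ge0 S; have := normr_ge0 u; nra.
Qed.

Lemma geometric_bound_cor (t y0 h : R) n : 0 < h -> `|t * h| <= 4^-1 ->
  h * cmod (\sum_(k < n) cis (t * (y0 + h * k%:R))) * `|t| <= 4.
Proof.
move=> h0 th; have := geometric_bound n th.
rewrite normrM (gtr0_norm h0).
have -> : \sum_(k < n) cis (t * (y0 + h * k%:R)) =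
  cis (t * y0) * \sum_(k < n) cis (t * h * k%:R).
  by rewrite mulr_sumr; apply: eq_bigr => k _; rewrite mulrDr cisD mulrA.
by rewrite cmodM cmod_cis mul1r; congr (_ <= _); ring.
Qed.

(* Abel summation with the weights [exp (- h k)], for which the discrete
   derivative of the phase becomes the constant [al (1 - exp (- h))]. *)
Lemma exponential_phase_bound al h n : 0 < h -> h <= 2^-1 ->
  2 * n%:R * h ^+ 2 * al ^+ 2 * expR (h * n%:R) <= 1 ->
  h * cmod (\sum_(k < n) cis (al * expR (h * k%:R))) * `|al| <= 6.
Proof.
move=> h0 h2 small.
set g := fun k : nat => cis (al * expR (h * k%:R)).
set w := fun k : nat => expR (- (h * k%:R)) : R.
set h' := 1 - expR (- h).
set ph := fun k : nat => al * (expR (h * k.+1%:R) - expR (h * k%:R)).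
have w0 k : 0 < w k by exact: expR_gt0.
have ww k : w k.+1 <= w k.
  by rewrite /w ler_expR lerN2 ler_pM2l// ler_nat.
have hh1 : h' <= h.
  by rewrite /h'; have := expR_ge1Dx (- h); lra.
have hh2 : h / 2 <= h'.
  have e1 := expR_ge1Dx h; have e2 := expR_ge1Dx (- h).
  have e3 := expRxMexpNx_1 h; have e4 := expR_gt0 (- h).
  rewrite /h'; nra.
have wph k : w k.+1 * ph k = al * h'.
  rewrite /w /ph /h' -natr1 mulrDr mulr1 mulrCA mulrBr opprD expRD.
  have -> : expR (- (h * k%:R)) * expR (- h) * expR (h * k%:R + h) = 1 :> R.
    by rewrite -!expRD; apply/eqP; rewrite -expR0; apply/eqP; congr expR; ring.
  have -> // : expR (- (h * k%:R)) * expR (- h) * expR (h * k%:R) = expR (- h) :> R.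
  by rewrite -!expRD; congr expR; ring.
(* The error made when the increment [cis (ph k) - 1] is replaced by its linear part [i ph k]. The
   weighted linear part is the constant [al h'] by [wph], and the hypothesis [small] bounds the sum
   of all these errors by [1]. *)
pose r k := (w k.+1)%:C * (g k.+1 - g k) - (0 +i* (al * h')) * g k.
have rE k : r k = (w k.+1)%:C * g k * (cis (ph k) - 1 - 0 +i* ph k).
  rewrite /r; have -> : g k.+1 = g k * cis (ph k).
    by rewrite /g /ph -cisD; congr cis; ring.
  rewrite -(wph k).
  have -> : 0 +i* (w k.+1 * ph k) = (w k.+1)%:C * (0 +i* ph k) :> R[i].
    by apply/eqP; rewrite eq_complex /=; apply/andP; split; apply/eqP; ring.
  by ring.
have r_le k : (k < n)%N -> cmod (r k) <= 2 * h ^+ 2 * al ^+ 2 * expR (h * n%:R).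
  move=> kn; rewrite rE !cmodM cmod_cis mulr1 cmod_real (gtr0_norm (w0 _)).
  apply: (@le_trans _ _ (w k.+1 * (2 * ph k ^+ 2))).
    by rewrite ler_pM2l// cmod_cis_lin.
  have -> : w k.+1 * (2 * ph k ^+ 2) = 2 * (al * h') ^+ 2 * expR (h * k.+1%:R).
    rewrite -(wph k) [(w k.+1 * ph k) ^+ 2]exprMn.
    have -> : w k.+1 ^+ 2 = w k.+1 * expR (- (h * k.+1%:R)) by rewrite expr2.
    have := expRxMexpNx_1 (h * k.+1%:R); set A := expR _; set B := expR _ => AB.
    transitivity (w k.+1 * (2 * ph k ^+ 2) * (A * B)); first by rewrite AB mulr1.
    by ring.
  have hp0 : 0 <= h' by lra.
  rewrite exprMn [al ^+ 2 * _]mulrC mulrA; apply: ler_pM => //.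
  - by apply: mulr_ge0; rewrite ?sqr_ge0// mulr_ge0// sqr_ge0.
  - rewrite ler_wpM2r ?sqr_ge0// ler_pM2l// ler_sqr ?nnegrE//; lra.
  - by rewrite ler_expR ler_pM2l// ler_nat.
have rsum : cmod (\sum_(k < n) r k) <= 1.
  apply: (le_trans (cmod_sum _ _ _)).
  apply: (@le_trans _ _ (\sum_(k < n) 2 * h ^+ 2 * al ^+ 2 * expR (h * n%:R))).
    by apply: ler_sum => k _; exact: r_le.
  rewrite sumr_const card_ord -[leLHS]mulr_natl.
  by move: small; congr (_ <= _); ring.
have abel : \sum_(k < n) (w k.+1)%:C * (g k.+1 - g k) =
    (w n)%:C * g n - (w 0)%:C * g 0 + \sum_(k < n) (w k - w k.+1)%:C * g k.
  rewrite -(@telescope_sumr _ 0 n (fun k => (w k)%:C * g k))// big_mkord -big_split /=.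
  by apply: eq_bigr => k _; rewrite rmorphB; ring.
(* The weights decrease, so the boundary terms [w n + w 0] and the total variation [w 0 - w n] add
   up to [2 * w 0 = 2]. *)
have abel_le : cmod (\sum_(k < n) (w k.+1)%:C * (g k.+1 - g k)) <= 2.
  rewrite abel (le_trans (cmodD _ _))//.
  have c1 : cmod ((w n)%:C * g n - (w 0)%:C * g 0) <= w n + w 0.
    rewrite (le_trans (cmodB _ _))// !cmodM !cmod_cis !cmod_real !mulr1.
    by rewrite !gtr0_norm.
  have c2 : cmod (\sum_(k < n) (w k - w k.+1)%:C * g k) <= w 0 - w n.
    rewrite (le_trans (cmod_sum _ _ _))//.
    have -> : w 0 - w n = \sum_(k < n) (w k - w k.+1).
      rewrite -opprB -(@telescope_sumr _ 0 n w)// big_mkord -sumrN.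
      by apply: eq_bigr => k _; rewrite opprB.
    apply: ler_sum => k _; rewrite cmodM cmod_cis mulr1 cmod_real ger0_norm//.
    by rewrite subr_ge0.
  have w01 : w 0 = 1 by rewrite /w mulr0 oppr0 expR0.
  by lra.
have fin : cmod ((0 +i* (al * h')) * \sum_(k < n) g k) <= 3.
  rewrite mulr_sumr.
  have -> : \sum_(k < n) 0 +i* (al * h') * g k =
    \sum_(k < n) (w k.+1)%:C * (g k.+1 - g k) - \sum_(k < n) r k.
    by rewrite -sumrB; apply: eq_bigr => k _; rewrite /r; ring.
  by rewrite (le_trans (cmodB _ _))//; lra.
have ci : cmod (0 +i* (al * h')) = `|al| * h'.
  rewrite cmodE /= expr0n add0r sqrtr_sqr normrM [X in _ * X]ger0_norm//; lra.
rewrite cmodM ci in fin.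
have := cmod_ge0 (\sum_(k < n) g k); have := normr_ge0 al.
move: (`|al|) (cmod _) fin => A S fin A0 S0.
(* Abel summation gives 2 and the errors give 1; passing from [h'] to [h / 2] doubles the resulting
   3. *)
have hh : h / 2 * (A * S) <= A * h' * S.
  by rewrite -[A * h' * S]mulrAC [leRHS]mulrC ler_wpM2r ?mulr_ge0.
have -> : h * S * A = 2 * (h / 2 * (A * S)) by field.
have := le_trans hh fin; lra.
Qed.

End ExponentialSums.

Section Fejer.
Variable R : realType.
Implicit Types (x y : R) (M : nat).

Definition ep x : R[i] := cis (2 * pi * x).

Arguments ep : simpl never.

Lemma epD x y : ep (x + y) = ep x * ep y.
Proof. by rewrite /ep mulrDr cisD. Qed.

Lemma epN x : ep (- x) = (ep x)^J.
Proof. by rewrite /ep mulrN cisN. Qed.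

Lemma cmod_ep x : cmod (ep x) = 1.
Proof. exact: cmod_cis. Qed.

Lemma ep_nat n : ep n%:R = 1.
Proof. exact: cis_2pi_nat. Qed.

(* The nonzero integers of absolute value at most [M]. *)
Definition zr M (p : 'I_M * bool) : R := (-1) ^+ p.2 * p.1.+1%:R.

Lemma norm_zr M (p : 'I_M * bool) : `|zr p| = p.1.+1%:R.
Proof. by rewrite /zr normrM normrX normrN1 expr1n mul1r normr_nat. Qed.

Lemma ep_zr M (p : 'I_M * bool) n : ep (n%:R * zr p) = 1.
Proof.
rewrite /zr; case: p => m [] /=; last by rewrite mul1r -natrM ep_nat.
by rewrite mulN1r mulrN -natrM epN ep_nat conjc1.
Qed.

Definition fejer M x : R := cmod (\sum_(j < M) ep (j%:R * x)) ^+ 2 / M%:R.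

Definition fejc M (p : 'I_M * bool) : R := 1 - p.1.+1%:R / M%:R.

Lemma fejc_itv M (p : 'I_M * bool) : 0 <= fejc p <= 1.
Proof.
case: p => m b; rewrite /fejc /=.
have M0 : 0 < M%:R :> R by rewrite ltr0n; case: m => m /=; case: M.
rewrite subr_ge0 ler_pdivrMr// mul1r ler_nat ltn_ord /=.
by rewrite gerBl divr_ge0.
Qed.

Lemma fejer_expand_aux M x :
  (cmod (\sum_(j < M) ep (j%:R * x)) ^+ 2)%:C =
  M%:R + \sum_(m < M) (M%:R - m.+1%:R) *
    (ep (m.+1%:R * x) + ep (- (m.+1%:R * x))).
Proof.
elim: M => [|M IH]; first by rewrite !big_ord0 cmod0 expr0n addr0.
have rv : ep (M%:R * x) * (\sum_(j < M) ep (j%:R * x))^J =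
    \sum_(m < M) ep (m.+1%:R * x).
  rewrite conjC_sum mulr_sumr (reindex_inj rev_ord_inj).
  apply: eq_bigr => m _; rewrite -epN -epD; congr ep.
  have -> : (rev_ord m : nat) = (M - m.+1)%N by [].
  rewrite natrB//; ring.
have rv' : (ep (M%:R * x))^J * (\sum_(j < M) ep (j%:R * x)) =
    \sum_(m < M) ep (- (m.+1%:R * x)).
  rewrite -[LHS]conjcK conjCM conjcK rv conjC_sum.
  by apply: eq_bigr => m _; rewrite epN.
rewrite big_ord_recr /= cmod_sqr rmorphD /=.
set D := \sum_(j < M) _ in IH rv rv' *.
have -> : (D + ep (M%:R * x)) * (D^J + (ep (M%:R * x))^J) =
   D * D^J + (ep (M%:R * x) * D^J + (ep (M%:R * x))^J * D)
   + ep (M%:R * x) * (ep (M%:R * x))^J by ring.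
rewrite -cmod_sqr IH rv rv' -cmod_sqr cmod_ep expr1n [RHS]addrC big_ord_recr /=.
rewrite subrr mul0r addr0.
have -> : \sum_(m < M) (M.+1%:R - m.+1%:R) *
      (ep (m.+1%:R * x) + ep (- (m.+1%:R * x))) =
    \sum_(m < M) (M%:R - m.+1%:R) * (ep (m.+1%:R * x) + ep (- (m.+1%:R * x))) +
    (\sum_(m < M) ep (m.+1%:R * x) + \sum_(m < M) ep (- (m.+1%:R * x))).
  rewrite -!big_split /=; apply: eq_bigr => m _; rewrite -[M.+1%:R]natr1; ring.
rewrite -[M.+1%:R]natr1 rmorph1; ring.
Qed.

Lemma fejer_expand M x : (0 < M)%N ->
  (fejer M x)%:C = 1 + \sum_(p : 'I_M * bool) (fejc p)%:C * ep (zr p * x).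
Proof.
move=> M0; have Mn : M%:R != 0 :> R[i] by rewrite pnatr_eq0 -lt0n.
rewrite /fejer realCM fejer_expand_aux fmorphV rmorph_nat mulrDl divff//.
congr (_ + _); rewrite mulr_suml.
rewrite -(pair_big predT predT (fun (m : 'I_M) (b : bool) =>
  (fejc (m, b))%:C * ep (zr (m, b) * x))) /=.
apply: eq_bigr => m _; rewrite big_bool /= /fejc /zr /= mul1r mulN1r mulNr.
have -> : (1 - m.+1%:R / M%:R)%:C = 1 - m.+1%:R / M%:R :> R[i].
  by rewrite rmorphB rmorph1 fmorph_div !rmorph_nat.
by field.
Qed.

Lemma fejer_ge0 M x : 0 <= fejer M x.
Proof. by rewrite mulr_ge0 ?sqr_ge0. Qed.

Lemma fejer_le M x : fejer M x <= M%:R.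
Proof.
case: M => [|M]; first by rewrite /fejer invr0 mulr0.
rewrite /fejer ler_pdivrMr ?ltr0n// -expr2 ler_sqr ?nnegrE ?cmod_ge0//.
rewrite (le_trans (cmod_sum _ _ _))// (eq_bigr (fun=> 1)); last first.
  by move=> j _; rewrite cmod_ep.
by rewrite sumr_const card_ord.
Qed.

(** For [j < M] the phase [2 pi j x] has modulus at most [1], because [2 pi < 8]; every term of the
    kernel's inner sum then has real part at least [1 / 2]. *)
Lemma fejer_near0 M x : (0 < M)%N -> `|x| * (8 * M%:R) <= 1 ->
  M%:R / 4 <= fejer M x.
Proof.
move=> M0 xM; have Mp : 0 < M%:R :> R by rewrite ltr0n.
have h : M%:R / 2 <= cmod (\sum_(j < M) ep (j%:R * x)).
  rewrite (le_trans _ (Re_le_cmod _))// raddf_sum /=.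
  apply: (@le_trans _ _ (\sum_(j < M) (2^-1 : R))).
    by rewrite sumr_const card_ord -[leRHS]mulr_natl.
  apply: ler_sum => j _; apply: cos_ge_half.
  rewrite !normrM !normr_nat (ger0_norm (pi_ge0 R)).
  have p4 : pi < 4 :> R by have := @pihalf_lt2 R; lra.
  have jM : j%:R <= M%:R :> R by rewrite ler_nat ltnW.
  apply: le_trans xM; have -> : 2 * pi * (j%:R * `|x|) = `|x| * (2 * pi * j%:R) by ring.
  rewrite ler_wpM2l//; apply: ler_pM => //; first by rewrite mulr_ge0 ?pi_ge0.
  lra.
rewrite /fejer ler_pdivlMr// -[leLHS](_ : (M%:R / 2) ^+ 2 = _); last by field.
by rewrite ler_sqr ?nnegrE ?cmod_ge0 ?divr_ge0.
Qed.

Lemma fejer_shift M L x (p : 'I_L * bool) : fejer M (x + zr p) = fejer M x.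
Proof.
rewrite /fejer; congr (cmod _ ^+ 2 / _); apply: eq_bigr => j _.
by rewrite mulrDr epD ep_zr mulr1.
Qed.

Lemma fejer_shift_nat M x n : fejer M (x - n%:R) = fejer M x.
Proof.
rewrite /fejer; congr (cmod _ ^+ 2 / _); apply: eq_bigr => j _.
by rewrite mulrBr epD -natrM epN ep_nat conjc1 mulr1.
Qed.

Lemma fejer_near_nat M x n : (0 < M)%N -> `|x - n%:R| * (8 * M%:R) <= 1 ->
  M%:R / 4 <= fejer M x.
Proof. by move=> M0 xn; rewrite -(fejer_shift_nat M x n) fejer_near0. Qed.

End Fejer.

(** * Logarithmic grids *)

Section ExponentialFamily.
Variables (R : realType) (I : finType) (tau : I -> R).
Implicit Types (a : I -> R[i]) (y z : R).

Definition expsum a y : R[i] := \sum_i a i * cis (tau i * y).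

Definition expsum1 y : R[i] := \sum_i cis (tau i * y).

Lemma expsum1E y : expsum1 y = expsum (fun=> 1) y.
Proof. by apply: eq_bigr => i _; rewrite mul1r. Qed.

Lemma expsumD a y z : expsum a (y + z) = expsum (fun i => a i * cis (tau i * z)) y.
Proof. by apply: eq_bigr => i _; rewrite mulrDr cisD; ring. Qed.

Lemma expsum1_conj y : (expsum1 y)^J = expsum1 (- y).
Proof. by rewrite conjC_sum; apply: eq_bigr => i _; rewrite mulrN cisN. Qed.

Lemma cmod_expsum1N y : cmod (expsum1 (- y)) = cmod (expsum1 y).
Proof. by rewrite -expsum1_conj cmodJ. Qed.

Lemma cmod_expsum_le a y (A : R) : (forall i, cmod (a i) <= A) ->
  cmod (expsum a y) <= A * #|I|%:R.
Proof.
move=> aA; rewrite (le_trans (cmod_sum _ _ _))//.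
apply: (@le_trans _ _ (\sum_(i : I) A)).
  by apply: ler_sum => i _; rewrite cmodM cmod_cis mulr1.
by rewrite sumr_const mulr_natr.
Qed.

Section Positivity.
Variables (T : Type) (s : seq T) (ph : T -> R).

Definition ksum (b : T -> R) t : R[i] := \sum_(u <- s) (b u)%:C * cis (t * ph u).

(** Opening the squares and regrouping moves the points [tau] outside and the frequencies [ph] into
    a square. The new weights [|ksum|^2] are nonnegative, which is what allows the coefficients [a]
    to be replaced by upper bounds. *)
Lemma positivity_expand (b : T -> R) a :
  (\sum_(u <- s) \sum_(v <- s) b u * b v *
     cmod (expsum a (ph u - ph v)) ^+ 2)%:C =
  \sum_i \sum_j (a i * (a j)^J) * (cmod (ksum b (tau i - tau j)) ^+ 2)%:C.
Proof.
rewrite realC_sum.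
under eq_bigr => u _.
  rewrite realC_sum.
  under eq_bigr => v _.
    rewrite realCM cmod_sum_sqr mulr_sumr.
    under eq_bigr => i _ do rewrite mulr_sumr.
    over.
  rewrite exchange_big /=.
  under eq_bigr => i _ do rewrite exchange_big /=.
  over.
rewrite exchange_big /=; apply: eq_bigr => i _.
rewrite exchange_big /=; apply: eq_bigr => j _.
rewrite cmod_sum_sqr mulr_sumr; apply: eq_bigr => u _.
rewrite mulr_sumr; apply: eq_bigr => v _.
rewrite !conjCM conjc_real realCM -!cisN.
have e1 : cis (tau i * (ph u - ph v)) * cis (- (tau j * (ph u - ph v))) =
   cis ((tau i - tau j) * ph u) * cis (- ((tau i - tau j) * ph v)).
  by rewrite -!cisD; congr cis; ring.
transitivity ((b u)%:C * (b v)%:C * (a i * (a j)^J) *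
  (cis (tau i * (ph u - ph v)) * cis (- (tau j * (ph u - ph v))))); first by ring.
by rewrite e1; ring.
Qed.

Lemma positivity_one (b : T -> R) :
  \sum_(u <- s) \sum_(v <- s) b u * b v * cmod (expsum1 (ph u - ph v)) ^+ 2 =
  \sum_i \sum_j cmod (ksum b (tau i - tau j)) ^+ 2.
Proof.
apply: (@complexI R).
transitivity ((\sum_(u <- s) \sum_(v <- s) b u * b v *
     cmod (expsum (fun=> 1) (ph u - ph v)) ^+ 2)%:C).
  by congr (_%:C); apply: eq_bigr => u _; apply: eq_bigr => v _; rewrite expsum1E.
rewrite positivity_expand [RHS]realC_sum; apply: eq_bigr => i _.
by rewrite realC_sum; apply: eq_bigr => j _; rewrite conjc1 !mul1r.
Qed.

(** The shift [z] only rotates the coefficients [a]. On the dual side these are bounded by [A]; the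
    identity is then read backwards with all coefficients equal to [1], and the weights [b], which
    now stand in front of squares, are bounded by [Bt]. *)
Lemma positivity_le (b : T -> R) a (A Bt : R) z :
  (forall i, cmod (a i) <= A) -> (forall u, 0 <= b u <= Bt) ->
  \sum_(u <- s) \sum_(v <- s) b u * b v * cmod (expsum a (ph u - ph v + z)) ^+ 2 <=
  A ^+ 2 * Bt ^+ 2 * \sum_(u <- s) \sum_(v <- s) cmod (expsum1 (ph u - ph v)) ^+ 2.
Proof.
move=> aA bB.
pose a' i := a i * cis (tau i * z).
have a'A i : cmod (a' i) <= A by rewrite cmodM cmod_cis mulr1.
have b0 u : 0 <= b u by have /andP[] := bB u.
apply: (@le_trans _ _ (A ^+ 2 * \sum_(u <- s) \sum_(v <- s) b u * b v *
     cmod (expsum1 (ph u - ph v)) ^+ 2)).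
  under eq_bigr => u _ do under eq_bigr => v _ do rewrite expsumD -/a'.
  set X := (X in X <= _).
  have X0 : 0 <= X.
    apply: sumr_ge0 => u _; apply: sumr_ge0 => v _.
    by rewrite mulr_ge0 ?sqr_ge0 ?mulr_ge0.
  rewrite -(ger0_norm X0) -cmod_real positivity_expand positivity_one.
  rewrite mulr_sumr (le_trans (cmod_sum _ _ _))//; apply: ler_sum => i _.
  rewrite mulr_sumr (le_trans (cmod_sum _ _ _))//; apply: ler_sum => j _.
  rewrite cmodM cmod_real (ger0_norm (sqr_ge0 _)) cmodM cmodJ.
  by rewrite ler_wpM2r ?sqr_ge0// expr2 ler_pM ?cmod_ge0.
rewrite -mulrA ler_wpM2l ?sqr_ge0// mulr_sumr; apply: ler_sum => u _.
rewrite mulr_sumr; apply: ler_sum => v _; rewrite ler_wpM2r ?sqr_ge0//.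
by have /andP[? ?] := bB u; have /andP[? ?] := bB v; rewrite expr2 ler_pM.
Qed.

End Positivity.

End ExponentialFamily.

(* The powers of 2 below are not optimised: [Z] only has to exceed a fixed power
   of [T], [N] and [M]. *)
Definition room (k x Z : nat) : Prop := (2 ^ k * x <= Z)%N.

Definition tall (R : realType) (Z : nat) (T : R) : Prop :=
  2 ^+ 80 * (T + 1) ^+ 4 <= Z%:R.

(* A logarithmic grid of step [gh] on which every [ln n], [n <= gZ], is
   replaced by a nearby multiple [gh * gell n], in such a way that
   [n |-> gh * gell n] stays completely additive. [gL] is a majorant for all
   the logarithmic and divisor losses. *)
Record grid (R : realType) := Grid {
  gh : R; gell : nat -> nat; gZ : nat; gJ : nat; gD : nat; gL : R;
  gh_gt0 : 0 < gh;
  gellM : forall m n, (0 < m)%N -> (0 < n)%N -> gell (m * n) = (gell m + gell n)%N;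
  gell_close : forall n, (0 < n <= gZ)%N ->
    `|gh * (gell n)%:R - ln n%:R| * gZ%:R ^+ 4 <= 1;
  gh_small : gh * gZ%:R ^+ 10 <= 1;
  gZ_ge : (2 ^ 10 <= gZ)%N;
  gJ_ge : gZ%:R ^+ 3 <= 2 ^+ gJ :> R;
  gJ_le : gJ.+1%:R <= gL;
  gD_ge : forall n, (0 < n <= gZ)%N -> (size (divisors n) <= gD)%N;
  gD_le : gD%:R <= gL;
  gL_ge : 2 ^+ 10 <= gL }.

Section GridSums.
Variables (R : realType) (G : grid R).

Definition lam n : R := gh G * (gell G n)%:R.

Lemma lamM m n : (0 < m)%N -> (0 < n)%N -> lam (m * n) = lam m + lam n.
Proof. by move=> m0 n0; rewrite /lam gellM// natrD mulrDr. Qed.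

Lemma gL_gt0 : 0 < gL G.
Proof. by rewrite (lt_le_trans _ (gL_ge G))// exprn_gt0. Qed.

Lemma gL_ge1 : 1 <= gL G.
Proof. by rewrite (le_trans _ (gL_ge G))// exprn_ege1// ler1n. Qed.

(** A pair with product [m] is determined by its first entry, a divisor of [m]. *)
Lemma count_mul_le (s1 s2 : seq nat) m : uniq s1 -> uniq s2 ->
  (forall n, n \in s1 -> 0 < n)%N -> (forall n, n \in s2 -> 0 < n)%N ->
  (0 < m <= gZ G)%N ->
  (count (fun u : nat * nat => (u.1 * u.2)%N == m)
    [seq (p, n) | p <- s1, n <- s2] <= gD G)%N.
Proof.
move=> u1 u2 p1 p2 mZ; have /andP[m0 _] := mZ.
rewrite (leq_trans _ (gD_ge mZ))// -size_filter.
rewrite -(size_map (fun u : nat * nat => u.1)).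
apply: uniq_leq_size.
  rewrite map_inj_in_uniq; first by apply: filter_uniq; apply: allpairs_uniq => // -[? ?] [? ?] _ _.
  move=> [x1 x2] [y1 y2]; rewrite !mem_filter /=.
  case/andP => /eqP xm /allpairsP[[p n]/= [ps ns [e1 e2]]].
  case/andP => /eqP ym /allpairsP[[p' n']/= [ps' ns' [e3 e4]]] e5.
  rewrite e5; congr pair; apply/eqP.
  by rewrite -(@eqn_pmul2l y1) ?ym -?xm ?e5// e3 p1.
move=> d /mapP[[x1 x2]]; rewrite mem_filter /= => /andP[/eqP xm _] ->.
by rewrite -dvdn_divisors// -xm dvdn_mulr.
Qed.

Section Family.
Variables (I : finType) (tau : I -> R).

Definition qsum (s : seq nat) : R :=
  \sum_(m <- s) \sum_(n <- s) cmod (expsum1 tau (lam m - lam n)) ^+ 2.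

Lemma qsum_ge0 s : 0 <= qsum s.
Proof. by apply: sumr_ge0 => m _; apply: sumr_ge0 => n _; rewrite sqr_ge0. Qed.

Lemma qsum_sub s s' : uniq s -> {subset s <= s'} -> qsum s <= qsum s'.
Proof.
move=> us ss; apply: (@le_trans _ _ (\sum_(m <- s) \sum_(n <- s')
    cmod (expsum1 tau (lam m - lam n)) ^+ 2)).
  by apply: ler_sum => m _; apply: ler_sum_uniq_sub => // n; rewrite sqr_ge0.
by apply: ler_sum_uniq_sub => // n; apply: sumr_ge0 => m _; rewrite sqr_ge0.
Qed.

(** Multiplying [m] and [n] by the same [p] leaves [lam m - lam n] unchanged. Only the first
    variable is counted with multiplicity: for fixed [p] and [m] the sum over [p n] is enlarged to
    all of [s'], so a single factor [gD] is lost. *)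
Lemma qsum_mono (sp s s' : seq nat) : uniq sp -> uniq s -> uniq s' ->
  (forall n, n \in sp -> 0 < n)%N -> (forall n, n \in s -> 0 < n)%N ->
  (forall n, n \in s' -> 0 < n <= gZ G)%N ->
  (forall p n, p \in sp -> n \in s -> (p * n)%N \in s') ->
  (size sp)%:R * qsum s <= (gD G)%:R * qsum s'.
Proof.
move=> usp us us' psp ps ps' sub.
pose F m n := cmod (expsum1 tau (lam m - lam n)) ^+ 2.
pose H m := \sum_(n <- s') F m n.
have H0 m : 0 <= H m by apply: sumr_ge0 => n _; rewrite sqr_ge0.
have := @ler_sum_fibre R _ _ [seq (p, n) | p <- sp, n <- s] s'
  (fun u : nat * nat => (u.1 * u.2)%N) H (gD G).
have -> : \sum_(n <- s') H n = qsum s' by [].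
move=> h; apply: le_trans (h _ us' H0 _).
- have -> : (size sp)%:R * qsum s = \sum_(p <- sp) qsum s.
    by rewrite big_const_seq count_predT iter_addr_0 mulr_natl.
  rewrite big_allpairs_dep /= big_seq [leRHS]big_seq; apply: ler_sum => p pp.
  rewrite /qsum [leLHS]big_seq [leRHS]big_seq; apply: ler_sum => m ms.
  have -> : \sum_(n <- s) cmod (expsum1 tau (lam m - lam n)) ^+ 2 =
      \sum_(n <- [seq (p * n)%N | n <- s]) F (p * m)%N n.
    rewrite big_map big_seq [RHS]big_seq; apply: eq_bigr => n ns.
    have e : lam m - lam n = lam (p * m) - lam (p * n).
      rewrite (lamM (psp _ pp) (ps _ ms)) (lamM (psp _ pp) (ps _ ns)).
      by rewrite opprD addrACA subrr add0r.
    by rewrite /F -e.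
  apply: ler_sum_uniq_sub; last by move=> n; rewrite sqr_ge0.
    rewrite map_inj_in_uniq// => x y _ _ /eqP.
    by rewrite eqn_pmul2l ?psp// => /eqP.
  by move=> n /mapP[k ks ->]; exact: sub.
- by move=> u /allpairsP[[p n] [/= pp nn ->]]; exact: sub.
- by move=> m ms; apply: count_mul_le => //; exact: ps'.
Qed.

(** On the dual side [qsum s] is a sum of [|k|^2] over pairs of points. Cauchy-Schwarz passes to
    [|k|^4], and [k^2] is a sum over products [m n], that is, a polynomial on [s'] with coefficients
    at most [gD]. So the length is squared at the cost of a factor [#|I|^2] and divisor losses. *)
Lemma qsum_sqr (s s' : seq nat) : uniq s -> uniq s' ->
  (forall n, n \in s -> 0 < n)%N -> (forall n, n \in s' -> 0 < n <= gZ G)%N ->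
  (forall m n, m \in s -> n \in s -> (m * n)%N \in s') ->
  qsum s ^+ 2 <= #|I|%:R ^+ 2 * (gD G)%:R ^+ 2 * qsum s'.
Proof.
move=> us us' ps ps' sub.
pose k t : R[i] := \sum_(n <- s) cis (t * lam n).
have kE t : ksum s lam (fun=> 1) t = k t.
  by apply: eq_bigr => n _; rewrite mul1r.
have qE : qsum s = \sum_(u : I * I) cmod (k (tau u.1 - tau u.2)) ^+ 2.
  rewrite -(pair_big predT predT (fun i j => cmod (k (tau i - tau j)) ^+ 2)) /=.
  under [RHS]eq_bigr => i _ do under eq_bigr => j _ do rewrite -kE.
  rewrite -positivity_one; apply: eq_bigr => m _; apply: eq_bigr => n _.
  by rewrite !mul1r.
pose s2 := [seq (m, n) | m <- s, n <- s].
pose ph2 (u : nat * nat) := lam (u.1 * u.2).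
have k2 t : k t ^+ 2 = ksum s2 ph2 (fun=> 1) t.
  rewrite expr2 /k /ksum big_allpairs_dep /= mulr_suml big_seq [RHS]big_seq.
  apply: eq_bigr => m ms; rewrite mulr_sumr big_seq [RHS]big_seq.
  apply: eq_bigr => n ns; rewrite mul1r -cisD /ph2/= lamM ?ps//.
  by rewrite mulrDr.
have cs : qsum s ^+ 2 <= #|I|%:R ^+ 2 *
    \sum_i \sum_j cmod (ksum s2 ph2 (fun=> 1) (tau i - tau j)) ^+ 2.
  rewrite qE; apply: (le_trans (sum_sqr_le _ _)).
  have -> : size (index_enum (Datatypes_prod__canonical__fintype_Finite I I)) =
     (#|I| * #|I|)%N by rewrite -card_prod cardT enumT.
  rewrite natrM -expr2 ler_wpM2l ?exprn_ge0//.
  rewrite -(pair_big predT predT (fun i j => (cmod (k (tau i - tau j)) ^+ 2) ^+ 2)) /=.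
  apply: ler_sum => i _; apply: ler_sum => j _.
  by rewrite -k2 expr2 [k _ ^+ 2]expr2 cmodM -expr2.
apply: (le_trans cs); rewrite -mulrA ler_wpM2l ?exprn_ge0//.
rewrite -positivity_one expr2 -mulrA.
pose F m n := cmod (expsum1 tau (lam m - lam n)) ^+ 2.
have Fge m n : 0 <= F m n by exact: sqr_ge0.
have cm m : m \in s' ->
   (count (fun u : nat * nat => (u.1 * u.2)%N == m) s2 <= gD G)%N.
  by move=> ms; apply: count_mul_le => //; exact: ps'.
have im u : u \in s2 -> (u.1 * u.2)%N \in s'.
  by move=> /allpairsP[[p n] [/= pp nn ->]]; exact: sub.
apply: (@le_trans _ _ (\sum_(u <- s2) (gD G)%:R * \sum_(n <- s') F (u.1 * u.2)%N n)).
  apply: ler_sum => u _.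
  have := @ler_sum_fibre R _ _ s2 s' (fun u : nat * nat => (u.1 * u.2)%N)
    (F (u.1 * u.2)%N) (gD G) im us' (Fge _) cm.
  by apply: le_trans; apply: ler_sum => v _; rewrite !mul1r.
rewrite -mulr_sumr ler_wpM2l//.
apply: (@ler_sum_fibre R _ _ s2 s' (fun u : nat * nat => (u.1 * u.2)%N)
   (fun m => \sum_(n <- s') F m n) (gD G)) => // m.
by apply: sumr_ge0.
Qed.

(* Each dyadic block is moved up to the top one by [qsum_mono]. *)
Lemma qsum_dyadic a : (4 * 2 ^ a <= gZ G)%N ->
  qsum (index_iota 1 (2 ^ a)) <=
  2 * a%:R * (gD G)%:R * qsum (index_iota (2 ^ a) (4 * 2 ^ a)).
Proof.
move=> aZ; set bx := index_iota (2 ^ a) _.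
pose blk j := index_iota (2 ^ j) (2 ^ j.+1).
have blk_le j : (j < a)%N -> 2 ^+ (a - j) * qsum (blk j) <= (gD G)%:R * qsum bx.
  move=> ja; have -> : 2 ^+ (a - j) =
      (size (index_iota (2 ^ (a - j)) (2 ^ (a - j).+1)))%:R :> R.
    rewrite size_iota expnS mul2n -addnn addnK.
    by rewrite natrX.
  have p2 k : (0 < 2 ^ k)%N by rewrite expn_gt0.
  apply: qsum_mono; rewrite ?iota_uniq//.
  - by move=> n; rewrite mem_index_iota => /andP[n1 _]; exact: leq_trans (p2 _) n1.
  - by move=> n; rewrite mem_index_iota => /andP[n1 _]; exact: leq_trans (p2 _) n1.
  - move=> n; rewrite mem_index_iota => /andP[n1 n2].
    by rewrite (leq_trans (p2 a) n1) (leq_trans (ltnW n2)).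
  - move=> p n; rewrite !mem_index_iota => /andP[p1 p3] /andP[n1 n2].
    have e1 : (2 ^ a = 2 ^ (a - j) * 2 ^ j)%N by rewrite -expnD subnK// ltnW.
    rewrite e1 leq_mul//=.
    have -> : (4 * (2 ^ (a - j) * 2 ^ j) = 2 ^ (a - j).+1 * 2 ^ j.+1)%N.
      by rewrite !expnS; ring.
    by rewrite ltn_mul.
(* On the dual side the polynomial on [[1, 2^a)] is the sum of its [a] dyadic blocks, so
   Cauchy-Schwarz costs a factor [a]. *)
have split_q : qsum (index_iota 1 (2 ^ a)) <= a%:R * \sum_(j < a) qsum (blk j).
  have qE s : qsum s = \sum_i \sum_j cmod (ksum s lam (fun=> 1) (tau i - tau j)) ^+ 2.
    rewrite -positivity_one; apply: eq_bigr => m _; apply: eq_bigr => n _.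
    by rewrite !mul1r.
  rewrite qE (eq_bigr _ (fun (j : 'I_a) _ => qE (blk j))).
  rewrite mulr_sumr.
  under [leRHS]eq_bigr => j _ do rewrite mulr_sumr.
  rewrite [leRHS]exchange_big /=; apply: ler_sum => i _.
  under [leRHS]eq_bigr => j _ do rewrite mulr_sumr.
  rewrite [leRHS]exchange_big /=; apply: ler_sum => i' _.
  rewrite -mulr_sumr.
  have -> : ksum (index_iota 1 (2 ^ a)) lam (fun=> 1) (tau i - tau i') =
     \sum_(j < a) ksum (blk j) lam (fun=> 1) (tau i - tau i').
    elim: (a) => [|b IH]; first by rewrite expn0 big_ord0 /ksum /index_iota big_nil.
    rewrite big_ord_recr /= -IH /ksum (@big_cat_nat _ _ _ (2 ^ b))//.
      by rewrite expn_gt0.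
    by rewrite leq_exp2l.
  have := @cmod_sum_sqr_le R _ (index_enum 'I_a)
    (fun j => ksum (blk j) lam (fun=> 1) (tau i - tau i')).
  by have -> : size (index_enum 'I_a) = a by rewrite -[RHS]card_ord cardT enumT.
apply: (le_trans split_q).
apply: (@le_trans _ _ (a%:R * \sum_(j < a) (2 ^- (a - j)) * ((gD G)%:R * qsum bx))).
  rewrite ler_wpM2l//; apply: ler_sum => j _.
  by rewrite mulrC ler_pdivlMr ?exprn_gt0// mulrC blk_le.
rewrite -mulr_suml.
have geo : \sum_(j < a) 2 ^- (a - j) <= 2 :> R.
  have : \sum_(j < a) 2 ^- (a - j) = 1 - 2 ^- a :> R.
    elim: (a) => [|b IH]; first by rewrite big_ord0 expr0 invr1 subrr.
    rewrite big_ord_recl /= subn0.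
    have -> : \sum_(j < b) 2 ^- (b.+1 - bump 0 j) = \sum_(j < b) 2 ^- (b - j) :> R.
      by apply: eq_bigr => j _; rewrite /bump add1n subSS.
    by rewrite IH exprS; field; rewrite expf_neq0.
  move=> ->; have : 0 <= 2 ^- a :> R by rewrite invr_ge0 exprn_ge0.
  lra.
have q0 := qsum_ge0 bx.
have -> : 2 * a%:R * (gD G)%:R * qsum bx = a%:R * (2 * ((gD G)%:R * qsum bx)).
  by ring.
by rewrite ler_wpM2l// ler_wpM2r// mulr_ge0.
Qed.

End Family.
End GridSums.

Section ExpBounds.
Variable R : realType.
Implicit Types x r : R.

Lemma expR_le_inv x : x < 1 -> expR x <= (1 - x)^-1.
Proof.
move=> x1; have h := expR_ge1Dx (- x); have e := expRxMexpNx_1 x.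
have x0 : 0 < 1 - x by rewrite subr_gt0.
rewrite -[leRHS]mul1r ler_pdivlMr//; have := expR_ge0 x; nra.
Qed.

(** [41 / 10] bounds the length of the logarithmic window of the grid, so ratios of points of one
    window lie between [2^(-7)] and [2^7]. This is the source of the powers [2^7] below. *)
Lemma expR_le_128 x : x <= 41 / 10 -> expR x <= 2 ^+ 7.
Proof.
move=> x4; apply: (@le_trans _ _ (expR (16%:R * (41 / 160)))).
  rewrite ler_expR; lra.
rewrite expRM_natl.
have h : expR (41 / 160 : R) <= 35 / 26.
  apply: (le_trans (expR_le_inv _)); first lra.
  by rewrite (_ : (1 - 41 / 160)^-1 = 160 / 119); [lra|field].
have h0 : 0 <= expR (41 / 160 : R) by exact: expR_ge0.
have sq a b : 0 <= a -> a <= b -> a ^+ 2 <= b ^+ 2 :> R.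
  by move=> a0 ab; rewrite ler_sqr ?nnegrE// (le_trans a0).
have h2 : expR (41 / 160 : R) ^+ 2 <= 29 / 16.
  by apply: (le_trans (sq _ _ h0 h)); lra.
have h4 : (expR (41 / 160 : R) ^+ 2) ^+ 2 <= 23 / 7.
  by apply: (le_trans (sq _ _ _ h2)); [exact: sqr_ge0|lra].
have h8 : ((expR (41 / 160 : R) ^+ 2) ^+ 2) ^+ 2 <= 54 / 5.
  by apply: (le_trans (sq _ _ _ h4)); [exact: sqr_ge0|lra].
have -> : expR (41 / 160 : R) ^+ 16 = (((expR (41 / 160 : R) ^+ 2) ^+ 2) ^+ 2) ^+ 2.
  by rewrite -!exprM.
by apply: (le_trans (sq _ _ _ h8)); [exact: sqr_ge0|lra].
Qed.

Lemma abs_expR_sub1 x : `|x| <= 2^-1 -> `|expR x - 1| <= 2 * `|x|.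
Proof.
rewrite ler_norml => /andP[h1 h2].
have e1 := expR_ge1Dx x.
have e2 : expR x <= (1 - x)^-1 by apply: expR_le_inv; lra.
have e3 : (1 - x)^-1 <= 1 + 2 * `|x|.
  rewrite -[leLHS]mul1r ler_pdivrMr; last lra.
  by have [x0|x0] := leP 0 x; [rewrite ger0_norm//|rewrite ltr0_norm//]; nra.
rewrite ler_norml; apply/andP; split; last lra.
by have := ler_norm (- x); rewrite normrN; lra.
Qed.

Lemma abs_le_expR_sub1 x r : r <= 2^-1 -> `|expR x - 1| <= r -> `|x| <= 2 * r.
Proof.
rewrite !ler_norml => r2 /andP[h1 h2]; apply/andP; split; last first.
  by have := expR_ge1Dx x; lra.
have e1 := expR_ge1Dx (- x); have e2 := expRxMexpNx_1 x.
have e3 : 0 < expR (- x) by exact: expR_gt0.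
have : expR (- x) <= 1 + 2 * r by nra.
lra.
Qed.

Lemma sum_card_le (n : nat) x : 0 <= x ->
  \sum_(m < n) (m.+1%:R <= x)%R%:R <= x.
Proof.
move=> x0; have : \sum_(m < n) (m.+1%:R <= x)%R%:R <= (Num.truncn x)%:R :> R.
  elim: n => [|n IH]; first by rewrite big_ord0.
  rewrite big_ord_recr /=; have [nx|nx] := leP n.+1%:R x; last by rewrite addr0.
  apply: (@le_trans _ _ (\sum_(m < n.+1) 1)).
    rewrite big_ord_recr /= lerD2r; apply: ler_sum => m _.
    by case: (m.+1%:R <= x)%R; rewrite ?ler01.
  rewrite sumr_const card_ord ler_nat.
  by rewrite truncn_ge_nat.
by move=> /le_trans; apply; rewrite truncn_le.
Qed.

End ExpBounds.

(** * The window of the grid around [ln N] and phase sums along it *)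

Section GridGeometry.
Variables (R : realType) (G : grid R).
Notation h := (gh G).
Notation Z := (gZ G).
Notation L := (gL G).
Notation lamG := (lam G).
Notation LC := (lc (gJ G).+1).

Lemma gZ_ge2 : 2 ^+ 10 <= Z%:R :> R.
Proof. by rewrite -natrX ler_nat gZ_ge. Qed.

Lemma gZ_ge1 : 1 <= Z%:R :> R.
Proof. by rewrite (le_trans _ gZ_ge2)// exprn_ege1// ler1n. Qed.

Lemma gh_le_inv (c : R) : c <= Z%:R ^+ 10 -> h * c <= 1.
Proof.
by move=> cZ; rewrite (le_trans _ (gh_small G))// ler_wpM2l// ltW// gh_gt0.
Qed.

Lemma gh_le1000 : h * 2 ^+ 10 <= 1.
Proof.
apply: gh_le_inv; rewrite (le_trans gZ_ge2)// -[leLHS]expr1.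
by rewrite ler_weXn2l// gZ_ge1.
Qed.

Definition eps : R := (Z%:R ^+ 4)^-1.

Lemma eps_gt0 : 0 < eps.
Proof. by rewrite invr_gt0 exprn_gt0// (lt_le_trans _ gZ_ge1). Qed.

Lemma eps_small (c : R) : c <= Z%:R ^+ 4 -> eps * c <= 1.
Proof.
by move=> cZ; rewrite mulrC ler_pdivrMr ?mul1r// exprn_gt0// (lt_le_trans _ gZ_ge1).
Qed.

Lemma lam_close n : (0 < n <= Z)%N -> `|lamG n - ln n%:R| <= eps.
Proof.
move=> nZ; rewrite -[leRHS]mul1r ler_pdivlMr ?(gell_close nZ)//.
by rewrite exprn_gt0// (lt_le_trans _ gZ_ge1).
Qed.

(** The number of grid steps in a unit of logarithmic length, rounded up. *)
Definition gG := (Num.truncn h^-1).+1.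

Lemma gG_itv : 1 <= h * gG%:R <= 1 + h.
Proof.
have h0 := gh_gt0 G; have hi : 0 <= h^-1 by rewrite invr_ge0 ltW.
have /andP[t1 /ltW t2] := truncn_itv hi.
rewrite /gG mulrC -ler_pdivrMr// mul1r t2 /= -natr1 mulrDl mul1r lerD2r.
by rewrite -ler_pdivlMr// mul1r.
Qed.

Definition gH := (4 * gG)%N.

Lemma gH_le : h * gH%:R <= 41 / 10.
Proof.
have /andP[_ h2] := gG_itv; have := gh_le1000.
rewrite /gH natrM mulrCA; have := gh_gt0 G; lra.
Qed.

(* The index [d] encodes the difference [d - gH] of two grid indices. *)
Definition dv (d : nat) : R := h * (d%:R - gH%:R).

Lemma abs_dv (d : 'I_(2 * gH)) : `|dv d| <= 41 / 10.
Proof.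
apply: le_trans gH_le; rewrite normrM (gtr0_norm (gh_gt0 G)) ler_pM2l ?gh_gt0//.
have : (d < 2 * gH)%N by [].
rewrite -(ltr_nat R) natrM ler_norml => d2.
have : 0 <= d%:R :> R by []. lra.
Qed.

(** The ratio of two points of the window; it depends only on the difference of their indices. *)
Definition vv (d : nat) : R := expR (dv d).

Lemma vv_gt0 d : 0 < vv d.
Proof. exact: expR_gt0. Qed.

Lemma vv_le (d : 'I_(2 * gH)) : vv d <= 2 ^+ 7.
Proof. by apply: expR_le_128; have := abs_dv d; rewrite ler_norml => /andP[]. Qed.

Lemma vv_ge (d : 'I_(2 * gH)) : 1 <= vv d * 2 ^+ 7.
Proof.
have e : expR (- dv d) <= 2 ^+ 7.
  apply: expR_le_128; have := abs_dv d; rewrite ler_norml => /andP[]; lra.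
have := expRxMexpNx_1 (dv d); have := expR_gt0 (dv d); rewrite /vv; nra.
Qed.

Section Scale.
Variable N : nat.
Hypothesis N0 : (0 < N)%N.
Hypothesis NZ : room 10 N Z.

Let NZ' : (0 < N <= Z)%N.
Proof. by rewrite N0 (leq_trans _ NZ)// leq_pmull// expn_gt0. Qed.

(** The window starts one unit below [lam N] and has length about 4. It therefore contains the
    logarithms of [[N, 4 N)] with room for rounding errors and short shifts on both sides. *)
Definition yy (k : nat) : R := lamG N - h * gG%:R + h * k%:R.
Definition xx (k : nat) : R := expR (yy k).

Lemma xx_gt0 k : 0 < xx k.
Proof. exact: expR_gt0. Qed.

Lemma xxD k j : xx (k + j) = xx k * expR (h * j%:R).
Proof. by rewrite /xx -expRD /yy natrD; congr expR; ring. Qed.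

Lemma lnN_close : `|lamG N - ln N%:R| <= 1 / 100.
Proof.
apply: (le_trans (lam_close NZ')).
have e : eps * Z%:R <= 1.
  apply: eps_small; rewrite -[leLHS]expr1; apply: ler_weXn2l => //; exact: gZ_ge1.
have := gZ_ge2; have := eps_gt0; nra.
Qed.

Lemma xx_ge k : N%:R <= 8 * xx k.
Proof.
have NR : 0 < N%:R :> R by rewrite ltr0n.
have e1 : expR (ln N%:R - 3 / 2) <= xx k.
  rewrite ler_expR /yy; have := lnN_close; rewrite ler_norml => /andP[c1 c2].
  have /andP[_ g2] := gG_itv; have := gh_le1000.
  have : 0 <= h * k%:R by rewrite mulr_ge0// ltW// gh_gt0.
  have := gh_gt0 G; lra.
rewrite expRD lnK ?posrE// in e1.
have e2 : 8^-1 <= expR (- (3 / 2)) :> R.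
  rewrite expRN lef_pV2 ?posrE ?expR_gt0//.
  have -> : 3 / 2 = 3%:R * (1 / 2) :> R by field.
  rewrite expRM_natl.
  have e3 : expR (1 / 2 : R) <= 2.
    apply: (le_trans (expR_le_inv _)); first lra.
    by rewrite (_ : (1 - 1 / 2)^-1 = 2)//; field.
  have -> : 8 = 2 ^+ 3 :> R by ring.
  by rewrite lerXn2r ?nnegrE ?expR_ge0.
by nra.
Qed.

Lemma xx_le k : (k < gH)%N -> xx k <= 2 ^+ 7 * N%:R.
Proof.
move=> kH; have NR : 0 < N%:R :> R by rewrite ltr0n.
have e1 : xx k <= expR (ln N%:R + 41 / 10).
  rewrite ler_expR /yy; have := lnN_close; rewrite ler_norml => /andP[c1 c2].
  have /andP[g1 _] := gG_itv; have := gH_le.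
  have : h * k%:R <= h * gH%:R by rewrite ler_pM2l ?gh_gt0// ler_nat ltnW.
  lra.
rewrite expRD lnK ?posrE// in e1; rewrite (le_trans e1)// mulrC.
by rewrite ler_pM2r// expR_le_128.
Qed.

(** A Riemann sum for the integral of [e(th e^y)] over a part of the window. Its phase is
    [al exp(h k)] with [|al|] of order [N |th|], so [exponential_phase_bound] gives decay
    [1 / (N |th|)], and the length of the window gives the trivial bound. *)
Lemma grid_phase_sum (th : R) a b : (b <= gH)%N -> N%:R * `|th| <= Z%:R ->
  h * cmod (\sum_(a <= k < b) ep (th * xx k)) <= 24 * LC (N%:R * `|th|).
Proof.
move=> bH thZ; have NR : 0 < N%:R :> R by rewrite ltr0n.
have [ab|ba] := leqP a b; last first.
  by rewrite big_geq ?(ltnW ba)// cmod0 mulr0 mulr_ge0// lc_ge0.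
have [aH|aH] := ltnP a gH; last first.
  by rewrite big_geq ?(leq_trans bH)// cmod0 mulr0 mulr_ge0// lc_ge0.
have -> : \sum_(a <= k < b) ep (th * xx k) =
    \sum_(k < b - a) cis ((2 * pi * th * xx a) * expR (h * k%:R)).
  rewrite -{1}[a]add0n big_addn big_mkord; apply: eq_bigr => k _.
  by rewrite addnC xxD /ep; congr cis; ring.
set al := 2 * pi * th * xx a; set n := (b - a)%N.
have nH : (n <= gH)%N by rewrite /n (leq_trans (leq_subr _ _)).
have h0 := gh_gt0 G.
have hn : h * n%:R <= 41 / 10.
  by apply: le_trans gH_le; rewrite ler_pM2l// ler_nat.
have p2 : 2 <= pi :> R by exact: pi_ge2.
have p4 : pi <= 4 :> R by have := @pihalf_lt2 R; lra.
have absal : `|al| = 2 * pi * xx a * `|th|.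
  rewrite /al !normrM normr_nat (ger0_norm (pi_ge0 R)) (gtr0_norm (xx_gt0 a)); ring.
have al1 : N%:R * `|th| <= 2 * `|al|.
  rewrite absal mulrA ler_wpM2r//; have := xx_ge a; have := xx_gt0 a; nra.
have al2 : `|al| <= 2 ^+ 10 * Z%:R.
  rewrite absal; apply: (@le_trans _ _ (2 * 4 * (2 ^+ 7 * N%:R) * `|th|)).
    rewrite ler_wpM2r// ler_pM ?(ltW (xx_gt0 _)) ?xx_le//; lra.
  have -> : 2 * 4 * (2 ^+ 7 * N%:R) * `|th| = 2 ^+ 10 * (N%:R * `|th|) by ring.
  by rewrite ler_pM2l// exprn_gt0.
have Z1 := gZ_ge2.
have small : 2 * n%:R * h ^+ 2 * al ^+ 2 * expR (h * n%:R) <= 1.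
  have e128 : expR (h * n%:R) <= 2 ^+ 7 by exact: expR_le_128.
  have al22 : al ^+ 2 <= (2 ^+ 10 * Z%:R) ^+ 2.
    by rewrite -real_normK ?num_real// ler_sqr ?nnegrE// mulr_ge0.
  have c1 : 2 * n%:R * h ^+ 2 * al ^+ 2 * expR (h * n%:R) <=
     (2 * (41 / 10) * h) * (2 ^+ 10 * Z%:R) ^+ 2 * 2 ^+ 7.
    have E0 := expR_ge0 (h * n%:R); have A0 := sqr_ge0 al.
    move: (al ^+ 2) (expR _) al22 e128 A0 E0 => A E al22 e128 A0 E0.
    have -> : 2 * n%:R * h ^+ 2 * A * E = (2 * (h * n%:R) * h) * (A * E) by ring.
    rewrite -[leRHS]mulrA; apply: ler_pM.
    - by rewrite !mulr_ge0// ltW.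
    - by rewrite mulr_ge0.
    - by rewrite ler_pM2r//; lra.
    - exact: ler_pM.
  apply: (le_trans c1).
  have c2 : h * (2 ^+ 40 * Z%:R ^+ 2) <= 1.
    apply: gh_le_inv; have -> : 10%N = (4 + 4 + 2)%N by [].
    rewrite !exprD ler_wpM2r ?exprn_ge0// -exprD.
    have -> : 2 ^+ 40 = (2 ^+ 10) ^+ 4 :> R by rewrite -exprM.
    rewrite (@le_trans _ _ (Z%:R ^+ 4))//.
      by rewrite lerXn2r ?nnegrE ?exprn_ge0.
    by apply: ler_weXn2l => //; exact: gZ_ge1.
  apply: le_trans c2.
  have z2 : 0 <= h * Z%:R ^+ 2 by rewrite mulr_ge0 ?exprn_ge0// ltW.
  have -> : 2 * (41 / 10) * h * (2 ^+ 10 * Z%:R) ^+ 2 * 2 ^+ 7 =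
    (41 / 5 * 2 ^+ 27) * (h * Z%:R ^+ 2) by field.
  have -> : h * (2 ^+ 40 * Z%:R ^+ 2) = 2 ^+ 40 * (h * Z%:R ^+ 2) by ring.
  rewrite ler_wpM2r//; lra.
have h2 : h <= 2^-1 by have := gh_le1000; lra.
have bd := exponential_phase_bound h0 h2 small.
set S := cmod _ in bd *; have S0 : 0 <= S by exact: cmod_ge0.
have triv : h * S <= 41 / 10.
  apply: le_trans hn; rewrite ler_pM2l//.
  rewrite (le_trans (cmod_sum _ _ _))// (eq_bigr (fun=> 1)); last first.
    by move=> k _; rewrite cmod_cis.
  by rewrite sumr_const card_ord.
have hS : 0 <= h * S by rewrite mulr_ge0// ltW.
have t0 : 0 <= N%:R * `|th| by rewrite mulr_ge0.
(* [12 = 2 * 6]: the constant of [exponential_phase_bound] times the loss in [N |th| <= 2 |al|]. *)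
have : h * S / 12 <= 2 * LC (N%:R * `|th|).
  apply: le_lc.
  - by rewrite divr_ge0.
  - apply: (le_trans thZ); apply: le_trans (gJ_ge G).
    rewrite -[leLHS]expr1; apply: ler_weXn2l => //; exact: gZ_ge1.
  - lra.
  - have : h * S * (N%:R * `|th|) <= h * S * (2 * `|al|) by rewrite ler_wpM2l.
    lra.
lra.
Qed.

End Scale.
End GridGeometry.

Section Counting.
Variable R : realType.

Lemma sum_eq_le1 (I : finType) (T : eqType) (f : I -> T) (c : T) :
  injective f -> \sum_(i : I) (f i == c)%:R <= 1 :> R.
Proof.
move=> inj; have [/existsP[i /eqP fi]|/existsPn no] := boolP [exists i, f i == c].
  rewrite (bigD1 i)//= fi eqxx big1 ?addr0// => j ji.
  by case: eqP => // fj; rewrite (inj j i) ?eqxx// in ji; rewrite fj.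
by rewrite big1 ?ler01// => i _; rewrite (negbTE (no i)).
Qed.

Lemma lc_mul_le J (u : R) : 0 <= u -> lc J u * u <= J%:R.
Proof.
move=> u0; rewrite /lc mulr_suml.
apply: (@le_trans _ _ (\sum_(j < J) 1)); last by rewrite sumr_const card_ord.
apply: ler_sum => j _; have p2 : 0 < 2 ^+ j :> R by rewrite exprn_gt0.
have [uj|_] := leP u (2 ^+ j); last by rewrite mulr0 mul0r.
by rewrite mulr1 mulrC ler_pdivrMr// mul1r.
Qed.

Lemma lc_le2 J (u : R) : lc J u <= 2.
Proof.
have : lc J u <= 2 - 2 * 2 ^- J.
  rewrite /lc; elim: J => [|J IH]; first by rewrite big_ord0 expr0 invr1; lra.
  have t : 2 ^- J * (u <= 2 ^+ J)%R%:R <= 2 ^- J :> R.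
    by rewrite ler_piMr ?invr_ge0 ?exprn_ge0// lern1 leq_b1.
  rewrite big_ord_recr /=; apply: (le_trans (lerD IH t)).
  rewrite exprS invfM; have : 0 <= 2 ^- J :> R by rewrite invr_ge0 exprn_ge0.
  lra.
have : 0 <= 2 ^- J :> R by rewrite invr_ge0 exprn_ge0.
lra.
Qed.

(** The substitution [k1 = k2 + d - H], where the offset [H] keeps the difference in the natural
    numbers; the condition on [d] says that [k1] lies in its range. *)
Lemma reindex_diff (V : nmodType) (H : nat) (k2 : 'I_H) (f : nat -> V) :
  \sum_(k1 < H) f k1 =
  \sum_(d < 2 * H | (H <= k2 + d < 2 * H)%N) f (k2 + d - H)%N.
Proof.
have lt1 (k : 'I_H) : (k + H - k2 < 2 * H)%N.
  by have := ltn_ord k; have := ltn_ord k2; lia.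
rewrite (reindex_onto (fun k : 'I_H => Ordinal (lt1 k))
  (fun d : 'I_(2 * H) => insubd k2 (k2 + d - H)%N)) /=; last first.
  move=> d /andP[d1 d2]; apply: val_inj => /=; rewrite insubdK /in_mem /=.
    by have := ltn_ord k2; lia.
  by clear -d1 d2; lia.
apply: eq_big => [k|k _].
  have e : (k2 + (k + H - k2) = k + H)%N by have := ltn_ord k2; lia.
  rewrite e leq_addl/=.
  have -> : (k + H < 2 * H)%N by have := ltn_ord k; lia.
  rewrite /= addnK; apply/esym/eqP; apply: val_inj; rewrite insubdK//.
  exact: ltn_ord.
by congr f; have := ltn_ord k2; have := ltn_ord k; lia.
Qed.

Lemma sum_succ_le (M X : nat) (f : nat -> R) : (forall m, 0 <= f m) ->
  \sum_(m < M) (m.+1 < X)%N%:R * f m.+1 <= \sum_(m <- index_iota 1 X) f m.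
Proof.
move=> f0.
have -> : \sum_(m < M) (m.+1 < X)%N%:R * f m.+1 =
    \sum_(m <- [seq m.+1 | m <- iota 0 M & (m.+1 < X)%N]) f m.
  rewrite big_map big_filter [RHS]big_mkcond /=.
  rewrite (_ : iota 0 M = index_iota 0 M) ?big_mkord; last first.
    by rewrite /index_iota subn0.
  by apply: eq_bigr => m _; case: ifP; rewrite ?mul1r ?mul0r.
apply: ler_sum_uniq_sub => //.
  by rewrite map_inj_uniq ?filter_uniq ?iota_uniq// => x y [].
by move=> m /mapP[k]; rewrite mem_filter => /andP[kX _] ->; rewrite mem_index_iota.
Qed.

End Counting.

(** * Near-coincidences of [m v] and [m'] *)

Section BilinearKernel.
Variables (R : realType) (G : grid R).
Notation h := (gh G).
Notation Z := (gZ G).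
Notation L := (gL G).
Notation H := (gH G).
Notation lamG := (lam G).
Notation LC := (lc (gJ G).+1).
Variables (N M : nat).
Hypotheses (N0 : (0 < N)%N) (M0 : (0 < M)%N) (NMZ : room 10 (N * M) Z).

Let NR : 0 < N%:R :> R. Proof. by rewrite ltr0n. Qed.
Let MR : 0 < M%:R :> R. Proof. by rewrite ltr0n. Qed.

Let NMZR : 2 ^+ 10 * (N%:R * M%:R) <= Z%:R :> R.
Proof. by rewrite -natrX -!natrM ler_nat. Qed.

Let ZZ4 : Z%:R <= Z%:R ^+ 4 :> R.
Proof. by rewrite -[leLHS]expr1; apply: ler_weXn2l => //; exact: gZ_ge1. Qed.

Lemma M_le_Z k : (k <= 10)%N -> (2 ^ k * M <= Z)%N.
Proof.
move=> k10; apply: leq_trans NMZ; apply: leq_mul; first by rewrite leq_exp2l.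
by rewrite leq_pmull.
Qed.

(** The nine extra powers of 2 make room for both members of a pair: if [m' < 2^(a + 1)] and [m v]
    is close to [m'] with [v >= 2^(-7)], then [m < 2^(9 + a)]. *)
Definition blockM a := index_iota 1 (2 ^ (9 + a)).

(** [m v / m'] is the exponential of [z], so [|z| <= 2 D / m']. Replacing the two logarithms by
    [lam] costs at most [D / (2 m')] each, since [eps] is far smaller than [1 / (N M)]; the total is
    [3 D / m']. *)
Lemma pair_window (d : 'I_(2 * H)) (m m' : nat) (D : R) a :
  (0 < m <= M)%N -> (0 < m' <= M)%N -> N%:R^-1 <= D -> 4 * D < m'%:R ->
  (2 ^ a <= m' < 2 ^ a.+1)%N ->
  `|m%:R * vv G d - m'%:R| <= D ->
  (m < 2 ^ (9 + a))%N /\ `|dv G d - (lamG m' - lamG m)| <= 3 * D / 2 ^+ a.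
Proof.
move=> /andP[m0 mM] /andP[m'0 m'M] ND Dm' /andP[a1 a2] hD.
have mR : 0 < m%:R :> R by rewrite ltr0n.
have m'R : 0 < m'%:R :> R by rewrite ltr0n.
have D0 : 0 < D by apply: lt_le_trans ND; rewrite invr_gt0.
have a1R : 2 ^+ a <= m'%:R :> R by rewrite -natrX ler_nat.
have a2R : m'%:R <= 2 * 2 ^+ a :> R by rewrite -exprS -natrX ler_nat ltnW.
have p2 : 0 < 2 ^+ a :> R by rewrite exprn_gt0.
split.
  rewrite -(ltr_nat R) natrX exprD.
  have := vv_ge d; have := vv_gt0 G d; move: hD; rewrite ler_norml => /andP[_ h2].
  move: (vv G d) h2 => v h2 v0 v1.
  have e1 : m%:R <= m%:R * (v * 2 ^+ 7) by rewrite ler_peMr// ltW.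
  have e2 : m%:R * v <= 5 / 4 * m'%:R by lra.
  have e3 : m%:R * (v * 2 ^+ 7) <= 5 / 4 * m'%:R * 2 ^+ 7.
    by rewrite mulrA ler_pM2r// exprn_gt0.
  have -> : 2 ^+ 9 * 2 ^+ a = 4 * 2 ^+ 7 * 2 ^+ a :> R by ring.
  lra.
set z := dv G d - (ln m'%:R - ln m%:R).
have zE : expR z = m%:R * vv G d / m'%:R.
  rewrite /z !expRB !lnK ?posrE// /vv; field.
  by rewrite !gt_eqF.
have z1 : `|z| <= 2 * (D / m'%:R).
  apply: abs_le_expR_sub1; first by rewrite ler_pdivrMr//; lra.
  have -> : expR z - 1 = (m%:R * vv G d - m'%:R) / m'%:R.
    by rewrite zE mulrBl divff// gt_eqF.
  by rewrite normrM normfV (gtr0_norm m'R) ler_pM2r ?invr_gt0.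
have mZ k : (0 < k <= M)%N -> (0 < k <= Z)%N.
  move=> /andP[k0 kM]; rewrite k0 (leq_trans kM)//.
  by have := M_le_Z (leq0n 10); rewrite expn0 mul1n.
have c1 := lam_close (mZ m _); have c2 := lam_close (mZ m' _).
rewrite m0 mM in c1; rewrite m'0 m'M in c2.
move: (c1 isT) (c2 isT) => {}c1 {}c2.
have e0 : eps G <= D / (2 * m'%:R).
  have h1 : eps G * (N%:R * M%:R * 2) <= 1.
    apply: eps_small; apply: le_trans ZZ4; apply: le_trans NMZR.
    have : 0 <= N%:R * M%:R :> R by rewrite mulr_ge0. lra.
  rewrite ler_pdivlMr ?mulr_gt0//.
  apply: le_trans ND; rewrite -[leRHS]mul1r ler_pdivlMr//.
  apply: le_trans h1; rewrite -mulrA ler_pM2l ?eps_gt0//.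
  have hm : m'%:R <= M%:R :> R by rewrite ler_nat.
  by have := ler_wpM2l (ltW NR) hm; lra.
have e1 : D / m'%:R <= D / 2 ^+ a by rewrite ler_pM2l// lef_pV2 ?posrE.
have -> : dv G d - (lamG m' - lamG m) =
  z - (lamG m' - ln m'%:R) + (lamG m - ln m%:R) by rewrite /z; ring.
rewrite (le_trans (ler_normD _ _))// (le_trans (lerD (ler_normB _ _) (lexx _)))//.
have -> : 3 * D / 2 ^+ a = 3 * (D / 2 ^+ a) by ring.
have e2 : D / (2 * m'%:R) = (D / m'%:R) / 2 by field; rewrite gt_eqF.
rewrite e2 in e0; lra.
Qed.

Definition near (r : R) (x : R) : R := (`|x| <= r)%R%:R.

Lemma near_ge0 r x : 0 <= near r x. Proof. by rewrite /near. Qed.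

(** The pairs with [m' <= 4 D] are counted trivially: four choices of signs, [M] values of [m] and
    at most [4 D] of [m']. For larger [m'] equal signs are impossible, and the two choices of
    opposite signs give the windows of [pair_window]. *)
Lemma pair_count (d : 'I_(2 * H)) (D : R) : N%:R^-1 <= D ->
  \sum_(p : 'I_M * bool) \sum_(q : 'I_M * bool)
     (`|zr R p * vv G d + zr R q| <= D)%R%:R <=
  16 * M%:R * D + 2 * \sum_(a < (gJ G).+1 | (2 ^ a <= M)%N)
    \sum_(m <- blockM a) \sum_(m' <- blockM a)
      near (3 * D / 2 ^+ a) (dv G d - (lamG m' - lamG m)).
Proof.
move=> ND; have D0 : 0 < D by apply: lt_le_trans ND; rewrite invr_gt0.
have v0 := vv_gt0 G d.
pose W m m' : R := \sum_(a < (gJ G).+1 | (2 ^ a <= M)%N)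
   (m < 2 ^ (9 + a))%N%:R * ((m' < 2 ^ (9 + a))%N%:R *
     near (3 * D / 2 ^+ a) (dv G d - (lamG m' - lamG m))).
have W0 m m' : 0 <= W m m'.
  by apply: sumr_ge0 => a _; rewrite mulr_ge0// mulr_ge0// near_ge0.
have term (m m' : 'I_M) : \sum_(b : bool) \sum_(b' : bool)
    (`|zr R (m, b) * vv G d + zr R (m', b')| <= D)%R%:R <=
    4 * (m'.+1%:R <= 4 * D)%R%:R + 2 * W m.+1 m'.+1.
  have [le4|gt4] := leP m'.+1%:R (4 * D).
    rewrite mulr1 (@le_trans _ _ 4)//; last first.
      by rewrite lerDl mulr_ge0// W0.
    apply: (@le_trans _ _ (\sum_(b : bool) \sum_(b' : bool) 1)).
      by apply: ler_sum => b _; apply: ler_sum => b' _; case: (_ <= D)%R; rewrite ?ler01.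
    by rewrite !big_bool /=; lra.
  rewrite mulr0 add0r.
  have same b : (`|zr R (m, b) * vv G d + zr R (m', b)| <= D)%R = false.
    apply/negbTE; rewrite -ltNge /zr /= -mulrA -mulrDr normrM normrX normrN1 expr1n mul1r.
    rewrite ger0_norm; last by rewrite addr_ge0// mulr_ge0// ltW.
    have : 0 <= m.+1%:R * vv G d by rewrite mulr_ge0// ltW.
    lra.
  rewrite !big_bool /= !same addr0 add0r /=.
  have dif : (`|m.+1%:R * vv G d - m'.+1%:R| <= D)%R%:R <= W m.+1 m'.+1.
    have [hD|_] := boolP (_ <= D); last exact: W0.
    have m'M : (0 < m'.+1 <= M)%N by rewrite ltn0Sn ltn_ord.
    have mM : (0 < m.+1 <= M)%N by rewrite ltn0Sn ltn_ord.
    pose a := trunc_log 2 m'.+1.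
    have aP : (2 ^ a <= m'.+1 < 2 ^ a.+1)%N by apply: trunc_log_bounds.
    have [ma na] := pair_window mM m'M ND gt4 aP hD.
    have a2M : (2 ^ a <= M)%N.
      by have /andP[a1 _] := aP; rewrite (leq_trans a1).
    have aJ : (a < (gJ G).+1)%N.
      rewrite ltnS -(@leq_exp2l 2)// -(ler_nat R) !natrX.
      apply: le_trans (gJ_ge G).
      have a2 : 2 ^+ a <= Z%:R :> R.
        rewrite -natrX ler_nat (leq_trans a2M)//.
        by have := M_le_Z (leq0n 10); rewrite expn0 mul1n.
      apply: (le_trans a2); rewrite -[leLHS]expr1.
      by apply: ler_weXn2l => //; exact: gZ_ge1.
    rewrite /W (bigD1 (Ordinal aJ))//= ma mul1r.
    have -> : (m'.+1 < 2 ^ (9 + a))%N.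
      have /andP[_ a3] := aP; rewrite (leq_trans a3)// leq_exp2l//.
      by clear; lia.
    rewrite mul1r /near na lerDl; apply: sumr_ge0 => b _.
    by rewrite mulr_ge0// mulr_ge0// near_ge0.
  rewrite /zr /= !expr0 !expr1 !mul1r !mulN1r mulNr [- (_ * _) + _]addrC.
  by rewrite [X in (X <= D)%R%:R + _]distrC; lra.
rewrite -(pair_big predT predT (fun (m : 'I_M) (b : bool) =>
   \sum_(q : 'I_M * bool) (`|zr R (m, b) * vv G d + zr R q| <= D)%R%:R)) /=.
under eq_bigr => m _.
  under eq_bigr => b _ do rewrite -(pair_big predT predT (fun (m' : 'I_M) (b' : bool) =>
     (`|zr R (m, b) * vv G d + zr R (m', b')| <= D)%R%:R)) /=.
  rewrite exchange_big /=; over.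
apply: (@le_trans _ _ (\sum_(m < M) \sum_(m' < M)
   (4 * (m'.+1%:R <= 4 * D)%R%:R + 2 * W m.+1 m'.+1))).
  by apply: ler_sum => m _; apply: ler_sum => m' _; exact: term.
rewrite (eq_bigr (fun m : 'I_M => \sum_(m' < M) 4 * (m'.+1%:R <= 4 * D)%R%:R +
   \sum_(m' < M) 2 * W m.+1 m'.+1)); last by move=> m _; rewrite big_split.
rewrite big_split /=; apply: lerD.
  rewrite sumr_const card_ord -[leLHS]mulr_natl -mulr_sumr.
  have := @sum_card_le R M (4 * D); rewrite mulr_ge0 ?(ltW D0)// => /(_ isT) h1.
  have : M%:R * (4 * \sum_(m' < M) (m'.+1%:R <= 4 * D)%R%:R) <= M%:R * (4 * (4 * D)).
    by rewrite ler_pM2l// ler_pM2l.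
  by move/le_trans; apply; lra.
under eq_bigr => m _ do rewrite -mulr_sumr.
rewrite -mulr_sumr ler_pM2l// /W.
under [leLHS]eq_bigr => m _ do rewrite exchange_big /=.
rewrite [leLHS]exchange_big /=; apply: ler_sum => a _.
under [leLHS]eq_bigr => m _ do rewrite -mulr_sumr.
pose F m : R := \sum_(m' <- blockM a) near (3 * D / 2 ^+ a) (dv G d - (lamG m' - lamG m)).
have F0 m : 0 <= F m by apply: sumr_ge0 => m' _; exact: near_ge0.
apply: (@le_trans _ _ (\sum_(m < M) (m.+1 < 2 ^ (9 + a))%N%:R * F m.+1)).
  apply: ler_sum => m _; rewrite ler_wpM2l//.
  exact: (@sum_succ_le R M _ (fun m' => near (3 * D / 2 ^+ a) (dv G d - (lamG m' - lamG m.+1)))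
    (fun m' => near_ge0 _ _)).
exact: sum_succ_le.
Qed.

Variables (g : R -> R) (Gam : R).
Hypotheses (g0 : forall y, 0 <= g y) (Gam0 : 0 <= Gam).
Hypothesis gGam : forall a z, (2 ^ a <= M)%N ->
  \sum_(m <- blockM a) \sum_(m' <- blockM a) g (lamG m' - lamG m + z) <=
  Gam * 2 ^+ a.

Definition gridnorm (f : R -> R) : R := h * \sum_(d < 2 * H) f (dv G d).

Lemma gridnorm_ge0 : 0 <= gridnorm g.
Proof. by rewrite mulr_ge0 ?sumr_ge0// ltW// gh_gt0. Qed.

(** [dv d], [lam m] and [lam m'] are multiples of the same step [h]. So a [dv d] inside the window
    is exactly one of the [2 K + 1] lattice shifts of [lam m' - lam m], and each shift is attained
    by at most one [d]; no regularity of [g] is needed. *)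
Lemma window_sum (m m' : nat) (r : R) : 0 <= r ->
  \sum_(d < 2 * H) g (dv G d) * near r (dv G d - (lamG m' - lamG m)) <=
  \sum_(i < (2 * Num.truncn (r / h)).+1)
    g (lamG m' - lamG m + h * (i%:R - (Num.truncn (r / h))%:R)).
Proof.
move=> r0; set K := Num.truncn _; have h0 := gh_gt0 G.
pose e (i : nat) (d : nat) : bool := (i + H + gell G m' == d + gell G m + K)%N.
apply: (@le_trans _ _ (\sum_(d < 2 * H) \sum_(i < (2 * K).+1)
   g (lamG m' - lamG m + h * (i%:R - K%:R)) * (e i d)%:R)).
  apply: ler_sum => d _; rewrite /near.
  have [hr|_] := boolP (_ <= r); last first.
    by rewrite mulr0 sumr_ge0// => i _; rewrite mulr_ge0.
  rewrite mulr1.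
  have dvE : dv G d - (lamG m' - lamG m) =
      h * ((d%:R + (gell G m)%:R) - (H%:R + (gell G m')%:R)).
    by rewrite /dv /lam; ring.
  have hK : `|(d%:R + (gell G m)%:R) - (H%:R + (gell G m')%:R)| <= r / h :> R.
    by rewrite ler_pdivlMr// mulrC -[X in X * _](gtr0_norm h0) -normrM -dvE.
  have rh0 : 0 <= r / h by rewrite divr_ge0// ltW.
  have /andP[_ K2] := truncn_itv rh0; rewrite -/K in K2.
  have := le_lt_trans hK K2; rewrite ltr_norml -natr1 => /andP[q1 q2].
  have n1 : (H + gell G m' <= d + gell G m + K)%N.
    rewrite -ltnS -(ltr_nat R) -natr1 !natrD; lra.
  have n2 : (d + gell G m <= H + gell G m' + K)%N.
    rewrite -ltnS -(ltr_nat R) -natr1 !natrD; lra.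
  have iK : (d + gell G m + K - (H + gell G m') < (2 * K).+1)%N.
    by clear -n1 n2; lia.
  have eT : e (d + gell G m + K - (H + gell G m'))%N d = true.
    by rewrite /e; apply/eqP; clear -n1; lia.
  rewrite (bigD1 (Ordinal iK))//= eT mulr1.
  have -> : lamG m' - lamG m + h *
      ((d + gell G m + K - (H + gell G m'))%N%:R - K%:R) = dv G d.
    by rewrite natrB// !natrD /dv /lam; ring.
  by rewrite lerDl sumr_ge0// => i _; rewrite mulr_ge0.
rewrite exchange_big /=; apply: ler_sum => i _.
rewrite -mulr_sumr ler_piMr//.
under eq_bigr => d _ do rewrite /e eq_sym.
apply: sum_eq_le1 => x y; move/eqP; rewrite !eqn_add2r => /eqP xy.
exact: val_inj.
Qed.

(** The kernel is split into layers [D = 2^s / N]. In each layer the windows around [lam m' - lam m]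
    have length of order [D / 2^a], and the hypothesis on [g] gives [Gam 2^a] for each shift, so
    [2^a] cancels and every layer contributes [D (M |g| + Gam)] up to logarithms. *)
Lemma bilinear_kernel :
  h * \sum_(d < 2 * H) g (dv G d) *
    (\sum_(p : 'I_M * bool) \sum_(q : 'I_M * bool)
       LC (N%:R * `|zr R p * vv G d + zr R q|)) <=
  16 * L ^+ 2 * (M%:R * gridnorm g + Gam) / N%:R.
Proof.
have h0 := gh_gt0 G.
have stepD (D : R) : N%:R^-1 <= D ->
  h * \sum_(d < 2 * H) g (dv G d) *
    (\sum_(p : 'I_M * bool) \sum_(q : 'I_M * bool)
       (`|zr R p * vv G d + zr R q| <= D)%R%:R) <=
  D * (16 * M%:R * gridnorm g + 14 * (gJ G).+1%:R * Gam).
  move=> ND; have D0 : 0 < D by apply: lt_le_trans ND; rewrite invr_gt0.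
  apply: (@le_trans _ _ (h * \sum_(d < 2 * H) (16 * M%:R * D * g (dv G d) +
     2 * \sum_(a < (gJ G).+1 | (2 ^ a <= M)%N) \sum_(m <- blockM a) \sum_(m' <- blockM a)
      g (dv G d) * near (3 * D / 2 ^+ a) (dv G d - (lamG m' - lamG m))))).
    rewrite ler_pM2l//; apply: ler_sum => d _.
    apply: (le_trans (ler_wpM2l (g0 _) (pair_count d ND))).
    rewrite mulrDr mulrC lerD2l mulrCA ler_pM2l// mulr_sumr; apply: ler_sum => a _.
    rewrite mulr_sumr; apply: ler_sum => m _.
    by rewrite mulr_sumr.
  rewrite big_split /= mulrDr mulrDr; apply: lerD.
    rewrite -mulr_sumr /gridnorm -!mulrA le_eqVlt; apply/orP; left; apply/eqP.
    by ring.
  rewrite -mulr_sumr exchange_big /=.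
  have blk a : (2 ^ a <= M)%N -> h * \sum_(d < 2 * H) \sum_(m <- blockM a) \sum_(m' <- blockM a)
      g (dv G d) * near (3 * D / 2 ^+ a) (dv G d - (lamG m' - lamG m)) <= 7 * D * Gam.
    move=> aM; have p2 : 0 < 2 ^+ a :> R by rewrite exprn_gt0.
    set r := 3 * D / 2 ^+ a; have r0 : 0 <= r by rewrite divr_ge0 ?mulr_ge0 ?ltW.
    set K := Num.truncn (r / h).
    rewrite exchange_big /=.
    apply: (@le_trans _ _ (h * \sum_(m <- blockM a) \sum_(m' <- blockM a)
        \sum_(i < (2 * K).+1) g (lamG m' - lamG m + h * (i%:R - K%:R)))).
      rewrite ler_pM2l//; apply: ler_sum => m _; rewrite exchange_big /=.
      by apply: ler_sum => m' _; exact: window_sum.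
    under eq_bigr => m _ do rewrite exchange_big /=.
    rewrite exchange_big /=.
    apply: (@le_trans _ _ (h * \sum_(i < (2 * K).+1) Gam * 2 ^+ a)).
      by rewrite ler_pM2l//; apply: ler_sum => i _; exact: gGam.
    rewrite sumr_const card_ord -[X in h * X]mulr_natl -natr1 natrM.
    have rh0 : 0 <= r / h by rewrite divr_ge0// ltW.
    have Kr : h * K%:R <= r.
      by rewrite mulrC -ler_pdivlMr// truncn_le.
    (* Of the [2 K + 1] shifts, [2 K] contribute at most [6 D] and the remaining one at most [D]
       because the step is tiny; this is the constant [7]. *)
    have h2a : h * 2 ^+ a <= D.
      apply: le_trans ND; rewrite -[leRHS]mul1r ler_pdivlMr// -mulrA.
      apply: (@le_trans _ _ (h * (M%:R * N%:R))).
        by rewrite ler_pM2l// ler_pM2r// -natrX ler_nat.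
      apply: gh_le_inv.
      have ZZ10 : Z%:R <= Z%:R ^+ 10 :> R.
        by rewrite -[leLHS]expr1; apply: ler_weXn2l => //; exact: gZ_ge1.
      apply: le_trans ZZ10; apply: le_trans NMZR; rewrite [M%:R * _]mulrC.
      by rewrite ler_peMl ?mulr_ge0// exprn_ege1// ler1n.
    have r2 : r * 2 ^+ a = 3 * D by rewrite /r -mulrA mulVf ?mulr1// gt_eqF.
    have -> : h * ((2 * K%:R + 1) * (Gam * 2 ^+ a)) =
      (2 * (h * K%:R) * 2 ^+ a + h * 2 ^+ a) * Gam by ring.
    rewrite ler_wpM2r//.
    have : h * K%:R * 2 ^+ a <= 3 * D by rewrite -r2 ler_pM2r.
    lra.
  rewrite mulrCA mulr_sumr.
  apply: (@le_trans _ _ (2 * \sum_(a < (gJ G).+1) 7 * D * Gam)).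
    rewrite ler_pM2l// big_mkcond [leRHS]big_mkcond /=; apply: ler_sum => a _.
    case: ifP => aM; last by rewrite !mulr_ge0// ltW.
    exact: blk.
  rewrite sumr_const card_ord -[X in 2 * X]mulr_natl; lra.
have := gridnorm_ge0; move: (gridnorm g) stepD => nr stepD nr0.
have JL := gJ_le G; have L0 := gL_gt0 G; have L1 := gL_ge1 G.
apply: (@le_trans _ _ (\sum_(s < (gJ G).+1)
    N%:R^-1 * (16 * M%:R * nr + 14 * (gJ G).+1%:R * Gam))); last first.
  rewrite sumr_const card_ord -[leLHS]mulr_natl mulrCA [leRHS]mulrC.
  rewrite ler_pM2l ?invr_gt0//.
  move: JL; move: ((gJ G).+1%:R) (ler0n R (gJ G).+1) => j j0 jL.
  have jL2 : j <= L ^+ 2.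
    by apply: (le_trans jL); rewrite -[leLHS]expr1; apply: ler_weXn2l.
  have e1 : j * (16 * M%:R * nr) <= L ^+ 2 * (16 * M%:R * nr).
    by rewrite ler_wpM2r// !mulr_ge0.
  have e2 : j * (14 * j * Gam) <= L ^+ 2 * (16 * Gam).
    have -> : j * (14 * j * Gam) = 14 * (j ^+ 2 * Gam) by ring.
    have j2 : j ^+ 2 <= L ^+ 2 by rewrite ler_sqr ?nnegrE// ltW.
    have : j ^+ 2 * Gam <= L ^+ 2 * Gam by rewrite ler_wpM2r.
    have : 0 <= j ^+ 2 * Gam by rewrite mulr_ge0 ?exprn_ge0.
    lra.
  lra.
have -> : h * \sum_(d < 2 * H) g (dv G d) *
    (\sum_(p : 'I_M * bool) \sum_(q : 'I_M * bool)
       LC (N%:R * `|zr R p * vv G d + zr R q|)) =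
   \sum_(s < (gJ G).+1) 2 ^- s * (h * \sum_(d < 2 * H) g (dv G d) *
    (\sum_(p : 'I_M * bool) \sum_(q : 'I_M * bool)
       (`|zr R p * vv G d + zr R q| <= 2 ^+ s / N%:R)%R%:R)).
  under [RHS]eq_bigr => s _ do rewrite mulrCA mulr_sumr.
  rewrite -mulr_sumr exchange_big /=; congr (_ * _); apply: eq_bigr => d _.
  under [RHS]eq_bigr => s _ do rewrite mulrCA.
  rewrite -mulr_sumr; congr (_ * _).
  under [RHS]eq_bigr => s _.
    rewrite mulr_sumr; under eq_bigr => p _ do rewrite mulr_sumr.
    over.
  rewrite [RHS]exchange_big /=; apply: eq_bigr => p _.
  rewrite [RHS]exchange_big /=; apply: eq_bigr => q _.
  by apply: eq_bigr => s _; rewrite ler_pdivlMr// [_ * N%:R]mulrC.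
apply: ler_sum => s _; have p2 : 0 < 2 ^+ s :> R by rewrite exprn_gt0.
rewrite mulrC ler_pdivrMr// mulrAC [_ * 2 ^+ s]mulrC.
by apply: stepD; rewrite ler_peMl ?invr_ge0// exprn_ege1// ler1n.
Qed.

End BilinearKernel.

(** * Reflection *)

Section PowerMeans.
Variables (R : realType) (I : Type) (r : seq I).

Lemma sum_cube_le (u : I -> R) : (forall i, 0 <= u i) ->
  (\sum_(i <- r) u i) ^+ 3 <= (size r)%:R ^+ 2 * \sum_(i <- r) u i ^+ 3.
Proof.
move=> u0; set S := \sum_(i <- r) u i; set n : R := (size r)%:R.
have S0 : 0 <= S by apply: sumr_ge0.
have [n0|n0] := eqVneq (size r) 0%N.
  by rewrite /S (size0nil n0) !big_nil /n n0 expr0n mulr0.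
have np : 0 < n by rewrite ltr0n lt0n.
set m := S / n; have m0 : 0 <= m by rewrite divr_ge0// ltW.
(* The tangent to the cube at the mean value [m] lies below its graph on the nonnegative axis;
   summed over [i] it gives [S^3 / n^2]. *)
have tangent i : 3 * m ^+ 2 * u i - 2 * m ^+ 3 <= u i ^+ 3.
  have : 0 <= (u i - m) ^+ 2 * (u i + 2 * m).
    by rewrite mulr_ge0 ?sqr_ge0// addr_ge0// mulr_ge0.
  by move=> ?; lra.
have : \sum_(i <- r) (3 * m ^+ 2 * u i - 2 * m ^+ 3) <= \sum_(i <- r) u i ^+ 3.
  by apply: ler_sum => i _.
rewrite sumrB -mulr_sumr -/S big_const_seq count_predT iter_addr_0 -[_ *+ size r]mulr_natl -/n.
have -> : 3 * m ^+ 2 * S - n * (2 * m ^+ 3) = S ^+ 3 / n ^+ 2.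
  by rewrite /m; field; rewrite gt_eqF.
by rewrite ler_pdivrMr ?exprn_gt0// mulrC.
Qed.

End PowerMeans.

Section Reflection.
Variables (R : realType) (G : grid R).
Notation h := (gh G).
Notation Z := (gZ G).
Notation L := (gL G).
Notation H := (gH G).
Notation lamG := (lam G).
Notation LC := (lc (gJ G).+1).
Variables (N M : nat).
Hypotheses (N0 : (0 < N)%N) (M0 : (0 < M)%N) (NMZ : room 10 (N * M) Z).

Let NR : 0 < N%:R :> R. Proof. by rewrite ltr0n. Qed.
Let MR : 0 < M%:R :> R. Proof. by rewrite ltr0n. Qed.
Let h0 : 0 < h. Proof. exact: gh_gt0. Qed.

Let NMZR : 2 ^+ 10 * (N%:R * M%:R) <= Z%:R :> R.
Proof. by rewrite -natrX -!natrM ler_nat. Qed.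

Let NZ : room 10 N Z.
Proof. by rewrite /room (leq_trans _ NMZ)// leq_mul2l leq_pmulr// orbT. Qed.

Let ZZ k : (0 < k)%N -> Z%:R <= Z%:R ^+ k :> R.
Proof.
by move=> k0; rewrite -[leLHS]expr1; apply: ler_weXn2l => //; exact: gZ_ge1.
Qed.

Lemma grid_phase_filter (th : R) (P : pred nat) a b :
  (forall k, (k < H)%N -> P k = (a <= k < b)%N) -> N%:R * `|th| <= Z%:R ->
  h * cmod (\sum_(k < H | P k) ep (th * xx G N k)) <= 24 * LC (N%:R * `|th|).
Proof.
move=> Pab thZ.
have -> : \sum_(k < H | P k) ep (th * xx G N k) =
    \sum_(a <= k < minn b H) ep (th * xx G N k).
  rewrite big_geq_mkord /= (@big_ord_widen_cond _ _ _ (minn b H) H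
    (fun i => (a <= i)%N) (fun i => ep (th * xx G N i)))//; last by rewrite geq_minr.
  apply: eq_bigl => k; rewrite Pab// leq_min (ltn_ord k) andbT.
  by rewrite andbC.
by apply: grid_phase_sum => //; rewrite geq_minr.
Qed.

Lemma yyB (k2 d : nat) : (H <= k2 + d)%N ->
  yy G N (k2 + d - H) - yy G N k2 = dv G d.
Proof. by move=> Hk; rewrite /yy /dv natrB// natrD; ring. Qed.

Lemma xxB (k2 d : nat) : (H <= k2 + d)%N ->
  xx G N (k2 + d - H) = vv G d * xx G N k2.
Proof. by move=> Hk; rewrite /xx /vv -expRD -(yyB Hk); congr expR; ring. Qed.

Section DoublePhase.
Variables (A B : finType) (za ca : A -> R) (zb cb : B -> R).
Hypotheses (ca1 : forall a, 0 <= ca a <= 1) (cb1 : forall b, 0 <= cb b <= 1).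
Hypothesis zab : forall a b (d : 'I_(2 * H)), N%:R * `|za a * vv G d + zb b| <= Z%:R.
Variable g : R -> R.
Hypothesis g0 : forall y, 0 <= g y.

(** After [k1 = k2 + d - H] the point [xx k1] is [vv d] times [xx k2] and [g] depends on [d] alone.
    The sum over [k2] is then a single phase sum of frequency [za vv d + zb], to which
    [grid_phase_filter] applies. *)
Lemma double_phase :
  h ^+ 2 * cmod (\sum_(k1 < H) \sum_(k2 < H)
    (\sum_a (ca a)%:C * ep (za a * xx G N k1)) *
    (\sum_b (cb b)%:C * ep (zb b * xx G N k2)) * (g (yy G N k1 - yy G N k2))%:C) <=
  24 * (h * \sum_(d < 2 * H) g (dv G d) *
    \sum_a \sum_b LC (N%:R * `|za a * vv G d + zb b|)).
Proof.
rewrite exchange_big /=.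
under eq_bigr => k2 _.
  rewrite (@reindex_diff _ _ k2 (fun k1 => (\sum_a (ca a)%:C * ep (za a * xx G N k1)) *
    (\sum_b (cb b)%:C * ep (zb b * xx G N k2)) * (g (yy G N k1 - yy G N k2))%:C)).
  over.
rewrite (exchange_big_dep predT)//=.
rewrite expr2 -mulrA [leRHS]mulrCA ler_pM2l//.
apply: (le_trans (ler_wpM2l (ltW h0) (cmod_sum _ _ _))).
rewrite !mulr_sumr; apply: ler_sum => d _.
have -> : \sum_(k2 < H | (H <= k2 + d < 2 * H)%N)
    (\sum_a (ca a)%:C * ep (za a * xx G N (k2 + d - H))) *
    (\sum_b (cb b)%:C * ep (zb b * xx G N k2)) *
    (g (yy G N (k2 + d - H) - yy G N k2))%:C =
   (g (dv G d))%:C * \sum_a \sum_b (ca a)%:C * (cb b)%:C *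
     \sum_(k2 < H | (H <= k2 + d < 2 * H)%N) ep ((za a * vv G d + zb b) * xx G N k2).
  under [X in _ = _ * X]eq_bigr => a _.
    under eq_bigr => b _ do rewrite mulr_sumr.
    rewrite exchange_big /=; over.
  rewrite [X in _ = _ * X]exchange_big /= mulr_sumr.
  apply: eq_bigr => k2 /andP[Hk _].
  rewrite yyB// xxB// mulrC; congr (_ * _).
  rewrite mulr_suml; apply: eq_bigr => a _.
  rewrite mulr_sumr; apply: eq_bigr => b _.
  have e : ep (za a * (vv G d * xx G N k2)) * ep (zb b * xx G N k2) =
      ep ((za a * vv G d + zb b) * xx G N k2).
    by rewrite -epD; congr ep; ring.
  by rewrite -e; ring.
rewrite cmodM cmod_real (ger0_norm (g0 _)) mulrCA [leRHS]mulrCA.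
rewrite ler_wpM2l//.
apply: (le_trans (ler_wpM2l (ltW h0) (cmod_sum _ _ _))).
rewrite !mulr_sumr; apply: ler_sum => a _.
apply: (le_trans (ler_wpM2l (ltW h0) (cmod_sum _ _ _))).
rewrite !mulr_sumr; apply: ler_sum => b _.
rewrite !cmodM !cmod_real.
have /andP[a0 a1] := ca1 a; have /andP[b0 b1] := cb1 b.
rewrite (ger0_norm a0) (ger0_norm b0).
set S := cmod _.
apply: (@le_trans _ _ (h * S)).
  by rewrite ler_pM2l// ler_piMl ?cmod_ge0// mulr_ile1.
have := @grid_phase_filter (za a * vv G d + zb b)
  (fun k => (H <= k + d < 2 * H)%N) (H - d) (2 * H - d) _ (zab a b d).
by apply => k kH; have := ltn_ord d; lia.
Qed.

End DoublePhase.

(** The frequencies of the full Fejér kernel: the unit summand carries the frequency [0] with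
    coefficient [1]. *)
Definition zs (p : 'I_M * bool + unit) : R := if p is inl p then zr R p else 0.
Definition cs (p : 'I_M * bool + unit) : R := if p is inl p then fejc R p else 1.

Lemma fejer_sum x : (fejer M x)%:C = \sum_p (cs p)%:C * ep (zs p * x).
Proof.
rewrite fejer_expand// big_sumType /= addrC; congr (_ + _).
by rewrite (big_pred1 tt) ?mul0r ?(ep_nat R 0) ?mulr1// => -[].
Qed.

Lemma zr_ge1 (p : 'I_M * bool) : 1 <= `|zr R p|.
Proof. by rewrite norm_zr ler1n. Qed.

Lemma zr_leM (p : 'I_M * bool) : `|zr R p| <= M%:R.
Proof. by rewrite norm_zr ler_nat. Qed.

Lemma zs_bound (p q : 'I_M * bool + unit) (d : 'I_(2 * H)) :
  N%:R * `|zs p * vv G d + zs q| <= Z%:R.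
Proof.
have zM u : `|zs u| <= M%:R by case: u => [u|[]] /=; rewrite ?zr_leM ?normr0.
apply: le_trans NMZR; rewrite mulrCA ler_pM2l//.
rewrite (le_trans (ler_normD _ _))// normrM (gtr0_norm (vv_gt0 G d)).
have := vv_le d; have := vv_gt0 G d; have := zM p; have := zM q.
have := normr_ge0 (zs p); have := normr_ge0 (zs q).
move: (vv G d) (`|zs p|) (`|zs q|) => v a b a0 b0 bM aM v0 v1.
have : a * v <= M%:R * 2 ^+ 7 by apply: ler_pM => //; exact: ltW.
lra.
Qed.

(** If exactly one of the two frequencies is zero, the combined frequency is at least [2^(-7)] and
    the layer sum is at most [2^7 L / N]; there are [4 M] such pairs. The pair of zero frequencies
    contributes at most [2]. *)
Lemma lc_sum_zs (d : 'I_(2 * H)) :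
  \sum_p \sum_q LC (N%:R * `|zs p * vv G d + zs q|) <=
  \sum_(p : 'I_M * bool) \sum_(q : 'I_M * bool)
     LC (N%:R * `|zr R p * vv G d + zr R q|) + 2 ^+ 9 * L * M%:R / N%:R + 2.
Proof.
have v0 := vv_gt0 G d; have v1 := vv_ge d.
have L0 := gL_gt0 G.
have lcu u : N%:R / 2 ^+ 7 <= u -> LC u <= 2 ^+ 7 * L / N%:R.
  move=> Nu; have u0 : 0 < u by apply: lt_le_trans Nu; rewrite divr_gt0// exprn_gt0.
  have h1 : LC u * u <= L by apply: le_trans (gJ_le G); apply: lc_mul_le; exact: ltW.
  have h2 : LC u * (N%:R / 2 ^+ 7) <= L.
    by apply: le_trans h1; rewrite ler_wpM2l// lc_ge0.
  by rewrite ler_pdivlMr//; lra.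
have bu (f : 'I_M * bool + unit -> R) :
    \sum_q f q = \sum_q f (inl q) + f (inr tt).
  by rewrite big_sumType /=; congr (_ + _); rewrite (big_pred1 tt)// => -[].
rewrite bu; under eq_bigr => p _ do rewrite bu.
rewrite big_split /= -!addrA lerD2l bu.
rewrite addrA; apply: lerD; last exact: lc_le2.
have -> : 2 ^+ 9 * L * M%:R / N%:R =
   \sum_(p : 'I_M * bool) 2 ^+ 7 * L / N%:R + \sum_(p : 'I_M * bool) 2 ^+ 7 * L / N%:R.
  rewrite !sumr_const card_prod card_ord card_bool.
  rewrite -[2 ^+ 7 * L / N%:R *+ _]mulr_natl natrM; field.
  by rewrite gt_eqF.
apply: lerD; apply: ler_sum => p _; apply: lcu.
  rewrite addr0 normrM (gtr0_norm v0) ler_pdivrMr ?exprn_gt0// -!mulrA ler_peMr ?(ltW NR)//.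
  by have := zr_ge1 p; nra.
rewrite mul0r add0r ler_pdivrMr ?exprn_gt0// -mulrA ler_peMr ?(ltW NR)//.
by have := zr_ge1 p; lra.
Qed.

(** The width of the averages. It is so small that moving [n < 4 N] by this logarithmic amount keeps
    it within [1 / (8 M)] of an integer, where the Fejér kernel is large, and that phases [t y] with
    [0 <= t <= N M] and [0 <= y <= avw] stay close to [0]. *)
Definition avw : R := (2 ^+ 7 * (N%:R * M%:R))^-1.
Definition gJ0 := Num.truncn (avw / h).

Lemma avw_gt0 : 0 < avw.
Proof. by rewrite invr_gt0 mulr_gt0 ?mulr_gt0 ?exprn_gt0. Qed.

Lemma gJ0_itv : avw / 2 <= h * gJ0%:R <= avw.
Proof.
have e0 : 0 <= avw / h by rewrite divr_ge0 ?ltW ?avw_gt0.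
have /andP[t1 t2] := truncn_itv e0; rewrite -/gJ0 in t1 t2.
have h1 : h * gJ0%:R <= avw by rewrite mulrC -ler_pdivlMr.
have h2 : avw < h * gJ0.+1%:R by rewrite mulrC -ltr_pdivrMr.
rewrite h1 andbT; move: h2; rewrite -natr1 mulrDr mulr1.
have : h * (2 ^+ 8 * (N%:R * M%:R)) <= 1.
  apply: gh_le_inv; apply: le_trans (@ZZ 10 isT); apply: le_trans NMZR.
  have : 0 < N%:R * M%:R :> R by rewrite mulr_gt0. lra.
have : h <= avw / 2 <-> h * (2 ^+ 8 * (N%:R * M%:R)) <= 1.
  have -> : avw / 2 = (2 ^+ 8 * (N%:R * M%:R))^-1.
    by rewrite /avw; field; rewrite !gt_eqF.
  by rewrite -ler_pdivlMr ?mul1r// mulr_gt0 ?mulr_gt0 ?exprn_gt0.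
move=> [_ hh] /hh; lra.
Qed.

Lemma gJ0_gt0 : (0 < gJ0)%N.
Proof.
have /andP[h1 _] := gJ0_itv; have := avw_gt0; rewrite lt0n; case: eqP => // j0.
by rewrite j0 mulr0 in h1; lra.
Qed.

Definition box := index_iota N (4 * N).

Definition kidx (n j : nat) := (gell G n + gG G + j - gell G N)%N.

Lemma box_bounds n : n \in box -> (N <= n < 4 * N)%N.
Proof. by rewrite mem_index_iota. Qed.

Lemma boxZ n : n \in box -> (0 < n <= Z)%N.
Proof.
move=> /box_bounds/andP[n1 n2]; rewrite (leq_trans N0 n1) (leq_trans (ltnW n2))//.
by rewrite (leq_trans _ NZ)// leq_mul2r orbC.
Qed.

Let eps_s : eps G * (2 ^+ 7 * (N%:R * M%:R)) <= 1.
Proof.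
apply: eps_small; apply: le_trans (@ZZ 4 isT); apply: le_trans NMZR.
by rewrite ler_pM2r ?mulr_gt0//; lra.
Qed.

Let eps_avw : eps G <= avw.
Proof.
have e := eps_s; rewrite -ler_pdivlMr ?mul1r in e => //.
by rewrite mulr_gt0 ?mulr_gt0 ?exprn_gt0.
Qed.

Let avw_small : avw <= 1 / 100.
Proof.
rewrite /avw -[leLHS]mul1r ler_pdivrMr ?mulr_gt0 ?exprn_gt0//.
have : 1 <= N%:R * M%:R :> R by rewrite -natrM ler1n muln_gt0 N0.
lra.
Qed.

Let hj_le j : (j < gJ0)%N -> 0 <= h * j%:R <= avw.
Proof.
move=> jJ; have /andP[_ h2] := gJ0_itv.
apply/andP; split; first by rewrite mulr_ge0// ltW.
by apply: le_trans h2; rewrite ler_pM2l// ler_nat ltnW.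
Qed.

Lemma kidx_le n j : n \in box -> (gell G N <= gell G n + gG G + j)%N.
Proof.
move=> nb; have /andP[n1 _] := box_bounds nb.
have c1 := lam_close (boxZ nb).
have c2 : `|lamG N - ln N%:R| <= eps G.
  by apply: lam_close; rewrite N0 (leq_trans _ NZ)// leq_pmull.
rewrite !ler_norml in c1 c2.
move/andP: c1 => [c1 _]; move/andP: c2 => [_ c2].
have lnn : ln (N%:R : R) <= ln n%:R.
  by rewrite ler_ln ?posrE ?ltr0n ?(leq_trans N0)// ler_nat.
have /andP[g1 _] := gG_itv G.
rewrite (leq_trans _ (leq_addr _ _))// -(ler_nat R) -(ler_pM2l h0) natrD mulrDr.
rewrite -/(lamG N) -/(lamG n); have := eps_avw; have := avw_small; lra.
Qed.

Lemma yy_kidx n j : n \in box -> yy G N (kidx n j) = lamG n + h * j%:R.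
Proof.
by move=> nb; rewrite /yy /kidx natrB ?kidx_le// !natrD /lam; ring.
Qed.

Lemma kidx_lt n j : n \in box -> (j < gJ0)%N -> (kidx n j < H)%N.
Proof.
move=> nb jJ; have /andP[n1 n2] := box_bounds nb.
have c1 := lam_close (boxZ nb).
have c2 : `|lamG N - ln N%:R| <= eps G.
  by apply: lam_close; rewrite N0 (leq_trans _ NZ)// leq_pmull.
rewrite !ler_norml in c1 c2.
move/andP: c1 => [_ c1]; move/andP: c2 => [c2 _].
have ln2 : ln 2 <= 1 :> R by apply: (@le_ln1Dx R 1); lra.
have lnn : ln (n%:R : R) <= ln N%:R + 2.
  apply: (@le_trans _ _ (ln (2 * (2 * N%:R) : R))).
    rewrite ler_ln ?posrE ?mulr_gt0// ?ltr0n ?(leq_trans N0)//.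
    by rewrite mulrA -natrM -natrM ler_nat ltnW.
  by rewrite lnM ?posrE ?mulr_gt0// lnM ?posrE//; lra.
have /andP[_ hj] := hj_le jJ.
have yk := yy_kidx j nb.
rewrite -(ltr_nat R) -(ltr_pM2l h0).
have /andP[g1 _] := gG_itv G.
have -> : h * (kidx n j)%:R = lamG n + h * j%:R - lamG N + h * (gG G)%:R.
  by rewrite -yk /yy; ring.
have -> : h * H%:R = 4 * (h * (gG G)%:R) by rewrite /gH natrM; ring.
have := eps_avw; have := avw_small; lra.
Qed.

Lemma xx_kidx n j : n \in box -> (j < gJ0)%N ->
  `|xx G N (kidx n j) - n%:R| * (8 * M%:R) <= 1.
Proof.
move=> nb jJ; have /andP[n1 n2] := box_bounds nb.
have nR : 0 < n%:R :> R by rewrite ltr0n (leq_trans N0).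
rewrite /xx yy_kidx//.
set w := lamG n + h * j%:R - ln n%:R.
have wE : expR (lamG n + h * j%:R) = n%:R * expR w.
  by rewrite /w expRB lnK ?posrE//; field; rewrite gt_eqF.
have w1 : `|w| <= 2 * avw.
  have c1 := lam_close (boxZ nb); have /andP[j1 j2] := hj_le jJ.
  have -> : w = (lamG n - ln n%:R) + h * j%:R by rewrite /w; ring.
  rewrite (le_trans (ler_normD _ _))// (ger0_norm j1); have := eps_avw; lra.
rewrite wE -[X in _ - X]mulr1 -mulrBr normrM (gtr0_norm nR).
have w2 := @abs_expR_sub1 R w; have e1 := avw_small.
have w3 : `|expR w - 1| <= 4 * avw.
  by apply: (le_trans (w2 _)); lra.
have n4 : n%:R <= 4 * N%:R :> R by rewrite -natrM ler_nat ltnW.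
have : n%:R * `|expR w - 1| <= (4 * N%:R) * (4 * avw).
  by apply: ler_pM => //; exact: ltW.
move=> h1; apply: (@le_trans _ _ ((4 * N%:R) * (4 * avw) * (8 * M%:R))).
  by rewrite ler_wpM2r// mulr_ge0.
have -> : 4 * N%:R * (4 * avw) * (8 * M%:R) = 2 ^+ 7 * (N%:R * M%:R) * avw by ring.
by rewrite /avw divff// gt_eqF// mulr_gt0 ?mulr_gt0 ?exprn_gt0.
Qed.

Lemma kidx_inj n j1 j2 : n \in box -> kidx n j1 = kidx n j2 -> j1 = j2.
Proof.
by move=> nb e; have := kidx_le j1 nb; have := kidx_le j2 nb; move: e; rewrite /kidx; lia.
Qed.

(** The indices [kidx n j] are distinct, and at each of them the Fejér kernel is at least [M / 4]. A
    sum over integers thus becomes a sum over the whole grid, with the kernel as the detector of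
    integers. *)
Lemma box_to_grid (F : nat -> R) : (forall k, 0 <= F k) ->
  \sum_(n <- box) \sum_(j < gJ0) F (kidx n j) <=
  4 / M%:R * \sum_(k < H) fejer M (xx G N k) * F k.
Proof.
move=> F0.
apply: (@le_trans _ _ (\sum_(k < H) F k * \sum_(n <- box) \sum_(j < gJ0)
    (kidx n j == k)%:R)).
  under [leRHS]eq_bigr => k _.
    rewrite mulr_sumr; under eq_bigr => n _ do rewrite mulr_sumr.
    over.
  rewrite [leRHS]exchange_big /= big_seq [leRHS]big_seq; apply: ler_sum => n nb.
  rewrite [leRHS]exchange_big /=; apply: ler_sum => j _.
  rewrite (bigD1 (Ordinal (kidx_lt nb (ltn_ord j))))//= eqxx mulr1 lerDl.
  by apply: sumr_ge0 => k _; rewrite mulr_ge0.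
rewrite mulr_sumr; apply: ler_sum => k _.
rewrite [fejer _ _ * _]mulrC mulrCA ler_wpM2l//.
have pos : 0 <= 4 / M%:R * fejer M (xx G N k).
  by rewrite mulr_ge0 ?fejer_ge0// divr_ge0.
have [/hasP[n nb /existsP[j /eqP kj]]|/hasPn no] :=
    boolP (has (fun n => [exists j : 'I_gJ0, kidx n j == k]) box); last first.
  rewrite big_seq big1// => n nb; rewrite big1// => j _.
  by have /existsPn/(_ j)/negbTE -> := no n nb.
apply: (@le_trans _ _ 1); last first.
  have := fejer_near_nat M0 (xx_kidx nb (ltn_ord j)); rewrite kj => hf.
  rewrite mulrAC ler_pdivlMr// mul1r; lra.
rewrite (bigD1_seq n)//= ?iota_uniq// [X in _ + X]big_seq_cond [X in _ + X]big1 ?addr0.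
  by apply: sum_eq_le1 => j1 j2 e; apply: val_inj; exact: (kidx_inj nb e).
move=> n' /andP[nb' nn']; rewrite big1// => j' _.
case: eqP => // kj'; exfalso.
have x1 := xx_kidx nb (ltn_ord j); have x2 := xx_kidx nb' (ltn_ord j').
rewrite kj in x1; rewrite kj' in x2.
have M1 : 1 <= M%:R :> R by rewrite ler1n.
have y1 : `|xx G N k - n%:R| <= 1 / 8 by have := normr_ge0 (xx G N k - n%:R); nra.
have y2 : `|xx G N k - n'%:R| <= 1 / 8 by have := normr_ge0 (xx G N k - n'%:R); nra.
have : `|n%:R - n'%:R| < 1 :> R.
  have -> : n%:R - n'%:R = (xx G N k - n'%:R) - (xx G N k - n%:R) by ring.
  by rewrite (le_lt_trans (ler_normB _ _))//; lra.
rewrite ltr_norml => /andP[q1 q2].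
have l1 : (n < n'.+1)%N by rewrite -(ltr_nat R) -natr1; lra.
have l2 : (n' < n.+1)%N by rewrite -(ltr_nat R) -natr1; lra.
by move/eqP: nn'; apply; clear -l1 l2; lia.
Qed.

Variables (g : R -> R) (Gam : R).
Hypotheses (g0 : forall y, 0 <= g y) (Gam0 : 0 <= Gam).
Hypothesis gGam : forall a z, (2 ^ a <= M)%N ->
  \sum_(m <- blockM a) \sum_(m' <- blockM a) g (lamG m' - lamG m + z) <=
  Gam * 2 ^+ a.

Lemma fejer_bilinear :
  h ^+ 2 * \sum_(k1 < H) \sum_(k2 < H)
    fejer M (xx G N k1) * fejer M (xx G N k2) * g (yy G N k1 - yy G N k2) <=
  2 ^+ 14 * L ^+ 2 * ((1 + M%:R / N%:R) * gridnorm G g + Gam / N%:R).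
Proof.
set S := \sum_(k1 < H) _.
have S0 : 0 <= S.
  apply: sumr_ge0 => k1 _; apply: sumr_ge0 => k2 _.
  by rewrite mulr_ge0// mulr_ge0// fejer_ge0.
have SC : S%:C = \sum_(k1 < H) \sum_(k2 < H)
    (\sum_p (cs p)%:C * ep (zs p * xx G N k1)) *
    (\sum_q (cs q)%:C * ep (zs q * xx G N k2)) * (g (yy G N k1 - yy G N k2))%:C.
  rewrite /S realC_sum; apply: eq_bigr => k1 _.
  rewrite realC_sum; apply: eq_bigr => k2 _.
  by rewrite realCM (realCM (fejer M _)) !fejer_sum.
rewrite -(ger0_norm S0) -cmod_real SC.
have cs1 p : 0 <= cs p <= 1.
  by case: p => [p|[]] /=; rewrite ?fejc_itv// ler01 lexx.
apply: (le_trans (double_phase cs1 cs1 zs_bound g0)).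
have nr0 := gridnorm_ge0 G g0.
have bk := bilinear_kernel N0 M0 NMZ g0 Gam0 gGam.
have L1 := gL_ge1 G.
apply: (@le_trans _ _ (24 * (h * \sum_(d < 2 * H) g (dv G d) *
    (\sum_(p : 'I_M * bool) \sum_(q : 'I_M * bool)
     LC (N%:R * `|zr R p * vv G d + zr R q|)) +
    gridnorm G g * (2 ^+ 9 * L * M%:R / N%:R + 2)))).
  rewrite ler_pM2l// /gridnorm -mulrA -mulrDr ler_pM2l// mulr_suml -big_split /=.
  apply: ler_sum => d _; rewrite -mulrDr ler_wpM2l// addrA.
  exact: lc_sum_zs.
apply: (@le_trans _ _ (24 * (16 * L ^+ 2 * (M%:R * gridnorm G g + Gam) / N%:R +
   gridnorm G g * (2 ^+ 9 * L * M%:R / N%:R + 2)))).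
  by rewrite ler_pM2l// lerD2r.
move: (gridnorm G g) nr0 => nr nr0.
set q := M%:R / N%:R; have q0 : 0 <= q by rewrite divr_ge0.
set c := Gam / N%:R; have c0 : 0 <= c by rewrite divr_ge0.
have -> : 16 * L ^+ 2 * (M%:R * nr + Gam) / N%:R = 16 * L ^+ 2 * (q * nr + c).
  by rewrite /q /c; field; rewrite gt_eqF.
have -> : 2 ^+ 9 * L * M%:R / N%:R = 2 ^+ 9 * L * q by rewrite /q mulrA.
have LL : L <= L ^+ 2 by rewrite expr2 ler_peMl// ltW// gL_gt0.
have L21 : 1 <= L ^+ 2 by rewrite exprn_ege1.
have t1 : L * (q * nr) <= L ^+ 2 * (q * nr) by rewrite ler_wpM2r// mulr_ge0.
have t2 : nr <= L ^+ 2 * nr by rewrite ler_peMl.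
have t3 : 0 <= L ^+ 2 * (q * nr) by rewrite mulr_ge0 ?sqr_ge0 ?mulr_ge0.
have t4 : 0 <= L ^+ 2 * c by rewrite mulr_ge0 ?sqr_ge0 ?mulr_ge0.
have t5 : 0 <= L ^+ 2 * nr by rewrite mulr_ge0 ?sqr_ge0 ?mulr_ge0.
lra.
Qed.

(** The finite substitute for Poisson summation in both variables. The pair sum over the box is
    averaged, detected by Fejér kernels and expanded into frequencies. The zero frequencies give
    [N^2 |g|]; the others give near-coincidences between integers of size about [M], measured by
    [Gam]. *)
Lemma reflection (F : R -> R) :
  (forall y, F y <= (gJ0%:R ^+ 2)^-1 * \sum_(j1 < gJ0) \sum_(j2 < gJ0)
     g (y + h * j1%:R - h * j2%:R)) ->
  \sum_(m <- box) \sum_(n <- box) F (lamG m - lamG n) <=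
  L ^+ 6 * ((N%:R ^+ 2 + N%:R * M%:R) * gridnorm G g + N%:R * Gam).
Proof.
move=> Fg; have J0 : 0 < gJ0%:R :> R by rewrite ltr0n gJ0_gt0.
apply: (@le_trans _ _ ((gJ0%:R ^+ 2)^-1 * \sum_(m <- box) \sum_(j1 < gJ0)
    \sum_(n <- box) \sum_(j2 < gJ0) g (yy G N (kidx m j1) - yy G N (kidx n j2)))).
  rewrite mulr_sumr big_seq [leRHS]big_seq; apply: ler_sum => m mb.
  rewrite exchange_big /= mulr_sumr big_seq [leRHS]big_seq; apply: ler_sum => n nb.
  apply: (le_trans (Fg _)); rewrite ler_pM2l ?invr_gt0 ?exprn_gt0//.
  apply: ler_sum => j1 _; apply: ler_sum => j2 _; rewrite !yy_kidx//.
  by rewrite le_eqVlt; apply/orP; left; apply/eqP; congr g; ring.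
pose Gk k1 := \sum_(n <- box) \sum_(j2 < gJ0) g (yy G N k1 - yy G N (kidx n j2)).
have Gk0 k : 0 <= Gk k by apply: sumr_ge0 => n _; apply: sumr_ge0.
have st1 := box_to_grid Gk0.
have st2 k1 : Gk k1 <= 4 / M%:R * \sum_(k < H) fejer M (xx G N k) *
    g (yy G N k1 - yy G N k).
  exact: (@box_to_grid (fun k => g (yy G N k1 - yy G N k))).
have st3 : \sum_(m <- box) \sum_(j1 < gJ0) Gk (kidx m j1) <=
   (4 / M%:R) ^+ 2 * \sum_(k1 < H) \sum_(k2 < H)
    fejer M (xx G N k1) * fejer M (xx G N k2) * g (yy G N k1 - yy G N k2).
  apply: (le_trans st1); rewrite expr2 -[leRHS]mulrA ler_wpM2l ?divr_ge0//.
  rewrite mulr_sumr; apply: ler_sum => k1 _.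
  have := ler_wpM2l (fejer_ge0 M (xx G N k1)) (st2 k1).
  move/le_trans; apply; rewrite mulrCA !mulr_sumr le_eqVlt; apply/orP; left; apply/eqP.
  by apply: eq_bigr => k2 _; rewrite !mulrA.
have fb := fejer_bilinear.
set S := \sum_(k1 < H) _ in st3 fb.
have S0 : 0 <= S.
  apply: sumr_ge0 => k1 _; apply: sumr_ge0 => k2 _.
  by rewrite mulr_ge0// mulr_ge0// fejer_ge0.
apply: (@le_trans _ _ ((gJ0%:R ^+ 2)^-1 * ((4 / M%:R) ^+ 2 * S))).
  by rewrite ler_pM2l ?invr_gt0 ?exprn_gt0.
have /andP[j1 _] := gJ0_itv.
have e0 := avw_gt0.
have hJ : (avw / 2) ^+ 2 <= (h * gJ0%:R) ^+ 2.
  rewrite ler_sqr ?nnegrE//; first by rewrite divr_ge0// ltW.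
  by rewrite mulr_ge0// ltW.
(* The number of averaging steps is of order [1 / (h N M)]. Its inverse square supplies the factor
   [h^2] of [fejer_bilinear], and [M^2] cancels against the two factors [4 / M]. *)
have inv : (gJ0%:R ^+ 2)^-1 <= h ^+ 2 * (2 ^+ 16 * (N%:R * M%:R) ^+ 2).
  rewrite -[leLHS]mul1r ler_pdivrMr ?exprn_gt0//.
  have -> : h ^+ 2 * (2 ^+ 16 * (N%:R * M%:R) ^+ 2) * gJ0%:R ^+ 2 =
     (h * gJ0%:R) ^+ 2 * (2 ^+ 16 * (N%:R * M%:R) ^+ 2) by ring.
  have e1 : (avw / 2) ^+ 2 * (2 ^+ 16 * (N%:R * M%:R) ^+ 2) = 1.
    by rewrite /avw; field; rewrite !gt_eqF.
  by rewrite -[leLHS]e1 ler_wpM2r// mulr_ge0 ?exprn_ge0 ?mulr_ge0.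
apply: (@le_trans _ _ (h ^+ 2 * (2 ^+ 16 * (N%:R * M%:R) ^+ 2) * ((4 / M%:R) ^+ 2 * S))).
  by rewrite ler_wpM2r// mulr_ge0// sqr_ge0.
have -> : h ^+ 2 * (2 ^+ 16 * (N%:R * M%:R) ^+ 2) * ((4 / M%:R) ^+ 2 * S) =
   2 ^+ 20 * N%:R ^+ 2 * (h ^+ 2 * S) by field; rewrite gt_eqF.
apply: (@le_trans _ _ (2 ^+ 20 * N%:R ^+ 2 * (2 ^+ 14 * L ^+ 2 *
   ((1 + M%:R / N%:R) * gridnorm G g + Gam / N%:R)))).
  by rewrite ler_wpM2l// mulr_ge0 ?exprn_ge0.
have -> : 2 ^+ 20 * N%:R ^+ 2 * (2 ^+ 14 * L ^+ 2 *
   ((1 + M%:R / N%:R) * gridnorm G g + Gam / N%:R)) =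
   (2 ^+ 34 * L ^+ 2) * ((N%:R ^+ 2 + N%:R * M%:R) * gridnorm G g + N%:R * Gam).
  by field; rewrite gt_eqF.
have nr0 := gridnorm_ge0 G g0.
rewrite ler_wpM2r//.
  by rewrite addr_ge0// mulr_ge0// ?addr_ge0 ?exprn_ge0 ?mulr_ge0.
have -> : L ^+ 6 = L ^+ 4 * L ^+ 2 by rewrite -exprD.
rewrite ler_wpM2r ?exprn_ge0 ?(ltW (gL_gt0 G))//.
apply: (@le_trans _ _ ((2 ^+ 10) ^+ 4)).
  by rewrite -exprM; apply: ler_weXn2l => //; rewrite ler1n.
by rewrite lerXn2r ?nnegrE ?exprn_ge0 ?gL_ge// ltW// gL_gt0.
Qed.

End Reflection.

(** * Heath-Brown's bound *)

Section MeanValue.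
Variables (R : realType) (G : grid R).
Notation h := (gh G).
Notation Z := (gZ G).
Notation L := (gL G).
Notation H := (gH G).
Notation LC := (lc (gJ G).+1).

Let h0 : 0 < h. Proof. exact: gh_gt0. Qed.

Let ZZ k : (0 < k)%N -> Z%:R <= Z%:R ^+ k :> R.
Proof.
by move=> k0; rewrite -[leLHS]expr1; apply: ler_weXn2l => //; exact: gZ_ge1.
Qed.

Lemma L_pow_le (c : R) j k : c <= 2 ^+ (10 * j) -> (j <= k)%N -> c <= L ^+ k.
Proof.
move=> cj jk; apply: (le_trans cj).
apply: (@le_trans _ _ (L ^+ j)); last by apply: ler_weXn2l => //; exact: gL_ge1.
by rewrite exprM lerXn2r ?nnegrE ?exprn_ge0 ?gL_ge// ltW// gL_gt0.
Qed.

Lemma grid_orthogonality (t y0 : R) n : (n <= 2 * H)%N -> `|t| <= Z%:R ->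
  h * cmod (\sum_(k < n) cis (t * (y0 + h * k%:R))) <= 18 * LC `|t|.
Proof.
move=> nH tZ.
have th : `|t * h| <= 4^-1.
  rewrite normrM (gtr0_norm h0).
  have : h * (Z%:R * 4) <= 1.
    apply: gh_le_inv; rewrite (exprS _ 9) ler_wpM2l//.
    have := @ZZ 9 isT; have := gZ_ge2 G; lra.
  by have := h0; nra.
have bd := @geometric_bound_cor R t y0 h n h0 th.
set S := cmod _ in bd *; have S0 : 0 <= S by exact: cmod_ge0.
have triv : h * S <= 82 / 10.
  apply: (@le_trans _ _ (h * (2 * H)%N%:R)); last first.
    by rewrite natrM; have := gH_le G; lra.
  rewrite ler_pM2l// (le_trans (cmod_sum _ _ _))// (eq_bigr (fun=> 1)); last first.
    by move=> k _; rewrite cmod_cis.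
  by rewrite sumr_const card_ord ler_nat.
have hS : 0 <= h * S by rewrite mulr_ge0// ltW.
have : h * S / 9 <= 2 * LC `|t|.
  apply: le_lc.
  - by rewrite divr_ge0.
  - by apply: (le_trans tZ); apply: le_trans (gJ_ge G); exact: ZZ.
  - lra.
  - lra.
lra.
Qed.

Section Family.
Variables (I : finType) (tau : I -> R) (B : nat) (T : R).
Hypotheses (tauB : multiplicity_le tau B) (tauT : forall i, 0 <= tau i <= T).
Hypothesis TZ : T <= Z%:R.

Lemma tau_diff i j : `|tau i - tau j| <= T.
Proof.
have /andP[i1 i2] := tauT i; have /andP[j1 j2] := tauT j.
by rewrite ler_norml; apply/andP; split; lra.
Qed.

Lemma mean_value (a : I -> R[i]) (y0 : R) n : (n <= 2 * H)%N ->
  h * \sum_(k < n) cmod (expsum tau a (y0 + h * k%:R)) ^+ 2 <=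
  54 * L * B%:R * \sum_i cmod (a i) ^+ 2.
Proof.
move=> nH.
have ao i i' : h * cmod (\sum_(k < n) cis (tau i * (y0 + h * k%:R)) *
    (cis (tau i' * (y0 + h * k%:R)))^J) <= 18 * LC `|tau i - tau i'|.
  under eq_bigr => k _ do rewrite -cisB -mulrBl.
  by apply: grid_orthogonality => //; rewrite (le_trans (tau_diff _ _)).
have := large_sieve tauB (ltW h0) (ler0n R 18) ao a.
move/le_trans; apply; rewrite ler_wpM2r//.
  by apply: sumr_ge0 => i _; exact: sqr_ge0.
rewrite ler_wpM2r//; have := gJ_le G; lra.
Qed.

Lemma gridnorm_sqr (a : I -> R[i]) (A : R) : (forall i, cmod (a i) <= A) ->
  gridnorm G (fun y => cmod (expsum tau a y) ^+ 2) <=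
  54 * L * B%:R * (A ^+ 2 * #|I|%:R).
Proof.
move=> aA; rewrite /gridnorm.
have -> : \sum_(d < 2 * H) cmod (expsum tau a (dv G d)) ^+ 2 =
    \sum_(d < 2 * H) cmod (expsum tau a (- (h * H%:R) + h * d%:R)) ^+ 2.
  by apply: eq_bigr => d _; congr (cmod (expsum _ _ _) ^+ 2); rewrite /dv; ring.
apply: (le_trans (mean_value _ _ (leqnn _))).
rewrite ler_wpM2l ?mulr_ge0 ?(ltW (gL_gt0 G))//.
apply: (@le_trans _ _ (\sum_(i : I) A ^+ 2)); last first.
  by rewrite sumr_const -[leLHS]mulr_natr.
apply: ler_sum => i _; have A0 : 0 <= A by apply: le_trans (aA i); exact: cmod_ge0.
by rewrite ler_sqr ?nnegrE ?cmod_ge0.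
Qed.

Section Averaging.
Variables (N M : nat).
Hypotheses (N0 : (0 < N)%N) (M0 : (0 < M)%N) (NMZ : room 10 (N * M) Z).
Hypothesis TNM : T <= N%:R * M%:R.
Notation J0 := (gJ0 G N M).

Definition gam i : R[i] := (J0%:R)^-1%:C * \sum_(j < J0) cis (tau i * (h * j%:R)).

Let J0p : 0 < J0%:R :> R.
Proof. by rewrite ltr0n gJ0_gt0. Qed.

Lemma gam_ge_half i : 2^-1 <= cmod (gam i).
Proof.
rewrite cmodM cmod_real ger0_norm ?invr_ge0// ler_pdivlMl//.
rewrite (le_trans _ (Re_le_cmod _))// raddf_sum /=.
apply: (@le_trans _ _ (\sum_(j < J0) (2^-1 : R))).
  by rewrite sumr_const card_ord -[leRHS]mulr_natl.
apply: ler_sum => j _; apply: cos_ge_half.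
have /andP[t0 tT] := tauT i.
have hj0 : 0 <= h * j%:R by rewrite mulr_ge0// ltW.
have hje : h * j%:R <= avw R N M.
  have /andP[_ h2] := gJ0_itv N0 M0 NMZ; apply: le_trans h2.
  by rewrite ler_pM2l// ler_nat ltnW.
have NMp : 0 < N%:R * M%:R :> R by rewrite mulr_gt0 ?ltr0n.
rewrite ger0_norm; last exact: mulr_ge0.
apply: (@le_trans _ _ ((N%:R * M%:R) * avw R N M)).
  by apply: ler_pM => //; exact: le_trans TNM.
have -> : (N%:R * M%:R) * avw R N M = (2 ^+ 7)^-1.
  by rewrite /avw; field; rewrite !gt_eqF ?ltr0n.
rewrite invf_le1 ?exprn_gt0//; lra.
Qed.

Lemma gam_neq0 i : gam i != 0.
Proof. by rewrite -cmod_eq0 gt_eqF// (lt_le_trans _ (gam_ge_half i)). Qed.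

(** Shifts by [h j1] and [- h j2] multiply the term of index [i], on average, by [gam i] and its
    conjugate. These weights undo that, so the unweighted sum is exactly the average in
    [expsum_average]. *)
Definition bb i : R[i] := (gam i * (gam i)^J)^-1.

Lemma bb_le4 i : cmod (bb i) <= 4.
Proof.
have hg := gam_ge_half i; rewrite cmodV cmodM cmodJ.
have : 4^-1 <= cmod (gam i) * cmod (gam i) by nra.
by move=> h4; rewrite invf_ple ?posrE//; apply: lt_le_trans h4.
Qed.

Lemma expsum_average y : expsum1 tau y = (J0%:R ^+ 2)^-1%:C *
  \sum_(u : 'I_J0 * 'I_J0) expsum tau bb (y + h * u.1%:R - h * u.2%:R).
Proof.
rewrite /expsum exchange_big /= mulr_sumr; apply: eq_bigr => i _.
rewrite -mulr_sumr.
have -> : \sum_(u : 'I_J0 * 'I_J0) cis (tau i * (y + h * u.1%:R - h * u.2%:R)) =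
   cis (tau i * y) * ((J0%:R ^+ 2)%:C * (gam i * (gam i)^J)).
  rewrite -(pair_big predT predT (fun j1 j2 : 'I_J0 =>
    cis (tau i * (y + h * j1%:R - h * j2%:R)))) /=.
  have e1 : \sum_(j < J0) cis (tau i * (h * j%:R)) = J0%:R%:C * gam i.
    by rewrite /gam mulrA -realCM divff ?gt_eqF// mul1r.
  have -> : (J0%:R ^+ 2)%:C * (gam i * (gam i)^J) =
     (J0%:R%:C * gam i) * (J0%:R%:C * gam i)^J.
    by rewrite conjCM conjc_real expr2 realCM; ring.
  rewrite -e1 conjC_sum mulr_suml mulr_sumr; apply: eq_bigr => j1 _.
  rewrite !mulr_sumr; apply: eq_bigr => j2 _.
  by rewrite -cisN -!cisD; congr cis; ring.
have g0 : gam i * (gam i)^J != 0.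
  by rewrite mulf_neq0 ?gam_neq0// conjc_eq0 gam_neq0.
have e2 : ((J0%:R ^+ 2)^-1)%:C * (J0%:R ^+ 2)%:C = 1 :> R[i].
  by rewrite -realCM mulVf// expf_neq0// gt_eqF.
rewrite /bb; move: (gam i * _) g0 (_ ^-1)%:C (_ ^+ 2)%:C e2 (cis _) => w w0 u v uv c.
have -> : u * (w^-1 * (c * (v * w))) = (u * v) * (w^-1 * w) * c by ring.
by rewrite uv mulVf// !mul1r.
Qed.

Let sizeJ : size (index_enum (Datatypes_prod__canonical__fintype_Finite 'I_J0 'I_J0)) = (J0 * J0)%N.
Proof. by rewrite -[in RHS](card_ord J0) -card_prod cardT enumT. Qed.

Lemma average_sqr y : cmod (expsum1 tau y) ^+ 2 <= (J0%:R ^+ 2)^-1 *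
  \sum_(j1 < J0) \sum_(j2 < J0) cmod (expsum tau bb (y + h * j1%:R - h * j2%:R)) ^+ 2.
Proof.
rewrite expsum_average cmodM cmod_real ger0_norm ?invr_ge0 ?sqr_ge0// exprMn.
rewrite (pair_big predT predT (fun j1 j2 : 'I_J0 =>
    cmod (expsum tau bb (y + h * j1%:R - h * j2%:R)) ^+ 2)) /=.
rewrite expr2 -mulrA ler_pM2l ?invr_gt0 ?exprn_gt0// ler_pdivrMl ?exprn_gt0//.
apply: (le_trans (cmod_sum_sqr_le _ _)).
by rewrite sizeJ natrM -expr2.
Qed.

Lemma average_cube y : cmod (expsum1 tau y) ^+ 3 <= (J0%:R ^+ 2)^-1 *
  \sum_(j1 < J0) \sum_(j2 < J0) cmod (expsum tau bb (y + h * j1%:R - h * j2%:R)) ^+ 3.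
Proof.
rewrite expsum_average cmodM cmod_real ger0_norm ?invr_ge0 ?sqr_ge0// exprMn.
rewrite (pair_big predT predT (fun j1 j2 : 'I_J0 =>
    cmod (expsum tau bb (y + h * j1%:R - h * j2%:R)) ^+ 3)) /=.
set S := cmod (\sum_u _); set S3 := \sum_(p | _) _.
have S3le : S ^+ 3 <= (J0%:R ^+ 2) ^+ 2 * S3.
  have le1 : S ^+ 3 <= (\sum_(u : 'I_J0 * 'I_J0)
      cmod (expsum tau bb (y + h * u.1%:R - h * u.2%:R))) ^+ 3.
    rewrite lerXn2r ?nnegrE ?cmod_ge0 ?cmod_sum//.
    by apply: sumr_ge0 => u _; exact: cmod_ge0.
  apply: (le_trans le1); apply: (le_trans (sum_cube_le _ _)).
    by move=> u; exact: cmod_ge0.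
  by rewrite sizeJ natrM -expr2.
have K0 : 0 < J0%:R ^+ 2 :> R by rewrite exprn_gt0.
move: (J0%:R ^+ 2) K0 S3le => K K0 S3le.
rewrite ler_pdivlMl//.
have -> : K * (K^-1 ^+ 3 * S ^+ 3) = (K ^+ 2)^-1 * S ^+ 3 by field; rewrite gt_eqF.
by rewrite ler_pdivrMl ?exprn_gt0.
Qed.

End Averaging.
End Family.
End MeanValue.

Section HeathBrown.
Variables (R : realType) (G : grid R).
Notation h := (gh G).
Notation Z := (gZ G).
Notation L := (gL G).
Notation H := (gH G).
Notation lamG := (lam G).
Variables (I : finType) (tau : I -> R) (B : nat) (T : R).
Hypotheses (tauB : multiplicity_le tau B) (tauT : forall i, 0 <= tau i <= T).
Hypotheses (T1 : 1 <= T) (TZ : tall Z T).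
Notation P := (#|I|%:R : R).
Notation Bp := (B%:R * P).

Let TZ1 : T <= Z%:R.
Proof.
apply: le_trans TZ; have : T <= (T + 1) ^+ 4.
  apply: (@le_trans _ _ (T + 1)); first lra.
  by rewrite -[leLHS]expr1; apply: ler_weXn2l => //; have := T1; lra.
have : 1 <= 2 ^+ 80 :> R by rewrite exprn_ege1// ler1n.
have := T1; nra.
Qed.

Definition qpow a := qsum G tau (index_iota 1 (2 ^ a)).

Lemma qpow_ge0 a : 0 <= qpow a. Proof. exact: qsum_ge0. Qed.

Let L1 : 1 <= L. Proof. exact: gL_ge1. Qed.
Let L0 : 0 < L. Proof. exact: gL_gt0. Qed.

Let Lpow k : 0 < L ^+ k. Proof. by rewrite exprn_gt0. Qed.

Lemma qpow_le a a' : (a <= a')%N -> qpow a <= qpow a'.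
Proof.
move=> aa; apply: qsum_sub; first exact: iota_uniq.
move=> n; rewrite !mem_index_iota => /andP[-> n2] /=.
by rewrite (leq_trans n2)// leq_exp2l.
Qed.

Lemma qpow_mono a a' : (a <= a')%N -> (2 ^ a' <= Z)%N ->
  2 ^+ (a' - a) * qpow a <= L * qpow a'.
Proof.
move=> aa aZ.
have := @qsum_mono R G I tau (index_iota 1 (2 ^ (a' - a)).+1)
  (index_iota 1 (2 ^ a)) (index_iota 1 (2 ^ a')).
rewrite !iota_uniq size_iota subn1 /= natrX => hm.
apply: (le_trans (hm isT isT isT _ _ _ _)).
- by move=> n; rewrite mem_index_iota => /andP[].
- by move=> n; rewrite mem_index_iota => /andP[].
- by move=> n; rewrite mem_index_iota => /andP[-> n2]; rewrite (leq_trans (ltnW n2)).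
- move=> p n; rewrite !mem_index_iota ltnS => /andP[p1 p2] /andP[n1 n2].
  rewrite muln_gt0 p1 n1 /= -(subnK aa) expnD.
  by rewrite (leq_ltn_trans (leq_mul p2 (leqnn n)))// ltn_pmul2l// expn_gt0.
- by rewrite ler_wpM2r ?qpow_ge0// gD_le.
Qed.

Lemma qpow_sqr a : (2 ^ (2 * a) <= Z)%N ->
  qpow a ^+ 2 <= P ^+ 2 * L ^+ 2 * qpow (2 * a).
Proof.
move=> aZ.
have := @qsum_sqr R G I tau (index_iota 1 (2 ^ a)) (index_iota 1 (2 ^ (2 * a))).
rewrite !iota_uniq => hm.
apply: (le_trans (hm isT isT _ _ _)).
- by move=> n; rewrite mem_index_iota => /andP[].
- by move=> n; rewrite mem_index_iota => /andP[-> n2]; rewrite (leq_trans (ltnW n2)).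
- move=> p n; rewrite !mem_index_iota => /andP[p1 p2] /andP[n1 n2].
  by rewrite muln_gt0 p1 n1 mul2n -addnn expnD /= ltn_mul.
- rewrite ler_wpM2r ?qpow_ge0// ler_wpM2l ?sqr_ge0//.
  by rewrite ler_sqr ?nnegrE ?(ltW L0)// gD_le.
Qed.

Lemma qpow_block a b : (a <= b)%N -> (2 ^ (9 + b) <= Z)%N ->
  qpow (9 + a) <= L / 2 ^+ b * qpow (9 + b) * 2 ^+ a.
Proof.
move=> ab bZ; have := @qpow_mono (9 + a) (9 + b).
rewrite leq_add2l ab subnDl => /(_ isT bZ).
have -> : 2 ^+ (b - a) = 2 ^+ b / 2 ^+ a :> R.
  by rewrite -{2}(subnK ab) exprD mulfK// expf_neq0.
have pa : 0 < 2 ^+ a :> R by rewrite exprn_gt0.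
have pb : 0 < 2 ^+ b :> R by rewrite exprn_gt0.
rewrite mulrAC ler_pdivrMr// mulrC => hm.
by rewrite -[leRHS]mulrA mulrAC ler_pdivlMr// mulrA.
Qed.

(** Reflection with [N = 2^a] and [M = 2^b]. The hypothesis on [g] holds because [positivity_le]
    removes the weights and the shift, and [qpow_block] moves each short block to the longest
    one. *)
Lemma reflection_two a b : (2 ^ (10 + a + b) <= Z)%N -> T <= 2 ^+ (a + b) ->
  qsum G tau (index_iota (2 ^ a) (4 * 2 ^ a)) <=
  L ^+ 8 * ((2 ^+ a ^+ 2 + 2 ^+ a * 2 ^+ b) * Bp + 2 ^+ a / 2 ^+ b * qpow (9 + b)).
Proof.
move=> abZ Tab.
have N0 : (0 < 2 ^ a)%N by rewrite expn_gt0.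
have M0 : (0 < 2 ^ b)%N by rewrite expn_gt0.
have NMZ : room 10 (2 ^ a * 2 ^ b) Z by rewrite /room -!expnD addnA.
have TNM : T <= (2 ^ a)%:R * (2 ^ b)%:R by rewrite !natrX -exprD.
have bZ : (2 ^ (9 + b) <= Z)%N.
  by apply: leq_trans abZ; rewrite leq_exp2l//; clear; lia.
pose g y := cmod (expsum tau (bb G tau (2 ^ a) (2 ^ b)) y) ^+ 2.
have g0 y : 0 <= g y by exact: sqr_ge0.
pose Gam := 16 * (L / 2 ^+ b * qpow (9 + b)).
have Gam0 : 0 <= Gam.
  by rewrite mulr_ge0// mulr_ge0 ?qpow_ge0// divr_ge0 ?exprn_ge0 ?(ltW L0).
have gGam a' z : (2 ^ a' <= 2 ^ b)%N ->
  \sum_(m <- blockM a') \sum_(m' <- blockM a') g (lamG m' - lamG m + z) <=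
  Gam * 2 ^+ a'.
  move=> aa; rewrite exchange_big /=.
  have b4 i : cmod (bb G tau (2 ^ a) (2 ^ b) i) <= 4.
    exact: (bb_le4 tauT N0 M0 NMZ TNM).
  have := @positivity_le R I tau nat (blockM a') lamG (fun=> 1)
    (bb G tau (2 ^ a) (2 ^ b)) 4 1 z b4.
  rewrite ler01 lexx => /(_ (fun=> isT)) pl.
  apply: (@le_trans _ _ (4 ^+ 2 * 1 ^+ 2 * qpow (9 + a'))).
    apply: le_trans pl; apply: ler_sum => m _; apply: ler_sum => n _.
    by rewrite !mul1r.
  rewrite expr1n mulr1 /Gam.
  have -> : 4 ^+ 2 = 16 :> R by ring.
  rewrite -mulrA ler_pM2l// qpow_block//.
  by move: aa; rewrite leq_exp2l.
have rf := @reflection R G _ _ N0 M0 NMZ g Gam g0 Gam0 gGam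
  (fun y => cmod (expsum1 tau y) ^+ 2)
  (average_sqr tauT N0 M0 NMZ TNM).
have -> : qsum G tau (index_iota (2 ^ a) (4 * 2 ^ a)) =
  \sum_(m <- box (2 ^ a)) \sum_(n <- box (2 ^ a)) cmod (expsum1 tau (lamG m - lamG n)) ^+ 2.
  by [].
apply: (le_trans rf); rewrite !natrX.
have gn : gridnorm G g <= 54 * L * B%:R * (4 ^+ 2 * P).
  by apply: (gridnorm_sqr tauB tauT) => // i; exact: (bb_le4 tauT N0 M0 NMZ TNM).
have -> : L ^+ 8 = L ^+ 6 * L ^+ 2 by rewrite -exprD.
rewrite -[leRHS]mulrA ler_pM2l// mulrDr; apply: lerD.
  have c0 : 0 <= 2 ^+ a ^+ 2 + 2 ^+ a * 2 ^+ b :> R.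
    by rewrite addr_ge0 ?mulr_ge0 ?exprn_ge0.
  rewrite [leRHS]mulrCA ler_wpM2l//; apply: (le_trans gn).
  have -> : 54 * L * B%:R * (4 ^+ 2 * P) = 864 * L * Bp by ring.
  rewrite ler_wpM2r ?mulr_ge0// expr2 ler_pM2r//.
  by apply: le_trans (gL_ge G); lra.
rewrite /Gam.
have -> : 2 ^+ a * (16 * (L / 2 ^+ b * qpow (9 + b))) =
  (16 * L) * (2 ^+ a / 2 ^+ b * qpow (9 + b)) by field; rewrite expf_neq0.
rewrite ler_wpM2r ?mulr_ge0 ?qpow_ge0 ?invr_ge0 ?exprn_ge0//.
rewrite expr2 ler_pM2r//.
by apply: le_trans (gL_ge G); lra.
Qed.

Lemma qpow_reflection a b : (2 ^ (10 + a + b) <= Z)%N -> T <= 2 ^+ (a + b) ->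
  qpow a <=
  L ^+ 11 * ((2 ^+ a ^+ 2 + 2 ^+ a * 2 ^+ b) * Bp + 2 ^+ a / 2 ^+ b * qpow (9 + b)).
Proof.
move=> abZ Tab; have r2 := reflection_two abZ Tab.
have aZ : (4 * 2 ^ a <= Z)%N.
  apply: leq_trans abZ; rewrite -[4%N]/(2 ^ 2)%N -expnD leq_exp2l//; clear; lia.
apply: (le_trans (qsum_dyadic tau aZ)).
have aL : a%:R <= L.
  apply: le_trans (gJ_le G); rewrite ler_nat ltnW// ltnS -(@leq_exp2l 2)//.
  rewrite -(ler_nat R) !natrX; apply: le_trans (gJ_ge G).
  apply: (@le_trans _ _ Z%:R).
    rewrite -natrX ler_nat (leq_trans _ aZ)// leq_pmull//.
  by rewrite -[leLHS]expr1; apply: ler_weXn2l => //; exact: gZ_ge1.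
have q0 := qsum_ge0 G tau (index_iota (2 ^ a) (4 * 2 ^ a)).
set q := qsum _ _ _ in r2 q0 *; set rhs := (X in L ^+ 8 * X) in r2.
have -> : L ^+ 11 = L ^+ 3 * L ^+ 8 by rewrite -exprD.
rewrite -[leRHS]mulrA; apply: ler_pM => //.
have -> : L ^+ 3 = L * L * L by rewrite !exprS expr0; ring.
apply: ler_pM => //; last exact: gD_le.
apply: ler_pM => //; apply: le_trans (gL_ge G); lra.
Qed.

(** Either [U] or [x] is at least [Q / 2]; in the second case [Q^2 / 4 <= K Q]. *)
Lemma self_improve (Q U x K : R) : 0 <= Q -> 0 <= U -> 0 <= K -> 0 <= x ->
  Q <= U + x -> x ^+ 2 <= K * Q -> Q <= 2 * U + 4 * K.
Proof.
move=> Q0 U0 K0 x0 QU xK; have [QU2|QU2] := leP Q (2 * U); first lra.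
have : Q / 2 <= x by lra.
move=> h1; have h2 : (Q / 2) ^+ 2 <= x ^+ 2.
  by rewrite ler_sqr ?nnegrE// divr_ge0.
have Qp : 0 < Q by lra.
have : Q * Q <= Q * (4 * K) by nra.
by rewrite ler_pM2l//; lra.
Qed.

(** In this range the reflected sum can be taken so short that its square has length at most [2^a]
    again. Reflection followed by [qpow_sqr] then bounds [qpow a] by a main term plus a multiple of
    its own square root, and [self_improve] concludes. For [a < 18] the trivial bound suffices. *)
Lemma qpow_long a : (2 ^ (10 + 2 * a) <= Z)%N -> 2 ^+ 20 * T ^+ 2 <= 2 ^+ (3 * a) ->
  qpow a <= L ^+ 29 * (2 ^+ a ^+ 2 * Bp + 2 ^+ a * P ^+ 2).
Proof.
move=> aZ Ta.
have P0 : 0 <= P by [].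
have B0 : 0 <= Bp by rewrite mulr_ge0.
have X1 : 1 <= 2 ^+ a :> R by rewrite exprn_ege1// ler1n.
have X0 : 0 < 2 ^+ a :> R by rewrite exprn_gt0.
have [a18|a18] := ltnP a 18.
  have h1 : qpow a <= 2 ^+ a ^+ 2 * P ^+ 2.
    rewrite /qpow /qsum.
    apply: (@le_trans _ _ (\sum_(m <- index_iota 1 (2 ^ a)) \sum_(n <- index_iota 1 (2 ^ a)) P ^+ 2)).
      apply: ler_sum => m _; apply: ler_sum => n _.
      rewrite ler_sqr ?nnegrE ?cmod_ge0// expsum1E.
      by have := @cmod_expsum_le R I tau (fun=> 1) (lamG m - lamG n) 1;
        rewrite mul1r; apply => i; rewrite cmod1.
    rewrite !big_const_seq !count_predT !iter_addr_0 size_iota -mulrnA -[leLHS]mulr_natl.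
    rewrite ler_wpM2r ?sqr_ge0// expr2 -!natrX -natrM ler_nat.
    by rewrite leq_mul// leq_subr.
  apply: (le_trans h1).
  have h2 : 2 ^+ a * P ^+ 2 <= 2 ^+ a ^+ 2 * Bp + 2 ^+ a * P ^+ 2.
    by rewrite lerDr mulr_ge0 ?exprn_ge0.
  apply: (le_trans _ (ler_wpM2l (ltW (Lpow 29)) h2)).
  rewrite expr2 -mulrA ler_wpM2r ?mulr_ge0 ?exprn_ge0//.
  apply: (@L_pow_le _ _ _ 2) => //; apply: ler_weXn2l; first by rewrite ler1n.
  by rewrite ltnW// (leq_trans a18).
(* The reflected length [2^(9 + b)] is chosen to be [2^(a/2)], rounded down. The condition on [T] is
   what reflection requires, [T <= 2^(a + b)]. *)
have [b ab] : exists b, (a./2 = 9 + b)%N.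
  exists (a./2 - 9)%N; rewrite subnKC// -[9%N]/(18./2)%N; exact: half_leq.
have a2 : (9 + b).*2 + odd a = a.
  by rewrite -ab -[RHS]odd_double_half addnC.
have Tab : T <= 2 ^+ (a + b).
  have T0 : 0 <= T by have := T1; lra.
  rewrite -ler_sqr ?nnegrE ?exprn_ge0//.
  rewrite -exprM -(@ler_pM2l _ (2 ^+ 20)) ?exprn_gt0// -exprD.
  apply: (le_trans Ta); apply: ler_weXn2l; first by rewrite ler1n.
  by rewrite -a2 -muln2; case: (odd a); clear; lia.
have abZ : (2 ^ (10 + a + b) <= Z)%N.
  by apply: leq_trans aZ; rewrite leq_exp2l//; rewrite -a2 -muln2; clear; lia.
have rf := qpow_reflection abZ Tab.
have sq : qpow (9 + b) ^+ 2 <= P ^+ 2 * L ^+ 2 * qpow a.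
  have bZ : (2 ^ (2 * (9 + b)) <= Z)%N.
    by apply: leq_trans aZ; rewrite leq_exp2l// -a2 -muln2; clear; lia.
  apply: (le_trans (qpow_sqr bZ)); rewrite ler_wpM2l ?mulr_ge0 ?exprn_ge0 ?(ltW L0)//.
  by apply: qpow_le; rewrite -[leqRHS]a2 mul2n leq_addr.
set y := qpow (9 + b) in rf sq; have y0 : 0 <= y by exact: qpow_ge0.
set c := L ^+ 11 * (2 ^+ a / 2 ^+ b).
have c0 : 0 <= c by rewrite mulr_ge0 ?divr_ge0 ?exprn_ge0 ?(ltW L0).
set U := L ^+ 11 * (2 * (2 ^+ a ^+ 2 * Bp)).
have U0 : 0 <= U by rewrite !mulr_ge0 ?exprn_ge0 ?(ltW L0).
have QU : qpow a <= U + c * y.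
  apply: (le_trans rf); rewrite mulrDr -[c * y]mulrA lerD2r.
  rewrite /U ler_pM2l// [leRHS]mulrA ler_wpM2r//.
  have : 2 ^+ b <= 2 ^+ a :> R.
    apply: ler_weXn2l; first by rewrite ler1n.
    by rewrite -a2 -muln2; clear; lia.
  have := X0; nra.
have := self_improve (qpow_ge0 a) U0 (_ : 0 <= c ^+ 2 * (P ^+ 2 * L ^+ 2)) _ QU.
move=> hs; apply: (le_trans (hs _ _ _)).
- by rewrite !mulr_ge0 ?exprn_ge0 ?(ltW L0).
- by rewrite mulr_ge0.
- by rewrite exprMn -[leRHS]mulrA ler_wpM2l ?sqr_ge0.
have c2 : c ^+ 2 <= L ^+ 22 * (2 ^+ 19 * 2 ^+ a).
  rewrite /c exprMn -exprM ler_pM2l// exprMn exprVn ler_pdivrMr ?exprn_gt0//.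
  rewrite -!exprM -!exprD; apply: ler_weXn2l; first by rewrite ler1n.
  by rewrite -a2 -muln2; case: (odd a); clear; lia.
have e1 : 4 * (c ^+ 2 * (P ^+ 2 * L ^+ 2)) <= L ^+ 29 * (2 ^+ a * P ^+ 2).
  apply: (@le_trans _ _ (4 * ((L ^+ 22 * (2 ^+ 19 * 2 ^+ a)) * (P ^+ 2 * L ^+ 2)))).
    by rewrite ler_pM2l// ler_wpM2r// mulr_ge0 ?exprn_ge0 ?(ltW L0).
  have -> : 4 * ((L ^+ 22 * (2 ^+ 19 * 2 ^+ a)) * (P ^+ 2 * L ^+ 2)) =
     2 ^+ 21 * (L ^+ 24 * (2 ^+ a * P ^+ 2)) by ring.
  have -> : L ^+ 29 = L ^+ 5 * L ^+ 24 by rewrite -exprD.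
  rewrite -[leRHS]mulrA ler_wpM2r ?mulr_ge0 ?exprn_ge0 ?(ltW L0)//.
  by apply: (@L_pow_le _ _ _ 3) => //; apply: ler_weXn2l => //; rewrite ler1n.
have e2 : 2 * U <= L ^+ 29 * (2 ^+ a ^+ 2 * Bp).
  have -> : 2 * U = 4 * (L ^+ 11 * (2 ^+ a ^+ 2 * Bp)) by rewrite /U; ring.
  have -> : L ^+ 29 = L ^+ 18 * L ^+ 11 by rewrite -exprD.
  rewrite -[leRHS]mulrA ler_wpM2r//.
    by rewrite mulr_ge0 ?mulr_ge0 ?exprn_ge0 ?(ltW L0).
  by apply: (@L_pow_le _ _ _ 1) => //; lra.
lra.
Qed.

Hypothesis BP : B%:R <= 4 * P.
Notation S := (Num.sqrt Bp).

Let P0 : 0 <= P. Proof. by []. Qed.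
Let U0 : 0 <= Bp. Proof. by rewrite mulr_ge0. Qed.
Let S0 : 0 <= S. Proof. exact: sqrtr_ge0. Qed.
Let S2 : S ^+ 2 = Bp. Proof. by rewrite sqr_sqrtr. Qed.
Let S2P : S <= 2 * P.
Proof.
by rewrite -ler_sqr ?nnegrE ?mulr_ge0// S2; have := P0; move: BP; nra.
Qed.

(** One reflection with the least admissible [b] leads to length [2^(9 + b)]. The square of this
    sum, slightly lengthened, falls in the range of [qpow_long], and the square root of that bound
    is inserted. *)
Lemma qpow_short a : (2 ^ (10 + 2 * a) <= Z)%N -> 2 ^+ (3 * a) < 2 ^+ 20 * T ^+ 2 ->
  qpow a <= L ^+ 30 * (2 ^+ a ^+ 2 * Bp + 2 ^+ a * P ^+ 2 + T * (P * S)).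
Proof.
move=> aZ Ta.
have fin (l s : R) : 0 <= s -> s <= l * s ->
    8 * s + l * ((2 ^+ 23 + 2 ^+ 11) * s) <= 2 ^+ 25 * l * s.
  by move=> ? ?; lra.
have fin0 (t x u b p : R) : x * u <= x * (x * b + p) -> 0 <= t * u -> 0 <= x * p ->
    0 <= x ^+ 2 * b -> 2 ^+ 22 * ((2 * t + x) * u) + 2 ^+ 11 * (x * p) <=
    (2 ^+ 23 + 2 ^+ 11) * (x ^+ 2 * b + x * p + t * u) by lra.
have fin3 (t x y u b p : R) : x * y * b <= (2 * t + x) * b -> t * b <= 2 * (t * u) ->
    x * b <= x ^+ 2 * b -> 0 <= t * u -> 0 <= x * p -> 0 <= x ^+ 2 * b ->
    (x ^+ 2 + x * y) * b <= 8 * (x ^+ 2 * b + x * p + t * u) by lra.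
have fin4 (p s b c : R) : s ^+ 2 = b -> b <= c -> p * s <= c + p ^+ 2.
  by move=> sb bc; have := sqr_ge0 (p - s); have := sqr_ge0 s; have := sqr_ge0 p; lra.
have fin5 (t p s : R) : t * s * s <= t * s * (2 * p) -> t * s ^+ 2 <= 2 * (t * (p * s)) by lra.
have X0 : 0 < 2 ^+ a :> R by rewrite exprn_gt0.
have ex : exists b, T <= 2 ^+ (a + b).
  exists (gJ G); apply: (le_trans TZ1).
  have Z3 : Z%:R <= Z%:R ^+ 3 :> R.
    by rewrite -[leLHS]expr1; apply: ler_weXn2l => //; exact: gZ_ge1.
  apply: (le_trans Z3); apply: (le_trans (gJ_ge G)).
  by apply: ler_weXn2l; [rewrite ler1n|exact: leq_addl].
case: (ex_minnP ex) => b Tab bmin.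
have ab2 : 2 ^+ a * 2 ^+ b <= 2 * T + 2 ^+ a.
  case: b Tab bmin => [|b] Tab bmin; first by rewrite expr0; have := T1; lra.
  have : 2 ^+ (a + b) < T.
    by rewrite ltNge; apply/negP => /bmin; rewrite ltnn.
  rewrite exprD exprS; lra.
have M0 : 0 < 2 ^+ b :> R by rewrite exprn_gt0.
have bT : 2 ^+ b <= 2 * T.
  case: b Tab bmin {ab2 M0} => [|b] Tab bmin; first by rewrite expr0; have := T1; lra.
  have : 2 ^+ (a + b) < T.
    by rewrite ltNge; apply/negP => /bmin; rewrite ltnn.
  have : 2 ^+ b <= 2 ^+ (a + b) :> R.
    by apply: ler_weXn2l; [rewrite ler1n|exact: leq_addl].
  rewrite exprS; lra.
have T0 : 0 <= T by have := T1; lra.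
have pow_le k (c : R) : 2 ^+ k <= c -> c <= Z%:R -> (2 ^ k <= Z)%N.
  by move=> kc cZ; rewrite -(ler_nat R) natrX (le_trans kc).
have TT : T ^+ 4 <= (T + 1) ^+ 4.
  by rewrite lerXn2r ?nnegrE//; have := T0; lra.
have TT1 : 1 <= T ^+ 4 by rewrite exprn_ege1.
have T4 : T <= T ^+ 4 by rewrite -[leLHS]expr1; apply: ler_weXn2l.
have abZ : (2 ^ (10 + a + b) <= Z)%N.
  have [aT|aT] := leP (2 ^+ a) T.
    apply: (pow_le _ (2 ^+ 12 * T)); first by rewrite -addnA exprD exprD; lra.
    by apply: le_trans TZ; move: (T ^+ 4) ((T + 1) ^+ 4) TT TT1 T4 => x y; lra.
  have -> : b = 0%N.
    by apply/eqP; rewrite -leqn0; apply: bmin; rewrite addn0 ltW.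
  by rewrite addn0 (leq_trans _ aZ)// leq_exp2l//; clear; lia.
have longT : 2 ^+ 20 * T ^+ 2 <= 2 ^+ (3 * (2 * (11 + b))).
  have T3 : T ^+ 3 <= 2 ^+ (3 * a) * 2 ^+ (3 * b).
    rewrite -exprD -mulnDr mulnC exprM lerXn2r ?nnegrE ?exprn_ge0//.
  have h1 : T ^+ 3 <= T ^+ 2 * (2 ^+ 20 * 2 ^+ (3 * b)).
    apply: (le_trans T3); rewrite mulrA ler_wpM2r ?exprn_ge0//.
    by rewrite mulrC ltW.
  have h2 : T <= 2 ^+ 20 * 2 ^+ (3 * b).
    by move: h1; rewrite (exprSr _ 2) ler_pM2l// exprn_gt0//; have := T1; lra.
  have h3 : T ^+ 2 <= (2 ^+ 20 * 2 ^+ (3 * b)) ^+ 2.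
    by rewrite ler_sqr ?nnegrE// mulr_ge0 ?exprn_ge0.
  apply: (@le_trans _ _ (2 ^+ 20 * (2 ^+ 20 * 2 ^+ (3 * b)) ^+ 2)).
    by rewrite ler_pM2l ?exprn_gt0.
  rewrite -exprD -exprM -exprD; apply: ler_weXn2l; first by rewrite ler1n.
  by clear; lia.
have bZ4 : (2 ^ (10 + 2 * (2 * (11 + b))) <= Z)%N.
  apply: (pow_le _ (2 ^+ 54 * (2 * T) ^+ 4)); last first.
    by apply: le_trans TZ; rewrite exprMn; move: (T ^+ 4) ((T + 1) ^+ 4) TT TT1 => x y; lra.
  have -> : (10 + 2 * (2 * (11 + b)) = 54 + b * 4)%N by clear; lia.
  rewrite exprD exprM ler_pM2l ?exprn_gt0// lerXn2r ?nnegrE ?exprn_ge0//.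
  by rewrite mulr_ge0.
have lg := qpow_long bZ4 longT.
have bZ2 : (2 ^ (2 * (11 + b)) <= Z)%N.
  by apply: leq_trans bZ4; rewrite leq_exp2l//; clear; lia.
have sq := qpow_sqr bZ2.
have yP : qpow (9 + b) <= L ^+ 16 * P * (2 ^+ 22 * 2 ^+ b ^+ 2 * S + 2 ^+ 11 * 2 ^+ b * P).
  have le911 : qpow (9 + b) <= qpow (11 + b) by apply: qpow_le; rewrite leq_add2r.
  apply: (le_trans le911).
  rewrite -ler_sqr ?nnegrE ?qpow_ge0//; last first.
    have LP : 0 <= L ^+ 16 * P by exact: mulr_ge0 (ltW (exprn_gt0 _ L0)) P0.
    have p22 : 0 <= 2 ^+ 22 * 2 ^+ b ^+ 2 :> R by apply: mulr_ge0; apply: exprn_ge0.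
    have p11 : 0 <= 2 ^+ 11 * 2 ^+ b :> R by apply: mulr_ge0; apply: exprn_ge0.
    exact: (mulr_ge0 LP (addr_ge0 (mulr_ge0 p22 S0) (mulr_ge0 p11 P0))).
  apply: (le_trans sq).
  apply: (@le_trans _ _ (P ^+ 2 * L ^+ 2 * (L ^+ 29 * (2 ^+ (2 * (11 + b)) ^+ 2 * Bp + 2 ^+ (2 * (11 + b)) * P ^+ 2)))).
    by rewrite ler_wpM2l// mulr_ge0 ?exprn_ge0 ?(ltW L0).
  have e1 : 2 ^+ (2 * (11 + b)) = (2 ^+ 11 * 2 ^+ b) ^+ 2 :> R.
    by rewrite -exprD -exprM mulnC.
  rewrite e1 -[in leLHS]S2.
  have e2 : 2 ^+ 22 = (2 ^+ 11) ^+ 2 :> R by rewrite -exprM.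
  rewrite e2; move: (2 ^+ 11 : R) (exprn_ge0 11 (ler0n R 2)) => c c0.
  move: (2 ^+ b) (ltW M0) => m m0.
  have -> : P ^+ 2 * L ^+ 2 * (L ^+ 29 * (((c * m) ^+ 2) ^+ 2 * S ^+ 2 + (c * m) ^+ 2 * P ^+ 2)) =
     L ^+ 31 * (P ^+ 2 * (((c * m) ^+ 2 * S) ^+ 2 + (c * m * P) ^+ 2)) by ring.
  have -> : (L ^+ 16 * P * (c ^+ 2 * m ^+ 2 * S + c * m * P)) ^+ 2 =
     L ^+ 32 * (P ^+ 2 * (((c * m) ^+ 2 * S) ^+ 2 + (c * m * P) ^+ 2 +
        2 * ((c * m) ^+ 2 * S) * (c * m * P))) by ring.
  apply: ler_pM; rewrite ?exprn_ge0 ?(ltW L0)//.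
  - by rewrite mulr_ge0 ?addr_ge0 ?sqr_ge0.
  - by apply: ler_weXn2l.
  - rewrite ler_wpM2l ?sqr_ge0// lerDl.
    by rewrite !mulr_ge0 ?sqr_ge0.
have rf := qpow_reflection abZ Tab.
apply: (le_trans rf).
have e30 : L ^+ 30 = L ^+ 11 * L ^+ 19 by rewrite -exprD.
rewrite e30 -[leRHS]mulrA ler_pM2l//.
have t1 : 2 ^+ a / 2 ^+ b * qpow (9 + b) <=
   L ^+ 16 * (2 ^+ 22 * ((2 * T + 2 ^+ a) * (P * S)) + 2 ^+ 11 * (2 ^+ a * P ^+ 2)).
  apply: (@le_trans _ _ (2 ^+ a / 2 ^+ b * (L ^+ 16 * P * (2 ^+ 22 * 2 ^+ b ^+ 2 * S + 2 ^+ 11 * 2 ^+ b * P)))).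
    by rewrite ler_wpM2l// divr_ge0 ?exprn_ge0.
  have -> : 2 ^+ a / 2 ^+ b * (L ^+ 16 * P * (2 ^+ 22 * 2 ^+ b ^+ 2 * S + 2 ^+ 11 * 2 ^+ b * P)) =
    L ^+ 16 * (2 ^+ 22 * ((2 ^+ a * 2 ^+ b) * (P * S)) + 2 ^+ 11 * (2 ^+ a * P ^+ 2)).
    by field; rewrite gt_eqF.
  by rewrite ler_pM2l// lerD2r ler_pM2l ?exprn_gt0// ler_wpM2r// mulr_ge0.
have XS : P * S <= 2 ^+ a * Bp + P ^+ 2.
  have X1 : 1 <= 2 ^+ a :> R by rewrite exprn_ege1// ler1n.
  by apply: (fin4 _ _ _ _ S2); rewrite ler_peMl.
have TS : T * Bp <= 2 * (T * (P * S)).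
  rewrite -[in leLHS]S2; have : T * S * S <= T * S * (2 * P) by rewrite ler_wpM2l// mulr_ge0.
  exact: fin5.
have L16 : 1 <= L ^+ 16 by rewrite exprn_ege1.
set X := 2 ^+ a in X0 ab2 Ta t1 XS *.
have XX : X * (P * S) <= X * (X * Bp + P ^+ 2) by rewrite ler_pM2l.
have XM : X * 2 ^+ b * Bp <= (2 * T + X) * Bp by rewrite ler_wpM2r.
have XB : X * Bp <= X ^+ 2 * Bp.
  have X1 : 1 <= X by rewrite exprn_ege1// ler1n.
  by rewrite ler_wpM2r// expr2 ler_peMl// ltW.
have V0 : 0 <= T * (P * S) by rewrite !mulr_ge0.
have XP0 : 0 <= X * P ^+ 2 by rewrite mulr_ge0 ?sqr_ge0// ltW.
have XB0 : 0 <= X ^+ 2 * Bp by rewrite mulr_ge0 ?sqr_ge0.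
have L19 : 2 ^+ 25 * L ^+ 16 <= L ^+ 19.
  rewrite (exprD _ 3 16) ler_pM2r//.
  by apply: (@L_pow_le _ _ _ 3) => //; apply: ler_weXn2l => //; rewrite ler1n.
set Sum := X ^+ 2 * Bp + X * P ^+ 2 + T * (P * S).
have Sum0 : 0 <= Sum by rewrite !addr_ge0.
apply: le_trans (ler_wpM2r Sum0 L19).
have y0 : 2 ^+ 22 * ((2 * T + X) * (P * S)) + 2 ^+ 11 * (X * P ^+ 2) <=
   (2 ^+ 23 + 2 ^+ 11) * Sum.
  exact: fin0.
have y1 : L ^+ 16 * (2 ^+ 22 * ((2 * T + X) * (P * S)) + 2 ^+ 11 * (X * P ^+ 2)) <=
  L ^+ 16 * ((2 ^+ 23 + 2 ^+ 11) * Sum) by rewrite ler_pM2l.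
have y2 : Sum <= L ^+ 16 * Sum by rewrite ler_peMl.
have y3 : (X ^+ 2 + X * 2 ^+ b) * Bp <= 8 * Sum by exact: fin3.
apply: (le_trans (lerD y3 (le_trans t1 y1))).
exact: fin.
Qed.

(* Heath-Brown's bound; the short case is applied at the scale where its last
   term balances the first. *)
Lemma heath_brown a : (2 ^ (10 + 2 * a) <= Z)%N ->
  qpow a <= L ^+ 32 * 2 ^+ a * (2 ^+ a * Bp + P ^+ 2 + Num.sqrt (Bp * (T * (P * S)))).
Proof.
move=> aZ; set V := T * (P * S); set W := Num.sqrt _.
have T0 : 0 <= T by have := T1; lra.
have V0 : 0 <= V by rewrite !mulr_ge0.
have W0 : 0 <= W by exact: sqrtr_ge0.
have W2 : W ^+ 2 = Bp * V by rewrite sqr_sqrtr// mulr_ge0.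
(* Scales at which the bound has only two terms: the third term of [qpow_short] is absorbed by the
   first, or [qpow_long] applies. The least such scale from [a] on is used, and [qpow_mono] carries
   the bound back to [a]. *)
pose ok k := (a <= k)%N && ((V <= 2 ^+ (2 * k) * Bp) || (2 ^+ 20 * T ^+ 2 <= 2 ^+ (3 * k))).
have ex : exists k, ok k.
  exists (a + gJ G)%N; rewrite /ok leq_addr /=; apply/orP; right.
  apply: (@le_trans _ _ (Z%:R ^+ 3)).
    rewrite (exprS _ 2); apply: ler_pM.
    - by rewrite exprn_ge0.
    - by rewrite exprn_ge0.
    - apply: le_trans TZ; have : 1 <= (T + 1) ^+ 4 by rewrite exprn_ege1//; have := T0; lra.
      by move: (_ ^+ 4) => x; lra.
    - by rewrite ler_sqr ?nnegrE.
  apply: (le_trans (gJ_ge G)); apply: ler_weXn2l; first by rewrite ler1n.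
  by clear; lia.
case: (ex_minnP ex) => a' /andP[aa' ok'] amin.
have X0 : 0 < 2 ^+ a :> R by rewrite exprn_gt0.
have X'0 : 0 < 2 ^+ a' :> R by rewrite exprn_gt0.
have stop : a' = a \/ exists2 k, a' = k.+1 & ~~ ok k /\ (a <= k)%N.
  have [->|ne] := eqVneq a' a; first by left.
  right; exists a'.-1; first by rewrite prednK//; clear -aa' ne; lia.
  split; last by clear -aa' ne; lia.
  by apply/negP => /amin; clear -aa' ne; lia.
(* If the scale had to be raised, its predecessor [k] fails both conditions. One failure gives
   [(2^k Bp)^2 < Bp V], so that [2^a' Bp <= 2 W]; the other keeps [2^k] below [2^7 T], hence within
   the height [Z]. *)
have [a'Z XU] : (2 ^ (10 + 2 * a') <= Z)%N /\ 2 ^+ a' * Bp <= 2 ^+ a * Bp + 2 * W.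
  case: stop => [->|[k a'E [nok ak]]].
    by split=> //; rewrite lerDl mulr_ge0.
  move: nok; rewrite /ok ak /= negb_or -!ltNge => /andP[k1 k2]; split.
    have kT : 2 ^+ k <= 2 ^+ 7 * T.
      rewrite leNgt; apply/negP => kT.
      have : (2 ^+ 7 * T) ^+ 3 <= 2 ^+ (3 * k).
        rewrite mulnC exprM lerXn2r ?nnegrE ?exprn_ge0// ?(ltW kT)//.
        by rewrite mulr_ge0 ?exprn_ge0.
      rewrite exprMn -exprM (exprS T 2) => k3.
      have : T ^+ 2 <= T * T ^+ 2 by rewrite ler_peMl ?sqr_ge0.
      have : 0 < T ^+ 2 by rewrite exprn_gt0//; have := T1; lra.
      by move: (T * T ^+ 2) (T ^+ 2) k3 k2 => y x k3 k2; lra.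
    rewrite -(ler_nat R) natrX.
    have -> : (10 + 2 * a' = 12 + k * 2)%N by rewrite a'E; clear; lia.
    rewrite exprD exprM; apply: le_trans TZ.
    apply: (@le_trans _ _ (2 ^+ 12 * (2 ^+ 7 * T) ^+ 2)).
      by rewrite ler_pM2l ?exprn_gt0// ler_sqr ?nnegrE ?exprn_ge0 ?mulr_ge0.
    have TT : T ^+ 2 <= (T + 1) ^+ 4.
      apply: (@le_trans _ _ ((T + 1) ^+ 2)).
        by rewrite ler_sqr ?nnegrE//; have := T0; lra.
      by apply: ler_weXn2l => //; have := T0; lra.
    by have := sqr_ge0 T; rewrite exprMn; move: (T ^+ 2) (_ ^+ 4) TT => x y; lra.
  have kW : 2 ^+ k * Bp <= W.
    rewrite -ler_sqr ?nnegrE ?mulr_ge0 ?exprn_ge0//.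
    rewrite W2 mulnC exprM in k1 *.
    have -> : (2 ^+ k * Bp) ^+ 2 = Bp * (2 ^+ k ^+ 2 * Bp) by ring.
    by rewrite ler_wpM2l// ltW.
  have := mulr_ge0 (exprn_ge0 a (ler0n R 2)) U0.
  by rewrite a'E exprS; lra.
have q' : qpow a' <= L ^+ 30 * (2 * (2 ^+ a' ^+ 2 * Bp) + 2 ^+ a' * P ^+ 2).
  have XU0 : 0 <= 2 ^+ a' ^+ 2 * Bp by rewrite mulr_ge0 ?sqr_ge0.
  have XP0 : 0 <= 2 ^+ a' * P ^+ 2 by rewrite mulr_ge0 ?sqr_ge0// ltW.
  have [lg|sh] := leP (2 ^+ 20 * T ^+ 2) (2 ^+ (3 * a')).
    apply: (le_trans (qpow_long a'Z lg)); apply: ler_pM; rewrite ?exprn_ge0 ?(ltW L0)//.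
    - by apply: ler_weXn2l.
    - lra.
  apply: (le_trans (qpow_short a'Z sh)); rewrite ler_pM2l//.
  case/orP: ok' => [|lg]; last by have := le_lt_trans lg sh; rewrite ltxx.
  rewrite mulnC exprM /V; lra.
have a'Z2 : (2 ^ a' <= Z)%N.
  by apply: leq_trans a'Z; rewrite leq_exp2l//; clear; lia.
have := qpow_mono aa' a'Z2.
have -> : 2 ^+ (a' - a) = 2 ^+ a' / 2 ^+ a :> R.
  by rewrite -[in RHS](subnK aa') exprD mulfK// expf_neq0.
rewrite mulrAC ler_pdivrMr// mulrC => qm.
rewrite -(ler_pM2r X'0); apply: (le_trans qm).
apply: (@le_trans _ _ (L * (L ^+ 30 * (2 * (2 ^+ a' ^+ 2 * Bp) + 2 ^+ a' * P ^+ 2)) * 2 ^+ a)).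
  by rewrite ler_pM2r// ler_pM2l.
have -> : L * (L ^+ 30 * (2 * (2 ^+ a' ^+ 2 * Bp) + 2 ^+ a' * P ^+ 2)) * 2 ^+ a =
  L ^+ 31 * (2 ^+ a * 2 ^+ a') * (2 * (2 ^+ a' * Bp) + P ^+ 2) by ring.
have -> : L ^+ 32 * 2 ^+ a * (2 ^+ a * Bp + P ^+ 2 + W) * 2 ^+ a' =
  L ^+ 31 * (2 ^+ a * 2 ^+ a') * (L * (2 ^+ a * Bp + P ^+ 2 + W)) by ring.
rewrite ler_pM2l; last by rewrite !mulr_gt0.
have s0 : 0 <= 2 ^+ a * Bp + P ^+ 2 + W by rewrite !addr_ge0 ?mulr_ge0 ?sqr_ge0 ?exprn_ge0.
have L4 : 4 <= L by apply: le_trans (gL_ge G); lra.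
apply: le_trans (ler_wpM2r s0 L4).
have := mulr_ge0 (exprn_ge0 a (ler0n R 2)) U0; have := sqr_ge0 P.
lra.
Qed.

End HeathBrown.

(** * The additive energy *)

Section Pairs.
Variables (R : realType) (G : grid R).
Notation h := (gh G).
Notation Z := (gZ G).
Notation L := (gL G).
Notation H := (gH G).
Notation lamG := (lam G).
Variables (I : finType) (tau : I -> R) (T : R).
Hypotheses (tauB : multiplicity_le tau 2) (tauT : forall i, 0 <= tau i <= T).
Hypotheses (T1 : 1 <= T) (TZ : tall Z (2 * T)).
Notation P := (#|I|%:R : R).

Let L1 : 1 <= L. Proof. exact: gL_ge1. Qed.
Let L0 : 0 < L. Proof. exact: gL_gt0. Qed.
Let Lpow k : 0 < L ^+ k. Proof. by rewrite exprn_gt0. Qed.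

Let T4Z : 2 * (T + 1) <= Z%:R.
Proof.
apply: le_trans TZ; have t1 : 1 <= 2 * T + 1 by have := T1; lra.
apply: (@le_trans _ _ (2 ^+ 80 * (2 * T + 1))).
  have : 0 <= 2 ^+ 80 - 2 ^+ 2 :> R by rewrite subr_ge0; apply: ler_weXn2l => //; rewrite ler1n.
  have := T1; nra.
by rewrite ler_pM2l ?exprn_gt0// -[leLHS]expr1; apply: ler_weXn2l.
Qed.

Lemma card_le_T : P <= 2 * (T + 1).
Proof.
have T0 : 0 <= T by have := T1; lra.
have /andP[t1 t2] := truncn_itv T0.
have : (#|[set i | (0 <= tau i < 0 + (Num.truncn T).+1%:R)%R]| <=
  (Num.truncn T).+1 * 2)%N by exact: card_window.
have -> : [set i | (0 <= tau i < 0 + (Num.truncn T).+1%:R)%R] = [set: I].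
  apply/setP => i; rewrite !inE add0r; have /andP[-> i2] := tauT i.
  by rewrite (le_lt_trans i2).
rewrite cardsT -(ler_nat R) natrM -natr1; move: t1; lra.
Qed.

Definition pbin (u : I * I) : int := Num.floor (tau u.1 - tau u.2).

Definition bin_size (u : I * I) : nat := #|[set v | pbin v == pbin u]|.

(* The number of quadruples with approximately equal differences. *)
Definition energy : R := \sum_(u : I * I) (bin_size u)%:R.

Definition bin_level u : nat := trunc_log 2 (bin_size u).

Lemma energy_ge0 : 0 <= energy.
Proof. by apply: sumr_ge0 => u _; exact: ler0n. Qed.

Lemma bin_size_gt0 u : (0 < bin_size u)%N.
Proof. by rewrite /bin_size card_gt0; apply/set0Pn; exists u; rewrite inE. Qed.

Lemma bin_level_itv u : (2 ^ bin_level u <= bin_size u < 2 ^ (bin_level u).+1)%N.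
Proof. by apply: trunc_log_bounds; rewrite ?bin_size_gt0. Qed.

Lemma bin_size_eq u v : pbin u = pbin v -> bin_size u = bin_size v.
Proof. by rewrite /bin_size => ->. Qed.

Lemma pbin_itv u : (pbin u)%:~R <= tau u.1 - tau u.2 < (pbin u)%:~R + 1.
Proof. by have := floor_itv (tau u.1 - tau u.2); rewrite intrD. Qed.

(** For fixed [i] the points [tau j] of a bin lie in a unit interval that is open on the left.
    Starting at the smallest of them turns it into a window of the form used in
    [multiplicity_le]. *)
Lemma bin_row_le i (z : int) : (#|[set j | pbin (i, j) == z]| <= 2)%N.
Proof.
have [no|[j0]] := set_0Vmem [set j | pbin (i, j) == z]; first by rewrite no cards0.
rewrite inE => pj0.
case: (@arg_minP _ R I j0 (fun j => pbin (i, j) == z) tau pj0) => j1 pj1 jmin.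
apply: leq_trans (tauB (tau j1)); apply: subset_leq_card.
apply/fintype.subsetP => j; rewrite !inE => pj; rewrite (jmin j pj) /=.
have := pbin_itv (i, j); have := pbin_itv (i, j1); rewrite (eqP pj) (eqP pj1) /=.
move=> /andP[a1 a2] /andP[b1 b2]; lra.
Qed.

Lemma bin_size_le u : (bin_size u <= 2 * #|I|)%N.
Proof.
rewrite /bin_size -sum1dep_card.
rewrite -(pair_big_dep predT (fun i j => pbin (i, j) == pbin u) (fun _ _ => 1%N)) /=.
apply: (@leq_trans (\sum_(i : I) 2)%N); last by rewrite sum_nat_const mulnC.
by apply: leq_sum => i _; rewrite sum1dep_card bin_row_le.
Qed.

Lemma energy_le : energy <= 2 * P ^+ 3.
Proof.
apply: (@le_trans _ _ (\sum_(u : I * I) 2 * P)).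
  by apply: ler_sum => u _; rewrite -natrM ler_nat bin_size_le.
rewrite sumr_const card_prod -[leLHS]mulr_natl natrM; lra.
Qed.

Lemma bin_level_lt u : (bin_level u < (gJ G).+1)%N.
Proof.
have /andP[s1 _] := bin_level_itv u.
have P0 : 0 <= P by [].
rewrite ltnS -(@leq_exp2l 2)// -(ler_nat R) natrX.
apply: (@le_trans _ _ (bin_size u)%:R); first by rewrite -natrX ler_nat.
rewrite [leRHS]natrX; apply: le_trans (gJ_ge G).
apply: (@le_trans _ _ (2 * P)).
  by rewrite -natrM ler_nat bin_size_le.
have Z2 := gZ_ge2 G.
apply: (@le_trans _ _ (2 * Z%:R)).
  by rewrite ler_pM2l// (le_trans card_le_T).
apply: (@le_trans _ _ (Z%:R ^+ 2)).
  by rewrite expr2 ler_pM2r; lra.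
by apply: ler_weXn2l => //; exact: gZ_ge1.
Qed.

(** The pairs of one level form a type so that their differences can serve as a family of points of
    their own, with known multiplicity; the earlier results apply to this family. *)
Definition level_pairs (b : nat) : finType := {u : I * I | u \in [set v | bin_level v == b]}.

Definition pdiff (u : I * I) : R := tau u.1 - tau u.2 + T.

Definition level_diff b (u : level_pairs b) : R := pdiff (val u).

Lemma pdiff_itv u : 0 <= pdiff u <= 2 * T.
Proof.
have /andP[i1 i2] := tauT u.1; have /andP[j1 j2] := tauT u.2.
by rewrite /pdiff; apply/andP; split; lra.
Qed.

Lemma card_bin_lt (z : int) b :
  (#|[set u : level_pairs b | pbin (val u) == z]| <= 2 ^ b.+1)%N.
Proof.
have [->|[u]] := set_0Vmem [set u : level_pairs b | pbin (val u) == z].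
  by rewrite cards0.
rewrite inE => /eqP uz.
have ub : bin_level (val u) = b by have := valP u; rewrite inE => /eqP.
have /andP[_ /ltnW s2] := bin_level_itv (val u); rewrite ub in s2.
apply: leq_trans s2; rewrite /bin_size -(card_imset _ val_inj).
apply: subset_leq_card; apply/fintype.subsetP => v /imsetP[w].
by rewrite !inE => /eqP wz ->; rewrite wz uz.
Qed.

(** A unit window meets at most two consecutive bins, each with fewer than [2^(b + 1)] pairs of this
    level. *)
Lemma level_multiplicity b : multiplicity_le (@level_diff b) (2 ^ (b + 2)).
Proof.
move=> x; set z := Num.floor (x - T).
apply: (@leq_trans (#|[set u : level_pairs b | pbin (val u) == z]| +
   #|[set u : level_pairs b | pbin (val u) == (z + 1)%R]|)%N); last first.
  rewrite addn2 expnS mul2n -addnn.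
  by apply: leq_add; exact: card_bin_lt.
rewrite (leq_trans _ (leq_card_setU _ _))// subset_leq_card//.
apply/fintype.subsetP => u; rewrite !inE /level_diff /pdiff => /andP[x1 x2].
have /andP[z1 z2] := floor_itv (x - T); rewrite -/z intrD in z1 z2.
have [zl|zl] := ltP (tau (val u).1 - tau (val u).2) (z%:~R + 1).
  by apply/orP; left; rewrite /pbin floor_eq intrD; apply/andP; split; lra.
by apply/orP; right; rewrite /pbin floor_eq !intrD; apply/andP; split; lra.
Qed.

Lemma card_level b : #|level_pairs b| = #|[set v | bin_level v == b]|.
Proof. by rewrite card_sig; apply: eq_card => u; rewrite !inE. Qed.

Lemma level_energy b : 2 ^+ b * #|level_pairs b|%:R <= energy.
Proof.
rewrite card_level -sum1dep_card natr_sum mulr_sumr big_mkcond /=.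
apply: ler_sum => u _; case: ifP => [/eqP <-|_]; last exact: ler0n.
by have /andP[s1 _] := bin_level_itv u; rewrite mulr1 -natrX ler_nat.
Qed.

(** A bin lies entirely in one level, since the level depends only on the bin size. This gives the
    condition [B <= 4 P] of Heath-Brown's bound for the family of pairs. *)
Lemma level_card_ge b : (0 < #|level_pairs b|)%N -> (2 ^ b <= #|level_pairs b|)%N.
Proof.
rewrite card_level card_gt0 => /set0Pn[u]; rewrite inE => /eqP ub.
have /andP[s1 _] := bin_level_itv u; rewrite ub in s1.
apply: (leq_trans s1); rewrite /bin_size; apply: subset_leq_card.
apply/fintype.subsetP => v; rewrite !inE => /eqP /bin_size_eq e.
by rewrite /bin_level e -ub.
Qed.

Lemma level_card_le b : #|level_pairs b|%:R <= P ^+ 2.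
Proof.
by rewrite card_level -natrX ler_nat (leq_trans (max_card _))// card_prod expnS expn1.
Qed.

Definition pair_coef (a : I -> R[i]) (u : I * I) : R[i] := a u.1 * (a u.2)^J.

Lemma pair_coef_le a A : (forall i, cmod (a i) <= A) ->
  forall u, cmod (pair_coef a u) <= A ^+ 2.
Proof. by move=> aA u; rewrite cmodM cmodJ expr2 ler_pM ?cmod_ge0. Qed.

(** [|S|^2] is itself an exponential sum over differences of points. The translation by [T], which
    makes these differences nonnegative, costs only a unimodular factor. *)
Lemma expsum_quartic a y :
  cmod (expsum tau a y) ^+ 4 = cmod (expsum pdiff (pair_coef a) y) ^+ 2.
Proof.
have -> : expsum pdiff (pair_coef a) y =
    cis (T * y) * (cmod (expsum tau a y) ^+ 2)%:C.
  rewrite cmod_sum_sqr mulr_sumr /expsum.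
  rewrite -(pair_big predT predT (fun i j => pair_coef a (i, j) * cis (pdiff (i, j) * y))) /=.
  apply: eq_bigr => i _; rewrite mulr_sumr; apply: eq_bigr => j _.
  rewrite /pdiff /pair_coef /= !mulrDl !cisD mulNr cisN conjCM; ring.
rewrite cmodM cmod_cis mul1r cmod_real ger0_norm ?sqr_ge0//.
by rewrite -exprM.
Qed.

Lemma level_split (a : I * I -> R[i]) y :
  cmod (expsum pdiff a y) ^+ 2 <=
  L * \sum_(b < (gJ G).+1) cmod (expsum (@level_diff b) (fun u => a (val u)) y) ^+ 2.
Proof.
have -> : expsum pdiff a y =
    \sum_(b < (gJ G).+1) expsum (@level_diff b) (fun u => a (val u)) y.
  rewrite /expsum (partition_big (fun u => Ordinal (bin_level_lt u)) predT)//=.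
  apply: eq_bigr => b _.
  rewrite -(big_sub [set v | bin_level v == b] (fun u => a u * cis (pdiff u * y))).
  by apply: eq_bigl => u; rewrite inE.
apply: (le_trans (cmod_sum_sqr_le _ _)).
rewrite ler_wpM2r//; first by apply: sumr_ge0 => b _; exact: sqr_ge0.
have -> : size (index_enum 'I_(gJ G).+1) = (gJ G).+1.
  by rewrite -[RHS]card_ord cardT enumT.
exact: gJ_le.
Qed.

(** The fourth power is a square for the family of pairs. On a level the mean value theorem gives
    multiplicity times cardinality, that is [2^(b + 2)] times the number of pairs, which is at most
    four times the energy. *)
Lemma energy_gridnorm a A : (forall i, cmod (a i) <= A) ->
  gridnorm G (fun y => cmod (expsum tau a y) ^+ 4) <= L ^+ 4 * A ^+ 4 * energy.
Proof.
move=> aA; have h0 := gh_gt0 G.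
pose J := (gJ G).+1.
have E0 := energy_ge0.
have A40 : 0 <= A ^+ 4 by rewrite (exprM _ 2 2) sqr_ge0.
have lev (b : 'I_J) : gridnorm G (fun y => cmod (expsum (@level_diff b)
    (fun u => pair_coef a (val u)) y) ^+ 2) <= L ^+ 2 * (A ^+ 4 * energy).
  have TZ2 : 2 * T <= Z%:R by have := T4Z; lra.
  apply: (le_trans (gridnorm_sqr (@level_multiplicity b)
    (fun u => pdiff_itv (val u)) TZ2 (fun u => pair_coef_le aA (val u)))).
  have -> : 54 * L * (2 ^ (b + 2))%:R * (A ^+ 2 ^+ 2 * #|level_pairs b|%:R) =
    (216 * L) * (A ^+ 4 * (2 ^+ b * #|level_pairs b|%:R)).
    by rewrite natrX exprD; ring.
  apply: ler_pM.
  - exact: (mulr_ge0 (ler0n R 216) (ltW L0)).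
  - by rewrite (mulr_ge0 A40)// mulr_ge0// exprn_ge0.
  - by rewrite expr2 ler_pM2r//; apply: le_trans (gL_ge G); lra.
  - by rewrite ler_wpM2l// level_energy.
apply: (@le_trans _ _ (L * \sum_(b < J) gridnorm G (fun y => cmod (expsum (@level_diff b)
    (fun u => pair_coef a (val u)) y) ^+ 2))).
  rewrite /gridnorm -mulr_sumr mulrCA ler_pM2l// exchange_big /= mulr_sumr.
  apply: ler_sum => d _; rewrite expsum_quartic; exact: level_split.
have s1 : \sum_(b < J) gridnorm G (fun y => cmod (expsum (@level_diff b)
    (fun u => pair_coef a (val u)) y) ^+ 2) <= L * (L ^+ 2 * (A ^+ 4 * energy)).
  apply: (@le_trans _ _ (\sum_(b < J) L ^+ 2 * (A ^+ 4 * energy))).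
    by apply: ler_sum => b _; exact: lev.
  rewrite sumr_const card_ord -[leLHS]mulr_natl ler_wpM2r ?gJ_le//.
  by apply: mulr_ge0; [exact: ltW|exact: mulr_ge0].
apply: (le_trans (ler_wpM2l (ltW L0) s1)).
by rewrite le_eqVlt; apply/orP; left; apply/eqP; ring.
Qed.

Definition W4 : R := Num.sqrt (energy * (T * (P ^+ 2 * Num.sqrt energy))).

(** Heath-Brown's bound for the differences of one level, with [B P] replaced by the energy. An
    empty level is treated apart, because [B <= 4 P] fails for it. *)
Lemma level_heath_brown b a : (2 ^ (10 + 2 * a) <= Z)%N ->
  qsum G (@level_diff b) (index_iota 1 (2 ^ a)) <=
  L ^+ 33 * (2 ^+ a * (2 ^+ a * energy + P ^+ 4 + W4)).
Proof.
move=> aZ; have E0 := energy_ge0.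
have W0 : 0 <= W4 by exact: sqrtr_ge0.
have X0 : 0 < 2 ^+ a :> R by rewrite exprn_gt0.
have [c0|cpos] := posnP #|level_pairs b|.
  have -> : qsum G (@level_diff b) (index_iota 1 (2 ^ a)) = 0.
    rewrite /qsum big1// => m _; rewrite big1// => n _.
    rewrite /expsum1 big1 ?cmod0 ?expr0n// => u _.
    by have := card0_eq c0 u; rewrite inE.
  by rewrite mulr_ge0 ?mulr_ge0 ?addr_ge0 ?mulr_ge0 ?exprn_ge0 ?(ltW L0).
have B4 : (2 ^ (b + 2))%:R <= 4 * #|level_pairs b|%:R :> R.
  by rewrite -natrM ler_nat addn2 !expnS mulnA leq_mul2l level_card_ge.
have T2 : 1 <= 2 * T by have := T1; lra.
apply: (le_trans (heath_brown (@level_multiplicity b) (fun u => pdiff_itv (val u))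
   T2 TZ B4 aZ)).
set p := #|level_pairs b|%:R in B4 *.
have p0 : 0 <= p by exact: ler0n.
have e4 : (2 ^ (b + 2))%:R * p <= 4 * energy.
  have := level_energy b; rewrite -/p natrX exprD; lra.
set Bp := _ * p in e4 *; have Bp0 : 0 <= Bp by rewrite mulr_ge0.
have p2 : p <= P ^+ 2 by exact: level_card_le.
have p4 : p ^+ 2 <= P ^+ 4.
  by rewrite (exprM _ 2 2) ler_sqr ?nnegrE ?sqr_ge0.
have s4 : Num.sqrt Bp <= 2 * Num.sqrt energy.
  have -> : 2 * Num.sqrt energy = Num.sqrt (4 * energy).
    rewrite sqrtrM//; congr (_ * _).
    by rewrite -[4](_ : 2 ^+ 2 = _) ?sqrtr_sqr ?normr_nat//; ring.
  by rewrite ler_wsqrtr.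
have sw : Num.sqrt (Bp * (2 * T * (p * Num.sqrt Bp))) <= 4 * W4.
  have -> : 4 * W4 = Num.sqrt (16 * (energy * (T * (P ^+ 2 * Num.sqrt energy)))).
    rewrite [RHS]sqrtrM//; congr (_ * _).
    by rewrite -[16](_ : 4 ^+ 2 = _) ?sqrtr_sqr ?normr_nat//; ring.
  apply: ler_wsqrtr.
  have T0 : 0 <= T by have := T1; lra.
  have -> : 16 * (energy * (T * (P ^+ 2 * Num.sqrt energy))) =
     (4 * energy) * (2 * T * (P ^+ 2 * (2 * Num.sqrt energy))) by ring.
  apply: ler_pM => //.
    by rewrite !mulr_ge0 ?sqrtr_ge0.
  rewrite ler_wpM2l ?mulr_ge0//.
  by apply: ler_pM; rewrite ?sqrtr_ge0.
rewrite [leRHS](_ : _ = L ^+ 32 * 2 ^+ a * (L * (2 ^+ a * energy + P ^+ 4 + W4))); last ring.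
rewrite ler_pM2l ?mulr_gt0//.
have s0 : 0 <= 2 ^+ a * energy + P ^+ 4 + W4.
  by rewrite !addr_ge0 ?mulr_ge0 ?exprn_ge0 ?(ltW X0).
have L4 : 4 <= L by apply: le_trans (gL_ge G); lra.
apply: le_trans (ler_wpM2r s0 L4).
have : 2 ^+ a * Bp <= 2 ^+ a * (4 * energy) by rewrite ler_pM2l.
have : 0 <= P ^+ 4 by rewrite exprn_ge0.
lra.
Qed.

Lemma pairs_heath_brown a : (2 ^ (10 + 2 * a) <= Z)%N ->
  qsum G pdiff (index_iota 1 (2 ^ a)) <=
  L ^+ 35 * (2 ^+ a * (2 ^+ a * energy + P ^+ 4 + W4)).
Proof.
move=> aZ; set J := (gJ G).+1.
apply: (@le_trans _ _ (L * \sum_(b < J) qsum G (@level_diff b) (index_iota 1 (2 ^ a)))).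
  rewrite /qsum [X in L * X]exchange_big /= mulr_sumr; apply: ler_sum => m _.
  rewrite [X in L * X]exchange_big /= mulr_sumr; apply: ler_sum => n _.
  have := level_split (fun=> 1) (lamG m - lamG n); rewrite -expsum1E.
  move/le_trans; apply; rewrite ler_pM2l//; apply: ler_sum => b _.
  by rewrite -expsum1E.
set X := (X in L ^+ 35 * X).
have X0 : 0 <= X.
  by rewrite mulr_ge0 ?addr_ge0 ?mulr_ge0 ?exprn_ge0 ?energy_ge0 ?sqrtr_ge0.
apply: (@le_trans _ _ (L * \sum_(b < J) L ^+ 33 * X)).
  by rewrite ler_pM2l//; apply: ler_sum => b _; exact: level_heath_brown.
rewrite sumr_const card_ord -[X in L * X]mulr_natl.
have -> : L ^+ 35 * X = L * (L * (L ^+ 33 * X)) by ring.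
by rewrite ler_pM2l// ler_wpM2r ?gJ_le// mulr_ge0// ltW.
Qed.

Lemma energy_quartic a (z A : R) k : (forall i, cmod (a i) <= A) ->
  (2 ^ (10 + 2 * k) <= Z)%N ->
  \sum_(m <- index_iota 1 (2 ^ k)) \sum_(m' <- index_iota 1 (2 ^ k))
    cmod (expsum tau a (lamG m - lamG m' + z)) ^+ 4 <=
  A ^+ 4 * (L ^+ 35 * (2 ^+ k * (2 ^+ k * energy + P ^+ 4 + W4))).
Proof.
move=> aA kZ.
have A40 : 0 <= A ^+ 4 by rewrite (exprM _ 2 2) sqr_ge0.
apply: le_trans (ler_wpM2l A40 (pairs_heath_brown kZ)).
have := @positivity_le R _ pdiff nat (index_iota 1 (2 ^ k)) lamG (fun=> 1)
    (pair_coef a) (A ^+ 2) 1 z (pair_coef_le aA).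
rewrite ler01 lexx => /(_ (fun=> isT)).
have -> : A ^+ 2 ^+ 2 * 1 ^+ 2 = A ^+ 4 by ring.
apply: le_trans.
apply: ler_sum => m _; apply: ler_sum => n _.
by rewrite !mul1r expsum_quartic.
Qed.

End Pairs.

Section DualSquare.
Variables (R : realType) (I : finType) (t : I -> R) (ns : seq nat).

Lemma dual_square (mu : nat -> R) (a : nat -> R[i]) (A : R) :
  (forall n, cmod (a n) <= A) ->
  \sum_i cmod (\sum_(n <- ns) a n * cis (t i * mu n)) ^+ 2 <=
  A ^+ 2 * \sum_(m <- ns) \sum_(n <- ns) cmod (expsum1 t (mu m - mu n)).
Proof.
move=> aA; set S := \sum_i _.
have S0 : 0 <= S by apply: sumr_ge0 => i _; exact: sqr_ge0.
have SE : S%:C = \sum_(m <- ns) \sum_(n <- ns) a m * (a n)^J * expsum1 t (mu m - mu n).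
  rewrite /S realC_sum; under eq_bigr => i _ do rewrite cmod_sum_sqr.
  rewrite exchange_big /=; apply: eq_bigr => m _.
  rewrite exchange_big /=; apply: eq_bigr => n _.
  rewrite /expsum1 mulr_sumr; apply: eq_bigr => i _.
  by rewrite conjCM mulrBr cisB; ring.
rewrite -(ger0_norm S0) -cmod_real SE (le_trans (cmod_sum _ _ _))// mulr_sumr.
apply: ler_sum => m _; rewrite (le_trans (cmod_sum _ _ _))// mulr_sumr.
apply: ler_sum => n _; rewrite !cmodM cmodJ ler_wpM2r ?cmod_ge0//.
by rewrite expr2 ler_pM ?cmod_ge0.
Qed.

End DualSquare.

Section CubeSums.
Variables (R : realType).

Lemma sum_cube_holder (T : Type) (s : seq T) (x : T -> R) :
  (\sum_(u <- s) x u ^+ 3) ^+ 2 <= (\sum_(u <- s) x u ^+ 2) * \sum_(u <- s) x u ^+ 4.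
Proof.
have := sum_mul_sqr_le s x (fun u => x u ^+ 2).
rewrite (eq_bigr (fun u => x u ^+ 3)); last by move=> u _; rewrite -exprS.
by under [in X in _ <= _ * X -> _]eq_bigr => u _ do rewrite -exprM.
Qed.

Lemma le_sqrt_mul (x y z : R) : 0 <= y -> 0 <= z -> x ^+ 2 <= y ^+ 2 * z ->
  x <= y * Num.sqrt z.
Proof.
move=> y0 z0 xyz; have [x0|/ltW x0] := leP 0 x; last first.
  by rewrite (le_trans x0)// mulr_ge0// sqrtr_ge0.
by rewrite -ler_sqr ?nnegrE ?mulr_ge0 ?sqrtr_ge0// exprMn sqr_sqrtr.
Qed.

End CubeSums.

(** * The energy in terms of cubic sums, and their reflection *)

Section EnergyBound.
Variables (R : realType) (G : grid R).
Notation h := (gh G).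
Notation Z := (gZ G).
Notation L := (gL G).
Notation H := (gH G).
Notation lamG := (lam G).
Variables (I : finType) (tau : I -> R) (T : R).
Hypotheses (tauB : multiplicity_le tau 2) (tauT : forall i, 0 <= tau i <= T).
Hypotheses (T1 : 1 <= T) (TZ : tall Z (2 * T)).
Notation P := (#|I|%:R : R).
Notation E := (energy tau).
Variables (N M : nat).
Hypotheses (N0 : (0 < N)%N) (M0 : (0 < M)%N) (NMZ : room 10 (N * M) Z).
Hypothesis TNM : T <= N%:R * M%:R.

Let L1 : 1 <= L. Proof. exact: gL_ge1. Qed.
Let L0 : 0 < L. Proof. exact: gL_gt0. Qed.
Let Lpow k : 0 < L ^+ k. Proof. by rewrite exprn_gt0. Qed.
Let NR : 0 < N%:R :> R. Proof. by rewrite ltr0n. Qed.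

Section CubeBound.
Variables (q : nat) (kap : I -> nat).
Hypotheses (q0 : (0 < q)%N) (tauq : forall i, tau i = (kap i)%:R / (2 * q%:R)).
Variables (ns : seq nat) (c : nat -> R[i]) (A V : R).
Hypotheses (nsu : uniq ns) (nsb : {subset ns <= box N}).
Hypotheses (cA : forall n, cmod (c n) <= A) (V0 : 0 <= V).

Definition dsum t : R[i] := \sum_(n <- ns) c n * cis (t * lamG n).

Hypothesis DV : forall i, V <= cmod (dsum (tau i)).

Let qR : 0 < q%:R :> R. Proof. by rewrite ltr0n. Qed.
Let A0 : 0 <= A. Proof. exact: le_trans (cmod_ge0 _) (cA 0). Qed.

Let fr n : R := lamG n - lamG N.

Lemma box_freq n : n \in box N -> `|lamG n - lamG N| <= 2.
Proof.
move=> nb; have /andP[n1 n2] := box_bounds nb.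
have nZ := boxZ N0 M0 NMZ nb.
have NZ : (0 < N <= Z)%N.
  by rewrite N0 (leq_trans _ NMZ)// (leq_trans (leq_pmulr _ M0))// leq_pmull// expn_gt0.
have c1 := lam_close nZ; have c2 := lam_close NZ.
have e1 : eps G * 2 <= 1 / 100.
  have : eps G * 200 <= 1.
    apply: eps_small; apply: (@le_trans _ _ Z%:R); first by have := gZ_ge2 G; lra.
    by rewrite -[leLHS]expr1; apply: ler_weXn2l => //; exact: gZ_ge1.
  lra.
have nR : 0 < n%:R :> R by rewrite ltr0n (leq_trans N0).
have ln4 : ln 4 <= 9 / 5 :> R.
  rewrite -[leRHS]expRK ler_ln ?posrE ?expR_gt0//.
  have e : 1 + 9 / 20 <= expR (9 / 20) :> R by apply: expR_ge1Dx.
  have -> : 9 / 5 = 4%:R * (9 / 20) :> R by field.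
  rewrite expRM_natl; apply: (@le_trans _ _ ((1 + 9 / 20) ^+ 4)); first lra.
  by rewrite lerXn2r ?nnegrE ?expR_ge0//; lra.
have l1 : ln (N%:R : R) <= ln n%:R by rewrite ler_ln ?posrE// ler_nat.
have l2 : ln (n%:R : R) <= ln N%:R + 9 / 5.
  have n4 : ln (n%:R : R) <= ln (4 * N%:R).
    by rewrite ler_ln ?posrE ?mulr_gt0// -natrM ler_nat ltnW.
  by rewrite lnM ?posrE// in n4; lra.
move: c1 c2; rewrite !ler_norml => /andP[a1 a2] /andP[b1 b2].
by apply/andP; split; lra.
Qed.

(** Averages over shifts up to [1 / 2] in [t]. Measured from [lam N] the frequencies [fr n] are at
    most [2] in modulus, so the phases stay below [1] and the average is at least [1 / 2];
    [coef_avg] divides it out, which makes [dsum] an exact average of [dsum_avg]. *)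
Definition shift_avg n : R[i] :=
  (q%:R^-1)%:C * \sum_(s < q) cis (fr n * (s%:R / (2 * q%:R))).

Lemma shift_avg_ge_half n : n \in box N -> 2^-1 <= cmod (shift_avg n).
Proof.
move=> nb; rewrite cmodM cmod_real ger0_norm ?invr_ge0// ler_pdivlMl//.
rewrite (le_trans _ (Re_le_cmod _))// raddf_sum /=.
apply: (@le_trans _ _ (\sum_(s < q) (2^-1 : R))).
  by rewrite sumr_const card_ord -[leRHS]mulr_natl.
apply: ler_sum => s _; apply: cos_ge_half.
have sq : `|s%:R / (2 * q%:R)| <= 2^-1 :> R.
  rewrite ger0_norm ?divr_ge0 ?mulr_ge0// ler_pdivrMr ?mulr_gt0// mulrA mulVf// mul1r.
  by rewrite ler_nat ltnW.
have := box_freq nb; rewrite normrM -/(fr n); have := normr_ge0 (fr n).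
have := normr_ge0 (s%:R / (2 * q%:R) : R); move: sq; nra.
Qed.

Definition coef_avg n : R[i] := if n \in box N then c n / shift_avg n else 0.

Lemma coef_avg_le n : cmod (coef_avg n) <= 2 * A.
Proof.
rewrite /coef_avg; case: ifP => nb; last by rewrite cmod0 mulr_ge0.
have hg := shift_avg_ge_half nb; have gp : 0 < cmod (shift_avg n) by lra.
rewrite cmodM cmodV ler_pdivrMr//; have := cA n; have := A0; nra.
Qed.

Definition dsum_avg t : R[i] := \sum_(n <- ns) coef_avg n * cis (t * fr n).

Lemma dsum_sqr_le t : cmod (dsum t) ^+ 2 <=
  q%:R^-1 * \sum_(s < q) cmod (dsum_avg (t + s%:R / (2 * q%:R))) ^+ 2.
Proof.
have -> : dsum t = cis (t * lamG N) * ((q%:R^-1)%:C *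
    \sum_(s < q) dsum_avg (t + s%:R / (2 * q%:R))).
  rewrite /dsum /dsum_avg exchange_big /= !mulr_sumr big_seq [RHS]big_seq.
  apply: eq_bigr => n nn; rewrite -mulr_sumr.
  under [in RHS]eq_bigr => s _ do rewrite mulrDl cisD [_ / _ * fr n]mulrC.
  rewrite -mulr_sumr.
  have gn : shift_avg n != 0.
    by rewrite -cmod_eq0 gt_eqF// (lt_le_trans _ (shift_avg_ge_half (nsb nn))).
  have -> : t * lamG n = t * lamG N + t * fr n by rewrite /fr; ring.
  rewrite cisD /coef_avg (nsb nn).
  have -> : \sum_(s < q) cis (fr n * (s%:R / (2 * q%:R))) = q%:R%:C * shift_avg n.
    by rewrite /shift_avg mulrA -realCM divff ?gt_eqF// mul1r.
  have e : (q%:R^-1)%:C * q%:R%:C = 1 :> R[i] by rewrite -realCM mulVf ?gt_eqF.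
  move: (shift_avg n) gn (_^-1)%:C q%:R%:C e => w w0 u v uv.
  have -> : cis (t * lamG N) * (u * (c n / w * (cis (t * fr n) * (v * w)))) =
    c n * (cis (t * lamG N) * cis (t * fr n)) * ((u * v) * (w / w)) by ring.
  by rewrite uv divff// !mulr1.
rewrite cmodM cmod_cis mul1r cmodM cmod_real ger0_norm ?invr_ge0// exprMn.
rewrite expr2 -mulrA ler_pM2l ?invr_gt0// ler_pdivrMl//.
apply: (le_trans (cmod_sum_sqr_le _ _)).
by have -> : size (index_enum 'I_q) = q by rewrite -[RHS]card_ord cardT enumT.
Qed.

Definition triple_diff (w : (I * I) * I) : R := tau w.2 - (tau w.1.1 - tau w.1.2).

Lemma cmod_triple th : cmod (expsum1 triple_diff th) = cmod (expsum1 tau th) ^+ 3.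
Proof.
have -> : expsum1 triple_diff th =
   expsum1 tau th * (expsum1 tau (- th) * expsum1 tau th).
  rewrite /expsum1 mulrC -(pair_big predT predT (fun u k => cis (triple_diff (u, k) * th))) /=.
  rewrite -(pair_big predT predT (fun i j => \sum_k cis (triple_diff ((i, j), k) * th))) /=.
  rewrite !mulr_suml; apply: eq_bigr => i _.
  rewrite -mulrA mulrCA mulr_suml; apply: eq_bigr => j _.
  rewrite mulrCA mulr_sumr mulr_sumr; apply: eq_bigr => k _.
  by rewrite -!cisD; congr cis; rewrite /triple_diff /=; ring.
by rewrite !cmodM cmod_expsum1N; ring.
Qed.

Lemma triple_sum_le w :
  \sum_(u : (I * I) * I) cmod (dsum_avg (triple_diff u + w)) ^+ 2 <=
  4 * A ^+ 2 * \sum_(m <- box N) \sum_(n <- box N) cmod (expsum1 tau (lamG m - lamG n)) ^+ 3.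
Proof.
have cw n : cmod (coef_avg n * cis (w * fr n)) <= 2 * A.
  by rewrite cmodM cmod_cis mulr1 coef_avg_le.
have := @dual_square R _ triple_diff ns fr _ (2 * A) cw.
under eq_bigr => u _.
  have -> : \sum_(n <- ns) coef_avg n * cis (w * fr n) * cis (triple_diff u * fr n) =
     dsum_avg (triple_diff u + w).
    apply: eq_bigr => n _.
    have -> : (triple_diff u + w) * fr n = w * fr n + triple_diff u * fr n by ring.
    by rewrite cisD mulrA.
  over.
move/le_trans; apply.
have -> : (2 * A) ^+ 2 = 4 * A ^+ 2 by ring.
rewrite ler_wpM2l ?mulr_ge0 ?sqr_ge0//.
apply: (@le_trans _ _ (\sum_(m <- ns) \sum_(n <- ns) cmod (expsum1 tau (lamG m - lamG n)) ^+ 3)).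
  apply: ler_sum => m _; apply: ler_sum => n _.
  by rewrite cmod_triple /fr (_ : _ - _ = lamG m - lamG n)//; ring.
have cube0 y : 0 <= cmod (expsum1 tau y) ^+ 3 by rewrite exprn_ge0 ?cmod_ge0.
apply: (@le_trans _ _ (\sum_(m <- ns) \sum_(n <- box N) cmod (expsum1 tau (lamG m - lamG n)) ^+ 3)).
  by apply: ler_sum => m _; apply: ler_sum_uniq_sub.
by apply: ler_sum_uniq_sub => // m; apply: sumr_ge0.
Qed.

(* [tau l] differs by less than [1] from [tau k - tau i + tau j] when the pairs
   [(i, j)] and [(k, l)] lie in one bin, so the average of [dsum_avg] near
   [tau l] is dominated by a longer average around that triple difference. *)
Lemma energy_cubes : V ^+ 2 * E <=
  40 * A ^+ 2 * \sum_(m <- box N) \sum_(n <- box N) cmod (expsum1 tau (lamG m - lamG n)) ^+ 3.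
Proof.
set Sig := \sum_(m <- box N) _.
pose F x := cmod (dsum_avg x) ^+ 2.
have F0 x : 0 <= F x by exact: sqr_ge0.
(* The displacement of [tau l] from the triple difference is a multiple of [1 / (2 q)] in [(-1, 1)],
   and the average adds up to [1 / 2]. So the offsets [sh s] with [s < 5 q], which run from [-1] to
   [3 / 2], contain every average needed. *)
pose sh (s : nat) : R := s%:R / (2 * q%:R) - 1.
pose row (u : I * I) k := \sum_(s < 5 * q) F (triple_diff (u, k) + sh s).
have row0 u k : 0 <= row u k by apply: sumr_ge0.
have one (u : I * I) k l : pbin tau (k, l) == pbin tau u ->
    V ^+ 2 <= q%:R^-1 * row u k.
  move=> kl.
  apply: (@le_trans _ _ (cmod (dsum (tau l)) ^+ 2)).
    by rewrite ler_sqr ?nnegrE ?cmod_ge0.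
  apply: (le_trans (dsum_sqr_le _)); rewrite ler_pM2l ?invr_gt0//.
  have := pbin_itv tau (k, l); have := pbin_itv tau u; rewrite (eqP kl) /=.
  move=> /andP[a1 a2] /andP[b1 b2].
  have q2 : 0 < 2 * q%:R :> R by rewrite mulr_gt0.
  have d1 : tau k - tau l - (tau u.1 - tau u.2) < 1 by lra.
  have d2 : -1 < tau k - tau l - (tau u.1 - tau u.2) by lra.
  have dE : tau k - tau l - (tau u.1 - tau u.2) = ((kap k)%:R + (kap u.2)%:R -
     ((kap l)%:R + (kap u.1)%:R)) / (2 * q%:R).
    by rewrite !tauq; field; rewrite gt_eqF.
  rewrite dE ltr_pdivrMr// mul1r in d1.
  rewrite dE ltr_pdivlMr// mulN1r in d2.
  have n1 : (kap k + kap u.2 < kap l + kap u.1 + 2 * q)%N.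
    rewrite -(ltr_nat R) natrD [ltRHS]natrD (natrD _ (kap l)) natrM; lra.
  have n2 : (kap l + kap u.1 < kap k + kap u.2 + 2 * q)%N.
    rewrite -(ltr_nat R) natrD [ltRHS]natrD (natrD _ (kap k)) natrM; lra.
  pose s0 := (kap l + kap u.1 + 2 * q - (kap k + kap u.2))%N.
  have s0q : (s0 + q <= 5 * q)%N by clear -n1 n2; rewrite /s0; lia.
  have eqF (s : nat) : F (tau l + s%:R / (2 * q%:R)) =
      F (triple_diff (u, k) + sh (s0 + s)).
    congr F; rewrite /triple_diff /sh /s0 /= !tauq natrD natrB; last by rewrite ltnW.
    rewrite (natrD _ (kap l + kap u.1)%N) natrM (natrD _ (kap l)) (natrD _ (kap k)).
    by field; rewrite gt_eqF.
  under eq_bigr => s _ do rewrite -/(F _) eqF.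
  rewrite /row -(big_mkord predT (fun s => F (triple_diff (u, k) + sh (s0 + s)))).
  rewrite -(big_mkord predT (fun s => F (triple_diff (u, k) + sh s))).
  have -> : \sum_(0 <= s < q) F (triple_diff (u, k) + sh (s0 + s)) =
      \sum_(s0 <= s < s0 + q) F (triple_diff (u, k) + sh s).
    have := big_addn 0 (s0 + q) s0 predT (fun s => F (triple_diff (u, k) + sh s)).
    by rewrite add0n addKn => ->; apply: eq_bigr => s _; rewrite addnC.
  rewrite (@big_cat_nat _ _ _ s0 0 (5 * q))//=; last by rewrite (leq_trans (leq_addr _ _) s0q).
  rewrite (@big_cat_nat _ _ _ (s0 + q) s0 (5 * q))//= ?leq_addr//.
  by rewrite addrCA lerDl addr_ge0// sumr_ge0.
(* For given [u] and [k] at most two [l] put [(k, l)] in the bin of [u]; hence the factor 2, and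
   [40 = 2 * 5 * 4] with the five half-unit ranges and the square of the bound [2 A]. *)
apply: (@le_trans _ _ (\sum_(u : I * I) \sum_k 2 * (q%:R^-1 * row u k))).
  rewrite /energy mulr_sumr; apply: ler_sum => u _.
  rewrite /bin_size -sum1dep_card natr_sum mulr_sumr.
  rewrite -(pair_big_dep predT (fun i j => pbin tau (i, j) == pbin tau u)
    (fun _ _ => V ^+ 2 * 1)) /=.
  apply: ler_sum => k _.
  apply: (@le_trans _ _ (\sum_(l | pbin tau (k, l) == pbin tau u) q%:R^-1 * row u k)).
    by apply: ler_sum => l kl; rewrite mulr1; exact: one kl.
  rewrite sumr_const -[leLHS]mulr_natl ler_wpM2r ?mulr_ge0 ?invr_ge0//.
  rewrite ler_nat; apply: leq_trans (bin_row_le tauB k (pbin tau u)).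
  by apply: subset_leq_card; apply/fintype.subsetP => l; rewrite !inE.
have -> : \sum_(u : I * I) \sum_k 2 * (q%:R^-1 * row u k) =
    2 * q%:R^-1 * \sum_(s < 5 * q) \sum_(w : (I * I) * I) F (triple_diff w + sh s).
  rewrite [in RHS]exchange_big /= mulr_sumr.
  rewrite -(pair_big predT predT (fun u k => 2 / q%:R * \sum_(s < 5 * q) F (triple_diff (u, k) + sh s))) /=.
  by apply: eq_bigr => u _; apply: eq_bigr => k _; rewrite mulrA.
apply: (@le_trans _ _ (2 * q%:R^-1 * \sum_(s < 5 * q) 4 * A ^+ 2 * Sig)).
  rewrite ler_pM2l ?divr_gt0//; apply: ler_sum => s _; exact: triple_sum_le.
rewrite sumr_const card_ord -[X in _ * X]mulr_natl natrM le_eqVlt; apply/orP; left.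
by apply/eqP; field; rewrite gt_eqF.
Qed.

End CubeBound.

Hypothesis P1 : 1 <= P.

Definition W2 : R := Num.sqrt (P * (T * (P * Num.sqrt P))).

Let P0 : 0 <= P. Proof. by []. Qed.
Let E0 : 0 <= E. Proof. exact: energy_ge0. Qed.
Let W20 : 0 <= W2. Proof. exact: sqrtr_ge0. Qed.
Let W40 : 0 <= W4 tau T. Proof. exact: sqrtr_ge0. Qed.
Let T0 : 0 <= T. Proof. by have := T1; lra. Qed.
Let TZ2 : tall Z T.
Proof.
rewrite /tall; apply: le_trans TZ; rewrite ler_pM2l ?exprn_gt0// lerXn2r ?nnegrE//; have := T0; lra.
Qed.

Lemma qpow_two a : (2 ^ (10 + 2 * a) <= Z)%N ->
  qpow G tau a <= L ^+ 33 * 2 ^+ a * (2 ^+ a * P + P ^+ 2 + W2).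
Proof.
move=> aZ; have X0 : 0 < 2 ^+ a :> R by rewrite exprn_gt0.
have B4 : 2%:R <= 4 * P by have := P1; lra.
apply: (le_trans (heath_brown tauB tauT T1 TZ2 B4 aZ)).
have s4 : Num.sqrt (2%:R * P) <= 2 * Num.sqrt P.
  rewrite sqrtrM// ler_wpM2r ?sqrtr_ge0//.
  rewrite -ler_sqr ?nnegrE ?sqrtr_ge0// sqr_sqrtr//; lra.
have sw : Num.sqrt (2%:R * P * (T * (P * Num.sqrt (2%:R * P)))) <= 2 * W2.
  have -> : 2 * W2 = Num.sqrt (2 ^+ 2 * (P * (T * (P * Num.sqrt P)))).
    by rewrite sqrtrM ?sqr_ge0// sqrtr_sqr normr_nat.
  apply: ler_wsqrtr.
  have -> : 2 ^+ 2 * (P * (T * (P * Num.sqrt P))) =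
    2%:R * P * (T * (P * (2 * Num.sqrt P))) by ring.
  by rewrite ler_wpM2l ?mulr_ge0// ler_wpM2l// ler_wpM2l.
rewrite [leRHS](_ : _ = L ^+ 32 * 2 ^+ a * (L * (2 ^+ a * P + P ^+ 2 + W2))); last ring.
rewrite ler_pM2l ?mulr_gt0//.
have s0 : 0 <= 2 ^+ a * P + P ^+ 2 + W2.
  by rewrite addr_ge0// addr_ge0 ?sqr_ge0// mulr_ge0// ltW.
have L4 : 4 <= L by apply: le_trans (gL_ge G); lra.
apply: le_trans (ler_wpM2r s0 L4).
have : 0 <= 2 ^+ a * P by rewrite mulr_ge0// ltW.
have := sqr_ge0 P; have := W20; lra.
Qed.

Hypotheses (MP : M%:R <= P) (MZ : room 28 (M ^ 2) Z).

Definition energy_gam : R := Num.sqrt ((P ^+ 2 + W2) * (P ^+ 4 + W4 tau T)).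

(** Cubes are interpolated between squares, bounded by [qpow_two], and fourth powers, bounded by
    [energy_quartic]. Since [M <= P], the terms that grow with the length are absorbed by [P^2] and,
    with [E <= 2 P^3], by [P^4]. *)
Lemma energy_gam_bound (b : I -> R[i]) a z : (forall i, cmod (b i) <= 4) ->
  (2 ^ a <= M)%N ->
  \sum_(m <- blockM a) \sum_(m' <- blockM a)
    cmod (expsum tau b (lamG m' - lamG m + z)) ^+ 3 <= L ^+ 38 * energy_gam * 2 ^+ a.
Proof.
move=> b4 aM; set k := (9 + a)%N.
have kZ : (2 ^ (10 + 2 * k) <= Z)%N.
  apply: leq_trans MZ; rewrite (_ : (10 + 2 * k = 28 + a * 2)%N); last by rewrite /k; clear; lia.
  by rewrite expnD expnM leq_mul2l leq_sqr aM orbT.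
have X0 : 0 < 2 ^+ k :> R by rewrite exprn_gt0.
have XM : 2 ^+ k <= 2 ^+ 9 * P.
  by rewrite exprD ler_pM2l ?exprn_gt0//; apply: le_trans MP; rewrite -natrX ler_nat.
pose s := [seq (m, n) | m <- blockM a, n <- blockM a].
pose x (u : nat * nat) := cmod (expsum tau b (lamG u.2 - lamG u.1 + z)).
have eqs p : \sum_(m <- blockM a) \sum_(m' <- blockM a)
    cmod (expsum tau b (lamG m' - lamG m + z)) ^+ p = \sum_(u <- s) x u ^+ p.
  by rewrite big_allpairs_dep.
rewrite eqs.
have x2 : \sum_(u <- s) x u ^+ 2 <= L ^+ 36 * (2 ^+ k * (P ^+ 2 + W2)).
  rewrite -eqs exchange_big /=.
  have := @positivity_le R I tau nat (blockM a) lamG (fun=> 1) b 4 1 z b4.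
  rewrite ler01 lexx => /(_ (fun=> isT)) pl.
  apply: (@le_trans _ _ (4 ^+ 2 * 1 ^+ 2 * qpow G tau k)).
    apply: le_trans pl; apply: ler_sum => m _; apply: ler_sum => n _.
    by rewrite !mul1r.
  rewrite expr1n mulr1; apply: (le_trans (ler_wpM2l (sqr_ge0 _) (qpow_two kZ))).
  have XP : 2 ^+ k * P + P ^+ 2 + W2 <= 2 ^+ 10 * (P ^+ 2 + W2).
    have : 2 ^+ k * P <= 2 ^+ 9 * P * P by rewrite ler_wpM2r.
    have := sqr_ge0 P; have := W20; lra.
  have s0 : 0 <= P ^+ 2 + W2 by rewrite addr_ge0 ?sqr_ge0.
  have s1 : L ^+ 33 * 2 ^+ k * (2 ^+ k * P + P ^+ 2 + W2) <=
      L ^+ 33 * 2 ^+ k * (2 ^+ 10 * (P ^+ 2 + W2)).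
    by rewrite ler_pM2l// mulr_gt0.
  apply: (le_trans (ler_wpM2l (sqr_ge0 _) s1)).
  have -> : 4 ^+ 2 * (L ^+ 33 * 2 ^+ k * (2 ^+ 10 * (P ^+ 2 + W2))) =
    2 ^+ 14 * (L ^+ 33 * (2 ^+ k * (P ^+ 2 + W2))) by ring.
  have -> : L ^+ 36 = L ^+ 3 * L ^+ 33 by rewrite -exprD.
  rewrite -[leRHS]mulrA ler_wpM2r//.
    by rewrite mulr_ge0 ?(ltW (Lpow _))// mulr_ge0// ltW.
  by apply: (@L_pow_le _ _ _ 2) => //; apply: ler_weXn2l => //; rewrite ler1n.
have x4 : \sum_(u <- s) x u ^+ 4 <= L ^+ 38 * (2 ^+ k * (P ^+ 4 + W4 tau T)).
  rewrite -eqs exchange_big /=.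
  apply: (le_trans (energy_quartic tauB tauT T1 TZ z b4 kZ)).
  have XE : 2 ^+ k * E + P ^+ 4 + W4 tau T <= 2 ^+ 11 * (P ^+ 4 + W4 tau T).
    have : 2 ^+ k * E <= (2 ^+ 9 * P) * (2 * P ^+ 3).
      by apply: ler_pM => //; exact: energy_le.
    have -> : (2 ^+ 9 * P) * (2 * P ^+ 3) = 2 ^+ 10 * P ^+ 4 by ring.
    have : 0 <= P ^+ 4 by rewrite exprn_ge0.
    have := W40; lra.
  have s0 : 0 <= P ^+ 4 + W4 tau T by rewrite addr_ge0 ?exprn_ge0.
  have s1 : L ^+ 35 * (2 ^+ k * (2 ^+ k * E + P ^+ 4 + W4 tau T)) <=
      L ^+ 35 * (2 ^+ k * (2 ^+ 11 * (P ^+ 4 + W4 tau T))).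
    by rewrite ler_pM2l// ler_pM2l.
  have s2 := ler_wpM2l (exprn_ge0 4 (ler0n R 4)) s1.
  apply: (le_trans s2).
  have -> : 4 ^+ 4 * (L ^+ 35 * (2 ^+ k * (2 ^+ 11 * (P ^+ 4 + W4 tau T)))) =
    2 ^+ 19 * (L ^+ 35 * (2 ^+ k * (P ^+ 4 + W4 tau T))) by ring.
  have -> : L ^+ 38 = L ^+ 3 * L ^+ 35 by rewrite -exprD.
  rewrite -[leRHS]mulrA ler_wpM2r//.
    by rewrite mulr_ge0 ?(ltW (Lpow _))// mulr_ge0// ltW.
  by apply: (@L_pow_le _ _ _ 2) => //; apply: ler_weXn2l => //; rewrite ler1n.
have c20 : 0 <= P ^+ 2 + W2 by rewrite addr_ge0 ?sqr_ge0.
have c40 : 0 <= P ^+ 4 + W4 tau T by rewrite addr_ge0 ?exprn_ge0.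
have cs : (\sum_(u <- s) x u ^+ 3) ^+ 2 <=
    (L ^+ 37 * 2 ^+ k) ^+ 2 * ((P ^+ 2 + W2) * (P ^+ 4 + W4 tau T)).
  apply: (le_trans (sum_cube_holder _ _)).
  apply: (le_trans (ler_pM _ _ x2 x4)).
  - by apply: sumr_ge0 => u _; exact: sqr_ge0.
  - by apply: sumr_ge0 => u _; rewrite exprn_ge0 ?cmod_ge0.
  - by rewrite le_eqVlt; apply/orP; left; apply/eqP; ring.
have := le_sqrt_mul (mulr_ge0 (ltW (Lpow 37)) (ltW X0)) (mulr_ge0 c20 c40) cs.
rewrite -/energy_gam => /le_trans; apply.
have -> : L ^+ 37 * 2 ^+ k * energy_gam = 2 ^+ 9 * (L ^+ 37 * energy_gam * 2 ^+ a).
  by rewrite /k exprD; ring.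
have -> : L ^+ 38 * energy_gam * 2 ^+ a = L * (L ^+ 37 * energy_gam * 2 ^+ a) by ring.
rewrite ler_wpM2r//; last by apply: le_trans (gL_ge G); lra.
by rewrite !mulr_ge0 ?exprn_ge0 ?sqrtr_ge0 ?(ltW L0).
Qed.

Lemma cube_gridnorm (b : I -> R[i]) : (forall i, cmod (b i) <= 4) ->
  gridnorm G (fun y => cmod (expsum tau b y) ^+ 3) <= L ^+ 4 * Num.sqrt (P * E).
Proof.
move=> b4; have h0 := gh_gt0 G.
apply: le_sqrt_mul; rewrite ?exprn_ge0 ?(ltW L0) ?mulr_ge0//.
have TZ1 : T <= Z%:R.
  apply: le_trans TZ2; have : T <= (T + 1) ^+ 4.
    apply: (@le_trans _ _ (T + 1)); first by lra.
    by rewrite -[leLHS]expr1; apply: ler_weXn2l => //; have := T0; lra.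
  have : 1 <= 2 ^+ 80 :> R by rewrite exprn_ege1// ler1n.
  have := T0; nra.
have g2 := gridnorm_sqr tauB tauT TZ1 b4.
have g4 := energy_gridnorm tauB tauT T1 TZ b4.
apply: (@le_trans _ _ (gridnorm G (fun y => cmod (expsum tau b y) ^+ 2) *
   gridnorm G (fun y => cmod (expsum tau b y) ^+ 4))).
  rewrite /gridnorm exprMn [leRHS]mulrACA -expr2 ler_wpM2l ?sqr_ge0//.
  exact: sum_cube_holder.
apply: (le_trans (ler_pM _ _ g2 g4)).
- by apply: gridnorm_ge0 => y; exact: sqr_ge0.
- by apply: gridnorm_ge0 => y; rewrite exprn_ge0 ?cmod_ge0.
have -> : 54 * L * 2%:R * (4 ^+ 2 * P) * (L ^+ 4 * 4 ^+ 4 * E) =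
  (54 * 2 ^+ 13) * (L ^+ 5 * (P * E)) by ring.
have -> : L ^+ 4 ^+ 2 * (P * E) = L ^+ 3 * (L ^+ 5 * (P * E)) by ring.
rewrite ler_wpM2r//.
  by rewrite mulr_ge0 ?(ltW (Lpow _))// mulr_ge0.
apply: (@L_pow_le _ _ _ 2) => //.
by apply: (@le_trans _ _ (2 ^+ 6 * 2 ^+ 13)); [lra|rewrite -exprD; apply: ler_weXn2l => //; rewrite ler1n].
Qed.

(** Reflection applied to the cube: the zero frequencies are measured by [cube_gridnorm], the
    reflected sums by [energy_gam_bound]. *)
Lemma cubes_bound :
  \sum_(m <- box N) \sum_(n <- box N) cmod (expsum1 tau (lamG m - lamG n)) ^+ 3 <=
  L ^+ 44 * ((N%:R ^+ 2 + N%:R * M%:R) * Num.sqrt (P * E) + N%:R * energy_gam).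
Proof.
have b4 i : cmod (bb G tau N M i) <= 4 by exact: (bb_le4 tauT N0 M0 NMZ TNM).
pose g y := cmod (expsum tau (bb G tau N M) y) ^+ 3.
have g0 y : 0 <= g y by rewrite exprn_ge0 ?cmod_ge0.
have gm0 : 0 <= energy_gam by exact: sqrtr_ge0.
have Gam0 : 0 <= L ^+ 38 * energy_gam by rewrite mulr_ge0// ltW.
have rf := @reflection R G _ _ N0 M0 NMZ g _ g0 Gam0
  (fun a z => @energy_gam_bound _ a z b4)
  (fun y => cmod (expsum1 tau y) ^+ 3)
  (average_cube tauT N0 M0 NMZ TNM).
apply: (le_trans rf).
have -> : L ^+ 44 = L ^+ 6 * L ^+ 38 by rewrite -exprD.
rewrite -[leRHS]mulrA ler_pM2l// mulrDr [X in _ + X]mulrCA lerD2r [leRHS]mulrCA.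
rewrite ler_wpM2l ?addr_ge0 ?sqr_ge0 ?mulr_ge0//.
apply: (le_trans (cube_gridnorm b4)); rewrite ler_wpM2r ?sqrtr_ge0//.
by apply: ler_weXn2l.
Qed.

End EnergyBound.

(** * The trace dichotomy *)

Section QuadraticForms.
Variables (R : realType) (G : grid R).
Notation h := (gh G).
Notation Z := (gZ G).
Notation L := (gL G).
Notation H := (gH G).
Notation lamG := (lam G).
Variables (I : finType) (tau : I -> R) (T : R).
Hypotheses (tauB : multiplicity_le tau 2) (tauT : forall i, 0 <= tau i <= T).
Hypothesis TZ : T <= Z%:R.
Variables (N M : nat).
Hypotheses (N0 : (0 < N)%N) (M0 : (0 < M)%N) (NMZ : room 10 (N * M) Z).
Hypothesis TNM : T <= N%:R * M%:R.
Notation y := (yy G N).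

Let L1 : 1 <= L. Proof. exact: gL_ge1. Qed.
Let L0 : 0 < L. Proof. exact: gL_gt0. Qed.
Let h0 : 0 < h. Proof. exact: gh_gt0. Qed.
Let NR : 0 < N%:R :> R. Proof. by rewrite ltr0n. Qed.
Let MR : 0 < M%:R :> R. Proof. by rewrite ltr0n. Qed.

Implicit Types u v : I -> R[i].

Definition nrm2 u : R := \sum_i cmod (u i) ^+ 2.

Lemma nrm2_ge0 u : 0 <= nrm2 u.
Proof. by apply: sumr_ge0 => i _; exact: sqr_ge0. Qed.

Definition hat u (k : nat) : R[i] := expsum tau u (y k).

Definition omg (k : nat) : R := fejer M (xx G N k).

Definition psi (k : nat) : R := omg k - 1.

Lemma omg_ge0 k : 0 <= omg k. Proof. exact: fejer_ge0. Qed.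

Lemma hat_mean_value u : h * \sum_(k < H) cmod (hat u k) ^+ 2 <= 108 * L * nrm2 u.
Proof.
have HH : (H <= 2 * H)%N by rewrite leq_pmull.
have := mean_value tauB tauT TZ u (lamG N - h * (gG G)%:R) HH.
by move/le_trans; apply; rewrite ler_wpM2r ?nrm2_ge0//; lra.
Qed.

(* [Kp] is the kernel of the quadratic form with weights [psi]; the remaining
   weight [1] contributes a nearly diagonal form by [hat_mean_value]. *)
Definition Kp (i j : I) : R[i] :=
  h%:C * \sum_(k < H) (psi k)%:C * cis ((tau i - tau j) * y k).

Definition act u (j : I) : R[i] := \sum_i u i * Kp i j.

(** The trace of the square of the Hermitian matrix [Kp], which is its squared Hilbert-Schmidt
    norm. *)
Definition T2 : R := \sum_i \sum_j cmod (Kp i j) ^+ 2.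

(** The trace of the cube of [Kp], written as the sum of its quadratic form over the rows of the
    matrix. *)
Definition T3 : R := \sum_i h * \sum_(k < H) psi k * cmod (hat (Kp i) k) ^+ 2.

Lemma psi_form u v :
  h%:C * \sum_(k < H) (psi k)%:C * (hat u k * (hat v k)^J) =
  \sum_j act u j * (v j)^J.
Proof.
rewrite mulr_sumr /act.
under [RHS]eq_bigr => j _.
  rewrite mulr_suml; under eq_bigr => i _ do rewrite /Kp mulr_sumr mulr_sumr mulr_suml.
  rewrite exchange_big /=; over.
rewrite [RHS]exchange_big /=; apply: eq_bigr => k _.
rewrite /hat /expsum conjC_sum mulrA mulr_sumr.
rewrite mulr_sumr; apply: eq_bigr => j _.
rewrite mulr_suml mulr_sumr; apply: eq_bigr => i _.
by rewrite conjCM mulrBl cisB; ring.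
Qed.

Lemma psi_form_real u :
  (h * \sum_(k < H) psi k * cmod (hat u k) ^+ 2)%:C = \sum_j act u j * (u j)^J.
Proof.
rewrite -psi_form realCM realC_sum; congr (_ * _); apply: eq_bigr => k _.
by rewrite realCM cmod_sqr.
Qed.

Lemma act_le u j : cmod (act u j) ^+ 2 <= nrm2 u * \sum_i cmod (Kp i j) ^+ 2.
Proof. exact: cmod_sum_mul_sqr_le. Qed.

Lemma nrm2_act u : nrm2 (act u) <= nrm2 u * T2.
Proof.
rewrite /T2 exchange_big /= mulr_sumr; apply: ler_sum => j _; exact: act_le.
Qed.

Lemma psi_form_sqr u :
  (h * \sum_(k < H) psi k * cmod (hat u k) ^+ 2) ^+ 2 <= nrm2 (act u) * nrm2 u.
Proof.
rewrite -real_normK ?num_real// -cmod_real psi_form_real.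
apply: (le_trans (cmod_sum_mul_sqr_le _ _ _)).
by rewrite le_eqVlt; apply/orP; left; apply/eqP; congr (_ * _);
  apply: eq_bigr => j _; rewrite cmodJ.
Qed.

Definition omg_form u : R := h * \sum_(k < H) omg k * cmod (hat u k) ^+ 2.

Lemma omg_form_ge0 u : 0 <= omg_form u.
Proof.
by rewrite mulr_ge0 ?(ltW h0)// sumr_ge0// => k _; rewrite mulr_ge0 ?omg_ge0 ?sqr_ge0.
Qed.

Lemma omg_form_split u : omg_form u =
  h * \sum_(k < H) cmod (hat u k) ^+ 2 + h * \sum_(k < H) psi k * cmod (hat u k) ^+ 2.
Proof.
rewrite -mulrDr -big_split /=; congr (_ * _); apply: eq_bigr => k _.
by rewrite /psi mulrBl mul1r addrC subrK.
Qed.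

(** [hat (act u)] is a combination of the functions [hat (Kp i)] with coefficients [u i];
    Cauchy-Schwarz leaves the form summed over the rows. Weight [1] gives [T2] by the mean value
    theorem, and weight [psi] gives [T3]. *)
Lemma omg_form_act u : omg_form (act u) <= nrm2 u * (108 * L * T2 + T3).
Proof.
have hatE k : hat (act u) k = \sum_i u i * hat (Kp i) k.
  rewrite /hat /expsum /act; under eq_bigr => j _ do rewrite mulr_suml.
  rewrite exchange_big /=; apply: eq_bigr => i _.
  by rewrite mulr_sumr; apply: eq_bigr => j _; rewrite mulrA.
apply: (@le_trans _ _ (nrm2 u * \sum_i omg_form (Kp i))).
  rewrite /omg_form -mulr_sumr mulrCA ler_pM2l//.
  rewrite exchange_big /= mulr_sumr; apply: ler_sum => k _.
  rewrite -mulr_sumr [leRHS]mulrCA ler_wpM2l ?omg_ge0// hatE.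
  exact: cmod_sum_mul_sqr_le.
rewrite ler_wpM2l ?nrm2_ge0//.
under eq_bigr => i _ do rewrite omg_form_split.
rewrite big_split /=; apply: lerD => //.
rewrite /T2 mulr_sumr; apply: ler_sum => i _; exact: hat_mean_value.
Qed.

Lemma omg_cauchy u v :
  cmod (h%:C * \sum_(k < H) (omg k)%:C * (hat u k * (hat v k)^J)) ^+ 2 <=
  omg_form u * omg_form v.
Proof.
rewrite cmodM cmod_real (gtr0_norm h0) exprMn.
have -> : \sum_(k < H) (omg k)%:C * (hat u k * (hat v k)^J) =
   \sum_(k < H) ((Num.sqrt (omg k))%:C * hat u k) * ((Num.sqrt (omg k))%:C * (hat v k)^J).
  apply: eq_bigr => k _; rewrite -{1}(sqr_sqrtr (omg_ge0 k)) expr2 realCM; ring.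
have := cmod_sum_mul_sqr_le (index_enum 'I_H)
  (fun k => (Num.sqrt (omg k))%:C * hat u k) (fun k => (Num.sqrt (omg k))%:C * (hat v k)^J).
move/(ler_wpM2l (sqr_ge0 h))/le_trans; apply.
rewrite /omg_form expr2 mulrACA le_eqVlt; apply/orP; left; apply/eqP.
congr (_ * _ * (_ * _)); apply: eq_bigr => k _;
  rewrite cmodM exprMn cmod_real ger0_norm ?sqrtr_ge0// sqr_sqrtr ?omg_ge0//.
by rewrite cmodJ.
Qed.

(* With [w := act u], the weighted form satisfies [<u, K w> = |w|^2 + O(L |u| |w|)];
   Cauchy-Schwarz for the nonnegative form [K] then turns [<u, K u>] large into
   [<w, K w>] large. *)
Lemma form_dichotomy u (mu : R) : 0 < nrm2 u -> 216 * L <= mu ->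
  mu * nrm2 u <= h * \sum_(k < H) psi k * cmod (hat u k) ^+ 2 ->
  mu ^+ 2 <= T2 /\ mu ^+ 3 <= 6 * (108 * L * T2 + T3).
Proof.
move=> U0 muL mupsi; set U := nrm2 u in U0 mupsi *.
set w := act u; set W := nrm2 w.
have mu0 : 0 < mu.
  by apply: lt_le_trans muL; apply: mulr_gt0; [rewrite ltr0n|exact: L0].
have psq : (mu * U) ^+ 2 <= W * U.
  have mU0 : 0 <= mu * U by apply: mulr_ge0; exact: ltW.
  apply: le_trans (psi_form_sqr u); rewrite ler_sqr ?nnegrE//; exact: le_trans mupsi.
have muW : mu ^+ 2 * U <= W.
  by rewrite -(ler_pM2r U0); move: psq; rewrite exprMn; congr (_ <= _); ring.
have muT : mu ^+ 2 <= T2.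
  by rewrite -(ler_pM2l U0) mulrC (le_trans muW)// nrm2_act.
split=> //.
set a := Num.sqrt U; set b := Num.sqrt W.
have a0 : 0 < a by rewrite sqrtr_gt0.
have b0 : 0 <= b by exact: sqrtr_ge0.
have aE : a ^+ 2 = U by rewrite sqr_sqrtr// ltW.
have bE : b ^+ 2 = W by rewrite sqr_sqrtr// nrm2_ge0.
have mab : mu * a <= b.
  by rewrite -ler_sqr ?nnegrE// ?mulr_ge0 ?(ltW mu0) ?(ltW a0)// exprMn aE bE.
have K0 : cmod (h%:C * \sum_(k < H) hat u k * (hat w k)^J) <= 108 * L * (a * b).
  rewrite -ler_sqr ?nnegrE ?cmod_ge0 ?mulr_ge0 ?(ltW L0) ?(ltW a0)//.
  rewrite cmodM cmod_real (gtr0_norm h0) exprMn.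
  have := cmod_sum_mul_sqr_le (index_enum 'I_H) (fun k => hat u k) (fun k => (hat w k)^J).
  move/(ler_wpM2l (sqr_ge0 h))/le_trans; apply.
  rewrite expr2 mulrACA.
  have e1 := hat_mean_value u; have e2 := hat_mean_value w.
  under [X in _ * (_ * X)]eq_bigr => k _ do rewrite cmodJ.
  apply: (le_trans (ler_pM _ _ e1 e2)).
  - by rewrite mulr_ge0 ?(ltW h0)// sumr_ge0// => k _; exact: sqr_ge0.
  - by rewrite mulr_ge0 ?(ltW h0)// sumr_ge0// => k _; exact: sqr_ge0.
  by rewrite -/U -/W -aE -bE le_eqVlt; apply/orP; left; apply/eqP; ring.
(* The constant [216] in the hypothesis on [mu] is chosen for this: the contribution of weight [1]
   is at most half of [|w|^2]. *)
have K0' : 108 * L * (a * b) <= W / 2.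
  rewrite -bE.
  have : 216 * L * a <= b by apply: le_trans mab; rewrite ler_pM2r.
  have := b0; nra.
have Kuw : W / 2 <= cmod (h%:C * \sum_(k < H) (omg k)%:C * (hat u k * (hat w k)^J)).
  have -> : h%:C * \sum_(k < H) (omg k)%:C * (hat u k * (hat w k)^J) =
     W%:C + h%:C * \sum_(k < H) hat u k * (hat w k)^J.
    have -> : W%:C = \sum_j act u j * (w j)^J.
      by rewrite /W /nrm2 realC_sum; apply: eq_bigr => j _; rewrite cmod_sqr.
    rewrite -psi_form -mulrDr -big_split /=; congr (_ * _); apply: eq_bigr => k _.
    by rewrite /psi rmorphB rmorph1; ring.
  set z := h%:C * _ in K0 *.
  have := cmodB (W%:C + z) z; rewrite addrK cmod_real ger0_norm ?nrm2_ge0//.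
  by have := le_trans K0 K0'; lra.
have Kuu : omg_form u <= 3 / 2 * (a * b).
  rewrite omg_form_split.
  have e1 := hat_mean_value u; rewrite -/U -aE in e1.
  have e2 : h * \sum_(k < H) psi k * cmod (hat u k) ^+ 2 <= a * b.
    apply: (le_trans (ler_norm _)); rewrite -ler_sqr ?nnegrE ?mulr_ge0 ?(ltW a0)//.
    rewrite real_normK ?num_real//; apply: (le_trans (psi_form_sqr u)).
    by rewrite exprMn aE bE mulrC.
  have e3 : 108 * L * a ^+ 2 <= a * b / 2.
    have : 216 * L * a <= b by apply: le_trans mab; rewrite ler_pM2r.
    have := a0; nra.
  lra.
have key : (W / 2) ^+ 2 <= 3 / 2 * (a * b) * (U * (108 * L * T2 + T3)).
  apply: (@le_trans _ _ (cmod (h%:C * \sum_(k < H) (omg k)%:C * (hat u k * (hat w k)^J)) ^+ 2)).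
    by rewrite ler_sqr ?nnegrE ?cmod_ge0 ?divr_ge0 ?nrm2_ge0.
  apply: (le_trans (omg_cauchy u w)); apply: ler_pM; rewrite ?omg_form_ge0//.
  exact: omg_form_act.
set X := 108 * L * T2 + T3 in key *.
have bp : 0 < b by apply: lt_le_trans mab; rewrite mulr_gt0.
have k3 : b ^+ 3 <= 6 * a ^+ 3 * X.
  rewrite -(ler_pM2r bp); move: key; rewrite -aE -bE.
  have -> : (b ^+ 2 / 2) ^+ 2 = b ^+ 3 * b / 4 by field.
  have -> : 3 / 2 * (a * b) * (a ^+ 2 * X) = 6 * a ^+ 3 * X * b / 4 by field.
  by move=> ?; lra.
have : (mu * a) ^+ 3 <= b ^+ 3.
  by rewrite lerXn2r ?nnegrE ?mulr_ge0 ?(ltW mu0) ?(ltW a0).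
rewrite exprMn => m3; have a3 : 0 < a ^+ 3 by rewrite exprn_gt0.
rewrite -(ler_pM2r a3); apply: (le_trans m3); apply: (le_trans k3).
by rewrite le_eqVlt; apply/orP; left; apply/eqP; ring.
Qed.

Section LargeValues.
Variables (ns : seq nat) (c : nat -> R[i]) (Gc V : R).
Hypotheses (nsu : uniq ns) (nsb : {subset ns <= box N}).
Hypotheses (cG : \sum_(n <- ns) cmod (c n) ^+ 2 <= Gc) (V0 : 0 <= V).
Notation J0 := (gJ0 G N M).
Hypothesis DV : forall i, V <= cmod (dsum G ns c (tau i)).

Let J0p : 0 < J0%:R :> R. Proof. by rewrite ltr0n gJ0_gt0. Qed.

(** The test vector for duality: the conjugated values of the polynomial, with the factor [gam] that
    spreads every [n] over the short range of grid points [kidx n j]. *)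
Definition smoothed i : R[i] := (dsum G ns c (tau i) * gam G tau N M i)^J.

Lemma smoothed_ge : V ^+ 2 * #|I|%:R <= 4 * nrm2 smoothed.
Proof.
rewrite /nrm2 mulr_sumr.
apply: (@le_trans _ _ (\sum_(i : I) V ^+ 2)).
  by rewrite sumr_const -[leRHS]mulr_natr.
apply: ler_sum => i _; rewrite cmodJ cmodM exprMn.
have g2 := gam_ge_half tauT N0 M0 NMZ TNM i.
have : 4^-1 <= cmod (gam G tau N M i) ^+ 2 by nra.
have : V ^+ 2 <= cmod (dsum G ns c (tau i)) ^+ 2 by rewrite ler_sqr ?nnegrE ?cmod_ge0.
have := sqr_ge0 V; nra.
Qed.

Lemma smoothedE i : (smoothed i)^J = (J0%:R^-1)%:C *
  \sum_(n <- ns) \sum_(j < J0) c n * cis (tau i * y (kidx G N n j)).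
Proof.
rewrite /smoothed conjcK /dsum mulr_suml mulr_sumr big_seq [RHS]big_seq.
apply: eq_bigr => n nn; rewrite /gam mulr_sumr mulr_sumr mulr_sumr.
apply: eq_bigr => j _; rewrite (yy_kidx N0 M0 NMZ) ?nsb// mulrDr cisD; ring.
Qed.

(** The squared norm of the test vector is a sum over [n] of [c n] times averages of its transform.
    Cauchy-Schwarz separates the coefficients, and [box_to_grid] turns the remaining sum over
    integers into the form with Fejér weights. *)
Lemma smoothed_form : nrm2 smoothed ^+ 2 <= 2 ^+ 10 * Gc * N%:R * omg_form smoothed.
Proof.
pose X k := hat smoothed k.
have Gc0 : 0 <= Gc by apply: le_trans cG; apply: sumr_ge0 => n _; exact: sqr_ge0.
have nE : (nrm2 smoothed)%:C = (J0%:R^-1)%:C *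
    \sum_(n <- ns) \sum_(j < J0) c n * X (kidx G N n j).
  rewrite /nrm2 realC_sum.
  under eq_bigr => i _.
    rewrite cmod_sqr smoothedE mulrCA mulr_sumr.
    under eq_bigr => n _ do rewrite mulr_sumr.
    over.
  rewrite -mulr_sumr exchange_big /=; congr (_ * _); apply: eq_bigr => n _.
  rewrite exchange_big /=; apply: eq_bigr => j _.
  rewrite /X /hat /expsum mulr_sumr; apply: eq_bigr => i _; ring.
have -> : nrm2 smoothed ^+ 2 = cmod (nrm2 smoothed)%:C ^+ 2.
  by rewrite cmod_real ger0_norm ?nrm2_ge0.
rewrite nE cmodM cmod_real ger0_norm ?invr_ge0// exprMn.
pose s := [seq (n, j) | n <- ns, j <- index_enum 'I_J0].
have cs : cmod (\sum_(n <- ns) \sum_(j < J0) c n * X (kidx G N n j)) ^+ 2 <=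
   (J0%:R * Gc) * \sum_(n <- ns) \sum_(j < J0) cmod (X (kidx G N n j)) ^+ 2.
  have := @cmod_sum_mul_sqr_le R _ s (fun p : nat * 'I_J0 => c p.1)
    (fun p : nat * 'I_J0 => X (kidx G N p.1 p.2)).
  rewrite !big_allpairs_dep /=; move/le_trans; apply.
  rewrite ler_wpM2r//.
    by apply: sumr_ge0 => n _; apply: sumr_ge0 => j _; exact: sqr_ge0.
  under eq_bigr => n _ do rewrite sumr_const card_ord -[_ *+ J0]mulr_natl.
  by rewrite -mulr_sumr ler_pM2l.
have F0 k : 0 <= cmod (X k) ^+ 2 by exact: sqr_ge0.
have sub : \sum_(n <- ns) \sum_(j < J0) cmod (X (kidx G N n j)) ^+ 2 <=
   4 / M%:R * \sum_(k < H) omg k * cmod (X k) ^+ 2.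
  apply: le_trans (box_to_grid N0 M0 NMZ F0); apply: ler_sum_uniq_sub => // n.
  exact: sumr_ge0.
have J2 : 0 < J0%:R^-1 ^+ 2 :> R by rewrite exprn_gt0// invr_gt0.
apply: (@le_trans _ _ (J0%:R^-1 ^+ 2 * ((J0%:R * Gc) * (4 / M%:R * \sum_(k < H) omg k * cmod (X k) ^+ 2)))).
  rewrite ler_pM2l//; apply: (le_trans cs); rewrite ler_wpM2l// mulr_ge0//.
have /andP[j1 _] := gJ0_itv N0 M0 NMZ.
have avE : avw R N M / 2 = (2 ^+ 8 * (N%:R * M%:R))^-1.
  by rewrite /avw; field; rewrite !gt_eqF.
have inv : J0%:R^-1 <= h * (2 ^+ 8 * (N%:R * M%:R)).
  rewrite -[leLHS]mul1r ler_pdivrMr//.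
  rewrite avE -[leLHS]mul1r ler_pdivrMr ?mulr_gt0 ?exprn_gt0// in j1.
  by apply: (le_trans j1); rewrite le_eqVlt; apply/orP; left; apply/eqP; ring.
rewrite /omg_form; set Sg := \sum_(k < H) _.
have Sg0 : 0 <= Sg by apply: sumr_ge0 => k _; rewrite mulr_ge0 ?omg_ge0.
have -> : J0%:R^-1 ^+ 2 * (J0%:R * Gc * (4 / M%:R * Sg)) = J0%:R^-1 * (Gc * (4 / M%:R * Sg)).
  by field; rewrite !gt_eqF.
apply: (le_trans (ler_wpM2r _ inv)).
  by rewrite mulr_ge0// mulr_ge0// divr_ge0.
by rewrite le_eqVlt; apply/orP; left; apply/eqP; field; rewrite gt_eqF.
Qed.

(** The mean value theorem for the polynomial, recovered from [smoothed_form] by the trivial bound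
    [M] for the Fejér kernel. *)
Lemma mean_value_points : V ^+ 2 * #|I|%:R <= L ^+ 3 * N%:R * M%:R * Gc.
Proof.
have sm := smoothed_ge; have sf := smoothed_form.
have U0 := nrm2_ge0 smoothed; set U := nrm2 smoothed in sm sf U0 *.
have Gc0 : 0 <= Gc by apply: le_trans cG; apply: sumr_ge0 => n _; exact: sqr_ge0.
have om : omg_form smoothed <= M%:R * (108 * L * U).
  apply: (@le_trans _ _ (M%:R * (h * \sum_(k < H) cmod (hat smoothed k) ^+ 2))).
    rewrite mulrCA ler_pM2l// mulr_sumr; apply: ler_sum => k _.
    by rewrite ler_wpM2r ?sqr_ge0// fejer_le.
  by rewrite ler_pM2l// hat_mean_value.
have NG : 0 <= 2 ^+ 10 * Gc * N%:R by rewrite !mulr_ge0 ?exprn_ge0.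
have := le_trans sf (ler_wpM2l NG om).
have [Ue|Un] := eqVneq U 0.
  move=> _; apply: (le_trans sm); rewrite Ue mulr0.
  by rewrite mulr_ge0 ?mulr_ge0 ?exprn_ge0 ?(ltW L0).
have Up : 0 < U by rewrite lt_def Un.
have -> : 2 ^+ 10 * Gc * N%:R * (M%:R * (108 * L * U)) =
  (2 ^+ 10 * 108 * (L * N%:R * M%:R * Gc)) * U by ring.
rewrite expr2 ler_pM2r// => U1; apply: (le_trans sm).
have -> : L ^+ 3 * N%:R * M%:R * Gc = L ^+ 2 * (L * N%:R * M%:R * Gc) by ring.
set X := L * _ * _ * _ in U1 *; have X0 : 0 <= X by rewrite !mulr_ge0 ?(ltW L0).
apply: (@le_trans _ _ (2 ^+ 20 * X)).
  by have := X0; have := U1; lra.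
by rewrite ler_wpM2r//; apply: (@L_pow_le _ _ _ 2).
Qed.

(** A large [V^2 P / (Gc N)] forces the form with Fejér weights to be large on [smoothed]; since
    weight [1] accounts for at most [108 L] times the squared norm, the part with weights [psi] is
    large and [form_dichotomy] applies. *)
Lemma trace_dichotomy (z : R) : 0 < z -> 0 < V -> (0 < #|I|)%N ->
  z * (2 ^+ 13 * Gc * N%:R) <= V ^+ 2 * #|I|%:R ->
  216 * L <= z -> z ^+ 2 <= T2 /\ z ^+ 3 <= 6 * (108 * L * T2 + T3).
Proof.
move=> z0 Vp Ip zV zL.
have sm := smoothed_ge; set U := nrm2 smoothed in sm *.
have Up : 0 < U.
  have : 0 < V ^+ 2 * #|I|%:R by rewrite mulr_gt0 ?exprn_gt0// ltr0n.
  lra.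
apply: (@form_dichotomy smoothed z) => //; rewrite -/U.
have sf := smoothed_form; rewrite -/U omg_form_split in sf.
have mv := hat_mean_value smoothed; rewrite -/U in mv.
have Gc0 : 0 <= Gc by apply: le_trans cG; apply: sumr_ge0 => n _; exact: sqr_ge0.
set p := h * \sum_(k < H) psi k * _ in sf *.
have c0 : 0 < 2 ^+ 10 * Gc * N%:R.
  rewrite lt_def mulr_ge0 ?mulr_ge0 ?exprn_ge0// andbT; apply/eqP => c0.
  by rewrite c0 mul0r in sf; have := exprn_gt0 2 Up; lra.
have zU : 2 * z * (2 ^+ 10 * Gc * N%:R) <= U.
  have -> : 2 * z * (2 ^+ 10 * Gc * N%:R) = z * (2 ^+ 13 * Gc * N%:R) / 4 by field.
  lra.
have e1 : 2 * z * U * (2 ^+ 10 * Gc * N%:R) <= U ^+ 2.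
  by rewrite expr2 mulrAC ler_pM2r.
have e2 : 2 * z * U * (2 ^+ 10 * Gc * N%:R) <= (108 * L * U + p) * (2 ^+ 10 * Gc * N%:R).
  apply: (le_trans e1); apply: (le_trans sf); rewrite [leRHS]mulrC ler_pM2l// lerD2r//.
have : 2 * z * U <= 108 * L * U + p by rewrite -(ler_pM2r c0).
have : 108 * L * U <= z * U by rewrite ler_pM2r//; have := L0; lra.
lra.
Qed.

End LargeValues.
End QuadraticForms.

(** * Ternary linear forms *)

Section IntegerPoints.
Variable R : realType.

Definition zi M (p : 'I_M * bool) : int := (-1) ^+ p.2 * p.1.+1%:Z.

Lemma zr_int M (p : 'I_M * bool) : zr R p = (zi p)%:~R.
Proof. by rewrite /zi intrM rmorphXn /= rmorphN1. Qed.

Lemma zi_inj M : injective (@zi M).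
Proof.
move=> [m b] [m' b'] e; have ea := congr1 absz e.
move: ea; rewrite /zi /= !abszM !abszX !absz_nat /= !exp1n !mul1n => -[mm].
move: e; rewrite /zi /= mm => e; congr pair; first exact: val_inj.
by case: b b' e => -[].
Qed.

Lemma int_window (x : R) (z z' : int) :
  x <= z%:~R < x + 1 -> x <= z'%:~R < x + 1 -> z = z'.
Proof.
move=> /andP[a1 a2] /andP[b1 b2].
have h1 : (z%:~R : R) < (z' + 1)%:~R by rewrite intrD; lra.
have h2 : (z'%:~R : R) < (z + 1)%:~R by rewrite intrD; lra.
by rewrite !ltr_int in h1 h2; move: h1 h2; lia.
Qed.

Lemma zr_multiplicity M : multiplicity_le (@zr R M) 1.
Proof.
move=> x; apply/card_le1_eqP => p p'; rewrite !inE !zr_int => hp hp'.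
by apply: zi_inj; exact: int_window hp' hp.
Qed.

Lemma count_zr M (th D : R) : 0 <= D ->
  \sum_(p : 'I_M * bool) (`|th + zr R p| <= D)%R%:R <= (Num.truncn (2 * D)).+1%:R :> R.
Proof.
move=> D0.
have -> : \sum_(p : 'I_M * bool) (`|th + zr R p| <= D)%R%:R =
    (#|[set p : 'I_M * bool | (`|th + zr R p| <= D)%R]|)%:R :> R.
  rewrite -sum1dep_card natr_sum [RHS]big_mkcond /=.
  by apply: eq_bigr => p _; case: ifP.
rewrite ler_nat; apply: (@leq_trans ((Num.truncn (2 * D)).+1 * 1)); last by rewrite muln1.
apply: leq_trans (card_window (@zr_multiplicity M) (- th - D) _).
apply: subset_leq_card; apply/fintype.subsetP => p; rewrite !inE ler_norml.
have D20 : 0 <= 2 * D by rewrite mulr_ge0.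
have /andP[_ t2] := truncn_itv D20.
by move=> /andP[h1 h2]; apply/andP; split; lra.
Qed.

(* Shifts by integers do not change the Fejér kernel, and at most one integer
   lies within [D] of [- th]. *)
Lemma count_zr_fejer M (th D : R) : 0 < D -> 8 * D <= 1 ->
  \sum_(p : 'I_M * bool) (`|th + zr R p| <= D)%R%:R <=
  4 / (Num.truncn (8 * D)^-1)%:R * fejer (Num.truncn (8 * D)^-1) th.
Proof.
move=> D0 D1; set Q := Num.truncn _.
have D8 : 0 < 8 * D by rewrite mulr_gt0.
have i0 : 0 <= (8 * D)^-1 by rewrite invr_ge0 ltW.
have Q0 : (0 < Q)%N by rewrite /Q truncn_gt0 invf_ge1.
have QR : 0 < Q%:R :> R by rewrite ltr0n.
have [/existsP[p0 hp0]|/existsPn no] := boolP [exists p : 'I_M * bool, `|th + zr R p| <= D]; last first.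
  rewrite big1 => [|p _]; last by rewrite (negbTE (no p)).
  by apply: mulr_ge0; [exact: divr_ge0|exact: fejer_ge0].
apply: (@le_trans _ _ 1).
  apply: (le_trans (count_zr M th (ltW D0))).
  have t1 : (Num.truncn (2 * D) < 1)%N.
    rewrite -(ltr_nat R); apply: (@le_lt_trans _ _ (2 * D)); last lra.
    by rewrite truncn_le mulr_ge0// ltW.
  by rewrite ltnS leqn0 in t1; rewrite (eqP t1).
rewrite -(fejer_shift Q th p0) mulrAC ler_pdivlMr// mul1r.
have := @fejer_near0 R Q (th + zr R p0) Q0 _.
have hQ : `|th + zr R p0| * (8 * Q%:R) <= 1.
  have QD : Q%:R * (8 * D) <= 1.
    by rewrite -ler_pdivlMr// mul1r /Q truncn_le.
  have : `|th + zr R p0| * (8 * Q%:R) <= D * (8 * Q%:R) by rewrite ler_pM2r// mulr_gt0.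
  lra.
move=> /(_ hQ); lra.
Qed.

End IntegerPoints.

Section ProductSieve.
Variables (R : realType) (G : grid R).
Notation h := (gh G).
Notation Z := (gZ G).
Notation L := (gL G).
Notation H := (gH G).
Notation LC := (lc (gJ G).+1).

Let h0 : 0 < h. Proof. exact: gh_gt0. Qed.
Let L1 : 1 <= L. Proof. exact: gL_ge1. Qed.
Let L0 : 0 < L. Proof. exact: gL_gt0. Qed.

(** The analogue of [grid_phase_sum] over index differences. The first ratio is
    [E = exp(- h H) >= 2^(-7)], so no scale [N] enters and the decay is in [|th|] itself. *)
Lemma vv_phase_sum (th : R) : `|th| <= Z%:R ->
  h * cmod (\sum_(d < 2 * H) ep (th * vv G d)) <= 2 ^+ 9 * LC `|th|.
Proof.
move=> thZ; set E := expR (- (h * H%:R)).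
have E1 : E <= 1 by rewrite -expR0 ler_expR oppr_le0 mulr_ge0// ltW.
have E0 : 0 < E by exact: expR_gt0.
have E128 : 1 <= E * 2 ^+ 7.
  have := expRxMexpNx_1 (h * H%:R); rewrite -/E.
  have := expR_le_128 (gH_le G); have := E0; nra.
have -> : \sum_(d < 2 * H) ep (th * vv G d) =
   \sum_(d < 2 * H) cis ((2 * pi * th * E) * expR (h * d%:R)).
  apply: eq_bigr => d _; rewrite /ep /vv /dv /E; congr cis.
  rewrite -!mulrA -expRD; congr (_ * (_ * (_ * expR _))); ring.
set al := 2 * pi * th * E.
have p2 : 2 <= pi :> R by exact: pi_ge2.
have p4 : pi <= 4 :> R by have := @pihalf_lt2 R; lra.
have absal : `|al| = 2 * pi * E * `|th|.
  by rewrite /al !normrM normr_nat (ger0_norm (pi_ge0 R)) (gtr0_norm E0); ring.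
have t0 := normr_ge0 th.
have al1 : `|th| <= 2 ^+ 5 * `|al|.
  rewrite absal; have : 4 * (E * 2 ^+ 7) <= 2 * pi * (E * 2 ^+ 7) by rewrite ler_pM2r ?mulr_gt0 ?exprn_gt0//; lra.
  move=> e1; have e2 : 1 <= 2 * pi * E * 2 ^+ 5 by lra.
  have : `|th| <= (2 * pi * E * 2 ^+ 5) * `|th| by rewrite ler_peMl.
  lra.
have al2 : `|al| <= 8 * Z%:R.
  rewrite absal; have : 2 * pi * E <= 8 * 1 by apply: ler_pM => //; [rewrite mulr_ge0 ?pi_ge0|exact: ltW|lra].
  move=> e1; rewrite mulr1 in e1; apply: ler_pM => //.
  by rewrite !mulr_ge0 ?pi_ge0// ltW.
have hn : h * (2 * H)%N%:R <= 82 / 10 by rewrite natrM; have := gH_le G; lra.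
have small : 2 * (2 * H)%N%:R * h ^+ 2 * al ^+ 2 * expR (h * (2 * H)%N%:R) <= 1.
  have ex : expR (h * (2 * H)%N%:R) <= 2 ^+ 14.
    rewrite natrM mulrCA (mulrDl 1 1) mul1r expRD.
    rewrite (_ : 2 ^+ 14 = 2 ^+ 7 * 2 ^+ 7); last by rewrite -exprD.
    by apply: ler_pM; rewrite ?expR_ge0// expR_le_128 ?gH_le.
  have al22 : al ^+ 2 <= (8 * Z%:R) ^+ 2.
    by rewrite -real_normK ?num_real// ler_sqr ?nnegrE// mulr_ge0.
  have : h * (2 ^+ 30 * Z%:R ^+ 2) <= 1.
    apply: gh_le_inv; rewrite (_ : Z%:R ^+ 10 = Z%:R ^+ 3 * Z%:R ^+ 5 * Z%:R ^+ 2); last by ring.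
    rewrite ler_wpM2r ?exprn_ge0//.
    apply: (@le_trans _ _ (Z%:R ^+ 3)).
      by rewrite (exprM _ 10 3) lerXn2r ?nnegrE ?exprn_ge0 ?gZ_ge2.
    by rewrite ler_peMr ?exprn_ge0// exprn_ege1// gZ_ge1.
  apply: le_trans.
  have -> : 2 * (2 * H)%N%:R * h ^+ 2 * al ^+ 2 * expR (h * (2 * H)%N%:R) =
     2 * (h * (2 * H)%N%:R) * h * (al ^+ 2 * expR (h * (2 * H)%N%:R)) by ring.
  have -> : h * (2 ^+ 30 * Z%:R ^+ 2) = 2 ^+ 10 * h * ((8 * Z%:R) ^+ 2 * 2 ^+ 14) by ring.
  apply: ler_pM.
  - by rewrite !mulr_ge0// ltW.
  - by rewrite mulr_ge0 ?sqr_ge0 ?expR_ge0.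
  - by rewrite ler_pM2r//; lra.
  - by apply: ler_pM; rewrite ?sqr_ge0 ?expR_ge0.
have hh : h <= 2^-1 by have := gh_le1000 G; lra.
have bd := exponential_phase_bound h0 hh small.
set S := cmod _ in bd *; have S0 : 0 <= S by exact: cmod_ge0.
have triv : h * S <= 82 / 10.
  apply: le_trans hn; rewrite ler_pM2l//.
  rewrite (le_trans (cmod_sum _ _ _))// (eq_bigr (fun=> 1)); last first.
    by move=> k _; rewrite cmod_cis.
  by rewrite sumr_const card_ord.
have hS : 0 <= h * S by rewrite mulr_ge0// ltW.
have : h * S / 2 ^+ 8 <= 2 * LC `|th|.
  apply: le_lc.
  - by rewrite divr_ge0 ?exprn_ge0.
  - apply: (le_trans thZ); apply: le_trans (gJ_ge G).
    by rewrite -[leLHS]expr1; apply: ler_weXn2l => //; exact: gZ_ge1.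
  - lra.
  - have : h * S * `|th| <= h * S * (2 ^+ 5 * `|al|) by rewrite ler_wpM2l.
    lra.
lra.
Qed.

Variables (Q M : nat).
Hypothesis QMZ : (2 * (Q * M) <= Z)%N.
Local Notation U := (('I_Q * bool) * ('I_M * bool))%type.

Definition znu (u : U) : R := zr R u.1 * zr R u.2.

Lemma norm_znu u : `|znu u| = (u.1.1.+1 * u.2.1.+1)%N%:R.
Proof. by rewrite normrM !norm_zr natrM. Qed.

(** A unit window contains at most one integer. Its representations as a product of two signed
    integers are given by a divisor and two signs. *)
Lemma znu_multiplicity : multiplicity_le znu (4 * gD G).
Proof.
move=> x; set S := [set u | _].
have [->|[u0 u0S]] := set_0Vmem S; first by rewrite cards0.
pose m0 := (u0.1.1.+1 * u0.2.1.+1)%N.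
have m0Z : (0 < m0 <= Z)%N.
  rewrite muln_gt0 /=; apply: leq_trans QMZ; rewrite mul2n -addnn.
  by apply: leq_trans (leq_addr _ _); apply: leq_mul; exact: ltn_ord.
have znuI (u : U) : znu u = (zi u.1 * zi u.2)%:~R by rewrite /znu !zr_int intrM.
have Seq u : u \in S -> (u.1.1.+1 * u.2.1.+1)%N = m0 /\ znu u = znu u0.
  move=> uS; have e : znu u = znu u0.
    move: uS u0S; rewrite !inE !znuI => a b; congr (_%:~R).
    exact: int_window a b.
  by split=> //; apply/eqP; rewrite -(eqr_nat R) -!norm_znu e.
pose f (u : U) := (u.1.1.+1, (u.1.2, u.2.2)).
pose tg := [seq (d, b) | d <- divisors m0, b <- enum {: bool * bool}].
rewrite cardE -(size_map f); apply: (@leq_trans (size tg)).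
  apply: uniq_leq_size.
    rewrite map_inj_in_uniq ?enum_uniq// => u v; rewrite !mem_enum => uS vS.
    have [u1 _] := Seq _ uS; have [v1 _] := Seq _ vS.
    move: u v u1 v1 {uS vS} => [[l b] [m b']] [[l' c] [m' c']] /= u1 v1 [e1 e2 e3].
    rewrite e2 e3; move: v1; rewrite -u1 e1 => /eqP.
    rewrite eqn_pmul2l// eqSS => /eqP e4.
    by congr (_, _, (_, _)); apply: val_inj.
  move=> w /mapP[u]; rewrite mem_enum => uS ->.
  have [u1 _] := Seq _ uS.
  apply/allpairsP; exists (u.1.1.+1, (u.1.2, u.2.2)) => /=; split=> //.
    by rewrite -dvdn_divisors ?(andP m0Z).1// -u1 dvdn_mulr.
  by rewrite mem_enum.
rewrite size_allpairs -cardE card_prod card_bool mulnC leq_mul2l /=.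
exact: gD_ge.
Qed.

Definition zphase (u : U) (d : 'I_(2 * H)) : R[i] := ep (znu u * vv G d).

Lemma zphase_orthogonal u u' :
  h * cmod (\sum_d zphase u d * (zphase u' d)^J) <= 2 ^+ 9 * LC `|znu u - znu u'|.
Proof.
rewrite /zphase; under eq_bigr => d _ do rewrite -epN -epD -mulNr -mulrDl.
apply: vv_phase_sum; apply: (le_trans (ler_normB _ _)); rewrite !norm_znu -natrD ler_nat.
apply: leq_trans QMZ; rewrite mul2n -addnn.
by apply: leq_add; apply: leq_mul; exact: ltn_ord.
Qed.

Let const_le : 3 * 2 ^+ 9 * (gJ G).+1%:R * (4 * gD G)%N%:R <= L ^+ 4.
Proof.
have J1 := gJ_le G; have D1 := gD_le G; rewrite natrM.
have -> : 3 * 2 ^+ 9 * (gJ G).+1%:R * (4%:R * (gD G)%:R) =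
  (3 * 2 ^+ 11) * ((gJ G).+1%:R * (gD G)%:R) :> R by ring.
have -> : L ^+ 4 = L ^+ 2 * (L * L) by ring.
apply: ler_pM.
- by rewrite mulr_ge0 ?exprn_ge0.
- by rewrite mulr_ge0.
- by apply: (@L_pow_le _ _ _ 2) => //; lra.
- exact: ler_pM.
Qed.

Lemma product_sieve (a : U -> R[i]) :
  h * \sum_d cmod (\sum_u a u * zphase u d) ^+ 2 <= L ^+ 4 * \sum_u cmod (a u) ^+ 2.
Proof.
have := large_sieve znu_multiplicity (ltW h0) (exprn_ge0 9 (ler0n R 2)) zphase_orthogonal a.
by move/le_trans; apply; rewrite ler_wpM2r// sumr_ge0// => u _; exact: sqr_ge0.
Qed.

Lemma product_sieve_dual (f : 'I_(2 * H) -> R[i]) :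
  \sum_u cmod (h%:C * \sum_d f d * zphase u d) ^+ 2 <=
  L ^+ 4 * (h * \sum_d cmod (f d) ^+ 2).
Proof.
have := large_sieve_dual znu_multiplicity (ltW h0) (exprn_ge0 9 (ler0n R 2)) zphase_orthogonal f.
move/le_trans; apply; rewrite ler_wpM2r// mulr_ge0 ?(ltW h0)// sumr_ge0// => d _.
exact: sqr_ge0.
Qed.

End ProductSieve.

Section Layers.
Variables (R : realType) (G : grid R).
Notation h := (gh G).
Notation Z := (gZ G).
Notation L := (gL G).
Notation H := (gH G).
Notation LC := (lc (gJ G).+1).
Variables (M : nat) (M0 : (0 < M)%N) (s : 'I_(2 * H) -> R).
Hypothesis s0 : forall d, 0 <= s d.
Local Notation U := ('I_M * bool)%type.

Let h0 : 0 < h. Proof. exact: gh_gt0. Qed.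
Let L1 : 1 <= L. Proof. exact: gL_ge1. Qed.
Let L0 : 0 < L. Proof. exact: gL_gt0. Qed.
Let MR : 0 < M%:R :> R. Proof. by rewrite ltr0n. Qed.

Definition moment (p : nat) : R := h * \sum_d s d ^+ p.

Lemma moment_ge0 p : 0 <= moment p.
Proof. by rewrite mulr_ge0 ?(ltW h0)// sumr_ge0// => d _; rewrite exprn_ge0. Qed.

Definition form3 (p1 p2 p3 : U) (d1 d2 : nat) : R :=
  zr R p1 * vv G d1 + zr R p2 * vv G d2 + zr R p3.

Definition layer (D : R) : R := h ^+ 2 * \sum_d1 \sum_d2 s d1 * s d2 ^+ 2 *
  \sum_(p1 : U) \sum_(p2 : U) \sum_(p3 : U) (`|form3 p1 p2 p3 d1 d2| <= D)%R%:R.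

Let card_U : #|{: U}|%:R = 2 * M%:R :> R.
Proof. by rewrite card_prod card_ord card_bool natrM mulrC. Qed.

Let bound0 : 0 <= 4 * M%:R ^+ 2 * (moment 1 * moment 2).
Proof.
apply: mulr_ge0; first by rewrite mulr_ge0 ?sqr_ge0.
by apply: mulr_ge0; exact: moment_ge0.
Qed.

Let momentM : h ^+ 2 * \sum_d1 \sum_d2 s d1 * s d2 ^+ 2 = moment 1 * moment 2.
Proof.
rewrite /moment expr2 mulrACA; congr (_ * _); rewrite mulr_suml.
by apply: eq_bigr => d1 _; rewrite expr1 mulr_sumr.
Qed.

Lemma layer_large (D : R) : 1 <= 8 * D ->
  layer D <= 64 * D * (4 * M%:R ^+ 2 * (moment 1 * moment 2)).
Proof.
move=> D8; have D0 : 0 <= D by lra.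
have cnt (p1 p2 : U) d1 d2 : \sum_(p3 : U) (`|form3 p1 p2 p3 d1 d2| <= D)%R%:R <= 64 * D.
  apply: (le_trans (count_zr M (zr R p1 * vv G d1 + zr R p2 * vv G d2) D0)).
  rewrite -natr1; have : (Num.truncn (2 * D))%:R <= 2 * D by rewrite truncn_le mulr_ge0.
  lra.
apply: (@le_trans _ _ (h ^+ 2 * \sum_d1 \sum_d2 s d1 * s d2 ^+ 2 * (64 * D * (4 * M%:R ^+ 2)))).
  rewrite ler_wpM2l ?sqr_ge0//; apply: ler_sum => d1 _; apply: ler_sum => d2 _.
  rewrite ler_wpM2l ?mulr_ge0 ?sqr_ge0//.
  apply: (@le_trans _ _ (\sum_(p1 : U) \sum_(p2 : U) 64 * D)).
    by apply: ler_sum => p1 _; apply: ler_sum => p2 _.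
  rewrite !sumr_const -mulrnA -[leLHS]mulr_natl natrM card_U.
  by rewrite le_eqVlt; apply/orP; left; apply/eqP; ring.
under eq_bigr => d1 _ do rewrite -mulr_suml.
rewrite -mulr_suml mulrA momentM le_eqVlt; apply/orP; left; apply/eqP; ring.
Qed.

(** The condition that the form is within [D] of [0] for some integer [p3] is detected by a Fejér
    kernel of length [Q] about [1 / (8 D)]. Its constant term is the expected count. A nonzero
    frequency [l] splits into a phase in [l p1 vv d1] and one in [l p2 vv d2]; the large sieve for
    products, in dual form for [d2] and in direct form for [d1], bounds these on average. *)
Lemma layer_small (D : R) : 0 < D -> 8 * D <= 1 ->
  (2 * (Num.truncn (8 * D)^-1 * M) <= Z)%N ->
  layer D <= 64 * D * (4 * M%:R ^+ 2 * (moment 1 * moment 2) +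
    2 * M%:R * L ^+ 4 * Num.sqrt (moment 2 * moment 4)).
Proof.
set Q := Num.truncn _ => D0 D8 QMZ.
have D80 : 0 < 8 * D by rewrite mulr_gt0.
have i0 : 0 <= (8 * D)^-1 by rewrite invr_ge0 ltW.
have Q0 : (0 < Q)%N by rewrite /Q truncn_gt0 invf_ge1.
have QR : 0 < Q%:R :> R by rewrite ltr0n.
have QD : 4 / Q%:R <= 64 * D.
  have /andP[_ q2] := truncn_itv i0; rewrite -/Q -[Q.+1%:R]natr1 in q2.
  have Q1 : 1 <= Q%:R :> R by rewrite ler1n.
  have : 1 < (Q%:R + 1) * (8 * D) by rewrite -ltr_pdivrMr// mul1r.
  rewrite ler_pdivrMr//; nra.
(* [b] carries out the sum over [d2], [a] the sum over [p2], and [err] is what the nonzero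
   frequencies leave as a function of [d1]. The value of [a] at [(l, p1)] does not depend on
   [p1]. *)
pose g (l : 'I_Q * bool) : R := fejc R l.
pose b u : R[i] := h%:C * \sum_d (s d ^+ 2)%:C * @zphase R G Q M u d.
pose a (u : ('I_Q * bool) * U) : R[i] := (g u.1)%:C * \sum_(p2 : U) b (u.1, p2).
pose err d : R[i] := \sum_u a u * @zphase R G Q M u d.
have inner (d1 : 'I_(2 * H)) :
   (h * \sum_d2 s d2 ^+ 2 * \sum_(p1 : U) \sum_(p2 : U)
     fejer Q (zr R p1 * vv G d1 + zr R p2 * vv G d2))%:C =
   (4 * M%:R ^+ 2 * moment 2)%:C + err d1.
  have fE (d2 : 'I_(2 * H)) :
     (\sum_(p1 : U) \sum_(p2 : U) fejer Q (zr R p1 * vv G d1 + zr R p2 * vv G d2))%:C =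
     (4 * M%:R ^+ 2)%:C + \sum_(l : 'I_Q * bool) \sum_(p1 : U) \sum_(p2 : U)
       (g l)%:C * (@zphase R G Q M (l, p1) d1 * @zphase R G Q M (l, p2) d2).
    rewrite realC_sum; under eq_bigr => p1 _.
      rewrite realC_sum; under eq_bigr => p2 _ do rewrite fejer_expand//.
      rewrite big_split /= exchange_big /= sumr_const; over.
    rewrite big_split /= exchange_big /= sumr_const -mulrnA; congr (_ + _).
      rewrite -[LHS]mulr_natl mulr1 natrM.
      have -> : #|{: U}|%:R = (2 * M%:R)%:C :> R[i].
        by rewrite -card_U rmorph_nat.
      by rewrite -realCM; congr (_%:C); ring.
    apply: eq_bigr => l _; apply: eq_bigr => p1 _; apply: eq_bigr => p2 _.
    rewrite /g /zphase /znu /= -epD; congr (_ * ep _); ring.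
  rewrite realCM realC_sum.
  under eq_bigr => d2 _ do rewrite realCM fE mulrDr.
  rewrite big_split /= mulrDr; congr (_ + _).
    by rewrite -mulr_suml -realC_sum mulrA -!realCM /moment; congr (_%:C); ring.
  rewrite /err -(pair_big predT predT (fun l p1 => a (l, p1) * @zphase R G Q M (l, p1) d1)) /=.
  under eq_bigr => d2 _ do rewrite mulr_sumr.
  rewrite exchange_big /= mulr_sumr; apply: eq_bigr => l _.
  under eq_bigr => d2 _ do rewrite mulr_sumr.
  rewrite exchange_big /= mulr_sumr; apply: eq_bigr => p1 _.
  rewrite /a /= /b -mulr_sumr.
  rewrite exchange_big /= mulrCA mulr_sumr -mulrA mulr_sumr mulr_suml mulr_sumr.
  apply: eq_bigr => d2 _; rewrite !mulr_sumr mulr_suml mulr_sumr.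
  by apply: eq_bigr => p2 _; ring.
have step : layer D <= 4 / Q%:R * (h * \sum_d1 s d1 *
   (h * \sum_d2 s d2 ^+ 2 * \sum_(p1 : U) \sum_(p2 : U)
     fejer Q (zr R p1 * vv G d1 + zr R p2 * vv G d2))).
  rewrite /layer expr2 -mulrA [leRHS]mulrCA ler_pM2l//.
  rewrite mulr_sumr mulr_sumr; apply: ler_sum => d1 _.
  rewrite !mulr_sumr; apply: ler_sum => d2 _.
  rewrite [leLHS]mulrCA [leLHS](_ : _ = h * (s d1 * s d2 ^+ 2) *
    \sum_(p1 : U) \sum_(p2 : U) \sum_(p3 : U) (`|form3 p1 p2 p3 d1 d2| <= D)%R%:R); last by ring.
  rewrite [leRHS](_ : _ = h * (s d1 * s d2 ^+ 2) * (4 / Q%:R *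
     \sum_(p1 : U) \sum_(p2 : U) fejer Q (zr R p1 * vv G d1 + zr R p2 * vv G d2))); last by ring.
  rewrite ler_wpM2l ?mulr_ge0 ?sqr_ge0 ?(ltW h0)//.
  rewrite mulr_sumr; apply: ler_sum => p1 _; rewrite mulr_sumr; apply: ler_sum => p2 _.
  exact: count_zr_fejer.
have val : h * \sum_d1 s d1 * (h * \sum_d2 s d2 ^+ 2 * \sum_(p1 : U) \sum_(p2 : U)
     fejer Q (zr R p1 * vv G d1 + zr R p2 * vv G d2)) <=
   4 * M%:R ^+ 2 * (moment 1 * moment 2) + h * \sum_d1 s d1 * cmod (err d1).
  have -> : 4 * M%:R ^+ 2 * (moment 1 * moment 2) =
      h * \sum_d1 s d1 * (4 * M%:R ^+ 2 * moment 2).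
    rewrite -mulr_suml {1}/moment; under eq_bigr => d _ do rewrite expr1.
    by ring.
  rewrite -mulrDr -big_split ler_pM2l//=; apply: ler_sum => d1 _.
  rewrite -mulrDr ler_wpM2l//.
  set A := h * _; apply: (le_trans (ler_norm A)); rewrite -cmod_real /A inner.
  apply: (le_trans (cmodD _ _)); rewrite cmod_real ger0_norm//.
  by apply: mulr_ge0; [rewrite mulr_ge0 ?sqr_ge0|exact: moment_ge0].
(* Of the two factors [2 M], one counts the equal values of [a] over [p1] and the other comes from
   Cauchy-Schwarz in [p2]. *)
have errb : h * \sum_d cmod (err d) ^+ 2 <= (2 * M%:R * L ^+ 4) ^+ 2 * moment 4.
  apply: (le_trans (product_sieve QMZ a)).
  have ab : \sum_u cmod (a u) ^+ 2 <= (2 * M%:R) ^+ 2 * \sum_u cmod (b u) ^+ 2.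
    rewrite -(pair_big predT predT (fun l p1 => cmod (a (l, p1)) ^+ 2)) /=.
    rewrite -(pair_big predT predT (fun l p1 => cmod (b (l, p1)) ^+ 2)) /=.
    rewrite mulr_sumr; apply: ler_sum => l _.
    rewrite (eq_bigr (fun=> cmod ((g l)%:C * \sum_(p2 : U) b (l, p2)) ^+ 2))//.
    rewrite sumr_const -[leLHS]mulr_natl card_U.
    rewrite [(2 * M%:R) ^+ 2]expr2 -[leRHS]mulrA ler_pM2l ?mulr_gt0// cmodM exprMn.
    apply: (@le_trans _ _ (cmod (\sum_(p2 : U) b (l, p2)) ^+ 2)).
      rewrite ler_piMl ?sqr_ge0// cmod_real; have /andP[g0 g1] := fejc_itv R l.
      by rewrite ger0_norm// exprn_ile1.
    apply: (le_trans (cmod_sum_sqr_le _ _)); rewrite -card_U.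
    by rewrite (_ : size _ = #|{: U}|)// cardT enumT.
  apply: (le_trans (ler_wpM2l (exprn_ge0 4 (ltW L0)) ab)).
  have bb2 := product_sieve_dual QMZ (fun d => (s d ^+ 2)%:C).
  have -> : (2 * M%:R * L ^+ 4) ^+ 2 * moment 4 =
     L ^+ 4 * ((2 * M%:R) ^+ 2 * (L ^+ 4 * moment 4)) by ring.
  rewrite ler_wpM2l ?exprn_ge0 ?(ltW L0)// ler_wpM2l ?sqr_ge0//.
  apply: (le_trans bb2); rewrite ler_wpM2l ?exprn_ge0 ?(ltW L0)//.
  rewrite ler_pM2l//; apply: ler_sum => d _.
  by rewrite cmod_real ger0_norm ?sqr_ge0// -exprM.
have errs : h * \sum_d s d * cmod (err d) <= 2 * M%:R * L ^+ 4 * Num.sqrt (moment 2 * moment 4).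
  apply: le_sqrt_mul.
  - by rewrite !mulr_ge0 ?exprn_ge0 ?(ltW L0).
  - by rewrite mulr_ge0 ?moment_ge0.
  rewrite exprMn [leRHS]mulrCA; apply: (@le_trans _ _ (moment 2 * (h * \sum_d cmod (err d) ^+ 2))).
    rewrite /moment [leRHS]mulrACA -expr2 ler_wpM2l ?sqr_ge0//.
    exact: sum_mul_sqr_le.
  by rewrite ler_wpM2l ?moment_ge0.
apply: (le_trans step).
set Y := h * _ in val *.
have b1 := le_trans val (lerD (lexx _) errs).
apply: (le_trans (ler_wpM2l _ b1)); first by rewrite divr_ge0.
by rewrite ler_wpM2r// addr_ge0// !mulr_ge0 ?exprn_ge0 ?sqrtr_ge0 ?(ltW L0).
Qed.

Variable N : nat.
Hypotheses (N0 : (0 < N)%N) (NMZ : room 10 (N * M) Z).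

(** The argument is divided by [2^7] to leave room for the change of variables that replaces the
    form by a multiple of itself. *)
Definition kernel3 : R := h ^+ 2 * \sum_d1 \sum_d2 s d1 * s d2 ^+ 2 *
  \sum_(p1 : U) \sum_(p2 : U) \sum_(p3 : U)
    LC (N%:R * `|form3 p1 p2 p3 d1 d2| / 2 ^+ 7).

Lemma kernel3_bound : kernel3 <= L * 2 ^+ 13 / N%:R *
  (4 * M%:R ^+ 2 * (moment 1 * moment 2) +
    2 * M%:R * L ^+ 4 * Num.sqrt (moment 2 * moment 4)).
Proof.
have NR : 0 < N%:R :> R by rewrite ltr0n.
set B := (X in _ <= _ * X).
have e0 : 0 <= 2 * M%:R * L ^+ 4 * Num.sqrt (moment 2 * moment 4).
  by rewrite !mulr_ge0 ?exprn_ge0 ?sqrtr_ge0 ?(ltW L0).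
have B0 : 0 <= B by rewrite addr_ge0.
have lay (D : R) : 2 ^+ 7 / N%:R <= D -> layer D <= 64 * D * B.
  move=> ND; have D0 : 0 < D by apply: lt_le_trans ND; rewrite divr_gt0 ?exprn_gt0.
  have [D8|D8] := leP 1 (8 * D).
    apply: (le_trans (layer_large D8)); rewrite ler_wpM2l ?mulr_ge0 ?(ltW D0)//.
    by rewrite lerDl.
  apply: layer_small => //; first exact: ltW.
  apply: leq_trans NMZ; rewrite -(ler_nat R) (natrM _ 2)
    (natrM _ _ M) (natrM _ (2 ^ 10)) (natrM _ N) natrX.
  have i0 : 0 <= (8 * D)^-1 by rewrite invr_ge0 mulr_ge0// ltW.
  (* The smallest layer is [D = 2^7 / N], so the Fejér length never exceeds [N / 2^10]; this keeps
     the products in the sieve below the height [Z]. *)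
  have Qle : (Num.truncn (8 * D)^-1)%:R <= N%:R / 2 ^+ 10 :> R.
    apply: (@le_trans _ _ (8 * D)^-1); first by rewrite truncn_le.
    rewrite -[leRHS]invrK lef_pV2 ?posrE ?invr_gt0 ?mulr_gt0 ?divr_gt0 ?exprn_gt0//.
    rewrite invfM invrK.
    have -> : N%:R^-1 * 2 ^+ 10 = 8 * (2 ^+ 7 / N%:R) :> R by field; rewrite gt_eqF.
    by rewrite ler_pM2l.
  have : (Num.truncn (8 * D)^-1)%:R * M%:R <= N%:R / 2 ^+ 10 * M%:R :> R by rewrite ler_pM2r.
  have : 0 <= N%:R * M%:R :> R by rewrite mulr_ge0.
  lra.
have -> : kernel3 = \sum_(k < (gJ G).+1) 2 ^- k * layer (2 ^+ k * (2 ^+ 7 / N%:R)).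
  rewrite /kernel3 /layer.
  under [RHS]eq_bigr => k _ do rewrite mulrCA mulr_sumr.
  rewrite -[RHS]mulr_sumr; congr (_ * _); rewrite [RHS]exchange_big /=; apply: eq_bigr => d1 _.
  under [RHS]eq_bigr => k _ do rewrite mulr_sumr.
  rewrite [RHS]exchange_big /=; apply: eq_bigr => d2 _.
  under [RHS]eq_bigr => k _ do rewrite mulrCA.
  rewrite -[RHS]mulr_sumr; congr (_ * _).
  under [RHS]eq_bigr => k _ do rewrite mulr_sumr.
  rewrite [RHS]exchange_big /=; apply: eq_bigr => p1 _.
  under [RHS]eq_bigr => k _ do rewrite mulr_sumr.
  rewrite [RHS]exchange_big /=; apply: eq_bigr => p2 _.
  under [RHS]eq_bigr => k _ do rewrite mulr_sumr.
  rewrite [RHS]exchange_big /=; apply: eq_bigr => p3 _.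
  apply: eq_bigr => k _; congr (_ * (_ : bool)%:R).
  by rewrite mulrA ler_pdivrMr ?exprn_gt0// ler_pdivlMr// [_ * N%:R]mulrC.
apply: (@le_trans _ _ (\sum_(k < (gJ G).+1) 2 ^+ 13 / N%:R * B)).
  apply: ler_sum => k _; have p2 : 0 < 2 ^+ k :> R by rewrite exprn_gt0.
  rewrite mulrC ler_pdivrMr//; apply: (le_trans (lay _ _)).
    by rewrite ler_peMl ?divr_ge0 ?exprn_ge0// exprn_ege1// ler1n.
  by rewrite le_eqVlt; apply/orP; left; apply/eqP; ring.
rewrite sumr_const card_ord -[leLHS]mulr_natl mulrA ler_wpM2r//.
by rewrite -mulrA ler_wpM2r ?gJ_le// divr_ge0 ?exprn_ge0.
Qed.

End Layers.

(** * Bounds for the traces *)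

Section LayerCakeMono.
Variable R : realType.

Lemma lc_anti J (u v : R) : u <= v -> lc J v <= lc J u.
Proof.
move=> uv; apply: ler_sum => j _; rewrite ler_wpM2l ?invr_ge0 ?exprn_ge0//.
rewrite ler_nat; case: (leP v (2 ^+ j)) => // vj.
by rewrite (le_trans uv vj).
Qed.

End LayerCakeMono.

Section TraceBounds.
Variables (R : realType) (G : grid R).
Notation h := (gh G).
Notation Z := (gZ G).
Notation L := (gL G).
Notation H := (gH G).
Notation lamG := (lam G).
Notation LC := (lc (gJ G).+1).
Variables (I : finType) (tau : I -> R) (T : R).
Hypotheses (tauB : multiplicity_le tau 2) (tauT : forall i, 0 <= tau i <= T).
Hypotheses (T1 : 1 <= T) (TZ : tall Z (2 * T)).
Notation P := (#|I|%:R : R).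
Notation E := (energy tau).
Variables (N M : nat).
Hypotheses (N0 : (0 < N)%N) (M0 : (0 < M)%N) (NMZ : room 10 (N * M) Z).
Hypotheses (MZ : room 46 (M ^ 4) Z) (P1 : 1 <= P).
Local Notation U := ('I_M * bool)%type.
Notation y := (yy G N).
Notation S := (expsum1 tau).
Notation psiM := (psi G N M).

Let L1 : 1 <= L. Proof. exact: gL_ge1. Qed.
Let L0 : 0 < L. Proof. exact: gL_gt0. Qed.
Let Lpow k : 0 < L ^+ k. Proof. by rewrite exprn_gt0. Qed.
Let h0 : 0 < h. Proof. exact: gh_gt0. Qed.
Let NR : 0 < N%:R :> R. Proof. by rewrite ltr0n. Qed.
Let MR : 0 < M%:R :> R. Proof. by rewrite ltr0n. Qed.
Let P0 : 0 <= P. Proof. by []. Qed.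
Let T0 : 0 <= T. Proof. by have := T1; lra. Qed.
Let TZ2 : tall Z T.
Proof.
rewrite /tall; apply: le_trans TZ; rewrite ler_pM2l ?exprn_gt0// lerXn2r ?nnegrE//; have := T0; lra.
Qed.
Let TZ1 : T <= Z%:R.
Proof.
apply: le_trans TZ2; have : T <= (T + 1) ^+ 4.
  apply: (@le_trans _ _ (T + 1)); first by lra.
  by rewrite -[leLHS]expr1; apply: ler_weXn2l => //; have := T0; lra.
have : 1 <= 2 ^+ 80 :> R by rewrite exprn_ege1// ler1n.
have := T0; nra.
Qed.
Let W20 : 0 <= W2 I T. Proof. exact: sqrtr_ge0. Qed.

Lemma psi_expand k : (psiM k)%:C = \sum_(p : U) (fejc R p)%:C * ep (zr R p * xx G N k).
Proof. by rewrite /psi /omg rmorphB rmorph1 /= fejer_expand// addrC addKr. Qed.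

Definition tau2 : R := P * (M%:R * Num.sqrt P + P + Num.sqrt (W2 I T)).

Lemma tau2_ge : P <= tau2.
Proof.
rewrite -[leLHS]mulr1 ler_wpM2l//.
have : 0 <= M%:R * Num.sqrt P by rewrite mulr_ge0 ?sqrtr_ge0.
have : 0 <= Num.sqrt (W2 I T) by exact: sqrtr_ge0.
by have := P1; lra.
Qed.

(** Heath-Brown's bound is applied after squaring the length. Relative to a direct application this
    costs a factor [P^(1/2)] on the term in [M], but [T] enters to the power [1/4] instead of [1/2].
    The gain is essential: at [V = N^(4/5)], [T = N^(6/5)], [P = N^(2/5)] the bound for the
    quadratic trace must stay below 1; the direct one would be [N^(1/10)], this one is [N^(-1/20)],
    up to losses. *)
Lemma qpow_amplified a : (2 ^ a <= M)%N ->
  qpow G tau (9 + a) <= L ^+ 20 * tau2 * 2 ^+ a.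
Proof.
move=> aM; set k := (9 + a)%N.
have kZ : (2 ^ (10 + 2 * (2 * k)) <= Z)%N.
  apply: leq_trans MZ; rewrite (_ : (10 + 2 * (2 * k) = 46 + a * 4)%N); last by rewrite /k; clear; lia.
  by rewrite expnD expnM leq_mul2l leq_exp2r// aM orbT.
have kZ2 : (2 ^ (2 * k) <= Z)%N.
  by apply: leq_trans kZ; rewrite leq_exp2l//; clear; lia.
have X0 : 0 < 2 ^+ k :> R by rewrite exprn_gt0.
set X := 2 ^+ k in X0 *.
have q2 := qpow_two tauB tauT T1 TZ P1 kZ.
have sq := qpow_sqr tau kZ2.
set p := Num.sqrt P; set w := Num.sqrt (W2 I T).
have p0 : 0 <= p by exact: sqrtr_ge0.
have w0 : 0 <= w by exact: sqrtr_ge0.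
have pE : P = p ^+ 2 by rewrite sqr_sqrtr.
have wE : W2 I T = w ^+ 2 by rewrite sqr_sqrtr.
have X2 : 2 ^+ (2 * k) = X ^+ 2 by rewrite mulnC exprM.
rewrite X2 in q2.
have b1 : X ^+ 2 * P + P ^+ 2 + W2 I T <= (X * p + P + w) ^+ 2.
  have -> : (X * p + P + w) ^+ 2 = X ^+ 2 * p ^+ 2 + P ^+ 2 + w ^+ 2 +
    2 * (X * p * P + X * p * w + P * w) by ring.
  rewrite -pE -wE.
  have q1 := mulr_ge0 (mulr_ge0 (ltW X0) p0) P0.
  have q3 := mulr_ge0 (mulr_ge0 (ltW X0) p0) w0.
  have q4 := mulr_ge0 P0 w0; lra.
have b2 : qpow G tau k <= L ^+ 18 * (P * (X * (X * p + P + w))).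
  rewrite -ler_sqr ?nnegrE ?qpow_ge0//; last first.
    have Y0 : 0 <= X * p + P + w by rewrite addr_ge0// addr_ge0// mulr_ge0// ltW.
    exact: (mulr_ge0 (ltW (Lpow 18)) (mulr_ge0 P0 (mulr_ge0 (ltW X0) Y0))).
  apply: (le_trans sq).
  have PL0 : 0 <= P ^+ 2 * L ^+ 2 by rewrite mulr_ge0 ?sqr_ge0.
  apply: (le_trans (ler_wpM2l PL0 q2)).
  have -> : (L ^+ 18 * (P * (X * (X * p + P + w)))) ^+ 2 =
     L ^+ 36 * (P ^+ 2 * (X ^+ 2 * (X * p + P + w) ^+ 2)) by ring.
  have -> : P ^+ 2 * L ^+ 2 * (L ^+ 33 * X ^+ 2 * (X ^+ 2 * P + P ^+ 2 + W2 I T)) =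
     L ^+ 35 * (P ^+ 2 * (X ^+ 2 * (X ^+ 2 * P + P ^+ 2 + W2 I T))) by ring.
  apply: ler_pM.
  - by rewrite exprn_ge0 ?(ltW L0).
  - rewrite mulr_ge0 ?sqr_ge0// mulr_ge0 ?sqr_ge0// addr_ge0// addr_ge0 ?sqr_ge0//.
    by rewrite mulr_ge0 ?sqr_ge0.
  - by apply: ler_weXn2l.
  - by rewrite ler_wpM2l ?sqr_ge0// ler_wpM2l ?sqr_ge0.
have XE : X = 2 ^+ 9 * 2 ^+ a by rewrite /X /k exprD.
have XM : X <= 2 ^+ 9 * M%:R.
  by rewrite XE ler_pM2l ?exprn_gt0// -natrX ler_nat.
have b3 : X * p + P + w <= 2 ^+ 9 * (M%:R * p + P + w).
  have : X * p <= 2 ^+ 9 * M%:R * p by rewrite ler_wpM2r.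
  by have := P0; lra.
apply: (le_trans b2).
have Y0 : 0 <= M%:R * p + P + w by rewrite !addr_ge0// mulr_ge0.
apply: (@le_trans _ _ (L ^+ 18 * (P * (X * (2 ^+ 9 * (M%:R * p + P + w)))))).
  by rewrite ler_pM2l// ler_wpM2l// ler_pM2l.
rewrite XE /tau2 -/p -/w.
have -> : L ^+ 18 * (P * (2 ^+ 9 * 2 ^+ a * (2 ^+ 9 * (M%:R * p + P + w)))) =
  2 ^+ 18 * (L ^+ 18 * (P * (M%:R * p + P + w)) * 2 ^+ a) by ring.
have -> : L ^+ 20 * (P * (M%:R * p + P + w)) * 2 ^+ a =
  L ^+ 2 * (L ^+ 18 * (P * (M%:R * p + P + w)) * 2 ^+ a) by ring.
rewrite ler_wpM2r//.
  by rewrite !mulr_ge0 ?exprn_ge0 ?(ltW L0).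
by apply: (@L_pow_le _ _ _ 2) => //; apply: ler_weXn2l => //; rewrite ler1n.
Qed.

Lemma gridnorm_one : gridnorm G (fun z => cmod (S z) ^+ 2) <= 108 * L * P.
Proof.
have a1 (i : I) : cmod (1 : R[i]) <= 1 by rewrite cmod1.
have := gridnorm_sqr tauB tauT TZ1 a1.
rewrite expr1n mul1r (_ : 54 * L * 2%:R * P = 108 * L * P); last by ring.
apply: le_trans; rewrite /gridnorm ler_pM2l// le_eqVlt; apply/orP; left; apply/eqP.
by apply: eq_bigr => d _; rewrite expsum1E.
Qed.

(** [positivity_one] turns the sum of [|Kp i j|^2] into a double sum over the grid with weights
    [psi]. These have no zero frequency, so [double_phase] leads directly to [bilinear_kernel] with
    [g = |S|^2]. *)
Lemma T2_bound : T2 G tau N M <= L ^+ 27 / N%:R * tau2.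
Proof.
pose g z := cmod (S z) ^+ 2.
have g0 z : 0 <= g z by exact: sqr_ge0.
have t20 : 0 <= tau2 by apply: le_trans tau2_ge.
have T2E : T2 G tau N M = h ^+ 2 * \sum_(k1 < H) \sum_(k2 < H)
    psiM k1 * psiM k2 * g (y k1 - y k2).
  have := @positivity_one R I tau 'I_H (index_enum 'I_H) (fun k => y k) (fun k => psiM k).
  rewrite /g => ->; rewrite /T2 mulr_sumr; apply: eq_bigr => i _.
  rewrite mulr_sumr; apply: eq_bigr => j _.
  by rewrite /Kp cmodM exprMn cmod_real (gtr0_norm h0).
set Sg := \sum_(k1 < H) _ in T2E.
have SgC : Sg%:C = \sum_(k1 < H) \sum_(k2 < H)
    (\sum_(a : U) (fejc R a)%:C * ep (zr R a * xx G N k1)) *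
    (\sum_(b : U) (fejc R b)%:C * ep (zr R b * xx G N k2)) * (g (y k1 - y k2))%:C.
  rewrite realC_sum; apply: eq_bigr => k1 _; rewrite realC_sum; apply: eq_bigr => k2 _.
  by rewrite realCM (realCM (psiM k1)) !psi_expand.
have zb (a b : U) (d : 'I_(2 * H)) : N%:R * `|zr R a * vv G d + zr R b| <= Z%:R.
  exact: (zs_bound N0 NMZ (inl a) (inl b) d).
have dp := double_phase N0 M0 NMZ (@fejc_itv R M) (@fejc_itv R M) zb g0.
rewrite -SgC cmod_real in dp.
have Gam0 : 0 <= L ^+ 20 * tau2 by rewrite mulr_ge0// ltW.
have gG a z : (2 ^ a <= M)%N ->
  \sum_(m <- blockM a) \sum_(m' <- blockM a) g (lamG m' - lamG m + z) <=
  L ^+ 20 * tau2 * 2 ^+ a.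
  move=> aM; apply: le_trans (qpow_amplified aM); rewrite exchange_big /=.
  have a1 (i : I) : cmod (1 : R[i]) <= 1 by rewrite cmod1.
  have := @positivity_le R I tau nat (blockM a) lamG (fun=> 1) (fun=> 1) 1 1 z a1.
  rewrite ler01 lexx => /(_ (fun=> isT)); rewrite !expr1n !mul1r; apply: le_trans.
  apply: ler_sum => m _; apply: ler_sum => n _.
  by rewrite !mul1r /g expsum1E.
have bk := bilinear_kernel N0 M0 NMZ g0 Gam0 gG.
rewrite T2E; apply: (le_trans (ler_wpM2l (sqr_ge0 _) (ler_norm _))).
apply: (le_trans dp); apply: (@le_trans _ _ (24 * (16 * L ^+ 2 * (M%:R * gridnorm G g + L ^+ 20 * tau2) / N%:R))).
  by rewrite ler_pM2l.
have gn : M%:R * gridnorm G g <= 108 * L * tau2.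
  apply: (@le_trans _ _ (M%:R * (108 * L * P))).
    by rewrite ler_pM2l//; exact: gridnorm_one.
  rewrite mulrCA ler_pM2l ?mulr_gt0// /tau2 mulrC ler_wpM2l//.
  have : M%:R <= M%:R * Num.sqrt P.
    rewrite ler_peMr// -[leLHS]sqrtr1 ler_wsqrtr//.
  have : 0 <= Num.sqrt (W2 I T) by exact: sqrtr_ge0.
  by have := P0; lra.
have sum : M%:R * gridnorm G g + L ^+ 20 * tau2 <= 2 * (L ^+ 20 * tau2).
  have : 108 * L * tau2 <= L ^+ 20 * tau2.
    rewrite ler_wpM2r// (exprSr _ 19) ler_pM2r//.
    by apply: (@L_pow_le _ _ _ 1) => //; lra.
  lra.
apply: (@le_trans _ _ (24 * (16 * L ^+ 2 * (2 * (L ^+ 20 * tau2)) / N%:R))).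
  by rewrite ler_pM2l// ler_pM2r ?invr_gt0// ler_pM2l// mulr_gt0// exprn_gt0.
have -> : 24 * (16 * L ^+ 2 * (2 * (L ^+ 20 * tau2)) / N%:R) =
   768 * (L ^+ 22 * (tau2 / N%:R)) by field; rewrite gt_eqF.
have -> : L ^+ 27 / N%:R * tau2 = L ^+ 5 * (L ^+ 22 * (tau2 / N%:R)).
  by field; rewrite gt_eqF.
rewrite ler_wpM2r//.
  by rewrite mulr_ge0 ?divr_ge0// ltW.
by apply: (@L_pow_le _ _ _ 1) => //; lra.
Qed.

(** The indices form a cycle: the arguments of the three exponential sums add up to [0], so two
    index differences determine them all. *)
Lemma T3_expand : (T3 G tau N M)%:C = (h ^+ 3)%:C *
  \sum_(k3 < H) \sum_(k1 < H) \sum_(k2 < H)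
    (psiM k1 * psiM k2 * psiM k3)%:C *
    (S (y k1 - y k2) * S (y k3 - y k1) * S (y k2 - y k3)).
Proof.
have hatE i (k3 : 'I_H) : hat G tau N (Kp G tau N M i) k3 =
    h%:C * \sum_(k1 < H) (psiM k1)%:C * cis (tau i * y k1) * S (y k3 - y k1).
  rewrite /hat /expsum /Kp; under eq_bigr => j _ do rewrite -mulrA mulr_suml.
  rewrite -mulr_sumr exchange_big /=; congr (_ * _); apply: eq_bigr => k1 _.
  rewrite mulr_sumr; apply: eq_bigr => j _.
  rewrite -!mulrA -!cisD; congr (_ * cis _); ring.
rewrite /T3 realC_sum.
transitivity (\sum_i \sum_(k3 < H) (h ^+ 3)%:C * \sum_(k1 < H) \sum_(k2 < H)
    (psiM k1 * psiM k2 * psiM k3)%:C *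
    (cis (tau i * (y k1 - y k2)) * S (y k3 - y k1) * S (y k2 - y k3))).
  apply: eq_bigr => i _; rewrite realCM realC_sum mulr_sumr; apply: eq_bigr => k3 _.
  rewrite realCM hatE cmodM exprMn cmod_real (gtr0_norm h0) realCM cmod_sum_sqr.
  have e3 : (h ^+ 3)%:C = h%:C * (h ^+ 2)%:C by rewrite -realCM -exprS.
  rewrite e3 -mulrA; congr (_ * _); rewrite mulrCA; congr (_ * _).
  rewrite mulr_sumr; apply: eq_bigr => k1 _.
  rewrite mulr_sumr; apply: eq_bigr => k2 _.
  rewrite !conjCM conjc_real expsum1_conj opprB !realCM.
  by rewrite mulrBr cisB; ring.
rewrite exchange_big /= mulr_sumr; apply: eq_bigr => k3 _.
rewrite -mulr_sumr; congr (_ * _); rewrite exchange_big /=; apply: eq_bigr => k1 _.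
rewrite exchange_big /=; apply: eq_bigr => k2 _.
by rewrite -mulr_sumr; congr (_ * _); rewrite -!mulr_suml.
Qed.

Definition sabs (d : nat) : R := cmod (S (dv G d)).

Definition f3 (d1 d2 : nat) : R := sabs d1 * sabs d2 ^+ 2 *
  \sum_(p1 : U) \sum_(p2 : U) \sum_(p3 : U)
    LC (N%:R * `|form3 G p1 p2 p3 d1 d2| / 2 ^+ 7).

Lemma f3_ge0 d1 d2 : 0 <= f3 d1 d2.
Proof.
rewrite /f3 mulr_ge0 ?mulr_ge0 ?sqr_ge0 ?cmod_ge0//.
apply: sumr_ge0 => p1 _; apply: sumr_ge0 => p2 _; apply: sumr_ge0 => p3 _.
exact: lc_ge0.
Qed.

Lemma dv_rev d : (d <= 2 * H)%N -> dv G (2 * H - d) = - dv G d.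
Proof. by move=> dH; rewrite /dv natrB// natrM; ring. Qed.

Lemma dv_sub d1 d2 : (d1 <= d2 + H)%N -> dv G (d2 + H - d1) = dv G d2 - dv G d1.
Proof. by move=> dd; rewrite /dv natrB// natrD; ring. Qed.

(** The pairs of differences for which some [k3] can have both neighbours in the window. Outside it
    the inner sum is empty; inside it the indices [2 H - d1] and [d2 + H - d1] are again in
    range. *)
Definition admissible (d1 d2 : nat) : bool :=
  [&& (0 < d1)%N, (d1 < d2 + H)%N & (d2 < d1 + H)%N].

Let lcs (p1 p2 p3 : U) (d1 d2 : nat) : R := LC (N%:R * `|form3 G p1 p2 p3 d1 d2|).

Let lcs_le p1 p2 p3 d1 d2 : lcs p1 p2 p3 d1 d2 <= LC (N%:R * `|form3 G p1 p2 p3 d1 d2| / 2 ^+ 7).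
Proof.
apply: lc_anti; rewrite ler_pdivrMr ?exprn_gt0// ler_peMr ?mulr_ge0//.
by rewrite exprn_ege1// ler1n.
Qed.

(* Dividing the linear form by [vv d1] exchanges the roles of the first and the
   third variables, at the price of a factor [2 ^+ 7]. *)
Lemma admissible_swap (d1 d2 : 'I_(2 * H)) : admissible d1 d2 ->
  sabs d1 * sabs (d2 + H - d1) ^+ 2 *
    \sum_(p1 : U) \sum_(p2 : U) \sum_(p3 : U) lcs p1 p2 p3 d1 d2 <=
  f3 (2 * H - d1) (d2 + H - d1).
Proof.
case/and3P => d0 a1 a2; rewrite /f3.
have -> : sabs (2 * H - d1) = sabs d1.
  by rewrite /sabs dv_rev ?cmod_expsum1N// ltnW.
rewrite ler_wpM2l ?mulr_ge0 ?sqr_ge0 ?cmod_ge0//.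
rewrite exchange_big [leRHS]exchange_big /=; apply: ler_sum => p2 _.
rewrite exchange_big /=; apply: ler_sum => p3 _; apply: ler_sum => p1 _.
apply: lc_anti; rewrite ler_pdivrMr ?exprn_gt0// -mulrA ler_pM2l//.
have v0 := vv_gt0 G d1; have v1 := vv_ge d1.
have -> : form3 G p3 p2 p1 (2 * H - d1) (d2 + H - d1) = form3 G p1 p2 p3 d1 d2 / vv G d1.
  rewrite /form3 /vv dv_rev ?(ltnW (ltn_ord _))// dv_sub ?(ltnW a1)// expRB expRN.
  by field; rewrite gt_eqF ?expR_gt0.
rewrite normrM normfV (gtr0_norm v0) ler_pdivrMr// -mulrA ler_peMr//.
by rewrite mulrC.
Qed.

Lemma sum_grid_pairs (F : nat -> nat -> R) (Q : nat -> nat -> bool) :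
  \sum_(d1 < 2 * H) \sum_(d2 < 2 * H | Q d1 d2) F d1 d2 =
  \sum_(u <- [seq u <- [seq (d1, d2) | d1 <- index_iota 0 (2 * H), d2 <- index_iota 0 (2 * H)] |
     Q u.1 u.2]) F u.1 u.2.
Proof.
rewrite big_filter [RHS]big_mkcond big_allpairs_dep big_mkord /=.
by apply: eq_bigr => d1 _; rewrite big_mkord [LHS]big_mkcond.
Qed.

(** The map [(d1, d2)] to [(2 H - d1, d2 + H - d1)] is injective and stays in range, and [f3] is
    nonnegative. *)
Lemma admissible_sum :
  \sum_(d1 < 2 * H) \sum_(d2 < 2 * H | admissible d1 d2)
    f3 (2 * H - d1) (d2 + H - d1) <= \sum_(d1 < 2 * H) \sum_(d2 < 2 * H) f3 d1 d2.
Proof.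
rewrite (sum_grid_pairs (fun d1 d2 => f3 (2 * H - d1) (d2 + H - d1)) admissible).
have -> : \sum_(d1 < 2 * H) \sum_(d2 < 2 * H) f3 d1 d2 =
  \sum_(u <- [seq (d1, d2) | d1 <- index_iota 0 (2 * H), d2 <- index_iota 0 (2 * H)])
    f3 u.1 u.2.
  rewrite big_allpairs_dep big_mkord /=.
  by apply: eq_bigr => d1 _; rewrite big_mkord.
set s := [seq u <- _ | _].
pose f (u : nat * nat) := (2 * H - u.1, u.2 + H - u.1)%N.
have -> : \sum_(u <- s) f3 (2 * H - u.1) (u.2 + H - u.1) =
   \sum_(u <- [seq f u | u <- s]) f3 u.1 u.2 by rewrite big_map.
have sP u : u \in s -> [&& (u.1 < 2 * H)%N, (u.2 < 2 * H)%N & admissible u.1 u.2].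
  rewrite mem_filter => /andP[-> /allpairsP[[a b] [/= ha hb ->]]] /=.
  by move: ha hb; rewrite !mem_index_iota => /andP[_ ->] /andP[_ ->].
apply: ler_sum_uniq_sub; last by move=> u; exact: f3_ge0.
  rewrite map_inj_in_uniq.
    by apply: filter_uniq; apply: allpairs_uniq; rewrite ?iota_uniq// => -[? ?] [? ?].
  move=> [a b] [a' b'] /sP/and3P[/= h1 h2 /and3P[h3 h4 h5]] /sP/and3P[/= h1' h2' /and3P[h3' h4' h5']].
  by case=> e1 e2; congr pair; clear -h1 h1' e1 e2 h4 h4'; lia.
move=> u /mapP[[a b] /sP/and3P[/= h1 h2 /and3P[h3 h4 h5]] ->].
have m1 : (2 * H - a)%N \in index_iota 0 (2 * H).
  by rewrite mem_index_iota; clear -h1 h3; lia.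
have m2 : (b + H - a)%N \in index_iota 0 (2 * H).
  by rewrite mem_index_iota; clear -h4 h5 h1 h2; lia.
exact: (allpairs_f (fun a b : nat => (a, b)) m1 m2).
Qed.

(** With the differences [d1] and [d2] fixed, the sum over [k3] is a single phase sum whose
    frequency is the ternary form, so the cubic trace counts near-solutions weighted by three values
    of [S]. *)
Lemma T3_le_kernel : T3 G tau N M <= 24 * kernel3 M (fun d : 'I_(2 * H) => sabs d) N.
Proof.
pose c1 (d k : nat) := (H <= k + d < 2 * H)%N.
pose sgn (d1 d2 : nat) := S (dv G d1 - dv G d2) * S (- dv G d1) * S (dv G d2).
pose ph (d1 d2 : nat) (k : nat) := \sum_(p1 : U) \sum_(p2 : U) \sum_(p3 : U)
   (fejc R p1 * fejc R p2 * fejc R p3)%:C * ep (form3 G p1 p2 p3 d1 d2 * xx G N k).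
have TE : (T3 G tau N M)%:C = (h ^+ 3)%:C *
  \sum_(d1 < 2 * H) \sum_(d2 < 2 * H) sgn d1 d2 *
    \sum_(k < H | c1 d1 k && c1 d2 k) ph d1 d2 k.
  rewrite T3_expand; congr (_ * _).
  pose term (k3 k1 k2 : nat) := (psiM k1 * psiM k2 * psiM k3)%:C *
    (S (y k1 - y k2) * S (y k3 - y k1) * S (y k2 - y k3)).
  transitivity (\sum_(k3 < H) \sum_(d1 < 2 * H) \sum_(d2 < 2 * H)
    (if c1 d1 k3 && c1 d2 k3 then term k3 (k3 + d1 - H)%N (k3 + d2 - H)%N else 0)).
    apply: eq_bigr => k3 _.
    rewrite (@reindex_diff _ _ k3 (fun k1 => \sum_(k2 < H) term k3 k1 k2)) big_mkcond /=.
    apply: eq_bigr => d1 _; rewrite -/(c1 d1 k3); case: ifP => cd1; last by rewrite big1.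
    by rewrite (@reindex_diff _ _ k3 (fun k2 => term k3 (k3 + d1 - H)%N k2)) big_mkcond.
  rewrite exchange_big /=; apply: eq_bigr => d1 _.
  rewrite exchange_big /=; apply: eq_bigr => d2 _.
  rewrite -big_mkcond /= mulr_sumr; apply: eq_bigr => k3 /andP[/andP[a1 _] /andP[a2 _]].
  rewrite /term mulrC /sgn.
  have e1 : y (k3 + d1 - H) = dv G d1 + y k3 by rewrite -(yyB N a1) subrK.
  have e2 : y (k3 + d2 - H) = dv G d2 + y k3 by rewrite -(yyB N a2) subrK.
  have -> : y (k3 + d1 - H) - y (k3 + d2 - H) = dv G d1 - dv G d2 by rewrite e1 e2; ring.
  have -> : y k3 - y (k3 + d1 - H) = - dv G d1 by rewrite e1; ring.
  have -> : y (k3 + d2 - H) - y k3 = dv G d2 by rewrite e2; ring.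
  congr (_ * _); rewrite realCM (realCM (psiM _)) !psi_expand (xxB N a1) (xxB N a2).
  rewrite /ph mulr_suml mulr_suml; apply: eq_bigr => p1 _.
  rewrite [X in X * _]mulr_sumr mulr_suml; apply: eq_bigr => p2 _.
  rewrite [LHS]mulr_sumr; apply: eq_bigr => p3 _.
  have -> : form3 G p1 p2 p3 d1 d2 * xx G N k3 = zr R p1 * (vv G d1 * xx G N k3) +
     zr R p2 * (vv G d2 * xx G N k3) + zr R p3 * xx G N k3 by rewrite /form3; ring.
  by rewrite !epD (realCM (_ * _)) realCM; ring.
have phb (d1 d2 : 'I_(2 * H)) : h * cmod (\sum_(k < H | c1 d1 k && c1 d2 k) ph d1 d2 k) <=
   24 * \sum_(p1 : U) \sum_(p2 : U) \sum_(p3 : U) lcs p1 p2 p3 d1 d2.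
  rewrite /ph exchange_big /= mulr_sumr.
  apply: (le_trans (ler_wpM2l (ltW h0) (cmod_sum _ _ _))).
  rewrite mulr_sumr; apply: ler_sum => p1 _.
  rewrite exchange_big /= mulr_sumr.
  apply: (le_trans (ler_wpM2l (ltW h0) (cmod_sum _ _ _))).
  rewrite mulr_sumr; apply: ler_sum => p2 _.
  rewrite exchange_big /= mulr_sumr.
  apply: (le_trans (ler_wpM2l (ltW h0) (cmod_sum _ _ _))).
  rewrite mulr_sumr; apply: ler_sum => p3 _.
  rewrite -mulr_sumr cmodM cmod_real.
  have /andP[f10 f11] := fejc_itv R p1; have /andP[f20 f21] := fejc_itv R p2.
  have /andP[f30 f31] := fejc_itv R p3.
  rewrite ger0_norm; last by rewrite !mulr_ge0.
  set Sk := cmod _; apply: (@le_trans _ _ (h * Sk)).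
    by rewrite ler_pM2l// ler_piMl ?cmod_ge0// mulr_ile1 ?mulr_ge0// mulr_ile1.
  have fZ : N%:R * `|form3 G p1 p2 p3 d1 d2| <= Z%:R.
    have := @zr_leM R _ p1; have := @zr_leM R _ p2; have := @zr_leM R _ p3.
    move=> z3 z2 z1.
    have v1 := vv_gt0 G d1; have v2 := vv_gt0 G d2.
    have w1 := vv_le d1; have w2 := vv_le d2.
    apply: (@le_trans _ _ (N%:R * (2 ^+ 9 * M%:R))).
      rewrite ler_pM2l// /form3 (le_trans (ler_normD _ _))//.
      apply: (le_trans (lerD (ler_normD _ _) (lexx _))).
      rewrite (normrM (zr R p1)) (normrM (zr R p2)) (gtr0_norm v1) (gtr0_norm v2).
      have : `|zr R p1| * vv G d1 <= M%:R * 2 ^+ 7 by apply: ler_pM => //; exact: ltW.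
      have : `|zr R p2| * vv G d2 <= M%:R * 2 ^+ 7 by apply: ler_pM => //; exact: ltW.
      by have := MR; lra.
    apply: (@le_trans _ _ (2 ^ 10 * (N * M))%N%:R); last by rewrite ler_nat.
    rewrite (natrM _ (2 ^ 10)) (natrM _ N) natrX.
    have : 0 <= N%:R * M%:R :> R by rewrite mulr_ge0.
    lra.
  have cP k : (k < H)%N -> c1 d1 k && c1 d2 k =
      (maxn (H - d1) (H - d2) <= k < minn (2 * H - d1) (2 * H - d2))%N.
    by move=> kH; have := ltn_ord d1; have := ltn_ord d2; rewrite /c1; clear -kH; lia.
  exact: (grid_phase_filter N0 M0 NMZ cP fZ).
have adm (d1 d2 : 'I_(2 * H)) : ~~ admissible d1 d2 ->
   \sum_(k < H | c1 d1 k && c1 d2 k) ph d1 d2 k = 0.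
  move=> na; rewrite big_pred0// => k; apply/negbTE; apply: contra na.
  rewrite /c1 /admissible; have := ltn_ord k; clear; lia.
pose lsum (d1 d2 : nat) := \sum_(p1 : U) \sum_(p2 : U) \sum_(p3 : U) lcs p1 p2 p3 d1 d2.
have lsum0 d1 d2 : 0 <= lsum d1 d2.
  apply: sumr_ge0 => p1 _; apply: sumr_ge0 => p2 _; apply: sumr_ge0 => p3 _; exact: lc_ge0.
have tri : T3 G tau N M <= h ^+ 2 * \sum_(d1 < 2 * H) \sum_(d2 < 2 * H | admissible d1 d2)
   12 * (sabs d1 * sabs d2 ^+ 2 * lsum d1 d2 +
         sabs d1 * sabs (d2 + H - d1) ^+ 2 * lsum d1 d2).
  apply: (le_trans (ler_norm _)); rewrite -cmod_real TE cmodM cmod_real.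
  rewrite ger0_norm ?exprn_ge0 ?(ltW h0)// (exprSr h 2) -mulrA ler_pM2l ?exprn_gt0//.
  apply: (le_trans (ler_wpM2l (ltW h0) (cmod_sum _ _ _))).
  rewrite mulr_sumr; apply: ler_sum => d1 _.
  apply: (le_trans (ler_wpM2l (ltW h0) (cmod_sum _ _ _))).
  rewrite mulr_sumr [leRHS]big_mkcond /=; apply: ler_sum => d2 _.
  case: ifP => [ad|/negbT ad]; last by rewrite adm// mulr0 cmod0 mulr0.
  rewrite cmodM mulrCA.
  have sE : cmod (sgn d1 d2) = sabs (d2 + H - d1) * sabs d1 * sabs d2.
    rewrite /sgn !cmodM cmod_expsum1N /sabs dv_sub; last by case/and3P: ad => _ /ltnW.
    by rewrite -(opprB (dv G d2)) cmod_expsum1N.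
  rewrite sE.
  apply: (le_trans (ler_wpM2l _ (phb d1 d2))); first by rewrite !mulr_ge0 ?cmod_ge0.
  rewrite -/(lsum d1 d2).
  have a0 : 0 <= sabs d1 * lsum d1 d2 by rewrite mulr_ge0 ?cmod_ge0.
  (* Two of the three factors are separated by the inequality between arithmetic and geometric
     means, so that [24] becomes twice [12]. The term with [d2] is a term of [f3] already; the other
     becomes one after [admissible_swap]. *)
  have := sqr_ge0 (sabs d2 - sabs (d2 + H - d1)).
  move: (sabs d1) (sabs d2) (sabs (d2 + H - d1)) (lsum _ _) a0 => a b c l a0 bc.
  by have := mulr_ge0 a0 bc; lra.
apply: (le_trans tri); set X := \sum_(d1 < 2 * H) \sum_(d2 < 2 * H) f3 d1 d2.
rewrite -[leRHS]/(24 * (h ^+ 2 * X)).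
have -> : 24 * (h ^+ 2 * X) = h ^+ 2 * (12 * (X + X)) by ring.
rewrite /X.
rewrite ler_wpM2l ?sqr_ge0//.
under eq_bigr => d1 _ do rewrite -mulr_sumr big_split /=.
rewrite -mulr_sumr ler_pM2l// big_split /=; apply: lerD.
  apply: ler_sum => d1 _; rewrite [leLHS]big_mkcond /=; apply: ler_sum => d2 _.
  case: ifP => _; last exact: f3_ge0.
  rewrite /f3 ler_wpM2l ?mulr_ge0 ?sqr_ge0 ?cmod_ge0//.
  apply: ler_sum => p1 _; apply: ler_sum => p2 _; apply: ler_sum => p3 _; exact: lcs_le.
apply: le_trans admissible_sum; apply: ler_sum => d1 _; apply: ler_sum => d2 ad.
exact: admissible_swap.
Qed.

(** The moments of [|S|] enter: order two by the mean value theorem, order one from it by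
    Cauchy-Schwarz, order four by the energy. *)
Lemma T3_bound : T3 G tau N M <=
  L ^+ 13 / N%:R * (M%:R ^+ 2 * (P * Num.sqrt P) + M%:R * Num.sqrt (P * E)).
Proof.
have s0 (d : 'I_(2 * H)) : 0 <= sabs d by exact: cmod_ge0.
pose mo p := moment (fun d : 'I_(2 * H) => sabs d) p.
have kb := kernel3_bound M0 s0 N0 NMZ.
have E0 : 0 <= E by exact: energy_ge0.
have m2 : mo 2%N <= 108 * L * P by exact: gridnorm_one.
have m4 : mo 4%N <= L ^+ 4 * E.
  have a1 (i : I) : cmod (1 : R[i]) <= 1 by rewrite cmod1.
  have := energy_gridnorm tauB tauT T1 TZ a1; rewrite expr1n mulr1; apply: le_trans.
  rewrite /mo /moment /gridnorm ler_pM2l// le_eqVlt; apply/orP; left; apply/eqP.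
  by apply: eq_bigr => d _; rewrite /sabs expsum1E.
have mo0 p : 0 <= mo p by apply: moment_ge0.
have m1 : mo 1%N <= L * Num.sqrt P.
  apply: le_sqrt_mul => //; first exact: ltW.
  have hH : h * (2 * H)%N%:R <= 82 / 10 by rewrite natrM; have := gH_le G; lra.
  have : mo 1%N ^+ 2 <= h * (2 * H)%N%:R * mo 2%N.
    rewrite /mo /moment exprMn expr2 -mulrA -[leRHS]mulrA ler_pM2l// [leRHS]mulrCA ler_pM2l//.
    have := sum_sqr_le (index_enum 'I_(2 * H)) (fun d => sabs d).
    rewrite (_ : size _ = (2 * H)%N); last by rewrite -[RHS]card_ord cardT enumT.
    by under eq_bigr => d _ do rewrite -[sabs d]expr1.
  move/le_trans; apply.
  apply: (@le_trans _ _ (82 / 10 * (108 * L * P))).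
    by apply: ler_pM => //; rewrite mulr_ge0// ltW.
  have -> : 82 / 10 * (108 * L * P) = (82 / 10 * 108) * (L * P) by ring.
  rewrite (expr2 L) -[leRHS]mulrA ler_wpM2r ?mulr_ge0 ?(ltW L0)//.
  by apply: le_trans (gL_ge G); lra.
have m2' : mo 2%N <= L ^+ 2 * P.
  apply: (le_trans m2); rewrite ler_wpM2r// expr2 ler_pM2r//.
  by apply: le_trans (gL_ge G); lra.
apply: (le_trans T3_le_kernel).
apply: (@le_trans _ _ (24 * (L * 2 ^+ 13 / N%:R *
  (4 * M%:R ^+ 2 * (mo 1%N * mo 2%N) +
    2 * M%:R * L ^+ 4 * Num.sqrt (mo 2%N * mo 4%N))))).
  by rewrite ler_pM2l.
have e1 : 4 * M%:R ^+ 2 * (mo 1%N * mo 2%N) <= 4 * (L ^+ 3 * (M%:R ^+ 2 * (P * Num.sqrt P))).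
  have -> : 4 * (L ^+ 3 * (M%:R ^+ 2 * (P * Num.sqrt P))) =
     4 * M%:R ^+ 2 * ((L * Num.sqrt P) * (L ^+ 2 * P)) by ring.
  by rewrite ler_wpM2l ?mulr_ge0 ?sqr_ge0// ler_pM.
have e2 : 2 * M%:R * L ^+ 4 * Num.sqrt (mo 2%N * mo 4%N) <=
    2 * (L ^+ 7 * (M%:R * Num.sqrt (P * E))).
  have sm : Num.sqrt (mo 2%N * mo 4%N) <= L ^+ 3 * Num.sqrt (P * E).
    rewrite -ler_sqr ?nnegrE ?mulr_ge0 ?sqrtr_ge0 ?exprn_ge0 ?(ltW L0)//.
    rewrite exprMn (sqr_sqrtr (mulr_ge0 (mo0 2%N) (mo0 4%N))) (sqr_sqrtr (mulr_ge0 P0 E0)).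
    have -> : L ^+ 3 ^+ 2 * (P * E) = (L ^+ 2 * P) * (L ^+ 4 * E) by ring.
    exact: ler_pM.
  have -> : 2 * (L ^+ 7 * (M%:R * Num.sqrt (P * E))) =
     2 * M%:R * L ^+ 4 * (L ^+ 3 * Num.sqrt (P * E)) by ring.
  by rewrite ler_wpM2l// !mulr_ge0 ?exprn_ge0 ?(ltW L0).
set A := M%:R ^+ 2 * (P * Num.sqrt P) in e1 *.
set B := M%:R * Num.sqrt (P * E) in e2 *.
have A0 : 0 <= A by rewrite mulr_ge0 ?sqr_ge0// mulr_ge0// sqrtr_ge0.
have B0 : 0 <= B by rewrite mulr_ge0 ?sqrtr_ge0.
have e3 : L ^+ 3 * A <= L ^+ 7 * A by rewrite ler_wpM2r//; apply: ler_weXn2l.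
have LA : 0 <= L ^+ 7 * B by rewrite mulr_ge0// ltW.
have e4 := lerD e1 e2.
have e5 : 4 * (L ^+ 3 * A) + 2 * (L ^+ 7 * B) <= 4 * (L ^+ 7 * (A + B)) by lra.
have c0 : 0 <= 24 * (L * 2 ^+ 13 / N%:R) :> R.
  by rewrite mulr_ge0// divr_ge0// mulr_ge0 ?exprn_ge0// ltW.
rewrite mulrA; apply: (le_trans (ler_wpM2l c0 (le_trans e4 e5))).
have -> : 24 * (L * 2 ^+ 13 / N%:R) * (4 * (L ^+ 7 * (A + B))) =
  (96 * 2 ^+ 13) * (L ^+ 8 * ((A + B) / N%:R)) by field; rewrite gt_eqF.
have -> : L ^+ 13 / N%:R * (A + B) = L ^+ 5 * (L ^+ 8 * ((A + B) / N%:R)).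
  by field; rewrite gt_eqF.
rewrite ler_wpM2r//.
  by rewrite mulr_ge0 ?divr_ge0 ?addr_ge0// ltW.
by apply: (@L_pow_le _ _ _ 2) => //; lra.
Qed.

End TraceBounds.

(** * Exponents *)

Section Exponents.
Variable R : realType.
Implicit Types lm nu rho et sg al mu th ga : R.

(* [lm], [nu], [rho], [et], [sg] and [al] stand for the logarithms of [gL], of
   [N], of the number of points, of their energy, of [V] and of the bound for
   the coefficients; [mu] and [th] for those of [M] and of the length of the
   interval. The two long hypotheses are the trace and the energy bounds. *)
Lemma middle_exponents lm nu rho et sg al : 0 <= lm -> 0 <= nu -> 0 <= al ->
  7 / 10 * nu <= sg -> sg <= 4 / 5 * nu ->
  let mu := nu / 5 + lm in let th := 6 / 5 * nu in let ga := nu + lm - 2 / 3 * al in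
  3 * (2 * sg + rho - ga - nu - 2 * lm) <= 5 * lm +
    Num.max (29 * lm - nu + rho +
        Num.max (Num.max (mu + rho / 2) rho) (5 / 8 * rho + th / 4))
      (14 * lm - nu + Num.max (2 * mu + 3 / 2 * rho) (mu + (rho + et) / 2)) ->
  2 * sg + et <= 2 * al + 47 * lm +
    Num.max (Num.max (2 * nu) (nu + mu) + (rho + et) / 2)
      (nu + (Num.max (2 * rho) (5 / 4 * rho + th / 2) +
             Num.max (4 * rho) (3 / 4 * et + rho + th / 2)) / 2) ->
  rho <= 18 / 5 * nu - 4 * sg + 1000 * lm.
Proof.
move=> l0 n0 a0 s1 s2 /=.
(* Every choice of the dominant terms leaves a linear problem. The factor [A^2] of the energy bound,
   [2 * al] here, is offset by [- 2 / 3 * al] in [ga], which enters with the factor [3]. *)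
rewrite !maxEle; do ![case: ifP => _]; lra.
Qed.

Lemma high_exponents lm nu rho sg : 0 <= lm -> 0 <= nu -> 4 / 5 * nu <= sg ->
  let th := 2 * sg - 2 / 5 * nu in let mu := 2 * sg - 7 / 5 * nu + lm in
  let ga := nu + lm in rho <= th + lm ->
  2 * (2 * sg + rho - ga - nu - 2 * lm) <= 29 * lm - nu + rho +
    Num.max (Num.max (mu + rho / 2) rho) (5 / 8 * rho + th / 4) ->
  rho <= 2 * nu - 2 * sg + 1000 * lm.
Proof.
move=> l0 n0 s1 /= rt.
rewrite !maxEle; do ![case: ifP => _]; lra.
Qed.

End Exponents.

Lemma energy_gt0 (R : realType) (I : finType) (tau : I -> R) : (0 < #|I|)%N ->
  0 < energy tau.
Proof.
move=> /card_gt0P[i _]; rewrite /energy (bigD1 (i, i))//= ltr_wpDr//.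
  exact: sumr_ge0.
by rewrite ltr0n; apply/card_gt0P; exists (i, i); rewrite inE.
Qed.

Section LogarithmicBounds.
Variables (R : realType) (G : grid R).
Notation Z := (gZ G).
Notation L := (gL G).
Variables (I : finType) (tau : I -> R) (T : R).
Hypotheses (tauB : multiplicity_le tau 2) (tauT : forall i, 0 <= tau i <= T).
Hypotheses (T1 : 1 <= T) (TZ : tall Z (2 * T)).
Notation P := (#|I|%:R : R).
Notation E := (energy tau).
Variables (N M : nat).
Hypotheses (N0 : (0 < N)%N) (M0 : (0 < M)%N) (NMZ : room 10 (N * M) Z).
Hypotheses (MZ : room 46 (M ^ 4) Z) (TNM : T <= N%:R * M%:R).
Hypothesis I0 : (0 < #|I|)%N.
Variables (ns : seq nat) (c : nat -> R[i]).
Hypotheses (nsu : uniq ns) (nsb : {subset ns <= box N}).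
Variables (lm nu rho et mu th sg ga al : R).
Hypotheses (LE : L = expR lm) (NE : N%:R = expR nu) (PE : P = expR rho).
Hypotheses (Mmu : M%:R <= expR mu) (Tth : T <= expR th).
Hypothesis cG : \sum_(n <- ns) cmod (c n) ^+ 2 <= expR ga.
Hypothesis DV : forall i, expR sg <= cmod (dsum G ns c (tau i)).

Let L0 : 0 < L. Proof. exact: gL_gt0. Qed.
Let L1 : 1 <= L. Proof. exact: gL_ge1. Qed.
Let lm0 : 0 <= lm. Proof. by rewrite -ler_expR expR0 -LE. Qed.
Let LX k : L ^+ k = expR (k%:R * lm). Proof. by rewrite expRM_natl -LE. Qed.
Let P1 : 1 <= P. Proof. by rewrite ler1n. Qed.
Let P0 : 0 <= P. Proof. by []. Qed.
Let T0 : 0 <= T. Proof. by have := T1; lra. Qed.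
Let TZ2 : T <= Z%:R.
Proof.
apply: le_trans TZ; have : 2 * T + 1 <= (2 * T + 1) ^+ 4.
  by rewrite -[leLHS]expr1; apply: ler_weXn2l => //; have := T1; lra.
have : 1 <= 2 ^+ 80 :> R by rewrite exprn_ege1// ler1n.
have := T1; nra.
Qed.

Let L648 : 648 <= L. Proof. by apply: le_trans (gL_ge G); lra. Qed.
Let L40 : 40 <= L. Proof. by apply: le_trans L648; rewrite ler_nat. Qed.

(** Sums become maxima of exponents at the cost of one factor [gL], so all later estimates are
    linear in the exponents. *)
Lemma expR_add_le x y : expR x + expR y <= expR (lm + Num.max x y).
Proof.
rewrite expRD -LE.
have l2 : 2 <= L by apply: le_trans (gL_ge G); lra.
apply: (@le_trans _ _ (2 * expR (Num.max x y))).
  have : expR x <= expR (Num.max x y) by rewrite ler_expR le_max lexx.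
  have : expR y <= expR (Num.max x y) by rewrite ler_expR le_max lexx orbT.
  lra.
by rewrite ler_pM2r ?expR_gt0.
Qed.

Lemma le_expR_add (x y a b : R) : x <= expR a -> y <= expR b -> x + y <= expR (lm + Num.max a b).
Proof. by move=> xa yb; apply: le_trans (expR_add_le a b); exact: lerD. Qed.

Lemma le_expR_mul (x y a b : R) : 0 <= x -> 0 <= y ->
  x <= expR a -> y <= expR b -> x * y <= expR (a + b).
Proof. by move=> x0 y0 xa yb; rewrite expRD; exact: ler_pM. Qed.

Lemma sqrt_le_expR (x a : R) : x <= expR a -> Num.sqrt x <= expR (a / 2).
Proof.
move=> xa; apply: (le_trans (ler_wsqrtr xa)).
have -> : expR a = expR (a / 2) ^+ 2 by rewrite -expRM_natl; congr expR; field.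
by rewrite sqrtr_sqr gtr0_norm// expR_gt0.
Qed.

Lemma points_mean_value : 2 * sg + rho <= 3 * lm + nu + mu + ga.
Proof.
have := mean_value_points tauB tauT TZ2 N0 M0 NMZ TNM nsu nsb cG (expR_ge0 sg) DV.
have b : L ^+ 3 * N%:R * M%:R * expR ga <= L ^+ 3 * N%:R * expR mu * expR ga.
  by rewrite ler_wpM2r ?expR_ge0// ler_wpM2l// mulr_ge0// exprn_ge0// ltW.
by move=> /le_trans /(_ b); rewrite LX NE PE -expRM_natl -!expRD ler_expR; lra.
Qed.

Let sqP : Num.sqrt P <= expR (rho / 2).
Proof. by apply: sqrt_le_expR; rewrite PE. Qed.

Lemma W2_le : W2 I T <= expR (5 / 4 * rho + th / 2).
Proof.
have s0 : 0 <= Num.sqrt P by exact: sqrtr_ge0.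
have p0 := mulr_ge0 P0 s0.
rewrite (_ : 5 / 4 * rho + th / 2 = (rho + (th + (rho + rho / 2))) / 2); last by field.
apply: sqrt_le_expR; apply: le_expR_mul => //; [exact: mulr_ge0|by rewrite PE|].
by apply: le_expR_mul => //; apply: le_expR_mul => //; rewrite PE.
Qed.

Definition mx2 : R := Num.max (Num.max (mu + rho / 2) rho) (5 / 8 * rho + th / 4).

Lemma T2_log : T2 G tau N M <= expR (29 * lm - nu + rho + mx2).
Proof.
have t2 : tau2 I T M <= expR (rho + (2 * lm + mx2)).
  rewrite /tau2; apply: le_expR_mul => //; first by rewrite PE.
  apply: (@le_trans _ _ (expR (lm + Num.max (lm + Num.max (mu + rho / 2) rho) (5 / 8 * rho + th / 4)))).
    apply: le_expR_add.
      apply: le_expR_add; last by rewrite PE.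
      by apply: le_expR_mul => //; exact: sqrtr_ge0.
    rewrite (_ : 5 / 8 * rho + th / 4 = (5 / 4 * rho + th / 2) / 2); last by field.
    exact: sqrt_le_expR W2_le.
  rewrite ler_expR /mx2; set a := Num.max (mu + _) _; set b := _ + th / 4.
  have lm' := lm0; have [] := leP (lm + a) b; have [] := leP a b; lra.
have := T2_bound tauB tauT T1 TZ N0 M0 NMZ MZ P1.
have c0 : 0 <= L ^+ 27 / N%:R by rewrite divr_ge0// exprn_ge0// ltW.
move=> /le_trans /(_ (ler_wpM2l c0 t2)) /le_trans; apply.
rewrite LX NE -expRN -!expRD ler_expR; lra.
Qed.

Hypothesis EE : E = expR et.

Lemma T3_log : T3 G tau N M <=
  expR (14 * lm - nu + Num.max (2 * mu + 3 / 2 * rho) (mu + (rho + et) / 2)).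
Proof.
have c0 : 0 <= L ^+ 13 / N%:R by rewrite divr_ge0// exprn_ge0// ltW.
have E0 : 0 <= E by exact: energy_ge0.
have t3 : M%:R ^+ 2 * (P * Num.sqrt P) + M%:R * Num.sqrt (P * E) <=
  expR (lm + Num.max (2 * mu + 3 / 2 * rho) (mu + (rho + et) / 2)).
  apply: le_expR_add.
    rewrite (_ : 3 / 2 * rho = rho + rho / 2); last by field.
    apply: le_expR_mul => //.
      by rewrite expRM_natl; apply: lerXn2r; rewrite ?nnegrE ?expR_ge0.
    by apply: le_expR_mul => //; rewrite PE.
  apply: le_expR_mul => //.
  by apply: sqrt_le_expR; apply: le_expR_mul => //; rewrite ?PE ?EE.
have := T3_bound tauB tauT T1 TZ N0 M0 NMZ.
move=> /le_trans /(_ (ler_wpM2l c0 t3)) /le_trans; apply.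
rewrite LX NE -expRN -!expRD ler_expR; lra.
Qed.

(** [trace_dichotomy] with [z = exp w]. The [2 * lm] subtracted in [w] absorb the constant [2^13];
    the remaining [2 * lm] of the hypothesis give [216 L <= L^2 <= z]. *)
Lemma dichotomy_log : 4 * lm <= 2 * sg + rho - ga - nu ->
  2 * (2 * sg + rho - ga - nu - 2 * lm) <= 29 * lm - nu + rho + mx2 /\
  3 * (2 * sg + rho - ga - nu - 2 * lm) <= 5 * lm +
    Num.max (29 * lm - nu + rho + mx2)
      (14 * lm - nu + Num.max (2 * mu + 3 / 2 * rho) (mu + (rho + et) / 2)).
Proof.
set w := 2 * sg + rho - ga - nu - 2 * lm => ze.
have z1 : expR w * (2 ^+ 13 * expR ga * N%:R) <= expR sg ^+ 2 * P.
  have a2 : 2 ^+ 13 <= L ^+ 2 by apply: (@L_pow_le _ _ _ 2) => //; apply: ler_weXn2l => //; rewrite ler1n.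
  apply: (@le_trans _ _ (expR w * (L ^+ 2 * expR ga * N%:R))).
    by rewrite ler_pM2l ?expR_gt0// ler_wpM2r// ler_wpM2r ?expR_ge0.
  rewrite LX NE PE -expRM_natl -!expRD ler_expR /w; lra.
have z2 : 216 * L <= expR w.
  have a2 : 216 <= L by apply: le_trans (gL_ge G); lra.
  apply: (@le_trans _ _ (L ^+ 2)); first by rewrite expr2 ler_pM2r.
  rewrite LX ler_expR /w; lra.
have [t2 t3] := trace_dichotomy tauB tauT TZ2 N0 M0 NMZ TNM nsu nsb cG (expR_ge0 sg) DV
  (expR_gt0 w) (expR_gt0 sg) I0 z1 z2.
rewrite -expRM_natl in t2; rewrite -expRM_natl in t3.
split; first by rewrite -ler_expR; apply: (le_trans t2); exact: T2_log.
rewrite -ler_expR; apply: (le_trans t3).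
set x := 29 * lm - _ + _ + _; set u := 14 * lm - nu + _.
have h1 : L * T2 G tau N M <= expR (lm + x) by rewrite expRD -LE ler_pM2l//; exact: T2_log.
have h2 : T3 G tau N M <= expR (lm + u).
  by apply: (le_trans T3_log); rewrite ler_expR -/u; have := lm0; lra.
have a2 := L648.
apply: (@le_trans _ _ (L * expR (lm + Num.max (lm + x) (lm + u)))).
  apply: (@le_trans _ _ (648 * (expR (lm + x) + expR (lm + u)))).
    have := expR_ge0 (lm + u); lra.
  apply: (@le_trans _ _ (L * (expR (lm + x) + expR (lm + u)))).
    by rewrite ler_wpM2r// addr_ge0 ?expR_ge0.
  by rewrite ler_pM2l// expR_add_le.
have -> : Num.max (lm + x) (lm + u) = lm + Num.max x u by rewrite addr_maxr.
rewrite [X in X * _]LE -expRD ler_expR; move: (Num.max x u) => m; have := lm0; lra.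
Qed.

Variables (q : nat) (kap : I -> nat).
Hypotheses (q0 : (0 < q)%N) (tauq : forall i, tau i = (kap i)%:R / (2 * q%:R)).
Hypotheses (cA : forall n, cmod (c n) <= expR al).

Lemma energy_log : mu <= rho -> 2 * sg + et <= 2 * al + 47 * lm +
  Num.max (Num.max (2 * nu) (nu + mu) + (rho + et) / 2)
    (nu + (Num.max (2 * rho) (5 / 4 * rho + th / 2) +
           Num.max (4 * rho) (3 / 4 * et + rho + th / 2)) / 2).
Proof.
move=> mr; have MP : M%:R <= P by apply: (le_trans Mmu); rewrite PE ler_expR.
have fin m : 2 * sg + et <= lm + 2 * al + (44 * lm + (lm + (lm + m))) ->
    2 * sg + et <= 2 * al + 47 * lm + m by lra.
have E0 : 0 <= E by exact: energy_ge0.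
have MZ2 : room 28 (M ^ 2) Z.
  by apply: leq_trans MZ; apply: leq_mul; [rewrite leq_exp2l|rewrite leq_pexp2l].
have ec := energy_cubes tauB N0 M0 NMZ q0 tauq nsu nsb cA (expR_ge0 sg) DV.
have cb := cubes_bound tauB tauT T1 TZ N0 M0 NMZ TNM P1 MP MZ2.
have w4 : W4 tau T <= expR (3 / 4 * et + rho + th / 2).
  rewrite (_ : 3 / 4 * et + rho + th / 2 = (et + (th + (2 * rho + et / 2))) / 2); last by field.
  apply: sqrt_le_expR; apply: le_expR_mul => //; [|by rewrite EE|].
    by rewrite mulr_ge0// mulr_ge0 ?sqr_ge0 ?sqrtr_ge0.
  apply: le_expR_mul => //.
  apply: le_expR_mul; rewrite ?sqr_ge0 ?sqrtr_ge0//.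
    by rewrite expRM_natl PE.
  by apply: sqrt_le_expR; rewrite EE.
have w40 : 0 <= W4 tau T by exact: sqrtr_ge0.
have w20 : 0 <= W2 I T by exact: sqrtr_ge0.
set b := Num.max (4 * rho) _; set a := Num.max (2 * rho) _.
have eg : energy_gam tau T <= expR (lm + (a + b) / 2).
  rewrite (_ : lm + (a + b) / 2 = ((lm + a) + (lm + b)) / 2); last by field.
  apply: sqrt_le_expR; apply: le_expR_mul.
  - by rewrite addr_ge0 ?sqr_ge0.
  - by rewrite addr_ge0 ?exprn_ge0.
  - by apply: le_expR_add; [rewrite expRM_natl PE|exact: W2_le].
  - by apply: le_expR_add; [rewrite expRM_natl PE|exact: w4].
set d := Num.max (2 * nu) _; set r := (rho + et) / 2.
have f1 : (N%:R ^+ 2 + N%:R * M%:R) * Num.sqrt (P * E) <= expR (lm + d + r).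
  apply: le_expR_mul; rewrite ?sqrtr_ge0//.
  - apply: le_expR_add; first by rewrite expRM_natl NE.
    by apply: le_expR_mul => //; rewrite NE.
  - by apply: sqrt_le_expR; apply: le_expR_mul => //; rewrite ?PE ?EE.
have f2 : N%:R * energy_gam tau T <= expR (nu + (lm + (a + b) / 2)).
  by apply: le_expR_mul => //; rewrite ?sqrtr_ge0 ?NE.
have f := le_expR_add f1 f2.
have A20 : 0 <= expR al ^+ 2 by rewrite sqr_ge0.
have : expR sg ^+ 2 * E <= L * expR al ^+ 2 * (L ^+ 44 * expR (lm + Num.max (lm + d + r) (nu + (lm + (a + b) / 2)))).
  apply: (le_trans ec); apply: ler_pM.
  - by rewrite mulr_ge0.
  - by apply: sumr_ge0 => m _; apply: sumr_ge0 => n _; rewrite exprn_ge0 ?cmod_ge0.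
  - by rewrite ler_wpM2r// L40.
  - by apply: (le_trans cb); rewrite ler_wpM2l ?exprn_ge0// ltW.
rewrite LX EE [X in _ <= X * _ * _]LE -!expRM_natl -!expRD ler_expR.
have -> : Num.max (lm + d + r) (nu + (lm + (a + b) / 2)) =
  lm + Num.max (d + r) (nu + (a + b) / 2).
  by rewrite [RHS]addr_maxr; f_equal; ring.
exact: fin.
Qed.

Lemma low_points : ga = nu + lm -> rho <= 2 * nu + mu - 2 * sg + 1000 * lm.
Proof. by move=> gE; have := points_mean_value; have := lm0; rewrite gE; lra. Qed.

Let nu0 : 0 <= nu.
Proof. by rewrite -ler_expR expR0 -NE ler1n. Qed.

Lemma high_points : mu = 2 * sg - 7 / 5 * nu + lm -> th = 2 * sg - 2 / 5 * nu ->
  ga = nu + lm -> 4 / 5 * nu <= sg -> rho <= 2 * nu - 2 * sg + 1000 * lm.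
Proof.
move=> muE thE gE s1; have rt : rho <= th + lm.
  have four : 4 <= L by apply: le_trans L40; rewrite ler_nat.
  rewrite -ler_expR -PE expRD -LE mulrC; apply: (@le_trans _ _ (2 * (T + 1))).
    exact: card_le_T tauB tauT T1.
  apply: (@le_trans _ _ (4 * T)); first by have := T1; lra.
  by apply: ler_pM.
have /orP[far|] := orbN (2 * nu - 2 * sg + 1000 * lm < rho); last by rewrite -leNgt.
have cond : 4 * lm <= 2 * sg + rho - ga - nu by rewrite gE; have := lm0; lra.
have [d _] := dichotomy_log cond.
apply: (@high_exponents R lm nu rho sg) => //=; first by rewrite -thE.
by move: d; rewrite /mx2 muE thE gE.
Qed.

Lemma middle_points : 0 <= al -> ga = nu + lm - 2 / 3 * al -> mu = nu / 5 + lm ->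
  th = 6 / 5 * nu -> 7 / 10 * nu <= sg -> sg <= 4 / 5 * nu ->
  rho <= 18 / 5 * nu - 4 * sg + 1000 * lm.
Proof.
move=> a0 gE muE thE s1 s2.
(* If the claim fails, [rho] is so large that both the hypothesis of the dichotomy and [M <= P]
   hold; the exponents then contradict the failure. *)
have /orP[far|] := orbN (18 / 5 * nu - 4 * sg + 1000 * lm < rho); last by rewrite -leNgt.
have cond : 4 * lm <= 2 * sg + rho - ga - nu by rewrite gE; have := lm0; lra.
have [_ d] := dichotomy_log cond.
have mr : mu <= rho by rewrite muE; have := lm0; lra.
have e := energy_log mr.
apply: (@middle_exponents R lm nu rho et sg al) => //=.
  by move: d; rewrite /mx2 muE thE gE.
by move: e; rewrite muE thE.
Qed.

End LogarithmicBounds.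

Section GridExistence.
Variable R : realType.

Lemma logn_sum_widen (f : nat -> nat) n B : (0 < n)%N -> (n < B)%N ->
  (\sum_(0 <= p < n.+1) logn p n * f p = \sum_(0 <= p < B) logn p n * f p)%N.
Proof.
move=> n0 nB; rewrite [RHS](big_cat_nat (leq0n n.+1) nB)/=.
rewrite [X in (_ = _ + X)%N]big_nat [X in (_ = _ + X)%N]big1 ?addn0// => p /andP[np _].
by rewrite lognE; case: ifP => // /and3P[_ _ /(dvdn_leq n0)/(leq_trans np)]; rewrite ltnn.
Qed.

Lemma ln_prime_factors n : (0 < n)%N ->
  ln (n%:R : R) = \sum_(0 <= p < n.+1) (logn p n)%:R * ln p%:R.
Proof.
move=> n0; rewrite -[in LHS](partnT n0) /partn natr_prod.
suff: 0 < \prod_(0 <= p < n.+1) (p ^ logn p n)%:R :> R /\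
   ln (\prod_(0 <= p < n.+1) (p ^ logn p n)%:R : R) =
     \sum_(0 <= p < n.+1) (logn p n)%:R * ln p%:R by case.
elim: n.+1 => [|B [B0 IH]]; first by rewrite !big_nil ln1 ltr01.
rewrite !big_nat_recr//=.
have pp : 0 < (B ^ logn B n)%:R :> R.
  by rewrite ltr0n expn_gt0; case: B {B0 IH} => //; rewrite logn0.
split; first by rewrite mulr_gt0.
rewrite lnM ?posrE// IH; congr (_ + _); rewrite natrX.
have [->|B1] := posnP B; first by rewrite lognE /= mul0r expr0 ln1.
by rewrite lnXn ?ltr0n// mulr_natl.
Qed.

(** Each [ln p] is rounded down to a multiple of [h], and [ell] is extended from primes by complete
    additivity. The error at [n] is at most [h] times the number of its prime factors, hence at most
    [Z h]; the choice [h = Z^(-10)] leaves ample room. *)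
Lemma grid_exists (Z : nat) (L : R) : (2 ^ 10 <= Z)%N -> 2 ^+ 10 <= L ->
  (forall n, (0 < n <= Z)%N -> (size (divisors n))%:R <= L) ->
  (3 * (trunc_log 2 Z).+1).+1%:R <= L ->
  exists G : grid R, gZ G = Z /\ gL G = L.
Proof.
move=> Z10 L10 DL JL; pose h : R := Z%:R ^- 10.
have Zp : (0 < Z)%N by apply: leq_trans Z10.
have ZR : 0 < Z%:R :> R by rewrite ltr0n.
have h0 : 0 < h by rewrite invr_gt0 exprn_gt0.
pose f (p : nat) : nat := Num.truncn (ln (p%:R : R) / h).
pose ell n : nat := (\sum_(0 <= p < n.+1) logn p n * f p)%N.
have L0 : 0 <= L by apply: le_trans L10.
have ellM m n : (0 < m)%N -> (0 < n)%N -> ell (m * n)%N = (ell m + ell n)%N.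
  move=> m0 n0; have mn0 : (0 < m * n)%N by rewrite muln_gt0 m0.
  rewrite /ell (@logn_sum_widen f m (m * n).+1)//; last by rewrite ltnS leq_pmulr.
  rewrite (@logn_sum_widen f n (m * n).+1)//; last by rewrite ltnS leq_pmull.
  by rewrite -big_split/=; apply: eq_bigr => p _; rewrite lognM// mulnDl.
have fP p : (0 < p)%N -> `|h * (f p)%:R - ln p%:R| <= h.
  move=> p0; have lp : 0 <= ln (p%:R : R) / h by rewrite divr_ge0 ?ln_ge0 ?ler1n// ltW.
  have /andP[t1 t2] := truncn_itv lp; rewrite -/(f p) in t1 t2.
  have e : ln p%:R = h * (ln (p%:R : R) / h) by rewrite mulrC divfK// gt_eqF.
  rewrite {1}e -mulrBr normrM (gtr0_norm h0) ler_piMr ?(ltW h0)// ler_norml.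
  by move: t2; rewrite -natr1; lra.
have close n : (0 < n <= Z)%N -> `|h * (ell n)%:R - ln n%:R| * Z%:R ^+ 4 <= 1.
  move=> /andP[n0 nZ].
  have b1 : `|h * (ell n)%:R - ln n%:R| <= \sum_(0 <= p < n.+1) (logn p n)%:R * h.
    rewrite ln_prime_factors// /ell natr_sum mulr_sumr -sumrB.
    apply: (le_trans (ler_norm_sum _ _ _)); apply: ler_sum_nat => p _.
    rewrite natrM mulrCA -mulrBr normrM normr_nat.
    have [->|p0] := posnP p; first by rewrite lognE /= !mul0r.
    by rewrite ler_wpM2l// fP.
  (* [2] to the number of prime factors of [n], counted with multiplicity, is at most [n]. *)
  have b2 : (\sum_(0 <= p < n.+1) logn p n <= n)%N.
    have : (2 ^ (\sum_(0 <= p < n.+1) logn p n) <= n)%N.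
      rewrite -[leqRHS](partnT n0) /partn expn_sum; apply: leq_prod => p _.
      have [pp|np] := boolP (prime p); last by rewrite lognE (negbTE np).
      by have [->//|e0] := posnP (logn p n); rewrite leq_exp2r// prime_gt1.
    by apply: leq_trans; apply/ltnW/ltn_expl.
  have b3 : `|h * (ell n)%:R - ln n%:R| <= Z%:R * h.
    apply: (le_trans b1); rewrite -mulr_suml ler_pM2r// -natr_sum ler_nat.
    exact: leq_trans nZ.
  apply: (@le_trans _ _ (Z%:R * h * Z%:R ^+ 4)); first by rewrite ler_wpM2r// exprn_ge0// ltW.
  rewrite /h (_ : Z%:R * Z%:R ^- 10 * Z%:R ^+ 4 = Z%:R ^- 5); last by field; rewrite gt_eqF.
  by rewrite invf_le1 ?exprn_gt0// exprn_ege1// ler1n.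
have JZ : Z%:R ^+ 3 <= 2 ^+ (3 * (trunc_log 2 Z).+1) :> R.
  by rewrite mulnC exprM lerXn2r ?nnegrE// -natrX ler_nat ltnW// trunc_log_ltn.
have hZ : h * Z%:R ^+ 10 <= 1 by rewrite mulVf// gt_eqF ?exprn_gt0.
have DD n : (0 < n <= Z)%N -> (size (divisors n) <= Num.truncn L)%N.
  by move=> /DL; rewrite truncn_ge_nat.
have DL' : (Num.truncn L)%:R <= L by have /andP[] := truncn_itv L0.
by exists (Grid h0 ellM close hZ Z10 JZ JL DD DL' L10).
Qed.

(** The divisor numbers up to [Z] and the number of dyadic layers are both of order at most [Z^e].
    The prescribed lower bound [B] for the constant later makes [gL] majorise the constant of the
    hypothesis on the coefficients. *)
Lemma grid_subpoly (e B : R) : 0 < e -> exists2 K : R, B <= K &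
  forall Z : nat, (2 ^ 10 <= Z)%N -> exists G : grid R, gZ G = Z /\ gL G = K * Z%:R `^ e.
Proof.
move=> e0; have [K1 K10 K1P] := size_divisors_subpoly e0.
pose b := 4 + 3 / (e * ln 2); have l2 : 0 < ln 2 :> R by rewrite ln_gt0// ltr1n.
have b0 : 0 < b by rewrite addr_gt0// divr_gt0// mulr_gt0.
exists (`|B| + 2 ^+ 10 + K1 + b).
  by have := ler_norm B; have := @exprn_gt0 R 2 10; lra.
move=> Z Z10; have Z0 : (0 < Z)%N by apply: leq_trans Z10.
have Ze : 1 + e * ln Z%:R <= Z%:R `^ e.
  by rewrite /powR pnatr_eq0 -leqn0 leqNgt Z0 expR_ge1Dx.
have lZ : 0 <= ln (Z%:R : R) by rewrite ln_ge0// ler1n.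
have Ze1 : 1 <= Z%:R `^ e by apply: le_trans Ze; rewrite lerDl mulr_ge0// ltW.
have B0 := normr_ge0 B; have p10 : 0 <= 2 ^+ 10 :> R by rewrite exprn_ge0.
have Kge (x y : R) : 0 <= x -> x <= y -> x <= y * Z%:R `^ e.
  by move=> x0 xy; rewrite (le_trans xy)// ler_peMr// (le_trans x0).
apply: grid_exists => //.
- apply: Kge => //; lra.
- move=> n /andP[n0 nZ]; apply: (le_trans (K1P n n0)).
  apply: ler_pM; [exact: ltW|exact: powR_ge0|lra|].
  by apply: ge0_ler_powR; rewrite ?nnegrE ?ler_nat// ltW.
- apply: (@le_trans _ _ (b * Z%:R `^ e)); last by rewrite ler_wpM2r ?powR_ge0//; lra.
  set t := trunc_log 2 Z.
  have tZ : t%:R * (e * ln 2) <= Z%:R `^ e.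
    have : 2 ^+ t <= Z%:R :> R by rewrite -natrX ler_nat trunc_logP.
    rewrite -ler_ln ?posrE ?exprn_gt0 ?ltr0n// lnXn// -[ln 2 *+ t]mulr_natl => tl.
    apply: (@le_trans _ _ (e * ln Z%:R)); last by lra.
    by rewrite mulrCA ler_pM2l.
  have t3 : t%:R * 3 <= 3 / (e * ln 2) * Z%:R `^ e.
    rewrite mulrAC [3 * _]mulrC -[leRHS]mulrA [leRHS]mulrC mulrAC -mulrA.
    by rewrite mulrC ler_pM2l// ler_pdivlMr ?mulr_gt0.
  have -> : (3 * t.+1).+1%:R = t%:R * 3 + 4 :> R.
    by rewrite -addn1 natrD (natrM _ 3) -[t.+1%:R]natr1; ring.
  by rewrite /b mulrDl addrC lerD// ler_peMr.
Qed.

End GridExistence.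

Section Blocks.
Variables (R : realType) (G : grid R) (q : nat) (V : R) (ns : seq nat).
Hypothesis q0 : (0 < q)%N.

Definition lattice (I : Type) (kap : I -> nat) (i : I) : R := (kap i)%:R / (2 * q%:R).

(** Translating a block to the origin multiplies each [c n] by a unimodular number, so the bound for
    one interval applies to every block with coefficients of the same moduli. Working with the
    numerators [kap] makes the translation exact. *)
Lemma block_decomposition (T T0 : nat) (X : R) (I : finType) (kap : I -> nat)
    (c : nat -> R[i]) :
  (0 < T0)%N -> (forall i, kap i <= 2 * q * T)%N ->
  multiplicity_le (lattice kap) 2 ->
  (forall i, V <= cmod (dsum G ns c (lattice kap i))) ->
  (forall (J : finType) (kap' : J -> nat) (c' : nat -> R[i]),
     multiplicity_le (lattice kap') 2 -> (forall j, kap' j <= 2 * q * T0)%N ->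
     (forall n, cmod (c' n) = cmod (c n)) ->
     (forall j, V <= cmod (dsum G ns c' (lattice kap' j))) -> #|J|%:R <= X) ->
  #|I|%:R <= (T%:R / T0%:R + 1) * X.
Proof.
move=> T00 kT mul DV bd.
set D := (2 * q * T0)%N; have D0 : (0 < D)%N by rewrite !muln_gt0 q0 T00.
have qR : 2 * q%:R != 0 :> R by rewrite mulf_neq0 ?pnatr_eq0// -lt0n.
pose nb := (T %/ T0).+1.
have fb i : (kap i %/ D < nb)%N.
  have -> : nb = ((2 * q * T) %/ D).+1 by rewrite /nb divnMl// muln_gt0.
  by rewrite ltnS leq_div2r.
pose J (b : nat) : finType := {i | (kap i %/ D)%N == b}.
have -> : (#|I|%:R : R) = \sum_(b < nb) #|J b|%:R.
  rewrite -natr_sum -sum1_card; congr (_%:R).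
  rewrite (partition_big (fun i => Ordinal (fb i)) xpredT)//=.
  apply: eq_bigr => b _; rewrite card_sig -sum1_card; apply: eq_bigl => i.
  by rewrite !inE -val_eqE.
have blk (b : nat) : #|J b|%:R <= X.
  pose k' (j : J b) := (kap (val j) %% D)%N.
  have kE (j : J b) : kap (val j) = (b * D + k' j)%N.
    by rewrite {1}(divn_eq (kap (val j)) D) (eqP (valP j)).
  have tE (j : J b) : lattice kap (val j) = (b * T0)%N%:R + lattice k' j.
    rewrite /lattice kE natrD mulrDl; congr (_ + _).
    by rewrite /D !natrM; field; move: qR; rewrite mulf_eq0 negb_or => /andP[].
  apply: (bd (J b) k' (fun n => c n * cis ((b * T0)%N%:R * lam G n))).
  - move=> x; have := mul (x + (b * T0)%N%:R); apply: leq_trans.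
    rewrite -(card_imset _ val_inj); apply: subset_leq_card; apply/fintype.subsetP => i /imsetP[j].
    rewrite !inE => /andP[x1 x2] ->; rewrite tE; lra.
  - by move=> j; apply/ltnW/ltn_pmod.
  - by move=> n; rewrite cmodM cmod_cis mulr1.
  - move=> j; apply: (le_trans (DV (val j))).
    rewrite le_eqVlt; apply/orP; left; apply/eqP; congr cmod.
    by apply: eq_bigr => n _; rewrite tE mulrDl cisD mulrA.
have X0 : 0 <= X by apply: le_trans (blk 0%N).
apply: (@le_trans _ _ (\sum_(b < nb) X)); first exact: ler_sum.
rewrite sumr_const card_ord -[leLHS]mulr_natl ler_wpM2r// -natr1 lerD2r.
by rewrite ler_pdivlMr ?ltr0n// -natrM ler_nat leq_divM.
Qed.

End Blocks.

Lemma leq_pow2_mul (k l x y : nat) : (k <= l)%N -> (x <= y)%N ->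
  (2 ^ k * x <= 2 ^ l * y)%N.
Proof. by move=> kl xy; rewrite leq_mul// leq_pexp2l. Qed.

Lemma leq_pow2_mul_add (k j l x : nat) : (k + j <= l)%N ->
  (2 ^ k * (2 ^ j * x) <= 2 ^ l * x)%N.
Proof. by move=> kl; rewrite mulnA -expnD; apply: leq_pow2_mul. Qed.

Lemma inv_le_twice (R : realType) (x t : R) : 0 < x -> 0 < t -> x <= 2 * t ->
  t^-1 <= 2 * x^-1.
Proof.
by move=> x0 t0 xt; rewrite ler_pdivlMr// mulrC ler_pdivrMr.
Qed.

Section FixedGrid.
Variables (R : realType) (G : grid R) (q : nat) (ns : seq nat).
Hypotheses (q0 : (0 < q)%N) (nsu : uniq ns).
Variables (N T : nat).
Hypotheses (N0 : (0 < N)%N) (T1 : (0 < T)%N) (nsb : {subset ns <= box N}).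
Hypothesis ZB : room 90 ((T + N ^ 2 + 1) ^ 4) (gZ G).
Notation Z := (gZ G).
Notation L := (gL G).
Notation lm := (ln L).
Notation nu := (ln (N%:R : R)).
Variables (al sg : R).
Hypothesis al0 : 0 <= al.

Let LE : L = expR lm. Proof. by rewrite lnK// posrE gL_gt0. Qed.
Let L2 : 2 <= expR lm. Proof. by rewrite -LE; apply: le_trans (gL_ge G); lra. Qed.
Let lm0 : 0 <= lm. Proof. by rewrite ln_ge0// gL_ge1. Qed.
Let NE : N%:R = expR nu. Proof. by rewrite lnK// posrE ltr0n. Qed.
Let nu0 : 0 <= nu. Proof. by rewrite ln_ge0// ler1n. Qed.

Section OneInterval.
Variable T0 : nat.
Hypotheses (T00 : (0 < T0)%N) (T0B : (T0 <= T + N ^ 2)%N).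
Let M := (T0 %/ N).+1.

Let MB : (M <= T + N ^ 2 + 1)%N.
Proof. by rewrite addn1 ltnS (leq_trans (leq_div _ _)). Qed.

Let NMB : (N * M <= 2 * (T + N ^ 2 + 1))%N.
Proof.
have h := leq_divM T0 N; have NN : (N <= N ^ 2)%N by rewrite expnS leq_pmulr// expn1.
rewrite /M mulnS mulnC; move: h NN T0B; clear; lia.
Qed.

Let ZM : room 46 (M ^ 4) Z.
Proof.
have M4 : (M ^ 4 <= (T + N ^ 2 + 1) ^ 4)%N by rewrite leq_exp2r.
by apply: leq_trans ZB; apply: leq_pow2_mul M4.
Qed.

Let ZNM : room 10 (N * M) Z.
Proof.
have BB (B : nat) : (0 < B)%N -> (B <= B ^ 4)%N.
  by move=> B0; rewrite -[leqLHS]expn1 leq_pexp2l.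
have B4 : (T + N ^ 2 + 1 <= (T + N ^ 2 + 1) ^ 4)%N by apply: BB; rewrite addn1.
apply: leq_trans ZB; apply: (@leq_trans (2 ^ 11 * (T + N ^ 2 + 1))).
  by rewrite (expnSr 2 10) -mulnA; apply: leq_pow2_mul NMB.
exact: leq_pow2_mul B4.
Qed.

Let ZT : tall Z (2 * T0%:R : R).
Proof.
have cast (a b : nat) : 2 ^+ a * (2 * T0%:R + 1) ^+ b = (2 ^ a * (2 * T0 + 1) ^ b)%N%:R :> R.
  by rewrite (natrM _ (2 ^ a)) !natrX (natrD _ (2 * T0)) (natrM _ 2).
rewrite /tall cast ler_nat; apply: leq_trans ZB.
have B2 : (2 * T0 + 1 <= 2 * (T + N ^ 2 + 1))%N by move: T0B; clear; lia.
have B4 : ((2 * T0 + 1) ^ 4 <= 2 ^ 4 * (T + N ^ 2 + 1) ^ 4)%N.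
  by rewrite -expnMn leq_exp2r.
apply: (leq_trans (leq_pow2_mul (leqnn 80) B4)).
exact: leq_pow2_mul_add.
Qed.

Let TNM : T0%:R <= N%:R * M%:R :> R.
Proof. by rewrite -natrM ler_nat mulnC /M ltnW// ltn_ceil. Qed.

Let Mle : M%:R <= T0%:R / N%:R + 1 :> R.
Proof. by rewrite -natr1 lerD2r ler_pdivlMr ?ltr0n// -natrM ler_nat leq_divM. Qed.

Variables (J : finType) (kap : J -> nat) (c : nat -> R[i]).
Hypotheses (mul : multiplicity_le (lattice R q kap) 2).
Hypothesis kT : forall j, (kap j <= 2 * q * T0)%N.
Hypothesis cA : forall n, cmod (c n) <= expR al.
Hypothesis cG : \sum_(n <- ns) cmod (c n) ^+ 2 <= expR (nu + lm - 2 / 3 * al).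
Hypothesis DV : forall j, expR sg <= cmod (dsum G ns c (lattice R q kap j)).

Let tauT j : 0 <= lattice R q kap j <= T0%:R.
Proof.
have q2 : 0 < 2 * q%:R :> R by rewrite mulr_gt0// ltr0n.
rewrite /lattice divr_ge0 ?(ltW q2)//= ler_pdivrMr//.
by rewrite -(natrM _ 2) -natrM ler_nat mulnC.
Qed.

Let T01 : 1 <= T0%:R :> R. Proof. by rewrite ler1n. Qed.

Let cG1 : \sum_(n <- ns) cmod (c n) ^+ 2 <= expR (nu + lm).
Proof. by apply: (le_trans cG); rewrite ler_expR; have := al0; lra. Qed.

Let empty (x : R) : ((0 < #|J|)%N -> ln (#|J|%:R : R) <= x) -> #|J|%:R <= expR x.
Proof.
have [->|J0] := posnP #|J|; first by rewrite expR_ge0.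
by move=> /(_ isT); rewrite -ler_expR lnK// posrE ltr0n.
Qed.

Lemma low_interval : #|J|%:R <= M%:R * expR (2 * nu - 2 * sg + 1000 * lm).
Proof.
have MR : 0 < M%:R :> R by rewrite ltr0n.
rewrite -{1}(lnK MR) -expRD; apply: empty => J0.
have PE : #|J|%:R = expR (ln (#|J|%:R : R)) by rewrite lnK// posrE ltr0n.
have ME : M%:R <= expR (ln (M%:R : R)) by rewrite lnK.
have := low_points mul tauT T01 ZT N0 (ltn0Sn _) ZNM TNM nsu nsb LE NE PE ME cG1 DV erefl.
lra.
Qed.

Lemma high_interval : 4 / 5 * nu <= sg -> T0%:R <= expR (2 * sg - 2 / 5 * nu) ->
  #|J|%:R <= expR (2 * nu - 2 * sg + 1000 * lm).
Proof.
move=> s1 Tth; apply: empty => J0.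
have PE : #|J|%:R = expR (ln (#|J|%:R : R)) by rewrite lnK// posrE ltr0n.
have EE : energy (lattice R q kap) = expR (ln (energy (lattice R q kap))).
  by rewrite lnK// posrE energy_gt0.
have Mmu : M%:R <= expR (2 * sg - 7 / 5 * nu + lm).
  apply: (le_trans Mle); rewrite [X in _ / X]NE -expRN.
  have h1 : T0%:R * expR (- nu) <= expR (2 * sg - 7 / 5 * nu).
    apply: (@le_trans _ _ (expR (2 * sg - 2 / 5 * nu) * expR (- nu))).
      by rewrite ler_pM2r ?expR_gt0.
    by rewrite -expRD ler_expR; lra.
  have h2 : 1 <= expR (2 * sg - 7 / 5 * nu).
    by rewrite -[leLHS]expR0 ler_expR; have := nu0; lra.
  rewrite expRD; move: (expR (2 * sg - 7 / 5 * nu)) h1 h2 L2 => e h1 h2; nra.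
exact: (high_points mul tauT T01 ZT N0 (ltn0Sn _) ZNM ZM TNM J0 nsu nsb LE NE PE Mmu Tth cG1 DV EE).
Qed.

Lemma middle_interval : 7 / 10 * nu <= sg -> sg <= 4 / 5 * nu ->
  T0%:R <= expR (6 / 5 * nu) -> #|J|%:R <= expR (18 / 5 * nu - 4 * sg + 1000 * lm).
Proof.
move=> s1 s2 Tth; apply: empty => J0.
have PE : #|J|%:R = expR (ln (#|J|%:R : R)) by rewrite lnK// posrE ltr0n.
have EE : energy (lattice R q kap) = expR (ln (energy (lattice R q kap))).
  by rewrite lnK// posrE energy_gt0.
have Mmu : M%:R <= expR (nu / 5 + lm).
  apply: (le_trans Mle); rewrite [X in _ / X]NE -expRN.
  have h1 : T0%:R * expR (- nu) <= expR (nu / 5).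
    apply: (@le_trans _ _ (expR (6 / 5 * nu) * expR (- nu))).
      by rewrite ler_pM2r ?expR_gt0.
    by rewrite -expRD ler_expR; lra.
  have h2 : 1 <= expR (nu / 5) by rewrite -[leLHS]expR0 ler_expR; have := nu0; lra.
  rewrite expRD; move: (expR (nu / 5)) h1 h2 L2 => e h1 h2; nra.
exact: (middle_points mul tauT T01 ZT N0 (ltn0Sn _) ZNM ZM TNM J0 nsu nsb LE NE PE Mmu Tth cG DV EE q0
  (fun=> erefl) cA).
Qed.

End OneInterval.

Variables (I : finType) (kap : I -> nat) (c : nat -> R[i]).
Hypotheses (mul : multiplicity_le (lattice R q kap) 2).
Hypothesis kT : forall i, (kap i <= 2 * q * T)%N.
Hypothesis cA : forall n, cmod (c n) <= expR al.
Hypothesis cG : \sum_(n <- ns) cmod (c n) ^+ 2 <= expR (nu + lm - 2 / 3 * al).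
Hypothesis DV : forall i, expR sg <= cmod (dsum G ns c (lattice R q kap i)).

Let ind (T0 : nat) (X : R) : (0 < T0)%N ->
  (forall (J : finType) (kap' : J -> nat) (c' : nat -> R[i]),
     multiplicity_le (lattice R q kap') 2 -> (forall j, kap' j <= 2 * q * T0)%N ->
     (forall n, cmod (c' n) <= expR al) ->
     \sum_(n <- ns) cmod (c' n) ^+ 2 <= expR (nu + lm - 2 / 3 * al) ->
     (forall j, expR sg <= cmod (dsum G ns c' (lattice R q kap' j))) -> #|J|%:R <= X) ->
  #|I|%:R <= (T%:R / T0%:R + 1) * X.
Proof.
move=> T00 bd; apply: (@block_decomposition R G q (expR sg) ns q0 T T0 X I kap c) => //.
move=> J kap' c' m' k' cc' D'; apply: (bd J kap' c') => //.
  by move=> n; rewrite cc'.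
by apply: le_trans cG; apply: ler_sum => n _; rewrite cc'.
Qed.

(** The two extra factors [L] beyond [L^1000] absorb constants up to [4]. *)
Lemma fixed_grid_bound : #|I|%:R <= expR (1002 * lm) *
  (expR (2 * nu - 2 * sg) + expR (18 / 5 * nu - 4 * sg) + T%:R * expR (12 / 5 * nu - 4 * sg)).
Proof.
have TR : 0 <= T%:R :> R by [].
have e0 x : 0 < expR x :> R by exact: expR_gt0.
set a := expR (2 * nu - 2 * sg); set b := expR (18 / 5 * nu - 4 * sg).
set d := expR (12 / 5 * nu - 4 * sg).
have a0 : 0 < a by exact: e0.
have b0 : 0 < b by exact: e0.
have d0 : 0 < d by exact: e0.
have Td0 : 0 <= T%:R * d by rewrite mulr_ge0// ltW.
have fin k : k <= 4 -> forall S : R, 0 <= S -> S <= a + b + T%:R * d ->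
    k * (expR (1000 * lm) * S) <= expR (1002 * lm) * (a + b + T%:R * d).
  have -> : expR (1002 * lm) = expR lm * (expR lm * expR (1000 * lm)).
    by rewrite -!expRD; congr expR; lra.
  move: (expR (1000 * lm)) (e0 (1000 * lm)) => e ee k4 S S0 Sl.
  have le4 : 4 <= expR lm * expR lm by move: L2; nra.
  have -> : expR lm * (expR lm * e) * (a + b + T%:R * d) =
    (expR lm * expR lm) * (e * (a + b + T%:R * d)) by ring.
  have ep : 0 <= e by exact: ltW.
  have eS : e * S <= e * (a + b + T%:R * d) by exact: ler_wpM2l.
  apply: (@le_trans _ _ (4 * (e * S))); first by rewrite ler_wpM2r// mulr_ge0.
  by apply: ler_pM => //; rewrite mulr_ge0.
have blocks (e y a' d' t : R) : 0 < e -> 0 < a' -> a' * y = d' ->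
    (2 * (t * y) + 2) * (a' * e) <= 2 * (e * (a' + t * d')).
  by move=> ? ? <-; lra.
have twice (y : R) (n : nat) : (0 < n)%N -> y < n.+1%:R -> y <= 2 * n%:R.
  by move=> n0; have : 1 <= n%:R :> R; [rewrite ler1n|rewrite -natr1; lra].
have ge1 (y : R) : 0 <= y -> 1 <= expR y by move=> y0; rewrite -[leLHS]expR0 ler_expR.
have nn := nu0.
have m1 : 0 <= 6 / 5 * nu by lra.
have m2 : 4 / 5 * nu <= sg -> 0 <= 2 * sg - 2 / 5 * nu by lra.
have m3 : 6 / 5 * nu <= 2 * nu by lra.
have ad : a + T%:R * d <= a + b + T%:R * d by have := ltW b0; lra.
have bd : b + T%:R * d <= a + b + T%:R * d by have := ltW a0; lra.
have ad0 : 0 <= a + T%:R * d by exact: addr_ge0 (ltW a0) Td0.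
have bd0 : 0 <= b + T%:R * d by exact: addr_ge0 (ltW b0) Td0.
have two4 : 2 <= 4 :> R by lra.
have step (u v : R) : u <= v + 1 -> u + 1 <= v + 2 by lra.
have bdE : b * (expR (6 / 5 * nu))^-1 = d by rewrite -expRN -expRD; congr expR; lra.
have adE : a * (expR (2 * sg - 2 / 5 * nu))^-1 = d by rewrite -expRN -expRD; congr expR; lra.
(* For small [V] the mean value bound is applied to the whole of [[0, T]]; [V <= N^(7/10)] is
   equivalent to [T N V^(-2) <= T N^(12/5) V^(-4)]. *)
have [s1|s1] := leP sg (7 / 10 * nu).
  have TB : (T <= T + N ^ 2)%N by exact: leq_addr.
  have := low_interval T1 TB mul kT cG DV.
  have Mle : (T %/ N).+1%:R <= T%:R / N%:R + 1 :> R.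
    by rewrite -natr1 lerD2r ler_pdivlMr ?ltr0n// -natrM ler_nat leq_divM.
  move=> /le_trans; apply.
  apply: (le_trans (ler_wpM2r (ltW (e0 _)) Mle)).
  apply: (@le_trans _ _ (1 * (expR (1000 * lm) * (a + T%:R * expR (nu - 2 * sg))))).
    have -> : expR (nu - 2 * sg) = a * (expR nu)^-1.
      by rewrite -expRN -expRD; congr expR; ring.
    rewrite mul1r [X in _ / X]NE [X in _ * X]expRD -/a.
    move: (expR nu)^-1 (expR (1000 * lm)) => y e.
    by rewrite le_eqVlt; apply/orP; left; apply/eqP; ring.
  have u0 := e0 (nu - 2 * sg).
  apply: fin; [by lra|by apply: (addr_ge0 (ltW a0)); apply: (mulr_ge0 TR); exact: ltW|].
  have : T%:R * expR (nu - 2 * sg) <= T%:R * d by rewrite ler_wpM2l// ler_expR; lra.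
  by have := ltW b0; lra.
have [s2|s2] := leP sg (4 / 5 * nu).
  set x := expR (6 / 5 * nu); pose T0 := Num.truncn x.
  have x1 : 1 <= x by exact: ge1.
  have /andP[t1 t2] := truncn_itv (ltW (e0 (6 / 5 * nu))).
  rewrite -/x -/T0 in t1 t2.
  have T00 : (0 < T0)%N by rewrite truncn_gt0.
  have T0B : (T0 <= T + N ^ 2)%N.
    rewrite -(ler_nat R) (le_trans t1)// natrD natrX NE -expRM_natl.
    by apply: (@le_trans _ _ (expR (2 * nu))); [rewrite ler_expR|rewrite lerDr].
  have := @ind T0 (expR (18 / 5 * nu - 4 * sg + 1000 * lm)) T00
    (fun J kap' c' m' k' cA' cG' D' => middle_interval T00 T0B m' k' cA' cG' D' (ltW s1) s2 t1).
  move=> /le_trans; apply.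
  have T0R : 0 < T0%:R :> R by rewrite ltr0n.
  have xT : x <= 2 * T0%:R by exact: twice.
  have tt := inv_le_twice (e0 _) T0R xT.
  rewrite -/x in tt.
  apply: (@le_trans _ _ ((2 * (T%:R * x^-1) + 2) * expR (18 / 5 * nu - 4 * sg + 1000 * lm))).
    by rewrite ler_pM2r// lerD//; [rewrite mulrCA ler_wpM2l|rewrite ler1n].
  rewrite expRD -/b; apply: (@le_trans _ _ (2 * (expR (1000 * lm) * (b + T%:R * d)))).
    exact: blocks.
  exact: fin.
(* Here [V] has no upper bound, so the ideal length [V^2 N^(-2/5)] may exceed the height; the
   minimum with [T] prevents this, and then a bounded number of blocks suffices. *)
set x := expR (2 * sg - 2 / 5 * nu); pose T0 := minn (Num.truncn x) T.
have x1 : 1 <= x by apply: ge1; apply: m2; exact: ltW.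
have /andP[t1 t2] := truncn_itv (ltW (e0 (2 * sg - 2 / 5 * nu))).
rewrite -/x in t1 t2.
have T00 : (0 < T0)%N by rewrite leq_min truncn_gt0 x1.
have T0B : (T0 <= T + N ^ 2)%N by rewrite (leq_trans (geq_minr _ _))// leq_addr.
have T0x : T0%:R <= x by apply: le_trans t1; rewrite ler_nat geq_minl.
have := @ind T0 (expR (2 * nu - 2 * sg + 1000 * lm)) T00
  (fun J kap' c' m' k' cA' cG' D' => high_interval T00 T0B m' k' cG' D' (ltW s2) T0x).
move=> /le_trans; apply.
have T0R : 0 < T0%:R :> R by rewrite ltr0n.
have x0 : 0 < x by exact: e0.
have xi0 : 0 < x^-1 by rewrite invr_gt0.
have tt : T%:R / T0%:R <= 2 * (T%:R * x^-1) + 1.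
  have [tT|Tt] := leqP (Num.truncn x) T; last first.
    rewrite /T0 (minn_idPr (ltnW Tt)) divff ?pnatr_eq0 -?lt0n// lerDr.
    by rewrite mulr_ge0// mulr_ge0// ltW.
  have xT : x <= 2 * T0%:R.
    by apply: twice => //; rewrite /T0 (minn_idPl tT).
  apply: (@le_trans _ _ (2 * (T%:R * x^-1))); last by rewrite lerDl.
  by rewrite mulrCA ler_wpM2l// inv_le_twice.
apply: (@le_trans _ _ ((2 * (T%:R * x^-1) + 2) * expR (2 * nu - 2 * sg + 1000 * lm))).
  by rewrite ler_pM2r//; exact: step.
rewrite expRD -/a; apply: (@le_trans _ _ (2 * (expR (1000 * lm) * (a + T%:R * d)))).
  exact: blocks.
exact: fin.
Qed.

End FixedGrid.

(** * Discretisation and levels *)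

Section Discretisation.
Variables (R : realType) (G : grid R).
Notation Z := (gZ G).
Notation L := (gL G).

Let Zp : (0 < Z)%N. Proof. by apply: leq_trans (gZ_ge G). Qed.
Let ZR : 1 <= Z%:R :> R. Proof. by rewrite ler1n. Qed.

Lemma lattice_truncn (q : nat) (t : R) : (0 < q)%N -> 0 <= t ->
  (Num.truncn (2 * q%:R * t))%:R / (2 * q%:R) <= t <
    (Num.truncn (2 * q%:R * t))%:R / (2 * q%:R) + (2 * q%:R)^-1.
Proof.
move=> q0 t0; have qR : 0 < 2 * q%:R :> R by rewrite mulr_gt0// ltr0n.
have := truncn_itv (mulr_ge0 (ltW qR) t0); move: (Num.truncn _) => k /andP[h1 h2].
rewrite ler_pdivrMr// [t * _]mulrC h1/=.
rewrite -[X in _ + X]mul1r -mulrDl natr1.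
by rewrite ltr_pdivlMr// [t * _]mulrC.
Qed.

(** Rounding moves a point by less than [1 / 2], so a unit window of rounded points comes from a
    window of length [3 / 2], which is covered by two half-open windows of length [3 / 4] with at
    most one point each. *)
Lemma lattice_multiplicity (I : finType) (t : I -> R) (q : nat) : (0 < q)%N ->
  (forall i, 0 <= t i) -> (forall i j, i != j -> 1 <= `|t i - t j|) ->
  multiplicity_le (lattice R q (fun i => Num.truncn (2 * q%:R * t i))) 2.
Proof.
move=> q0 t0 sep x; set tau := lattice _ _ _.
have q2 : (2 * q%:R)^-1 <= 2^-1 :> R.
  by rewrite lef_pV2 ?posrE ?mulr_gt0 ?ltr0n// ler_peMr// ler1n.
have tt i : tau i <= t i < tau i + 2^-1.
  by have /andP[h1 h2] := lattice_truncn q0 (t0 i); rewrite h1/=; apply: (lt_le_trans h2); rewrite lerD2l.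
pose A := [set i | (x <= t i < x + 3 / 4)%R].
pose B := [set i | (x + 3 / 4 <= t i < x + 3 / 2)%R].
have small (y : R) : (#|[set i | (y <= t i < y + 3 / 4)%R]| <= 1)%N.
  apply/card_le1_eqP => i j; rewrite !inE => /andP[i1 i2] /andP[j1 j2].
  apply/eqP; apply: contraT => ij; have := sep _ _ ij; rewrite distrC.
  have : `|t i - t j| < 1 by rewrite ltr_norml; lra.
  lra.
have AB : [set i | (x <= tau i < x + 1)%R] \subset A :|: B.
  apply/fintype.subsetP => i; rewrite !inE => /andP[h1 h2].
  have /andP[h3 h4] := tt i; case: (ltP (t i) (x + 3 / 4)) => h5; lra.
apply: (leq_trans (subset_leq_card AB)); apply: (leq_trans (leq_card_setU _ _)).
have -> : B = [set i | (x + 3 / 4 <= t i < x + 3 / 4 + 3 / 4)%R].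
  by apply/setP => i; rewrite !inE (_ : x + 3 / 4 + 3 / 4 = x + 3 / 2)//; lra.
exact: (leq_add (small x) (small _)).
Qed.

(** Rounding [t] costs a phase error [Z / (4 Z^3)] and replacing [ln n] by [lam n] costs
    [(Z / 4) Z^(-4)], which the proof enlarges to [1 / (4 Z^2)]. With at most [Z] terms and
    coefficients at most [Z], the total is [1 / 2]. *)
Lemma discretisation (ns : seq nat) (c : nat -> R[i]) (t T : R) (q : nat) :
  q = (2 * Z ^ 3)%N ->
  (forall n, n \in ns -> (0 < n <= Z)%N) -> (forall n, n \in ns -> cmod (c n) <= Z%:R) ->
  (size ns <= Z)%N -> 0 <= t <= T -> 4 * T <= Z%:R ->
  cmod (\sum_(n <- ns) c n * cis (t * ln n%:R)) <=
  cmod (dsum G ns c ((Num.truncn (2 * q%:R * t))%:R / (2 * q%:R))) + 2^-1.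
Proof.
move=> qE nZ cZ sZ /andP[t0 tT] TZ.
have q0 : (0 < q)%N by rewrite qE muln_gt0 expn_gt0 Zp.
have /andP[h1 h2] := lattice_truncn q0 t0; set t' := _ / _ in h1 h2 *.
have t'0 : 0 <= t' by rewrite divr_ge0// mulr_ge0.
have ZZ : 0 < Z%:R :> R by have := ZR; lra.
have step n : n \in ns -> cmod (c n * cis (t * ln n%:R) - c n * cis (t' * lam G n)) <= 2^-1 / Z%:R.
  move=> nn; have /andP[n0 nz] := nZ n nn.
  rewrite -mulrBr cmodM; apply: (@le_trans _ _ (Z%:R * (2^-1 / Z%:R ^+ 2))); last first.
    by rewrite le_eqVlt; apply/orP; left; apply/eqP; field; rewrite gt_eqF.
  apply: ler_pM; rewrite ?cmod_ge0 ?cZ//.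
  apply: (le_trans (cmod_cis_sub _ _)).
  have -> : t * ln n%:R - t' * lam G n = (t - t') * ln n%:R + t' * (ln n%:R - lam G n) by ring.
  apply: (le_trans (ler_normD _ _)); rewrite (normrM (t - t')) (normrM t').
  have ln0 : 0 <= ln (n%:R : R) by rewrite ln_ge0// ler1n.
  have lnZ : ln (n%:R : R) <= Z%:R.
    apply: (@le_trans _ _ (n%:R)); last by rewrite ler_nat.
    have := expR_ge1Dx (ln (n%:R : R)); rewrite lnK ?posrE ?ltr0n//; lra.
  have a1 : `|t - t'| <= (4 * Z%:R ^+ 3)^-1.
    rewrite ger0_norm ?subr_ge0//; have -> : (4 * Z%:R ^+ 3)^-1 = (2 * q%:R)^-1 :> R.
      by rewrite qE (natrM _ 2) natrX mulrA -natrM.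
    by rewrite lerBlDl ltW.
  have a2 : `|ln n%:R - lam G n| <= (Z%:R ^+ 4)^-1.
    rewrite distrC -[leRHS]mul1r ler_pdivlMr ?exprn_gt0//.
    by apply: gell_close; rewrite n0.
  have -> : 2^-1 / Z%:R ^+ 2 = (4 * Z%:R ^+ 3)^-1 * Z%:R + 4^-1 * Z%:R ^+ 2 * (Z%:R ^+ 4)^-1 :> R.
    by field; rewrite gt_eqF.
  apply: lerD.
    by apply: ler_pM => //; rewrite ger0_norm.
  apply: ler_pM => //; rewrite ger0_norm//.
  apply: (@le_trans _ _ (4^-1 * Z%:R)); first by move: h1 tT TZ; lra.
  by rewrite ler_pM2l ?invr_gt0// expr2 ler_peMr// ltW.
have -> : \sum_(n <- ns) c n * cis (t * ln n%:R) = dsum G ns c t' +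
   \sum_(n <- ns) (c n * cis (t * ln n%:R) - c n * cis (t' * lam G n)).
  by rewrite /dsum -big_split/=; apply: eq_bigr => n _; rewrite addrC subrK.
apply: (le_trans (cmodD _ _)); rewrite lerD2l.
apply: (le_trans (cmod_sum _ _ _)); rewrite big_seq.
apply: (le_trans (ler_sum _ step)); rewrite -big_seq big_const_seq count_predT iter_addr_0.
by rewrite -[leLHS]mulr_natr -mulrA ler_piMr// mulrC ler_pdivrMr// mul1r ler_nat.
Qed.

End Discretisation.

(** * Dyadic levels of the coefficients *)

Section Levels.
Variables (R : realType) (G : grid R) (q : nat) (ns : seq nat).
Hypotheses (q0 : (0 < q)%N) (nsu : uniq ns).
Variables (N T : nat).
Hypotheses (N0 : (0 < N)%N) (T1 : (0 < T)%N) (nsb : {subset ns <= box N}).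
Hypothesis ZB : room 90 ((T + N ^ 2 + 1) ^ 4) (gZ G).
Notation Z := (gZ G).
Notation L := (gL G).
Notation lm := (ln L).
Notation nu := (ln (N%:R : R)).
Variables (I : finType) (kap : I -> nat) (c : nat -> R[i]) (S sg : R).
Hypotheses (mul : multiplicity_le (lattice R q kap) 2).
Hypothesis kT : forall i, (kap i <= 2 * q * T)%N.
Hypothesis cZ : forall n, n \in ns -> cmod (c n) <= Z%:R.
Hypothesis cS : forall j : nat,
  (count (fun n => 2 ^+ j < cmod (c n)) ns)%:R * expR (8 / 3 * (j%:R * ln 2)) <= S.
Hypotheses (SL : 8 * S <= L * N%:R).
Hypothesis DV : forall i, expR sg <= cmod (dsum G ns c (lattice R q kap i)).

Definition level (n : nat) : nat :=
  find (fun j => (cmod (c n) <= 2 ^+ j)%R) (iota 0 (gJ G).+1).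

Definition clev (j n : nat) : R[i] := if (n \in ns) && (level n == j) then c n else 0.

Let cJ n : n \in ns -> has (fun j => (cmod (c n) <= 2 ^+ j)%R) (iota 0 (gJ G).+1).
Proof.
move=> nn; apply/hasP; exists (gJ G); first by rewrite mem_iota/= ltnS leqnn.
have Z1 : 1 <= Z%:R :> R by rewrite ler1n (leq_trans _ (gZ_ge G)).
apply: (le_trans (cZ nn)); apply: le_trans (gJ_ge G).
by rewrite -[leLHS]expr1; apply: ler_weXn2l.
Qed.

Let level_lt n : n \in ns -> (level n < (gJ G).+1)%N.
Proof. by move=> /cJ; rewrite has_find size_iota. Qed.

Let level_le n : n \in ns -> cmod (c n) <= 2 ^+ level n.
Proof.
move=> nn; have := nth_find 0%N (cJ nn); rewrite -/(level n) nth_iota ?add0n//.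
exact: level_lt.
Qed.

Let level_gt n j : n \in ns -> level n = j.+1 -> 2 ^+ j < cmod (c n).
Proof.
move=> nn lj; have jl : (j < level n)%N by rewrite lj.
have := before_find 0%N jl; rewrite nth_iota; last by rewrite (ltn_trans jl)// level_lt.
by rewrite add0n => /negbT; rewrite -ltNge.
Qed.

Let clev_sum n : n \in ns -> \sum_(j < (gJ G).+1) clev j n = c n.
Proof.
move=> nn; rewrite (bigD1 (Ordinal (level_lt nn)))//= /clev nn eqxx/= big1 ?addr0// => j jn.
by case: eqP => // e; case/eqP: jn; apply: val_inj; rewrite /= e.
Qed.

Let two_expR j : 2 ^+ j = expR (j%:R * ln 2) :> R.
Proof. by rewrite expRM_natl lnK// posrE. Qed.

Let clev_le j n : cmod (clev j n) <= expR (j%:R * ln 2).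
Proof.
rewrite /clev; case: ifP => [/andP[nn /eqP <-]|_]; last by rewrite cmod0 expR_ge0.
by rewrite -two_expR level_le.
Qed.

Let LE : L = expR lm. Proof. by rewrite lnK// posrE gL_gt0. Qed.
Let NE : N%:R = expR nu. Proof. by rewrite lnK// posrE ltr0n. Qed.

(** Level [j + 1] has coefficients at most [2^(j + 1)], and the [8/3] moment bounds their number by
    [S 2^(- 8 j / 3)]; so the sum of squares is at most [4 S 2^(- 2 j / 3)], and passing to [j + 1]
    costs less than a factor 2. Level [0] holds all coefficients of modulus at most [1] and uses
    only the size of the range. *)
Let clev_sqr j : \sum_(n <- ns) cmod (clev j n) ^+ 2 <=
  expR (nu + lm - 2 / 3 * (j%:R * ln 2)).
Proof.
case: j => [|j].
  have -> : nu + lm - 2 / 3 * (0%:R * ln 2) = lm + nu by ring.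
  rewrite expRD -LE -NE; apply: (@le_trans _ _ (\sum_(n <- ns) 1)).
    apply: ler_sum => n _; have := clev_le 0 n; rewrite mul0r expR0.
    by rewrite -[X in _ -> _ <= X](expr1n _ 2) => h; rewrite lerXn2r ?nnegrE ?cmod_ge0.
  rewrite big_const_seq count_predT iter_addr_0.
  have sz : (size ns <= 3 * N)%N.
    apply: (leq_trans (uniq_leq_size nsu nsb)); rewrite size_iota; lia.
  apply: (@le_trans _ _ (3 * N)%N%:R); first by rewrite ler_nat.
  rewrite natrM ler_wpM2r//; apply: le_trans (gL_ge G); lra.
pose cnt := count (fun n => (2 ^+ j < cmod (c n))%R) ns.
have h1 : \sum_(n <- ns) cmod (clev j.+1 n) ^+ 2 <= cnt%:R * (2 ^+ j.+1) ^+ 2.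
  rewrite /cnt -sum1_count natr_sum mulr_suml [leRHS]big_mkcond/=.
  rewrite big_seq [leRHS]big_seq; apply: ler_sum => n nn.
  rewrite /clev nn /=; case: eqP => [lj|_].
    rewrite (level_gt nn lj) mul1r lerXn2r ?nnegrE ?cmod_ge0 ?exprn_ge0//.
    by rewrite -lj level_le.
  rewrite cmod0 expr0n/=; case: ifP => // _; rewrite mul1r exprn_ge0// exprn_ge0//.
apply: (le_trans h1); have := cS j; rewrite -/cnt => h2.
have e1 : (2 ^+ j.+1) ^+ 2 = 4 * expR (8 / 3 * (j%:R * ln 2)) * expR (- (2 / 3 * (j%:R * ln 2))) :> R.
  rewrite [2 ^+ j.+1]exprS exprMn two_expR -mulrA -expRD -expRM_natl.
  by congr (_ * expR _); [ring|lra].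
have S0 : 0 <= S by apply: le_trans h2; rewrite mulr_ge0// expR_ge0.
apply: (@le_trans _ _ (4 * S * expR (- (2 / 3 * (j%:R * ln 2))))).
  rewrite e1 [leLHS]mulrA ler_wpM2r ?expR_ge0// mulrCA ler_wpM2l//.
have e2 : expR (- (2 / 3 * (j%:R * ln 2))) <= 2 * expR (- (2 / 3 * (j.+1%:R * ln 2))) :> R.
  rewrite -[X in _ <= X * _](@lnK R 2) ?posrE// -expRD ler_expR -[j.+1%:R]natr1.
  have : 0 <= ln 2 :> R by rewrite ln_ge0// ler1n.
  lra.
apply: (@le_trans _ _ (8 * S * expR (- (2 / 3 * (j.+1%:R * ln 2))))).
  have -> : 8 * S * expR (- (2 / 3 * (j.+1%:R * ln 2))) =
    4 * S * (2 * expR (- (2 / 3 * (j.+1%:R * ln 2)))) by ring.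
  by rewrite ler_wpM2l// mulr_ge0.
rewrite [nu + lm]addrC !expRD -LE -NE ler_wpM2r ?expR_ge0//.
Qed.

(** There are at most [L] levels, so each point has a level whose partial sum is at least [V / L].
    Summation over levels costs one factor [L] and the smaller value at most [L^4]:
    [1007 = 1002 + 1 + 4]. *)
Lemma level_bound : #|I|%:R <= expR (1007 * lm) *
  (expR (2 * nu - 2 * sg) + expR (18 / 5 * nu - 4 * sg) + T%:R * expR (12 / 5 * nu - 4 * sg)).
Proof.
have lm0 : 0 <= lm by rewrite ln_ge0// gL_ge1.
pose Q (j : nat) (i : I) := (expR (sg - lm) <= cmod (dsum G ns (clev j) (lattice R q kap i)))%R.
have cover i : [exists j : 'I_(gJ G).+1, Q j i].
  apply: contraT; rewrite negb_exists => /forallP nQ.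
  suff : cmod (dsum G ns c (lattice R q kap i)) < expR sg by rewrite ltNge DV.
  have -> : dsum G ns c (lattice R q kap i) =
      \sum_(j < (gJ G).+1) dsum G ns (clev j) (lattice R q kap i).
    rewrite /dsum exchange_big/= big_seq [RHS]big_seq; apply: eq_bigr => n nn.
    by rewrite -mulr_suml clev_sum.
  apply: (le_lt_trans (cmod_sum _ _ _)).
  apply: (@lt_le_trans _ _ (\sum_(j < (gJ G).+1) expR (sg - lm))).
    apply: ltr_sum; last by move=> j _; rewrite ltNge; exact: nQ.
    by apply/hasP; exists ord0 => //; rewrite mem_index_enum.
  rewrite sumr_const card_ord -[leLHS]mulr_natl.
  apply: (@le_trans _ _ (L * expR (sg - lm))); first by rewrite ler_wpM2r ?expR_ge0// gJ_le.
  by rewrite [X in X * _]LE -expRD ler_expR; lra.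
pose J (j : nat) : finType := {i | Q j i}.
have lev j : #|J j|%:R <= expR (1002 * lm) * (expR (2 * nu - 2 * (sg - lm)) +
    expR (18 / 5 * nu - 4 * (sg - lm)) + T%:R * expR (12 / 5 * nu - 4 * (sg - lm))).
  have l0 : 0 <= j%:R * ln 2 :> R by rewrite mulr_ge0// ln_ge0// ler1n.
  apply: (fixed_grid_bound q0 nsu N0 T1 nsb ZB l0 (kap := fun u : J j => kap (val u)) _ _
    (clev_le j) (clev_sqr j)).
  - move=> x; apply: leq_trans (mul x); rewrite -(card_imset _ val_inj).
    apply: subset_leq_card; apply/fintype.subsetP => i /imsetP[u].
    by rewrite !inE => h ->.
  - by move=> u; exact: kT.
  - by move=> u; exact: (valP u).
have card : #|I|%:R <= \sum_(j < (gJ G).+1) #|J j|%:R :> R.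
  rewrite -natr_sum ler_nat -sum1_card.
  under [leqRHS]eq_bigr => j _ do rewrite card_sig -sum1_card big_mkcond/=.
  rewrite exchange_big/=; apply: leq_sum => i _.
  have /existsP[j Qj] := cover i; rewrite (bigD1 j)//= inE.
  by rewrite Qj.
apply: (le_trans card).
set X := expR (1002 * lm) * _ in lev.
apply: (@le_trans _ _ (\sum_(j < (gJ G).+1) X)); first by apply: ler_sum => j _; exact: lev.
have X0 : 0 <= X by apply: le_trans (lev 0%N).
rewrite sumr_const card_ord -[leLHS]mulr_natl.
apply: (@le_trans _ _ (L * X)); first by rewrite ler_wpM2r// gJ_le.
set a := expR (2 * nu - 2 * sg); set b := expR (18 / 5 * nu - 4 * sg).
set d := expR (12 / 5 * nu - 4 * sg).
have f1 : expR (2 * nu - 2 * (sg - lm)) <= expR (4 * lm) * a.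
  by rewrite -expRD ler_expR; lra.
have f2 : expR (18 / 5 * nu - 4 * (sg - lm)) <= expR (4 * lm) * b.
  by rewrite -expRD ler_expR; lra.
have f3 : expR (12 / 5 * nu - 4 * (sg - lm)) <= expR (4 * lm) * d.
  by rewrite -expRD ler_expR; lra.
have -> : expR (1007 * lm) = expR lm * (expR (1002 * lm) * expR (4 * lm)).
  by rewrite -!expRD; congr expR; lra.
rewrite [X in X * _ <= _]LE -[leRHS]mulrA ler_pM2l ?expR_gt0// -[leRHS]mulrA ler_pM2l ?expR_gt0//.
rewrite (mulrDr _ (a + b)) (mulrDr _ a) [expR (4 * lm) * (_ * d)]mulrCA.
by apply: lerD; [exact: lerD|rewrite ler_wpM2l].
Qed.

End Levels.

(** * Assembly *)

Section Reduction.
Variable R : realType.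

Definition dyadic_range (N : R) : seq nat :=
  [seq n <- index_iota 0 (Num.truncn (2 * N)).+1 | N < n%:R <= 2 * N].

Lemma dyadic_sumE (V : nmodType) (N : R) (f : nat -> V) :
  dyadic_sum N f = \sum_(n <- dyadic_range N) f n.
Proof. by rewrite /dyadic_sum big_filter. Qed.

Lemma dyadic_range_box (N : R) : 2 <= N -> {subset dyadic_range N <= box (Num.truncn N)}.
Proof.
move=> N2 n; rewrite mem_filter => /andP[/andP[n1 n2] _]; rewrite mem_index_iota.
have N0 : 0 <= N by lra.
have /andP[t1 t2] := truncn_itv N0.
have b : 1 <= (Num.truncn N)%:R :> R.
  by rewrite ler1n truncn_gt0; lra.
rewrite -(ler_nat R) -(ltr_nat R) (le_trans t1 (ltW n1))/= natrM.
by move: t2; rewrite -natr1; lra.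
Qed.

(** This is where [q >= 8/3] enters: as [2^j >= 1], each counted coefficient contributes at least
    [2^(8 j / 3)] to the moment. *)
Lemma count_level_le (N q S : R) (c : nat -> R) (s : seq nat) (j : nat) : 8 / 3 <= q ->
  (forall n, 0 <= c n) -> \sum_(n <- s) c n `^ q <= S ->
  (count (fun n => 2 ^+ j < c n) s)%:R * expR (8 / 3 * (j%:R * ln 2)) <= S.
Proof.
move=> q83 c0; apply: le_trans.
rewrite -sum1_count natr_sum mulr_suml big_mkcond/=; apply: ler_sum => n _.
case: ifP => jn; last exact: powR_ge0.
have p0 : 0 < 2 ^+ j :> R by rewrite exprn_gt0.
have p1 : 1 <= 2 ^+ j :> R by rewrite exprn_ege1// ler1n.
apply: (@le_trans _ _ ((2 ^+ j) `^ q)); last first.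
  by apply: ge0_ler_powR; rewrite ?nnegrE ?c0 ?(ltW p0) ?(ltW jn)//; lra.
apply: (@le_trans _ _ ((2 ^+ j) `^ (8 / 3))); last exact: ler_powR.
by rewrite mul1r /powR gt_eqF// lnXn// -[ln 2 *+ j]mulr_natl lexx.
Qed.

Lemma term_le (q S : R) (c : nat -> R) (s : seq nat) n : 1 <= q ->
  (forall n, 0 <= c n) -> \sum_(n <- s) c n `^ q <= S -> n \in s -> c n <= 1 + S.
Proof.
move=> q1 c0 cS ns; have S0 : 0 <= S.
  by apply: le_trans cS; apply: sumr_ge0 => m _; exact: powR_ge0.
have [c1|c1] := leP (c n) 1; first by lra.
apply: (@le_trans _ _ S); last by lra.
apply: le_trans cS; rewrite (big_rem n ns)/=.
apply: (@le_trans _ _ (c n `^ q)); first by apply: le1r_powR => //; exact: ltW.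
by rewrite lerDl; apply: sumr_ge0 => m _; exact: powR_ge0.
Qed.

Lemma expR_ln_powR (x k : R) : 0 < x -> expR (k * ln x) = x `^ k.
Proof. by move=> x0; rewrite /powR gt_eqF. Qed.

End Reduction.

Section SeparatedSets.
Local Open Scope classical_set_scope.

(** Two points with the same integer part are less than [1] apart, so the integer part is injective
    on [W] and takes finitely many values. *)
Lemma separated1_finite (R : realType) (W : set R) (T : R) :
  W `<=` [set t | 0 <= t <= T] -> separated1 W -> finite_set W.
Proof.
move=> WT sep.
have inj : {in W &, injective (@Num.truncn R)}.
  move=> t t'; rewrite !inE => Wt Wt' e; apply: contrapT => tt'.
  have /andP[/truncn_itv/andP[a1 a2] _] := WT _ Wt.
  have /andP[/truncn_itv/andP[b1 b2] _] := WT _ Wt'.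
  have := sep _ _ Wt Wt' tt'; rewrite e in a1 a2; rewrite -natr1 in a2 b2.
  suff : `|t - t'| < 1 by lra.
  by rewrite ltr_norml; lra.
have : finite_set (@Num.truncn R @` W).
  apply: (@sub_finite_set _ _ `I_(Num.truncn T).+1); last exact: finite_II.
  move=> _ [t Wt <-] /=; rewrite ltnS; apply: le_truncn.
  by have /andP[] := WT _ Wt.
move=> /card_le_finite; apply.
by rewrite (card_le_eqr (inj_card_eq inj)) card_lexx.
Qed.

Lemma separated1_family (R : realType) (W : set R) : finite_set W -> separated1 W ->
  exists (I : finType) (t : I -> R), [/\ #|` fset_set W| = #|I|, (forall i, W (t i)) &
    forall i j, i != j -> 1 <= `|t i - t j|].
Proof.
move=> fW sep; exists (fset_set W), val; split; first exact: cardfE.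
- by move=> i; have := valP i; rewrite in_fset_set// inE.
move=> i j ij; apply: sep.
- by have := valP i; rewrite in_fset_set// inE.
- by have := valP j; rewrite in_fset_set// inE.
by move=> e; case/eqP: ij; exact: val_inj.
Qed.

End SeparatedSets.

Section Assembly.
Variable R : realType.

Definition target (N T V : R) : R :=
  N ^+ 2 * V ^- 2 + N `^ (18 / 5) * V ^- 4 + T * N `^ (12 / 5) * V ^- 4.

Lemma target_ge0 (N T V : R) : 0 <= T -> 0 < V -> 0 <= target N T V.
Proof.
move=> T0 V0; have v k : 0 <= V ^- k by rewrite invr_ge0 exprn_ge0// ltW.
rewrite /target addr_ge0 ?addr_ge0//; first by rewrite mulr_ge0 ?sqr_ge0.
  by rewrite mulr_ge0 ?powR_ge0.
by rewrite mulr_ge0 ?mulr_ge0 ?powR_ge0.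
Qed.

(** For [V <= 1] the last term of the target is at least [T], which separation alone nearly
    gives. *)
Lemma trivial_bound (I : finType) (t : I -> R) (N T V : R) : 2 <= N -> 2 <= T -> 0 < V ->
  V <= 1 -> (forall i, 0 <= t i <= T) -> (forall i j, i != j -> 1 <= `|t i - t j|) ->
  #|I|%:R <= 4 * target N T V.
Proof.
move=> N2 T2 V0 V1 tT sep.
have t0 i : 0 <= t i by have /andP[] := tT i.
have mul := lattice_multiplicity (ltn0Sn 0) t0 sep.
have lT i : 0 <= lattice R 1 (fun i => Num.truncn (2 * 1%:R * t i)) i <= T.
  have /andP[h1 _] := lattice_truncn (ltn0Sn 0) (t0 i); have /andP[_ h2] := tT i.
  by rewrite (le_trans h1 h2) andbT divr_ge0.
have T1 : 1 <= T by lra.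
have := card_le_T mul lT T1.
have v1 k : 1 <= V ^- k by rewrite invf_ge1 ?exprn_gt0// exprn_ile1// ltW.
have n1 : 1 <= N `^ (12 / 5) by rewrite -[leLHS](powRr0 N); apply: ler_powR; lra.
have : T <= T * N `^ (12 / 5) * V ^- 4.
  rewrite -mulrA ler_peMr//; first by lra.
  by rewrite mulr_ege1.
have a1 : 0 <= N ^+ 2 * V ^- 2 by rewrite mulr_ge0 ?sqr_ge0// invr_ge0 exprn_ge0// ltW.
have a2 : 0 <= N `^ (18 / 5) * V ^- 4 by rewrite mulr_ge0 ?powR_ge0// invr_ge0 exprn_ge0// ltW.
rewrite /target; lra.
Qed.

Lemma exponents_le_target (N T V : R) (N1 T1 : nat) : 2 <= T -> 0 < V -> (0 < N1)%N ->
  N1%:R <= N -> T1%:R <= 2 * T ->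
  let nu := ln N1%:R in let sg := ln (V / 2) in
  expR (2 * nu - 2 * sg) + expR (18 / 5 * nu - 4 * sg) + T1%:R * expR (12 / 5 * nu - 4 * sg)
    <= 32 * target N T V.
Proof.
move=> T2 V0 N10 N1N T1T /=.
have V2 : 0 < V / 2 by rewrite divr_gt0.
have N1R : 0 < N1%:R :> R by rewrite ltr0n.
have vE k : expR (- (k%:R * ln (V / 2))) = 2 ^+ k * V ^- k.
  by rewrite expRN expRM_natl lnK ?posrE// expr_div_n invf_div.
have N0 : 0 < N by apply: lt_le_trans N1N.
have pw k : 0 <= k -> N1%:R `^ k <= N `^ k.
  by move=> k0; apply: ge0_ler_powR; rewrite ?nnegrE// ltW.
have v0 k : 0 <= V ^- k by rewrite invr_ge0 exprn_ge0// ltW.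
rewrite !expRD !expR_ln_powR// (vE 2) (vE 4).
rewrite (powR_mulrn 2 (ltW N1R)).
have a1 : N1%:R ^+ 2 * V ^- 2 <= N ^+ 2 * V ^- 2.
  by rewrite ler_wpM2r// lerXn2r ?nnegrE// ltW.
have a2 : N1%:R `^ (18 / 5) * V ^- 4 <= N `^ (18 / 5) * V ^- 4.
  by rewrite ler_wpM2r// pw//; lra.
have a3 : T1%:R * (N1%:R `^ (12 / 5) * V ^- 4) <= 2 * T * (N `^ (12 / 5) * V ^- 4).
  apply: ler_pM => //; first by rewrite mulr_ge0 ?powR_ge0.
  by rewrite ler_wpM2r// pw//; lra.
have b1 : 0 <= N ^+ 2 * V ^- 2 by rewrite mulr_ge0 ?sqr_ge0.
have b2 : 0 <= N `^ (18 / 5) * V ^- 4 by rewrite mulr_ge0 ?powR_ge0.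
rewrite /target; lra.
Qed.

Lemma leq_eight_mul (B Z : nat) : (0 < B)%N -> room 90 (B ^ 4) Z -> (8 * B <= Z)%N.
Proof.
move=> B0; apply: leq_trans; apply: (@leq_trans (2 ^ 3 * B ^ 4)); last exact: leq_pow2_mul.
by rewrite leq_mul2l -[leqLHS]expn1 leq_pexp2l.
Qed.

(** Since [V >= 1], the discretisation error [1 / 2] leaves at least [V / 2]. The resulting constant
    [32] is absorbed into one more factor [L]. *)
Lemma family_bound (G : grid R) (q N T V : R) (c : nat -> R[i]) (I : finType) (t : I -> R) :
  8 / 3 <= q -> 2 <= N -> 2 <= T -> 1 <= V ->
  let N1 := Num.truncn N in let T1 := (Num.truncn T).+1 in
  let S := \sum_(n <- dyadic_range N) cmod (c n) `^ q in
  room 90 ((T1 + N1 ^ 2 + 1) ^ 4) (gZ G) -> 1 + S <= (gZ G)%:R ->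
  8 * S <= gL G * N1%:R ->
  (forall i, 0 <= t i <= T) -> (forall i j, i != j -> 1 <= `|t i - t j|) ->
  (forall i, V <= cmod (\sum_(n <- dyadic_range N) c n * natpow_it n (t i))) ->
  #|I|%:R <= gL G ^+ 1008 * target N T V.
Proof.
move=> q83 N2 T2 V1 N1 T1 S.
have N0 : 0 <= N by lra.
have /andP[n1 n2] := truncn_itv N0; rewrite -/N1 in n1 n2.
have T0 : 0 <= T by lra.
have /andP[u1 u2] := truncn_itv T0; rewrite -/T1 in u2.
have N10 : (0 < N1)%N by rewrite truncn_gt0; lra.
have V0 : 0 < V by lra.
have t0 (tT : forall i, 0 <= t i <= T) i : 0 <= t i by have /andP[] := tT i.
have T1T : T1%:R <= 2 * T by rewrite /T1 -natr1; lra.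
have q1 : 1 <= q by lra.
have V2 : V / 2 <= V - 2^-1 by lra.
have NN : (N1 <= N1 ^ 2)%N by rewrite -[leqLHS]expn1 leq_pexp2l.
have Bp : (0 < T1 + N1 ^ 2 + 1)%N by rewrite addn1.
have T1p : (0 < T1)%N by [].
have L32 : 32 <= gL G by apply: le_trans (gL_ge G); lra.
move=> ZB SZ SL tT sep DV; have {}t0 := t0 tT.
set Z := gZ G in ZB SZ.
have BZ := leq_eight_mul Bp ZB.
have NZ : (4 * N1 <= Z)%N by apply: leq_trans BZ; rewrite leq_mul//; move: NN; clear; lia.
have TZ : 4 * T <= Z%:R.
  apply: (@le_trans _ _ (4 * T1)%N%:R).
    by rewrite (natrM _ 4) ler_pM2l// ltW.
  by rewrite ler_nat; apply: leq_trans BZ; rewrite leq_mul// -addnA leq_addr.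
set ns := dyadic_range N in S SZ SL DV *.
have nsu : uniq ns by rewrite filter_uniq// iota_uniq.
have nsb : {subset ns <= box N1} := dyadic_range_box N2.
have nZ n : n \in ns -> (0 < n <= Z)%N.
  move=> /nsb /box_bounds/andP[b1 b2]; rewrite (leq_trans N10 b1)/=.
  exact: leq_trans (ltnW b2) NZ.
have cZ n : n \in ns -> cmod (c n) <= Z%:R.
  move=> nn; apply: le_trans SZ.
  by apply: (@term_le R q S (fun n => cmod (c n)) ns n q1) => // m; exact: cmod_ge0.
have sZ : (size ns <= Z)%N.
  apply: leq_trans (uniq_leq_size nsu nsb) _; rewrite size_iota.
  by apply: leq_trans NZ; rewrite leq_subr.
pose qq := (2 * Z ^ 3)%N.
have q0 : (0 < qq)%N.
  by rewrite muln_gt0 expn_gt0 (leq_trans _ NZ)// muln_gt0 N10.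
have mul := lattice_multiplicity q0 t0 sep.
pose kap i := Num.truncn (2 * qq%:R * t i).
have kT i : (kap i <= 2 * qq * T1)%N.
  have qR : 0 <= 2 * qq%:R :> R by rewrite mulr_ge0.
  have /andP[h1 _] := truncn_itv (mulr_ge0 qR (t0 i)).
  rewrite -(ler_nat R) (le_trans h1)// (natrM _ (2 * qq)) (natrM _ 2) ler_wpM2l//.
  by have /andP[_ h2] := tT i; apply: (le_trans h2); exact: ltW.
have Vp : 0 < V / 2 by rewrite divr_gt0.
have DV' i : expR (ln (V / 2)) <= cmod (dsum G ns c (lattice R qq kap i)).
  rewrite lnK ?posrE//; apply: (le_trans V2); rewrite lerBlDr.
  exact: (le_trans (DV i) (discretisation (erefl qq) nZ cZ sZ (tT i) TZ)).
have cS j := @count_level_le R N q S (fun n => cmod (c n)) ns j q83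
  (fun n => cmod_ge0 (c n)) (lexx _).
have := level_bound q0 nsu N10 T1p nsb ZB mul kT cZ cS SL DV'.
move=> /le_trans; apply.
have L0 := gL_gt0 G.
have -> : expR (1007 * ln (gL G)) = gL G ^+ 1007 by rewrite expRM_natl lnK// posrE.
apply: (@le_trans _ _ (gL G ^+ 1007 * (32 * target N T V))).
  by rewrite ler_pM2l ?exprn_gt0//; exact: (exponents_le_target T2 V0 N10 n1 T1T).
rewrite (exprSr _ 1007) -[leRHS]mulrA ler_pM2l ?exprn_gt0//.
by rewrite ler_wpM2r ?target_ge0.
Qed.

End Assembly.

Section Height.
Variable R : realType.

(** The factor [4 k + 1] makes [Z] exceed [1 + k N^2], because [N^2] is at most four times the base
    of the fourth power. That base is at most [(N T)^2], which gives the exponent [8]. *)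
Lemma height_exists_aux (E k : nat) (N T : R) : (2 ^ 10 <= E)%N -> 2 <= N -> 2 <= T ->
  let N1 := Num.truncn N in let T1 := (Num.truncn T).+1 in
  let Z := (E * (T1 + N1 ^ 2 + 1) ^ 4 * (4 * k + 1))%N in
  [/\ (2 ^ 10 <= Z)%N, (E * (T1 + N1 ^ 2 + 1) ^ 4 <= Z)%N, 1 + k%:R * N ^+ 2 <= Z%:R,
    N <= Z%:R & Z%:R <= (E * (4 * k + 1))%N%:R * (N * T) ^+ 8].
Proof.
move=> E10 N2 T2 N1 T1; set B := (T1 + N1 ^ 2 + 1)%N => Z.
have N0 : 0 <= N by lra.
have /andP[n1 n2] := truncn_itv N0; rewrite -/N1 -natr1 in n1 n2.
have T0 : 0 <= T by lra.
have /andP[u1 u2] := truncn_itv T0.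
have E0 : (0 < E)%N by apply: leq_trans E10.
have B1 : (0 < B)%N by rewrite /B addn1.
have k1 : (0 < 4 * k + 1)%N by rewrite addn1.
have EBZ : (E * B ^ 4 <= Z)%N by rewrite leq_pmulr.
have BB : (B <= B ^ 4)%N by rewrite -[leqLHS]expn1 leq_pexp2l.
have BEB : (B <= E * B ^ 4)%N by rewrite (leq_trans BB)// leq_pmull.
have N1R : 1 <= N1%:R :> R by rewrite ler1n truncn_gt0; lra.
have BR : B%:R = (Num.truncn T)%:R + 2 + N1%:R ^+ 2 :> R.
  by rewrite /B /T1 !natrD natrX -[(Num.truncn T).+1%:R]natr1; ring.
have NB : N ^+ 2 <= 4 * B%:R.
  have : N ^+ 2 <= (2 * N1%:R) ^+ 2 by rewrite lerXn2r ?nnegrE ?mulr_ge0//; lra.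
  have : 0 <= (Num.truncn T)%:R :> R by [].
  by rewrite BR exprMn; lra.
have NB1 : N <= B%:R.
  have : 0 <= (Num.truncn T)%:R :> R by [].
  have : N1%:R <= N1%:R ^+ 2 :> R by rewrite expr2 ler_peMr//; lra.
  rewrite BR; lra.
have BNT : B%:R <= (N * T) ^+ 2.
  have h1 : N1%:R ^+ 2 <= N ^+ 2 by rewrite lerXn2r ?nnegrE.
  have h2 : 4 <= N ^+ 2 by nra.
  have h3 : 4 <= T ^+ 2 by nra.
  have h4 : T <= T ^+ 2 / 2 by nra.
  rewrite BR exprMn; nra.
split=> //.
- by apply: leq_trans EBZ; rewrite (leq_trans E10)// leq_pmulr// expn_gt0 B1.
- apply: (@le_trans _ _ (B * (4 * k + 1))%N%:R); last by rewrite ler_nat leq_mul2r BEB orbT.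
  rewrite natrM (natrD _ (4 * k)) (natrM _ 4).
  have : 1 <= B%:R :> R by rewrite ler1n.
  have : k%:R * N ^+ 2 <= k%:R * (4 * B%:R) by rewrite ler_wpM2l.
  lra.
- by rewrite (le_trans NB1)// ler_nat (leq_trans BEB).
- rewrite /Z mulnAC (natrM _ (E * _)) ler_wpM2l// natrX.
  by rewrite (exprM _ 2 4); apply: lerXn2r; rewrite ?nnegrE ?sqr_ge0.
Qed.

Lemma height_exists (C : R) : exists D : R, 1 <= D /\ forall N T : R, 2 <= N -> 2 <= T ->
  exists Z : nat, [/\ (2 ^ 10 <= Z)%N,
    room 90 (((Num.truncn T).+1 + Num.truncn N ^ 2 + 1) ^ 4) Z,
    1 + C * N ^+ 2 <= Z%:R, N <= Z%:R & Z%:R <= D * (N * T) ^+ 8].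
Proof.
have E10 : (2 ^ 10 <= 2 ^ 90)%N by rewrite leq_pexp2l.
rewrite /room; move: (2 ^ 90)%N E10 => E E10.
pose k := (Num.truncn `|C|).+1.
exists (E * (4 * k + 1))%N%:R; split.
  by rewrite ler1n muln_gt0 addn1 andbT; apply: leq_trans E10.
move=> N T N2 T2; have [h1 h2 h3 h4 h5] := @height_exists_aux E k N T E10 N2 T2.
eexists; split; [exact: h1|exact: h2| |exact: h4|exact: h5].
apply: le_trans h3; rewrite lerD2l ler_wpM2r ?sqr_ge0//.
have /andP[_ /ltW] := truncn_itv (normr_ge0 C); apply: le_trans; exact: ler_norm.
Qed.

Lemma power_subpoly (m : nat) (Kg D Z x d : R) : (0 < m)%N -> 0 <= Kg -> 0 < d ->
  0 <= Z -> 0 <= D -> 0 <= x -> Z <= D * x ^+ 8 ->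
  (Kg * Z `^ (d / (8 * m%:R))) ^+ m <= Kg ^+ m * D `^ (d / 8) * x `^ d.
Proof.
move=> m0 Kg0 d0 Z0 D0 x0 ZD; rewrite exprMn -mulrA ler_wpM2l ?exprn_ge0//.
have mR : m%:R != 0 :> R by rewrite pnatr_eq0 -lt0n.
rewrite -powR_mulrn ?powR_ge0// -powRrM (_ : d / (8 * m%:R) * m%:R = d / 8); last by field.
apply: (@le_trans _ _ ((D * x ^+ 8) `^ (d / 8))).
  by apply: ge0_ler_powR; rewrite ?nnegrE ?mulr_ge0 ?exprn_ge0//; lra.
rewrite powRM ?exprn_ge0// -(powR_mulrn 8)// -powRrM (_ : 8 * (d / 8) = d)//.
by field.
Qed.

End Height.

Local Open Scope classical_set_scope.

Theorem theorem1p2 (R : realType) (q : R) (hq : 8 / 3 <= q) (C : R -> R) :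
  forall delta' : R, 0 < delta' ->
  exists K : R,
  forall (N T : R) (c : nat -> R[i]) (V : R) (W : set R),
    2 <= N -> 2 <= T ->
    (forall delta : R, 0 < delta ->
       dyadic_sum N (fun n => cmod (c n) `^ q) <= C delta * N `^ (1 + delta)) ->
    0 < V ->
    W `<=` [set t | 0 <= t <= T] ->
    separated1 W ->
    (forall t : R, W t ->
       V <= cmod (dyadic_sum N (fun n => c n * natpow_it n t))) ->
    finite_set W /\
    #|` fset_set W|%:R <=
      K * (N * T) `^ delta' *
      (N ^+ 2 * V ^- 2 + N `^ (18 / 5) * V ^- 4 + T * N `^ (12 / 5) * V ^- 4).
Proof.
move=> d d0; have [m mE] : exists m, m = 1008%N by exists 1008%N.
have m0 : (0 < m)%N by rewrite mE.
(* [family_bound] loses [gL^1008], with [gL] a multiple of [Z^e] and [Z] at most a multiple of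
   [(N T)^8]; this [e] makes the loss a multiple of [(N T)^d]. *)
pose e := d / (8 * m%:R).
have e0 : 0 < e by rewrite divr_gt0// mulr_gt0 ?ltr0n.
have [Kg KB KP] := grid_subpoly (16 * `|C e|) e0.
(* The moment hypothesis is used at two exponents: at [1] only to place all coefficients below the
   height [Z], and at [e] to bound the moment by [gL N / 8], up to rounding of [N]. The constant
   [16] above is this [8] times the loss in [N <= 2 * truncn N]. *)
have [D [D1 DP]] := height_exists (C 1).
exists (4 + Kg ^+ m * D `^ (d / 8)) => N T c V W N2 T2 cq V0 WT sep DV.
have fW := separated1_finite WT sep; split=> //.
have [I [t [-> Wt tsep]]] := separated1_family fW sep.
have tT i : 0 <= t i <= T by exact: WT.
rewrite -/(target N T V).
have T0 : 0 <= T by exact: le_trans T2.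
have tg := target_ge0 N T0 V0.
have one_le (x : R) : 2 <= x -> 1 <= x by apply: le_trans; rewrite ler1n.
have NT1 : 1 <= N * T by rewrite mulr_ege1 ?one_le.
have NTd : 1 <= (N * T) `^ d by rewrite -[leLHS](powRr0 (N * T)); apply: ler_powR => //; exact: ltW.
have Kg0 : 0 <= Kg by apply: le_trans KB; rewrite mulr_ge0.
have K0 : 0 <= Kg ^+ m * D `^ (d / 8) by rewrite mulr_ge0 ?powR_ge0// exprn_ge0.
have [V1|V1] := leP V 1.
  apply: (le_trans (trivial_bound N2 T2 V0 V1 tT tsep)); rewrite ler_wpM2r//.
  apply: (@le_trans _ _ (4 * (N * T) `^ d)); first by rewrite ler_peMr.
  by rewrite ler_wpM2r ?powR_ge0// lerDl.
have N0 : 0 < N by exact: lt_le_trans N2.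
have /andP[n1 n2] := truncn_itv (ltW N0).
have N1R : 1 <= (Num.truncn N)%:R :> R by rewrite ler1n truncn_gt0 one_le.
have N1N : N <= 2 * (Num.truncn N)%:R by rewrite mulr_natl mulr2n (le_trans (ltW n2))// -natr1 lerD2l.
have D0 : 0 <= D by exact: le_trans D1.
have NT0 : 0 <= N * T by exact: le_trans NT1.
pose S := \sum_(n <- dyadic_range N) cmod (c n) `^ q.
have S1 : S <= C 1 * N ^+ 2.
  have := cq 1 ltr01; rewrite dyadic_sumE -/S; move/le_trans; apply.
  by rewrite -(powR_mulrn 2) ?(ltW N0)// natrD.
have Se : S <= `|C e| * (N * N `^ e).
  have Ne : N `^ (1 + e) = N * N `^ e.
    by rewrite powRD; [rewrite powRr1// ltW|rewrite (gt_eqF N0) implybT].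
  have := cq e e0; rewrite dyadic_sumE -/S Ne; move/le_trans; apply; rewrite ler_wpM2r ?ler_norm// mulr_ge0 ?powR_ge0//; exact: ltW.
have [Z [Z10 ZB ZC NZ ZD]] := DP N T N2 T2.
have [G [GZ GL]] := KP Z Z10.
have SZ : 1 + S <= (gZ G)%:R by rewrite GZ; apply: le_trans ZC; rewrite lerD2l.
have SL : 8 * S <= gL G * (Num.truncn N)%:R.
  have NZe : N `^ e <= Z%:R `^ e.
    by apply: ge0_ler_powR; rewrite ?nnegrE ?(ltW N0) ?(ltW e0).
  rewrite GL; apply: (@le_trans _ _ (16 * `|C e| * Z%:R `^ e * (Num.truncn N)%:R)); last first.
    by rewrite ler_wpM2r// ler_wpM2r// powR_ge0.
  have : N * N `^ e <= 2 * (Num.truncn N)%:R * Z%:R `^ e.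
    by apply: ler_pM => //; [exact: ltW|exact: powR_ge0].
  move/(ler_wpM2l (normr_ge0 (C e))) => /(le_trans Se); rewrite -(@ler_pM2l _ 8)//.
  by move/le_trans; apply; rewrite le_eqVlt; apply/orP; left; apply/eqP; ring.
rewrite -GZ in ZB.
have DV' i : V <= cmod (\sum_(n <- dyadic_range N) c n * natpow_it n (t i)).
  by rewrite -dyadic_sumE; apply: DV.
have := family_bound hq N2 T2 (ltW V1) ZB SZ SL tT tsep DV'; rewrite -mE => /le_trans; apply.
rewrite ler_wpM2r// GL; apply: (le_trans (power_subpoly m0 Kg0 d0 (ler0n R Z) D0 NT0 ZD)).
by rewrite ler_wpM2r ?powR_ge0// lerDr.
Qed.
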